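(* Let $G=\mathrm{SL}_2(\mathbb{R})$ with a fixed Haar measure $\mu$. There exists a constant $C>0$, depending only on $\mu$, with the following property. Let $\Gamma$ be a cocompact arithmetic Fuchsian subgroup of $G$ with invariant trace field $k$. Then $\Gamma$ is generated by the finite subset $$\left\{ \gamma\in\Gamma : \|\gamma\| < C \cdot [k:\mathbb{Q}]^{\frac{60}{1-\sqrt{1-4\lambda}}} \cdot \mathrm{vol}_\mu(G/\Gamma)^{\frac{6}{1-\sqrt{1-4\lambda}}} \right\},$$ where $\mathrm{vol}_\mu(G/\Gamma)$ is the covolume of $\Gamma$ with respect to $\mu$, and $\lambda=\min\{\tfrac14,\lambda_1(\Gamma)\}$, with $\lambda_1(\Gamma)$ the smallest non-zero eigenvalue of the Laplace-Beltrami operator on $\mathbb{H}^2/\Gamma$.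
   Context: Arithmetic Fuchsian groups: let $k$ be a totally real number field with ring of integers $R_k$, $A$ a quaternion algebra over $k$ ramified at all archimedean places except one, $\mathcal{O}$ an $R_k$-order in $A$, $\mathcal{O}^1$ the elements of $\mathcal{O}$ of $A$-norm (reduced norm) $1$, and $\rho$ a $k$-embedding of $A$ in $M_2(\mathbb{R})$. A subgroup $\Gamma$ of $\mathrm{SL}_2(\mathbb{R})$ is an arithmetic Fuchsian group if it is commensurable, up to conjugation, with some such $\rho(\mathcal{O}^1)$. The invariant trace field of $\Gamma$ is $k=\mathbb{Q}(\mathrm{tr}(\Gamma^{(2)}))$, where $\Gamma^{(2)}$ is the subgroup generated by the squares of elements of $\Gamma$; it coincides with the field $k$ in the definition. $\Gamma$ is cocompact if $G/\Gamma$ is compact. The group $\Gamma$ acts on the hyperbolic plane $\mathbb{H}^2$ (from the right). The norm $\|\cdot\|$ is the $L^\infty$-norm on $2\times2$ real matrices (maximum of the absolute values of the entries). *)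

(* Defs.v *)
From HB Require Import structures.
From mathcomp Require Import all_boot all_order all_algebra all_field.
From mathcomp Require Import all_classical all_reals all_analysis.
From mathcomp Require Import complex.

Set Implicit Arguments.
Unset Strict Implicit.
Unset Printing Implicit Defensive.

Import Order.TTheory GRing.Theory Num.Theory.
Import numFieldNormedType.Exports.

Local Open Scope classical_set_scope.
Local Open Scope ring_scope.

Record SL2 (R : realType) := MkSL2 { slmx : 'M[R]_2; _ : \det slmx == 1 }.

Section SL2Group.
Variable R : realType.

HB.instance Definition _ := [isSub for @slmx R].
HB.instance Definition _ := [Choice of SL2 R by <:].

Lemma det_slmx (g : SL2 R) : \det (slmx g) = 1.
Proof. by case: g => A /= /eqP. Qed.

Lemma slmx_unit (g : SL2 R) : slmx g \in unitmx.
Proof. by rewrite unitmxE det_slmx unitr1. Qed.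

Fact sl2_one_subproof : \det (1%:M : 'M[R]_2) == 1.
Proof. by rewrite det1. Qed.

Fact sl2_mul_subproof (g h : SL2 R) : \det (slmx g *m slmx h) == 1.
Proof. by rewrite det_mulmx !det_slmx mulr1. Qed.

Fact sl2_inv_subproof (g : SL2 R) : \det (invmx (slmx g)) == 1.
Proof. by rewrite det_inv det_slmx invr1. Qed.

Definition sl2_one := MkSL2 sl2_one_subproof.
Definition sl2_mul g h := MkSL2 (sl2_mul_subproof g h).
Definition sl2_inv g := MkSL2 (sl2_inv_subproof g).

Fact sl2_mulA : associative sl2_mul.
Proof. by move=> f g h; apply: val_inj; rewrite /= mulmxA. Qed.

Fact sl2_mul1 : left_id sl2_one sl2_mul.
Proof. by move=> g; apply: val_inj; rewrite /= mul1mx. Qed.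

Fact sl2_mulr1 : right_id sl2_one sl2_mul.
Proof. by move=> g; apply: val_inj; rewrite /= mulmx1. Qed.

Fact sl2_mulV : left_inverse sl2_one sl2_inv sl2_mul.
Proof. by move=> g; apply: val_inj; rewrite /= mulVmx ?slmx_unit. Qed.

Fact sl2_mulrV : right_inverse sl2_one sl2_inv sl2_mul.
Proof. by move=> g; apply: val_inj; rewrite /= mulmxV ?slmx_unit. Qed.

HB.instance Definition _ := isGroup.Build (SL2 R)
  sl2_mulA sl2_mul1 sl2_mulr1 sl2_mulV sl2_mulrV.
HB.instance Definition _ := isPointed.Build (SL2 R) 1%g.
HB.instance Definition _ :=
  Topological.copy (SL2 R) (initial_topology (@slmx R)).

End SL2Group.

(* SL_2(R) with its Borel sigma-algebra *)
Notation borelSL2 R := (g_sigma_algebraType (@open (SL2 R))).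

(* Regularity is automatic: SL_2(R) is locally compact and second countable. *)
Definition haar_measure (R : realType)
    (mu : {measure set (borelSL2 R) -> \bar R}) : Prop :=
  [/\ mu setT != 0%E,
      forall K : set (SL2 R), compact K -> (mu K < +oo)%E
    & forall (g : SL2 R) (B : set (borelSL2 R)), measurable B ->
        mu ((fun h : SL2 R => (g * h)%g) @` B) = mu B].

Section Subgroups.
Variable G : groupType.
Implicit Types H K S : set G.
Local Open Scope group_scope.

Definition is_subgroup H : Prop :=
  [/\ H 1, (forall x y, H x -> H y -> H (x * y)) & forall x, H x -> H x^-1].

Definition generated S : set G := smallest is_subgroup S.

Definition left_coset H (x : G) : set G := [set x * h | h in H].

Definition finite_index H K : Prop := finite_set (left_coset H @` K).

Definition commensurable H K : Prop :=
  finite_index (H `&` K) H /\ finite_index (H `&` K) K.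

Definition same_coset H : rel G :=
  fun x y => `[< left_coset H x = left_coset H y >].

Fact same_coset_refl H : reflexive (same_coset H).
Proof. by move=> x; apply/asboolP. Qed.

Fact same_coset_sym H : symmetric (same_coset H).
Proof. by move=> x y; apply/asboolP/asboolP. Qed.

Fact same_coset_trans H : transitive (same_coset H).
Proof. by move=> y x z /asboolP xy /asboolP yz; apply/asboolP; rewrite xy. Qed.

Canonical same_coset_equiv H :=
  EquivRel (same_coset H) (same_coset_refl H) (same_coset_sym H)
    (@same_coset_trans H).

Definition coset_space H := {eq_quot (same_coset_equiv H)}%qT.

End Subgroups.

Section Lattices.
Variable R : realType.
Implicit Types Gam : set (SL2 R).

Definition cocompact Gam : Prop :=
  compact [set: quotient_topology (coset_space Gam)].

Definition fundamental_domain Gam (F : set (borelSL2 R)) : Prop :=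
  measurable F /\
  set_bij F setT (\pi_(coset_space Gam) : SL2 R -> coset_space Gam)%qT.

(* vol_mu(G/Gam) = v, for the measure induced by mu on G/Gam; the value does
   not depend on the fundamental domain. *)
Definition has_covolume (mu : {measure set (borelSL2 R) -> \bar R}) Gam
    (v : R) : Prop :=
  exists2 F, fundamental_domain Gam F & mu F = v%:E.

Definition square_subgroup Gam : set (SL2 R) :=
  generated [set (g ^+ 2)%g | g in Gam].

Definition is_subfield (K : set R) : Prop :=
  [/\ K 1, (forall x y, K x -> K y -> K (x - y)),
      (forall x y, K x -> K y -> K (x * y)) & forall x, K x -> K x^-1].

Definition invariant_trace_field Gam : set R :=
  smallest is_subfield [set \tr (slmx g) | g in square_subgroup Gam].

End Lattices.

Section Laplacian.
Variable R : realType.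
Implicit Types (z : R * R) (f : R * R -> R).

(* The upper half-plane; (x, y) stands for x + iy. *)
Definition upper_half_plane : set (R * R) := [set z | 0 < z.2].
Local Notation H2 := upper_half_plane.

Definition moebius (g : SL2 R) z : R * R :=
  let w : R[i] := Complex z.1 z.2 in
  let e i j : R[i] := real_complex R (slmx g i j) in
  let w' := (e 0 0 * w + e 0 1) / (e 1 0 * w + e 1 1) in
  (complex.Re w', complex.Im w').

Definition dx f : R * R -> R := fun z => 'D_((1, 0) : R * R) f z.
Definition dy f : R * R -> R := fun z => 'D_((0, 1) : R * R) f z.

Fixpoint Cn_on_H2 (n : nat) f : Prop :=
  (forall z, H2 z -> {for z, continuous f}) /\
  if n is m.+1 then
    [/\ forall z, H2 z -> derivable f z ((1, 0) : R * R),
        forall z, H2 z -> derivable f z ((0, 1) : R * R),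
        Cn_on_H2 m (dx f) & Cn_on_H2 m (dy f)]
  else True.

Definition smooth_on_H2 f : Prop := forall n, Cn_on_H2 n f.

(* The positive Laplace-Beltrami operator of (dx^2 + dy^2) / y^2. *)
Definition laplace_beltrami f z : R :=
  - z.2 ^+ 2 * (dx (dx f) z + dy (dy f) z).

(* Functions on H^2/Gam are Gam-invariant functions on H^2.  In terms of
   z |-> moebius g z, the right action of g is that of g^-1, which has the
   same invariant functions. *)
Definition laplace_eigenvalue (Gam : set (SL2 R)) (l : R) : Prop :=
  exists f : R * R -> R,
    [/\ smooth_on_H2 f,
        forall g z, Gam g -> H2 z -> f (moebius g z) = f z,
        exists2 z, H2 z & f z != 0
      & forall z, H2 z -> laplace_beltrami f z = l * f z].

Definition smallest_nonzero_eigenvalue (Gam : set (SL2 R)) (l : R) : Prop :=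
  [/\ l != 0, laplace_eigenvalue Gam l
    & forall m, m != 0 -> laplace_eigenvalue Gam m -> l <= m].

End Laplacian.

Definition totally_real (R : realType) (k : fieldExtType rat) : Prop :=
  forall (s : {rmorphism k -> R[i]}) (x : k), complex.Im (s x) = 0.

Definition ring_of_integers (k : fieldExtType rat) : set k :=
  [set x | integralOver (intr : int -> k) x].

Section QuaternionAlgebra.
Variables (k : fieldExtType rat) (A : falgType k).

Definition simple_algebra : Prop :=
  forall I : {vspace A}, ({:A} * I <= I)%VS -> (I * {:A} <= I)%VS ->
    I = 0%VS \/ I = fullv.

Definition is_quaternion_algebra : Prop :=
  [/\ \dim {:A} = 4%N, 'Z({:A})%VS = 1%VS & simple_algebra].

(* For x <> 0, x is pure iff x is not in the centre k but x^2 is. *)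
Definition pure_quaternion (x : A) : Prop :=
  x = 0 \/ x \notin 1%VS /\ x * x \in 1%VS.

(* The norm of x = a + q, with a in k and q pure, is (a + q)(a - q). *)
Definition has_norm (x : A) (n : k) : Prop :=
  exists (a : k) (q : A),
    [/\ pure_quaternion q, x = a%:A + q & (a%:A + q) * (a%:A - q) = n%:A].

Definition is_order (O : set A) : Prop :=
  [/\ O 1,
      forall x y, O x -> O y -> O (x * y)
    & exists2 s : seq A, span s = fullv
      & O = [set x | exists2 c : 'I_(size s) -> k,
               forall i, ring_of_integers (c i)
               & x = \sum_(i < size s) c i *: s`_i]].

Definition norm_one (O : set A) : set A := [set x | O x /\ has_norm x 1].

Section BaseChange.
Variables (R : realType) (s : {rmorphism k -> R}).

(* The R-algebra A (x)_(k, s) R, in coordinates on the basis vbasis {:A}: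
   its structure constants are the images under s of those of A. *)
Definition base_change := 'rV[R]_(\dim {:A}).

Definition base_change_of (x : A) : base_change :=
  \row_l s (coord (vbasis {:A}) l x).

Definition base_change_mul (u v : base_change) : base_change :=
  \sum_i \sum_j (u 0 i * v 0 j) *:
    base_change_of ((vbasis {:A})`_i * (vbasis {:A})`_j).

Definition ramified_at : Prop :=
  forall u : base_change, u != 0 -> exists v : base_change,
    base_change_mul u v = base_change_of 1 /\
    base_change_mul v u = base_change_of 1.

End BaseChange.

(* For totally real k the archimedean places are the embeddings k -> R. *)
Definition ramified_except (R : realType) (s0 : {rmorphism k -> R}) : Prop :=
  ~ ramified_at s0 /\
  forall s : {rmorphism k -> R}, ~ (s =1 s0) -> ramified_at s.

End QuaternionAlgebra.

Section Arithmetic.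
Variable R : realType.

Definition image_in_SL2 (T : Type) (rho : T -> 'M[R]_2) (X : set T) :
  set (SL2 R) := [set g | exists2 x, X x & rho x = slmx g].

(* k acts on 'M[R]_2 through the embedding s0 at which A is unramified. *)
Definition arithmetic_Fuchsian (Gam : set (SL2 R)) : Prop :=
  is_subgroup Gam /\
  exists (k : fieldExtType rat) (A : falgType k) (O : set A)
         (s0 : {rmorphism k -> R}) (rho : {rmorphism A -> 'M[R]_2})
         (g : SL2 R),
    [/\ totally_real R k,
        is_quaternion_algebra A /\ ramified_except A s0,
        is_order O,
        injective rho /\ (forall (a : k) (x : A), rho (a *: x) = s0 a *: rho x)
      & commensurable [set (h ^ g)%g | h in Gam]
          (image_in_SL2 rho (norm_one O))].

End Arithmetic.

(* Main.v *)
(* Let n = [k : Q].  The trace of the square of an element of Gam has all its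
   conjugates, except possibly itself, in [-2, 2].  As in Dobrowolski's theorem,
   comparing the conjugates t of such a trace with their images P_p(t) under a
   Dickson polynomial, for a prime p of order n^(11/5), and bounding the
   Vandermonde determinant of all these numbers from both sides keeps the trace
   away from 2 by a power of 1/(n p).  Hence a neighbourhood of 1 of size
   c n^(-16/5), of volume at least c n^(-48/5), embeds in every translate into
   the quotient.

   Let T_S be the normalised convolution by X^S, X = cosh(d/2)^(-2).  These
   operators commute and Delta T_S = S (S - 1) (T_(S+1) - T_S); so an eigenvector
   of T_6^2 of maximal eigenvalue among the functions of mean zero can be taken to
   be an eigenfunction of the Laplacian, and the maximum principle bounds T_6 by
   1 / (1 + lambda / 5) on that space.  In the discrete wave equation driven by
   (1 + lambda / 5) T_6, started from the indicator function of a small ball, the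
   mean grows like r^N with r >= (27/20)^t while the part of mean zero stays
   bounded.  When r^N exceeds four times the ratio of the covolume to the volume
   of the ball, any two orbits of balls are connected, with constants of size
   q^N, ln q <= (9/2) ln (27/20).  This bounds the diameter of the quotient, hence
   the size of generators, by (n^(48/5) v)^(9 / (2 t)) up to a factor C^(1/t).

   The slack between 9/(2t) and 6/t absorbs that factor unless n and v are
   bounded; in that case a packing argument bounds the diameter, Harnack's
   inequality bounds lambda_1 from below, and 1/t is bounded. *)

Require Import Defs.
From HB Require Import structures.
From mathcomp Require Import all_boot all_order all_algebra all_field.
From mathcomp Require Import all_classical all_reals all_analysis.
From mathcomp Require Import complex measurable_realfun perm zify ring lra.

Set Implicit Arguments.
Unset Strict Implicit.
Unset Printing Implicit Defensive.

Import Order.TTheory GRing.Theory Num.Theory.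
Import numFieldNormedType.Exports.

(** * Primes and totients *)

(** The exponents arise as follows. The group has dimension 3, so a radius [n^(-16/5)] costs
    [n^(48/5)] in volume; raised to [9/(2t)] this gives [n^(216/(5t)) v^(9/(2t))], and
    [n^(84/(5t)) v^(3/(2t))] remains as slack. The index 6 has two sources: the crude volume growth
    used here makes [X^S] integrable from [S = 5] on, and the propagation estimate needs the moment
    of the squared Hilbert-Schmidt norm against [X^6]. That norm is an eigenfunction of [T_6] with
    eigenvalue 3/2; it serves as a weight in place of finite propagation speed, which [T_6] lacks.
    All functions stay bounded and invariant, without completion: compactness comes from [T_6],
    which maps sets bounded in mean square to bounded equicontinuous ones. *)

Lemma expn2_le_central_bin m : 2 ^ m <= 'C(m.*2, m).
Proof.
elim: m => [|m IHm]; first by rewrite bin0.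
have -> : 'C(m.+1.*2, m.+1) = 'C(m.*2.+1, m).*2.
  rewrite doubleS binS -[RHS]addnn; apply/eqP; rewrite eqn_add2r; apply/eqP.
  by rewrite -[LHS]bin_sub; [congr 'C(_, _)|]; lia.
rewrite expnS -muln2 mulnC leq_mul2r /= (leq_trans IHm) //.
case: m {IHm} => // m; rewrite binS; exact: leq_addr.
Qed.

(** By Legendre's formula the exponent is a sum over [k] of [2m %/ p^k] minus twice [m %/ p^k]; each
    such term is 0 or 1 and vanishes once [p^k] exceeds [2m]. *)
Lemma logn_central_bin p m : prime p -> 0 < m ->
  logn p 'C(m.*2, m) <= trunc_log p m.*2.
Proof.
move=> pr_p m0; have p1 := prime_gt1 pr_p.
have fE n : n <= m.*2 -> logn p n`! = \sum_(1 <= k < m.*2.+1) n %/ p ^ k.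
  move=> nm; rewrite logn_fact // [RHS](@big_cat_nat _ _ _ n.+1) //=.
  rewrite [X in _ + X]big1_seq ?addn0 // => k; rewrite mem_index_iota => /andP[_ /andP[nk _]].
  by rewrite divn_small // (leq_trans (ltn_expl n p1)) // leq_exp2l // ltnW.
have H : logn p 'C(m.*2, m) + ((logn p m`!) + (logn p m`!)) = logn p m.*2`!.
  rewrite -(@bin_fact m.*2 m); last lia.
  rewrite (_ : m.*2 - m = m); last lia.
  by rewrite !lognM ?muln_gt0 ?fact_gt0 ?bin_gt0 //; lia.
rewrite !fE in H; try lia.
have {}H : logn p 'C(m.*2, m) =
   \sum_(1 <= k < m.*2.+1) (m.*2 %/ p ^ k - (m %/ p ^ k).*2).
  rewrite sumnB; first by rewrite -H; under [X in _ = _ - X]eq_bigr do rewrite -addnn; rewrite big_split /=; lia.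
  move=> k _; rewrite -!muln2; exact: leq_div_mul || (rewrite mulnC [m * 2]mulnC; nia).
set L := trunc_log p m.*2.
have LP : m.*2 < p ^ L.+1 by apply: trunc_log_ltn.
rewrite H; apply: (@leq_trans (\sum_(1 <= k < m.*2.+1) (k <= L))).
  apply: leq_sum => k _; have [kL|kL] := leqP k L.
    have pk : 0 < p ^ k by rewrite expn_gt0 prime_gt0.
    have := divn_eq m (p ^ k); have := ltn_mod m (p ^ k); rewrite pk.
    move: (m %% _) (m %/ _) => r q rk mE.
    suff : m.*2 %/ p ^ k < q.*2.+2 by lia.
    by rewrite ltn_divLR //; nia.
  by rewrite (@divn_small m.*2) // (leq_trans LP) // leq_exp2l.
rewrite (bigID (fun k => k <= L)) /= [X in _ + X]big1 ?addn0; last by move=> i /negbTE ->.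
rewrite (eq_bigr (fun=> 1)); last by move=> i ->.
rewrite sum1_count.
have : count (fun k => k <= L) (index_iota 1 m.*2.+1) <= size (iota 1 L).
  rewrite -size_filter; apply: uniq_leq_size; first by rewrite filter_uniq ?iota_uniq.
  by move=> k; rewrite mem_filter mem_index_iota mem_iota; lia.
by rewrite size_iota.
Qed.

(** Erdos's argument: if no prime up to [2m] exceeded [y], then ['C(2m, m)] would have at most [y]
    prime factors, each contributing a prime power at most [2m], against the lower bound [2^m]. *)
Lemma prime_in_range y m : 0 < m -> m.*2 ^ y < 2 ^ m ->
  exists2 p, prime p & y < p <= m.*2.
Proof.
move=> m0 ym.
case: (boolP (has (fun p => prime p && (y < p)) (iota 0 m.*2.+1))) => [/hasP[p]|].
  by rewrite mem_iota => pm /andP[pp yp]; exists p => //; lia.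
rewrite -all_predC => /allP noP; exfalso.
suff : 'C(m.*2, m) <= m.*2 ^ y by have := expn2_le_central_bin m; lia.
have b0 : 0 < 'C(m.*2, m) by rewrite bin_gt0; lia.
rewrite [X in X <= _](prod_prime_decomp b0) prime_decompE big_map /=.
have small p : p \in primes 'C(m.*2, m) -> p \in iota 1 y.
  rewrite mem_primes => /and3P[pp _ pd].
  have l0 : 0 < logn p 'C(m.*2, m) by rewrite logn_gt0 mem_primes pp b0.
  have L0 := leq_trans l0 (logn_central_bin pp m0).
  have pm : p <= m.*2.
    rewrite leqNgt; apply/negP => mp.
    by move: L0; rewrite trunc_log_gt0 prime_gt1 //=; lia.
  have /noP /= : p \in iota 0 m.*2.+1 by rewrite mem_iota; lia.
  by rewrite /= pp /= -leqNgt mem_iota add1n ltnS prime_gt0.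
have sz : size (primes 'C(m.*2, m)) <= y.
  by rewrite -(size_iota 1 y); apply: uniq_leq_size => //; apply: primes_uniq.
apply: (@leq_trans (\prod_(p <- primes 'C(m.*2, m)) m.*2)).
  rewrite big_seq [X in _ <= X]big_seq; apply: leq_prod => p.
  rewrite mem_primes => /and3P[pp _ _].
  apply: (@leq_trans (p ^ trunc_log p m.*2)).
    by rewrite leq_exp2l ?prime_gt1 // logn_central_bin.
  by apply: trunc_logP; [apply: prime_gt1 | lia].
by rewrite big_const_seq count_predT iter_muln_1 leq_exp2l //; lia.
Qed.

(** The threshold [32 n^2] is [2 (4n)^2], what the comparison of determinants requires of [p]. The
    range given by [prime_in_range] loses a logarithm of [n]; the exponent 11/5 instead of 2 leaves
    [n^(1/5)] to absorb it. *)
Lemma exists_prime_above_square : exists C : nat, forall n, 0 < n ->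
  exists2 p, prime p & 32 * n ^ 2 <= p /\ p ^ 5 <= C * n ^ 11.
Proof.
suff [c cP] : exists c, forall n, 0 < n -> exists2 p, prime p & 32 * n ^ 2 <= p /\
    exists j, p <= c * (n ^ 2 * 2 ^ j) /\ 2 ^ (5 * j) <= 8 * n.
  exists (c ^ 5 * 8) => n n0; have [p pp [yp [j [pL jn5]]]] := cP n n0.
  exists p => //; split => //.
  apply: (@leq_trans ((c * (n ^ 2 * 2 ^ j)) ^ 5)); first by rewrite leq_exp2r.
  rewrite expnMn -mulnA leq_mul //.
  rewrite expnMn -!expnM [j * 5]mulnC (_ : n ^ 11 = n ^ (2 * 5) * n); last by rewrite -expnSr.
  by rewrite mulnCA leq_mul.
exists (2 * 32 * 44) => n n0.
set y := 32 * n ^ 2.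
have y0 : 0 < y by rewrite /y; nia.
set e := (trunc_log 2 y).+1.
have ye : y < 2 ^ e by apply: trunc_log_ltn.
have ey : 2 ^ e <= 2 * y by rewrite expnS leq_mul2l trunc_logP.
set L := 2 * e + 4.
have eL : e < 2 ^ e by apply: ltn_expl.
have yL : 2 * y * L < 2 ^ L.
  have -> : 2 ^ L = 16 * (2 ^ e * 2 ^ e) by rewrite -expnD -(expnD 2 4) /L; congr (_ ^ _); lia.
  by rewrite /L; move: (2 ^ e) ye ey eL => E; nia.
have [||p pp /andP[yp pm]] := @prime_in_range y (y * L).
- by rewrite /L; nia.
- by rewrite [y * L]mulnC expnM ltn_exp2r // -muln2; move: yL; lia.
exists p => //; split; first by apply: ltnW.
(* As [L] is linear in [e], this [j] gives [L <= 44 * 2^j], while [2^(20 j) <= 2^e] is of order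
   [n^2]. *)
exists (e %/ 20).
set j := e %/ 20.
have ej : L <= 44 * 2 ^ j.
  have : j < 2 ^ j by apply: ltn_expl.
  by rewrite /L /j; have := divn_eq e 20; have := ltn_mod e 20; move: (2 ^ _); lia.
have jn : 2 ^ (10 * j) <= 8 * n.
  rewrite -(@leq_exp2r _ _ 2) // -expnM.
  apply: (@leq_trans (2 ^ e)); first by rewrite leq_exp2l // /j; have := divn_eq e 20; lia.
  by apply: (leq_trans ey); rewrite /y expnMn; nia.
have jn5 : 2 ^ (5 * j) <= 8 * n.
  by apply: leq_trans jn; rewrite leq_exp2l //; lia.
split => //.
  apply: (leq_trans pm); rewrite -muln2 /y.
  have -> : 32 * n ^ 2 * L * 2 = 2 * 32 * n ^ 2 * L by lia.
  by move: (2 ^ j) (n ^ 2) ej => J q; nia.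
Qed.

(** Strip off one prime power at a time. The inequality [p^l <= phi(p^l)^2] can fail only for
    [p = 2], where a factor 2 is lost; coprimality makes this happen at most once, which the parity
    in the strengthened statement records. *)
Lemma leq_totient_sqr n : 0 < n -> n <= 2 * totient n ^ 2.
Proof.
suff H : forall m, 0 < m -> m <= (if odd m then 1 else 2) * totient m ^ 2.
  by move=> n0; apply: leq_trans (H n n0) _; case: odd => //; lia.
elim/ltn_ind => m IH m0.
have [m1|m1] := leqP m 1; first by have -> : m = 1 by lia.
set p := pdiv m; have pp : prime p by apply: pdiv_prime.
set q := p ^ logn p m.
have [||k cop mE] := @pfactor_coprime p m => //.
set l := logn p m in mE *.
have l0 : 0 < l by rewrite logn_gt0 mem_primes pp m0 pdiv_dvd.
have k0 : 0 < k by move: m0; rewrite mE muln_gt0 => /andP[].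
have p2 := prime_gt1 pp.
have km : k < m by rewrite mE -[X in X < _]muln1 ltn_pmul2l // -(expn0 p) ltn_exp2l.
have := IH k km k0.
rewrite mE totient_coprime; last by rewrite coprimeXr // coprime_sym.
rewrite totient_pfactor // oddM oddX.
have -> : (l == 0) = false by lia.
rewrite orFb expnMn.
have step : p ^ l <= (if odd p then 1 else 2) * (p.-1 * p ^ l.-1) ^ 2.
  case: l l0 {mE q} => // l _; rewrite /= expnMn expnS.
  have pl : 0 < p ^ l by rewrite expn_gt0 prime_gt0.
  case podd: (odd p).
    have p3 : 2 < p by move: (p2); rewrite leq_eqVlt => /orP[/eqP pE|//]; move: podd; rewrite -pE.
    by move: (p ^ l) pl p3 {pp p2 podd km cop IH} => Q Q0; case: (p) => // p' p3; rewrite /=; nia.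
  have -> : p = 2 by case/even_prime: pp => //; rewrite podd.
  by move: (2 ^ l) (expn_gt0 2 l) => Q /= Q0; nia.
case ok: (odd k); case op: (odd p); rewrite ?ok ?op /= in step *; move: (totient k ^ 2) ((_ * _) ^ 2) step => A B step H; try nia.
exfalso; have : 2 %| p by rewrite dvdn2 op.
have : 2 %| k by rewrite dvdn2 ok.
move=> d2k d2p; have pe : p = 2 by apply/esym/eqP; rewrite -dvdn_prime2.
by move: cop; rewrite pe coprime2n ok.
Qed.

Local Open Scope ring_scope.

(** * A Dobrowolski bound *)

Lemma irreducible_dvdp_of_common_root (K : numFieldType) (f g : {poly rat}) (x : K) :
  irreducible_poly f -> root (map_poly ratr f) x -> root (map_poly ratr g) x ->
  f %| g.
Proof.
move=> irr fx gx; case: (irr) => _ irrf.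
have rx : root (map_poly ratr (gcdp f g)) x.
  by rewrite gcdp_map root_gcd fx gx.
have sz : size (gcdp f g) != 1%N.
  apply/negP => /size_poly1P[c c0 gE]; move: rx.
  by rewrite gE map_polyC rootC fmorph_eq0 (negbTE c0).
by rewrite -(eqp_dvdl _ (irrf _ sz (dvdp_gcdl f g))) dvdp_gcdr.
Qed.

(** [K] need not be algebraically closed, so the common root is moved: [gcd(Phi_N, g)] is not
    constant, hence has a root in [algC], a primitive root of unity whose minimal polynomial is
    known. *)
Lemma totient_le_degree (K : numFieldType) N (z : K) (g : {poly rat}) :
  N.-primitive_root z -> g != 0 -> root (map_poly ratr g) z ->
  (totient N <= (size g).-1)%N.
Proof.
move=> prz g0 gz; have N0 := prim_order_gt0 prz.
set Phi : {poly rat} := map_poly intr 'Phi_N.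
have mapE (L : numFieldType) (q : {poly int}) : map_poly (ratr : rat -> L) (map_poly intr q) = map_poly intr q.
  by rewrite -map_poly_comp; apply: eq_map_poly => a /=; rewrite ratr_int.
have Phiz : root (map_poly ratr Phi) z.
  have Xn n x : root (map_poly intr ('X^n - 1 : {poly int})) x = (x ^+ n == 1 :> K).
    by rewrite rmorphB /= rmorph1 map_polyXn /root !hornerE subr_eq0.
  have : root (map_poly intr ('X^N - 1 : {poly int})) z by rewrite Xn (prim_expr_order prz).
  rewrite -prod_Cyclotomic // rmorph_prod /= -[root _ _]negbK -(big_map _ predT id) root_bigmul.
  rewrite all_map -has_predC => /hasP[d].
  rewrite -dvdn_divisors // => dN /=; rewrite negbK => zd.
  suff dE : d = N by rewrite /Phi mapE -dE.
  have d0 := dvdn_gt0 N0 dN.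
  apply/eqP; rewrite eqn_dvd dN /= (prim_order_dvd prz).
  have : root (map_poly intr ('X^d - 1 : {poly int})) z; last by rewrite Xn.
  rewrite -prod_Cyclotomic // (big_rem d) /=; last by rewrite -dvdn_divisors.
  by rewrite rmorphM /= rootM zd.
have [w /= wP] : exists w : algC, root (map_poly ratr (gcdp Phi g)) w.
  apply/closed_rootP; rewrite size_map_poly; apply/negP => /size_poly1P[c c0 gE].
  have : root (map_poly ratr (gcdp Phi g)) z by rewrite gcdp_map root_gcd Phiz gz.
  by rewrite gE map_polyC rootC fmorph_eq0 (negbTE c0).
move: wP; rewrite gcdp_map root_gcd mapE => /andP[wPhi wg].
have [w' prw'] := C_prim_root_exists N0.
have prw : N.-primitive_root w by rewrite -(root_cyclotomic prw') -(Cintr_Cyclotomic prw').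
have [pf [pfE _] dv] := minCpolyP w.
move: wg; rewrite dv => /(dvdp_leq g0).
have : size (minCpoly w) = (totient N).+1.
  by rewrite (minCpoly_cyclotomic prw) size_cyclotomic.
by rewrite pfE size_map_poly => ->; case: (size g).
Qed.

(* Dickson polynomials, the monic form of the Chebyshev polynomials: u + 1/u is sent to u^k + 1/u^k. *)
Fixpoint dickson (k : nat) : {poly int} :=
  match k with
  | 0%N => 2
  | k1.+1 => match k1 with 0%N => 'X | k2.+1 => 'X * dickson k1 - dickson k2 end
  end.

Lemma dicksonSS k : dickson k.+2 = 'X * dickson k.+1 - dickson k.
Proof. by []. Qed.

Lemma dickson_monic_size k : (dickson k.+1 \is monic) && (size (dickson k.+1) == k.+2).
Proof.
elim/ltn_ind: k => -[|k] IH; first by rewrite monicX size_polyX.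
have /andP[mk /eqP sk] := IH k (ltnSn k).
rewrite dicksonSS; have sX : size ('X * dickson k.+1) = k.+3.
  by rewrite mulrC size_mulX ?sk // monic_neq0.
have ss : (size (- dickson k) < size ('X * dickson k.+1)%R)%N.
  rewrite sX size_polyN; case: k IH {mk sk sX} => [|k] IH; first by rewrite /= -(rmorph_nat (@polyC int)) size_polyC.
  by have /andP[_ /eqP->] := IH k (ltnW (ltnSn _)); apply: ltnW.
by rewrite size_polyDl // sX eqxx andbT monicE lead_coefDl // lead_coefM lead_coefX mul1r -monicE.
Qed.

(** The target ring may be non-commutative: this is applied to 2 by 2 matrices, both for traces of
    powers in [SL2] and for the reduction modulo a prime. *)
Lemma dickson_eval (S : nzRingType) (f : {rmorphism {poly int} -> S}) (a b : S) k :
  a * b = 1 -> b * a = 1 -> f 'X = a + b -> f (dickson k) = a ^+ k + b ^+ k.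
Proof.
move=> ab ba fX; elim/ltn_ind: k => -[|[|k]] IH.
- by rewrite !expr0 rmorph_nat.
- by rewrite !expr1.
rewrite dicksonSS rmorphB rmorphM fX !IH // mulrDl !mulrDr -!exprS.
have -> : a * b ^+ k.+1 = b ^+ k by rewrite exprS mulrA ab mul1r.
have -> : b * a ^+ k.+1 = a ^+ k by rewrite exprS mulrA ba mul1r.
apply/eqP; rewrite subr_eq; apply/eqP.
by rewrite [a ^+ k + b ^+ k.+2]addrC addrACA [b ^+ k + _]addrC.
Qed.

Definition companion (R : nzRingType) n (f : {poly R}) : 'M[R]_n.+1 :=
  \matrix_(i, j) if i == n :> nat then - f`_j else (i.+1 == j :> nat)%:R.

Lemma companion_eigen (R : comNzRingType) n (f : {poly R}) (x : R) :
  f \is monic -> size f = n.+2 -> root f x ->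
  companion n f *m (\col_i x ^+ i) = x *: (\col_i x ^+ i).
Proof.
move=> mf sf /rootP fx; apply/matrixP => i j; rewrite !mxE.
under eq_bigr do rewrite !mxE.
have [iE|iE] := eqVneq (i : nat) n.
  move: fx; rewrite horner_coef sf big_ord_recr /=.
  have -> : f`_n.+1 = 1 by move/monicP: mf; rewrite lead_coefE sf.
  rewrite mul1r => /eqP; rewrite addrC addr_eq0 => /eqP fx.
  rewrite -exprS iE fx -sumrN; apply: eq_bigr => k _.
  by rewrite mulNr.
have iN : (i.+1 < n.+1)%N by rewrite ltnS ltn_neqAle -ltnS ltn_ord andbT.
rewrite (bigD1 (Ordinal iN)) //= eqxx mul1r big1 ?addr0 ?exprS //.
move=> k; rewrite -val_eqE /= => kn; rewrite eq_sym (negbTE kn).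
by rewrite mul0r.
Qed.

Lemma horner_mx_eigen (R : comNzRingType) n (A : 'M[R]_n.+1) (v : 'cV_n.+1) (x : R) (g : {poly R}) :
  A *m v = x *: v -> horner_mx A g *m v = g.[x] *: v.
Proof.
move=> Av; elim/poly_ind: g => [|g c IH]; first by rewrite rmorph0 mul0mx horner0 scale0r.
rewrite rmorphD rmorphM /= horner_mx_X horner_mx_C mulmxDl.
rewrite mul_scalar_mx !hornerE scalerDl; congr (_ + _).
by rewrite -mulmxE -mulmxA Av -scalemxAr IH scalerA mulrC.
Qed.

Section ConjugateRoots.
Variables (K : numFieldType) (n : nat) (f : {poly int}) (t : 'I_n.+1 -> K).
Hypothesis fE : map_poly intr f = \prod_i ('X - (t i)%:P).
Hypothesis t_inj : injective t.

Let V := Vandermonde n.+1 (\row_i t i).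

Let V_unit : V \in unitmx.
Proof.
rewrite unitmxE unitfE det_Vandermonde; apply/prodf_neq0 => i _.
apply/prodf_neq0 => j ij; rewrite !mxE subr_eq0; apply/eqP => /t_inj ji.
by rewrite ji ltnn in ij.
Qed.

Let f_monic : f \is monic.
Proof.
rewrite monicE; apply/eqP/(@intr_inj K); rewrite -lead_coef_map_inj //; last exact: intr_inj.
by rewrite fE; apply/monicP/monic_prod_XsubC.
Qed.

Let f_size : size f = n.+2.
Proof.
rewrite -(size_map_inj_poly (@intr_inj K)) // fE size_prod_XsubC.
by rewrite -[index_enum _]enumT size_enum_ord.
Qed.

(** Symmetric functions of the [g(t i)] are integers because they belong to the integer matrix
    [g(companion f)], which the Vandermonde matrix diagonalises: its determinant gives
    [conj_norm_int], its characteristic polynomial [conj_image_poly]. *)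
Lemma conj_diagonalised (g : {poly int}) :
  map_mx intr (horner_mx (companion n f) g) *m V =
  V *m diag_mx (\row_i (map_poly intr g).[t i]).
Proof.
rewrite map_horner_mx; set G := horner_mx _ _.
apply/matrixP => i j; rewrite mul_mx_diag mxE.
have cE : map_mx intr (companion n f) = companion n (map_poly intr f) :> 'M[K]__.
  apply/matrixP => a b; rewrite !mxE coef_map /=.
  by case: ifP => _; rewrite ?rmorphN // rmorph_nat.
have : G *m (\col_i (t j) ^+ i) = (map_poly intr g).[t j] *: (\col_i (t j) ^+ i).
  apply: horner_mx_eigen; rewrite cE; apply: companion_eigen.
  - exact: monic_map.
  - by rewrite size_map_inj_poly //; exact: intr_inj.
  - by rewrite fE -(big_map t predT (fun x => 'X - x%:P)) root_prod_XsubC map_f // mem_index_enum.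
move/matrixP/(_ i 0); rewrite !mxE => GE.
rewrite mulrC -GE; apply: eq_bigr => k _; by rewrite !mxE.
Qed.

Lemma conj_norm_int (g : {poly int}) :
  exists z : int, \prod_i (map_poly intr g).[t i] = z%:~R.
Proof.
exists (\det (horner_mx (companion n f) g)).
have /(congr1 determinant) := conj_diagonalised g.
rewrite !det_mulmx det_diag mulrC det_map_mx => /mulfI H; apply/esym.
rewrite H; last by rewrite -unitfE -unitmxE.
by apply: eq_bigr => i _; rewrite mxE.
Qed.

Lemma conj_image_poly (g : {poly int}) :
  exists2 F : {poly int}, F \is monic &
    map_poly intr F = \prod_i ('X - ((map_poly intr g).[t i])%:P).
Proof.
set G := horner_mx (companion n f) g.
exists (char_poly G); first exact: char_poly_monic.
rewrite map_char_poly /=; set GK := map_mx _ _; set D := \row_i (map_poly intr g).[t i].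
have GD : GK *m V = V *m diag_mx D by apply: conj_diagonalised.
transitivity (char_poly (diag_mx D)); last first.
  rewrite char_poly_trig ?diag_mx_is_trig //.
  by apply: eq_bigr => i _; rewrite !mxE eqxx mulr1n.
have VP : \det (map_mx polyC V) != 0 :> {poly K}.
  by rewrite -[map_mx _ _]/(map_mx (@polyC K) V) det_map_mx polyC_eq0 -unitfE -unitmxE.
apply: (mulIf VP); rewrite /char_poly -det_mulmx mulrC -det_mulmx; congr determinant.
rewrite /char_poly_mx mulmxBl mulmxBr -!map_mxM GD.
by rewrite scalar_mxC.
Qed.

End ConjugateRoots.

Lemma horner_deriv_prod_XsubC (R : comNzRingType) (I : finType) (t : I -> R) i :
  (\prod_j ('X - (t j)%:P))^`().[t i] = \prod_(j | j != i) (t i - t j).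
Proof.
rewrite (bigD1 i) //= derivM derivXsubC mul1r !hornerE subrr mul0r addr0.
by rewrite horner_prod; apply: eq_bigr => j _; rewrite !hornerE.
Qed.

Lemma normr_det_Vandermonde_sqr (K : numFieldType) n (x : 'I_n -> K) :
  `|\det (Vandermonde n (\row_i x i))| ^+ 2 = \prod_i \prod_(j | j != i) `|x i - x j|.
Proof.
rewrite det_Vandermonde normr_prod.
have -> : \prod_i \prod_(j | j != i) `|x i - x j| =
    (\prod_(i < n) \prod_(j < n | (i < j)%N) `|x i - x j|) *
    (\prod_(i < n) \prod_(j < n | (j < i)%N) `|x i - x j|).
  rewrite -big_split /=; apply: eq_bigr => i _.
  rewrite (bigID (fun j : 'I_n => (i < j)%N)) /=; congr (_ * _); apply: eq_bigl => j.
    by rewrite -val_eqE /=; lia.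
  by rewrite -val_eqE /=; lia.
rewrite [X in _ = _ * X](exchange_big_dep predT) //= expr2; congr (_ * _);
  apply: eq_bigr => i _; rewrite normr_prod; apply: eq_bigr => j _; rewrite !mxE // distrC //.
Qed.

Lemma normr_det_le (K : numFieldType) n (A : 'M[K]_n) (B : 'I_n -> K) :
  (forall i j, `|A i j| <= B j) -> `|\det A| <= n`!%:R * \prod_j B j.
Proof.
move=> AB; rewrite /determinant; apply: le_trans (ler_norm_sum _ _ _) _.
apply: (@le_trans _ _ (\sum_(s : {perm 'I_n}) \prod_j B j)).
  apply: ler_sum => s _; rewrite normrM normrX normrN1 expr1n mul1r normr_prod.
  rewrite [X in _ <= X](reindex_inj (@perm_inj _ s)) /=.
  by apply: ler_prod => i _; rewrite normr_ge0 AB.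
by rewrite sumr_const -card_Sn mulr_natl.
Qed.

(** Passing from monomials to Dickson polynomials is a unitriangular change of rows. At [u + 1/u]
    with [|u| >= 1] their values are at most [2 |u|^k], which keeps the Leibniz estimate of the
    determinant close to the size dictated by the [u i]. Row 0 is the constant 1 because [dickson 0]
    is 2. *)
Lemma det_dickson (K : comNzRingType) n (x : 'I_n -> K) :
  \det (\matrix_(i < n, j < n) (if i == 0%N :> nat then 1 else (map_poly intr (dickson i)).[x j])) =
  \det (Vandermonde n (\row_i x i)).
Proof.
pose c i : {poly K} := if i == 0%N then 1 else map_poly intr (dickson i).
have cs i : (size (c i) <= i.+1)%N /\ (c i)`_i = 1.
  rewrite /c; case: i => [|i]; first by rewrite eqxx size_poly1 coefC.
  have /andP[mi /eqP si] := dickson_monic_size i; split.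
    by rewrite -si; apply: size_poly.
  by rewrite coef_map /=; move/monicP: mi; rewrite lead_coefE si => ->.
pose L : 'M[K]_n := \matrix_(i, j) (c i)`_j.
have -> : (\matrix_(i < n, j < n) (if i == 0%N :> nat then 1 else (map_poly intr (dickson i)).[x j])) =
    L *m Vandermonde n (\row_i x i).
  apply/matrixP => i j; rewrite !mxE.
  transitivity (c i).[x j]; first by rewrite /c; case: ifP => //; rewrite hornerC.
  rewrite (@horner_coef_wide _ n); last by apply: leq_trans (proj1 (cs i)) _.
  by apply: eq_bigr => k _; rewrite !mxE.
rewrite det_mulmx det_trig.
  by rewrite big1 ?mul1r // => i _; rewrite mxE (proj2 (cs i)).
apply/is_trig_mxP => i j ij; rewrite mxE nth_default //; apply: leq_trans (proj1 (cs i)) ij.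
Qed.

Lemma dickson_horner (K : numFieldType) (u : K) k : u != 0 ->
  (map_poly intr (dickson k)).[u + u^-1] = u ^+ k + u^-1 ^+ k.
Proof.
move=> u0.
pose phi : {rmorphism {poly int} -> K} := horner_morph (fun a : int => mulrC (u + u^-1) (intr a)).
rewrite -[LHS]/(phi (dickson k)) (@dickson_eval _ phi u u^-1) ?mulfV ?mulVf //.
exact: horner_morphX.
Qed.

Lemma normr_dickson_eval_le (K : numFieldType) (u B : K) k : u != 0 ->
  `|u| <= B -> `|u^-1| <= B -> 1 <= B ->
  `|(map_poly intr (dickson k)).[u + u^-1]| <= 2 * B ^+ k.
Proof.
move=> u0 uB uB' B1.
rewrite dickson_horner //.
apply: le_trans (ler_normD _ _) _; rewrite mulr_natl mulr2n !normrX.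
have B0 : 0 <= B by apply: le_trans B1.
by apply: lerD; apply: lerXn2r; rewrite ?nnegrE ?normr_ge0.
Qed.

(** For the two companion matrices, [X |-> A X B^T] has the eigenvalue [u v] with the rank one
    eigenvector [a b^T], and its characteristic polynomial has the product of the degrees as its
    degree. *)
Lemma root_product_degree (K : numFieldType) m n (f g : {poly rat}) (u v : K) :
  f \is monic -> g \is monic -> size f = m.+2 -> size g = n.+2 ->
  root (map_poly ratr f) u -> root (map_poly ratr g) v ->
  exists2 H : {poly rat}, H \is monic &
    (size H).-1 = (m.+1 * n.+1)%N /\ root (map_poly ratr H) (u * v).
Proof.
move=> mf mg sf sg fu gv.
pose A : 'M[rat]_m.+1 := companion m f; pose B : 'M[rat]_n.+1 := companion n g.
pose W := lin_mx (mulmxr B^T \o mulmx A : 'M[rat]_(m.+1, n.+1) -> 'M[rat]_(m.+1, n.+1)).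
exists (char_poly W); first exact: char_poly_monic.
split; first by rewrite size_char_poly.
rewrite map_char_poly -eigenvalue_root_char; apply/eigenvalueP.
pose a : 'cV[K]_m.+1 := \col_i u ^+ i; pose b : 'cV[K]_n.+1 := \col_i v ^+ i.
have cE l (h : {poly rat}) : map_mx ratr (companion l h) = companion l (map_poly ratr h) :> 'M[K]__.
  apply/matrixP => i j; rewrite !mxE coef_map /=.
  by case: ifP => _; rewrite ?rmorphN // rmorph_nat.
have Aa : map_mx ratr A *m a = u *: a.
  by rewrite cE; apply: companion_eigen; rewrite ?monic_map ?size_map_poly.
have Bb : map_mx ratr B *m b = v *: b.
  by rewrite cE; apply: companion_eigen; rewrite ?monic_map ?size_map_poly.
exists (mxvec (a *m b^T)).
  rewrite (map_lin_mx (gf := mulmxr (map_mx ratr B)^T \o mulmx (map_mx ratr A))); last first.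
    by move=> X /=; rewrite !map_mxM map_trmx.
  rewrite mul_vec_lin /= mulmxA Aa -!scalemxAl -mulmxA -trmx_mul Bb.
  have -> : (v *: b)^T = v *: b^T by apply/matrixP => i j; rewrite !mxE.
  by rewrite -scalemxAr scalerA; apply: linearZ.
apply/negP => /eqP /(congr1 vec_mx); rewrite mxvecK linear0 => /matrixP/(_ 0 0).
by rewrite !mxE big_ord1 !mxE !expr0 mulr1 => /eqP; rewrite oner_eq0.
Qed.

(* [x^d f(x + 1/x)]: every u with u + 1/u a root of f is a root of it. *)
Lemma reciprocal_lift (K : numFieldType) d (f : {poly rat}) : f \is monic -> size f = d.+1 ->
  exists2 g : {poly rat}, g \is monic & size g = (2 * d).+1 /\
    forall u : K, u != 0 -> root (map_poly ratr f) (u + u^-1) -> root (map_poly ratr g) u.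
Proof.
move=> mf sf; pose g : {poly rat} := \sum_(k < d.+1) f`_k *: ('X^(d - k) * ('X^2 + 1) ^+ k).
have sX k : size (('X^2 + 1 : {poly rat}) ^+ k) = (2 * k).+1.
  have := size_exp ('X^2 + 1 : {poly rat}) k; rewrite size_XnaddC //= => <-.
  by rewrite prednK // size_poly_gt0 expf_neq0 // monic_neq0 // monicXnaddC.
have mX k : ('X^2 + 1 : {poly rat}) ^+ k \is monic by rewrite monic_exp // monicXnaddC.
have gE : g = ('X^2 + 1) ^+ d + \sum_(k < d) f`_k *: ('X^(d - k) * ('X^2 + 1) ^+ k).
  rewrite /g big_ord_recr /= subnn expr0 mul1r addrC.
  by move/monicP: mf; rewrite lead_coefE sf /= => ->; rewrite scale1r.
have lt : (size (\sum_(k < d) f`_k *: ('X^(d - k) * ('X^2 + 1) ^+ k) : {poly rat})%R < (2 * d).+1)%N.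
  apply: (@leq_ltn_trans (2 * d)); last by [].
  apply: (leq_trans (size_sum _ _ _)); apply/bigmax_leqP => k _.
  apply: (leq_trans (size_scale_leq _ _)); rewrite size_Mmonic ?sX ?monic_neq0 ?monicXn //.
  by rewrite size_polyXn; have := ltn_ord k; lia.
exists g; first by rewrite gE monicE lead_coefDl ?sX // -monicE.
split; first by rewrite gE size_polyDl sX.
move=> u u0 /rootP; rewrite horner_coef size_map_poly sf => fu.
apply/rootP; rewrite /g rmorph_sum /= horner_sum.
transitivity (u ^+ d * \sum_(i < d.+1) (map_poly ratr f)`_i * (u + u^-1) ^+ i); last by rewrite fu mulr0.
rewrite mulr_sumr; apply: eq_bigr => k _.
rewrite map_polyZ rmorphM /= !(rmorphXn, rmorphD, rmorph1) /= map_polyX !hornerE coef_map /=.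
have -> : u ^+ 2 + 1 = u * (u + u^-1) by rewrite mulrDr mulfV // expr2.
have -> : u ^+ d = u ^+ (d - k) * u ^+ k by rewrite -exprD subnK // -ltnS.
by rewrite exprMn; ring.
Qed.

(* Over F_p, write x = a + b with ab = 1 for two commuting matrices: Frobenius gives x^p = a^p + b^p. *)
Lemma dickson_mod_prime p : prime p ->
  map_poly (intr : int -> 'F_p) (dickson p) = 'X^p.
Proof.
move=> pp; pose B := {poly 'F_p}.
have chB : p \in [pchar B].
  rewrite inE pp /= -(rmorph_nat (@polyC 'F_p)) polyC_eq0.
  by have := pchar_Fp pp; rewrite inE pp.
have chM : p \in [pchar 'M[B]_2].
  rewrite inE pp /=; apply/eqP; rewrite -(rmorph_nat (@scalar_mx B 2)).
  by move: chB; rewrite inE pp /= => /eqP ->; rewrite rmorph0.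
pose a : 'M[B]_2 := \matrix_(i < 2, j < 2) (if i == 0 then (if j == 0 then 'X else -1) else (if j == 0 then 1 else 0)).
pose b : 'M[B]_2 := 'X%:M - a.
have ab : a * b = 1.
  rewrite /b; apply/matrixP => i j; rewrite !mxE big_ord_recl big_ord1 !mxE.
  by case: i => -[|[|//]] ?; case: j => -[|[|//]] ?; rewrite /= ?mulr1n ?mulr0n; ring.
have ba : b * a = 1.
  rewrite /b; apply/matrixP => i j; rewrite !mxE big_ord_recl big_ord1 !mxE.
  by case: i => -[|[|//]] ?; case: j => -[|[|//]] ?; rewrite /= ?mulr1n ?mulr0n; ring.
pose phi : {rmorphism {poly int} -> 'M[B]_2} := (@scalar_mx B 2) \o map_poly (intr : int -> 'F_p).
have := @dickson_eval _ phi a b p ab ba; rewrite /phi /= map_polyX addrC subrK => /(_ erefl) H.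
have : pFrobenius_aut chM 'X%:M = pFrobenius_aut chM (a + b) by rewrite addrC subrK.
rewrite pFrobenius_autD_comm ?/GRing.comm ?ab ?ba // !pFrobenius_autE -H -rmorphXn /=.
by move/matrixP/(_ 0 0); rewrite !mxE !mulr1n => ->.
Qed.

(** Modulo [p] the composite is [f(X^p)] by [dickson_mod_prime], and this is [f^p] because Frobenius
    fixes the coefficients. *)
Lemma comp_dickson_mod_prime p (f : {poly int}) : prime p ->
  exists g : {poly int}, f \Po dickson p = f ^+ p + p%:R * g.
Proof.
move=> pp; pose q := f \Po dickson p - f ^+ p.
have chB : p \in [pchar {poly 'F_p}].
  rewrite inE pp /= -(rmorph_nat (@polyC 'F_p)) polyC_eq0.
  by have := pchar_Fp pp; rewrite inE pp.
have q0 : map_poly (intr : int -> 'F_p) q = 0.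
  rewrite rmorphB rmorphXn /= map_comp_poly dickson_mod_prime //.
  set F := map_poly _ f; rewrite -[F ^+ p](pFrobenius_autE chB).
  rewrite -{2}[F]coefK poly_def rmorph_sum /= comp_polyE; apply/eqP; rewrite subr_eq0; apply/eqP.
  apply: eq_bigr => i _; rewrite -!mul_polyC rmorphM /= !pFrobenius_autE -exprM mulnC exprM; congr (_ * _).
  apply/esym; rewrite -rmorphXn /=; congr (_%:P).
  by have := expf_card F`_i; rewrite card_Fp.
exists (\poly_(i < size q) (q`_i %/ p)%Z); rewrite -[LHS](subrK (f ^+ p)) addrC; congr (_ + _).
rewrite -/q; apply/polyP => i; rewrite mulr_natl coefMn coef_poly.
have : (p %| q`_i)%Z.
  by rewrite (dvdz_pcharf (pchar_Fp pp)) -coef_map q0 coef0.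
move=> /dvdzP[c cE]; case: ltnP => si; last by rewrite nth_default // mul0rn.
rewrite cE mulzK; first by rewrite -mulr_natr natz.
by have := prime_gt0 pp; rewrite lt0n.
Qed.

Lemma degree_lt_pred_prime n p : (32 * n.+1 ^ 2 <= p)%N ->
  ((2 * n).+2 * (2 * n).+2 < p.-1)%N.
Proof. by nia. Qed.

Lemma fact_le_expn m : (m`! <= m ^ m)%N.
Proof.
elim: m => // m IH; rewrite factS expnS leq_mul2l /= (leq_trans IH) //.
by case: m {IH} => // m; rewrite leq_exp2r.
Qed.

Lemma addrV_sub (K : fieldType) (x y : K) : x != 0 -> y != 0 ->
  y + y^-1 - (x + x^-1) = (y - x) * (1 - (x * y)^-1).
Proof. by move=> x0 y0; field; rewrite x0 y0. Qed.

Lemma addrV_le (K : numFieldType) (x y : K) :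
  0 < x -> x <= y -> y^-1 <= x -> x + x^-1 <= y + y^-1.
Proof.
move=> x0 xy yx; have y0 := lt_le_trans x0 xy.
rewrite -subr_ge0 addrV_sub ?gt_eqF // mulr_ge0 ?subr_ge0 //.
rewrite invf_le1 ?mulr_gt0 //.
by rewrite -(ler_pM2r y0) mulVf ?gt_eqF in yx.
Qed.

Lemma addrV_lt (K : numFieldType) (x y : K) :
  1 <= x -> x < y -> x + x^-1 < y + y^-1.
Proof.
move=> x1 xy; have x0 : 0 < x by apply: lt_le_trans x1.
have y0 := lt_trans x0 xy.
rewrite -subr_gt0 addrV_sub ?gt_eqF // mulr_gt0 ?subr_gt0 //.
rewrite invf_lt1 ?mulr_gt0 //; apply: (le_lt_trans x1).
by rewrite -[X in X < _]mulr1 ltr_pM2l // (le_lt_trans x1).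
Qed.

Section SalemBound.
Variables (K : numFieldType) (f : {poly int}) (n : nat) (t u : 'I_n.+1 -> K) (U : K) (p : nat).
Hypothesis irr : irreducible_poly (map_poly intr f : {poly rat}).
Hypothesis fE : map_poly intr f = \prod_i ('X - (t i)%:P).
Hypothesis u0 : forall i, u i != 0.
Hypothesis tE : forall i, t i = u i + (u i)^-1.
Hypothesis uU : forall i, `|u i| <= U /\ `|(u i)^-1| <= U.
Hypothesis U1 : 1 < U.
Variable i0 : 'I_n.+1.
Hypothesis tU : t i0 = U + U^-1.
Hypothesis pr_p : prime p.
Hypothesis p_big : (32 * n.+1 ^ 2 <= p)%N.

Local Notation fK := (map_poly intr f : {poly K}).
Local Notation b := (fun i => (map_poly intr (dickson p)).[t i]).

Let ratrE (q : {poly int}) : map_poly (ratr : rat -> K) (map_poly intr q) = map_poly intr q.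
Proof. by rewrite -map_poly_comp; apply: eq_map_poly => a /=; rewrite ratr_int. Qed.

Let rootE x : root fK x = [exists i, x == t i].
Proof.
rewrite fE -(big_map t predT (fun x => 'X - x%:P)) root_prod_XsubC.
apply/mapP/existsP => [[i _ ->]|[i /eqP->]]; first by exists i.
by exists i => //; rewrite mem_index_enum.
Qed.

Let dvd_root (g : {poly int}) i j : (map_poly intr g : {poly K}).[t i] = 0 ->
  (map_poly intr g : {poly K}).[t j] = 0.
Proof.
move=> gi; have rt k : root (map_poly ratr (map_poly intr f : {poly rat})) (t k).
  by rewrite ratrE rootE; apply/existsP; exists k.
have : (map_poly intr f : {poly rat}) %| map_poly intr g.
  apply: (irreducible_dvdp_of_common_root irr (rt i)); rewrite ratrE; exact/rootP.
rewrite -(dvdp_map (@ratr K)) !ratrE => /dvdpP[q ->].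
have := rt j; rewrite ratrE => /rootP; by rewrite hornerM => ->; rewrite mulr0.
Qed.

Let f_size : size f = n.+2.
Proof.
rewrite -(size_map_inj_poly (@intr_inj K)) // fE size_prod_XsubC.
by rewrite -[index_enum _]enumT size_enum_ord.
Qed.

Let f_monic : f \is monic.
Proof.
rewrite monicE; apply/eqP/(@intr_inj K); rewrite -lead_coef_map_inj //; last exact: intr_inj.
by rewrite fE; apply/monicP/monic_prod_XsubC.
Qed.

Let t_inj : injective t.
Proof.
move=> i j tij; apply/eqP/negP => /negP ij.
have /dvd_root f'0 : (map_poly intr f^`() : {poly K}).[t i] = 0.
  rewrite -deriv_map fE horner_deriv_prod_XsubC.
  by apply/eqP/prodf_eq0; exists j; [rewrite eq_sym | rewrite tij subrr].
have : (map_poly intr f : {poly rat}) %| map_poly intr f^`().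
  apply: (@irreducible_dvdp_of_common_root K _ _ (t i)) => //.
    by rewrite ratrE rootE; apply/existsP; exists i.
  by rewrite ratrE; apply/rootP/(f'0 i).
move/dvdp_leq; rewrite !size_map_inj_poly //; try exact: intr_inj.
move=> H; have : (map_poly intr f^`() : {poly rat}) != 0.
  rewrite -size_poly_eq0 size_map_inj_poly //; last exact: intr_inj.
  rewrite size_poly_eq0; apply/eqP => /polyP/(_ n); rewrite coef_deriv coef0.
  have -> : f`_n.+1 = 1 by move/monicP: f_monic; rewrite lead_coefE f_size.
  by move/eqP; rewrite mulrn_eq0.
by move/H; rewrite leqNgt lt_size_deriv // -size_poly_eq0 f_size.
Qed.

(** A primitive [p]-th root of unity has degree [p - 1], whereas [u i] and [v] have degree at most
    twice that of [f], and their product at most the square of this: [p] is too large. *)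
Let degree_prod i (v : K) : v != 0 -> root fK (v + v^-1) ->
  p.-primitive_root (u i * v) -> False.
Proof.
move=> v0 fv prz.
have mf : (map_poly intr f : {poly rat}) \is monic by exact: monic_map.
have sf : size (map_poly intr f : {poly rat}) = n.+2 by rewrite size_map_inj_poly //; exact: intr_inj.
have [g mg [sg gP]] := reciprocal_lift K mf sf.
have sg2 : size g = (2 * n).+1.+2 by rewrite sg; lia.
have gu : root (map_poly ratr g) (u i).
  by apply: gP => //; rewrite ratrE -tE rootE; apply/existsP; exists i.
have gv : root (map_poly ratr g) v by apply: gP => //; rewrite ratrE.
have [H mH [sH rH]] := root_product_degree mg mg sg2 sg2 gu gv.
have := totient_le_degree prz (monic_neq0 mH) rH.
by rewrite sH totient_prime // leqNgt degree_lt_pred_prime.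
Qed.

Let bE i : b i = u i ^+ p + (u i)^-1 ^+ p.
Proof. by rewrite /= tE dickson_horner. Qed.

(** If [b i = b j], then [u i ^ p] is [u j ^ p] or its inverse, so [u i / u j] or [u i * u j] is a
    [p]-th root of unity; it is not 1 since [t i] and [t j] differ, and [degree_prod] excludes
    it. *)
Let b_inj : injective b.
Proof.
move=> i j /eqP; rewrite !bE -subr_eq0 => bij; apply/eqP/negP => /negP ij.
have tij : t i != t j by apply: contra ij => /eqP/t_inj ->.
have rt k : root fK (t k) by rewrite rootE; apply/existsP; exists k.
have prim (z : K) : z ^+ p = 1 -> z != 1 -> p.-primitive_root z.
  move=> zp z1; have [m prm mp] := prim_order_exists (prime_gt0 pr_p) zp.
  move/(primeP pr_p).2: mp => /orP[/eqP m1|/eqP <- //].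
  by move: prm; rewrite m1 => /prim_expr_order; rewrite expr1 => z1'; rewrite z1' eqxx in z1.
have fact : (u i ^+ p - u j ^+ p) * (1 - (u i * u j)^-1 ^+ p) == 0.
  move: bij; rewrite invfM exprMn !exprVn; have up k : u k ^+ p != 0 by rewrite expf_neq0.
  by move=> /eqP bij; apply/eqP; rewrite -bij; field; rewrite !up.
move: fact; rewrite mulf_eq0 !subr_eq0 => /orP[/eqP H|/eqP H].
  apply: (@degree_prod i (u j)^-1); rewrite ?invr_eq0 // ?invrK 1?addrC -?tE //.
  apply: prim; first by rewrite exprMn H exprVn mulfV // expf_neq0.
  apply: contra tij => /eqP /(canRL (mulfK _)); rewrite invr_eq0 invrK mul1r => /(_ (u0 j)) uij.
  by rewrite !tE uij.
apply: (@degree_prod i (u j)) => //; first by rewrite -tE.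
apply: prim; first by rewrite -[LHS]invrK -exprVn -H invr1.
apply: contra tij => /eqP uij.
have -> : t i = t j => //.
have ui : u i = (u j)^-1 by apply: (mulIf (u0 j)); rewrite uij mulVf.
by rewrite !tE ui invrK addrC.
Qed.

(** Irreducibility would carry the relation from [i] to [i0] and make [U^p + U^(-p)] one of the
    [t k]; but these are bounded in absolute value by [U + 1/U]. *)
Let b_not_root i : fK.[b i] != 0.
Proof.
apply/negP => /eqP fb.
have : (map_poly intr (f \Po dickson p) : {poly K}).[t i] = 0.
  by rewrite map_comp_poly horner_comp.
move/(@dvd_root _ i i0); rewrite map_comp_poly horner_comp => /rootP.
rewrite rootE => /existsP[k /eqP]; rewrite tU.
have U0 : 0 < U by apply: lt_trans U1.
rewrite dickson_horner ?gt_eqF // => tk.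
have : `|t k| <= U + U^-1.
  have [uk uk'] := uU k; rewrite tE; apply: le_trans (ler_normD _ _) _.
  rewrite normfV in uk' *; apply: addrV_le; rewrite ?normr_gt0 //.
  by rewrite -[X in _ <= X]invrK lef_pV2 ?posrE ?invr_gt0 ?normr_gt0.
have UV0 : 0 <= U^-1 by rewrite invr_ge0 ltW.
have P0 : 0 <= U ^+ p + U^-1 ^+ p by rewrite addr_ge0 ?exprn_ge0 // ltW.
rewrite -tk ger0_norm //; apply/negP.
rewrite exprVn in P0 *.
rewrite -real_ltNge ?(ger0_real P0) ?ger0_real ?(addr_ge0 (ltW U0)) //.
by apply: addrV_lt; rewrite ?ltW // -[X in X < _]expr1 ltr_eXn2l // prime_gt1.
Qed.

Let x (i : 'I_(n.+1 + n.+1)) := match fintype.split i with inl j => t j | inr j => b j end.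
Let xl i : x (lshift _ i) = t i. Proof. by rewrite /x (unsplitK (inl i)). Qed.
Let xr i : x (rshift _ i) = b i. Proof. by rewrite /x (unsplitK (inr i)). Qed.

Let int_ge1 (z : int) (y : K) : y = z%:~R -> y != 0 -> 1 <= `|y|.
Proof.
move=> ->; rewrite intr_eq0 -intr_norm ler1z => z0.
by rewrite -gtz0_ge1 normr_gt0.
Qed.

(** The squared Vandermonde determinant of all [t i] and [b i] is the product of two discriminants,
    which are non-zero integers, and of the square of the mixed product. The latter is the product
    of the [f(b i)], and [f(P_p) = f^p + p g] makes each [f(b i)] equal to [p g(t i)]. *)
Let det_lower : (p%:R ^+ n.+1) ^+ 2 <= `|\det (Vandermonde (n.+1 + n.+1) (\row_i x i))| ^+ 2 :> K.
Proof.
have [F mF FE] := conj_image_poly fE t_inj (dickson p).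
have disc_ge1 (h : {poly int}) (s : 'I_n.+1 -> K) : map_poly intr h = \prod_i ('X - (s i)%:P) ->
    injective s -> 1 <= \prod_i \prod_(j | j != i) `|s i - s j|.
  move=> hE s_inj; have [z zE] := conj_norm_int hE s_inj h^`().
  have -> : \prod_i \prod_(j | j != i) `|s i - s j| = `|\prod_i (map_poly intr h^`()).[s i]|.
    rewrite normr_prod; apply: eq_bigr => i _.
    by rewrite -deriv_map hE horner_deriv_prod_XsubC normr_prod.
  apply: (int_ge1 zE); apply/prodf_neq0 => i _; rewrite -deriv_map hE horner_deriv_prod_XsubC.
  by apply/prodf_neq0 => j ji; rewrite subr_eq0; apply: contra ji => /eqP/s_inj ->.
have mixed : p%:R ^+ n.+1 <= \prod_i \prod_j `|b i - t j|.
  have [g gE] := comp_dickson_mod_prime f pr_p.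
  have fb i : fK.[b i] = p%:R * (map_poly intr g).[t i].
    rewrite /= -horner_comp -map_comp_poly gE rmorphD rmorphXn rmorphM /= rmorph_nat hornerD horner_exp.
    have /rootP -> : root fK (t i) by rewrite rootE; apply/existsP; exists i.
    by rewrite expr0n gtn_eqF ?prime_gt0 // add0r hornerM -polyC_natr hornerC.
  have [z zE] := conj_norm_int fE t_inj g.
  have -> : \prod_i \prod_j `|b i - t j| = `|\prod_i fK.[b i]|.
    rewrite normr_prod; apply: eq_bigr => i _; rewrite fE horner_prod normr_prod.
    by apply: eq_bigr => j _; rewrite !hornerE.
  rewrite (eq_bigr _ (fun i _ => fb i)) big_split /= prodr_const card_ord normrM normrX normr_nat.
  rewrite ler_peMr ?exprn_ge0 //; apply: (int_ge1 zE).
  apply/prodf_neq0 => i _; apply/negP => /eqP gi0.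
  by have := b_not_root i; rewrite fb gi0 mulr0 eqxx.
rewrite normr_det_Vandermonde_sqr big_split_ord /=.
under eq_bigr => i _.
  rewrite big_split_ord /= xl.
  rewrite [X in X * _](eq_bigr (fun j => `|t i - t j|)); last by move=> j _; rewrite xl.
  rewrite [X in X * _](eq_bigl (fun j => j != i)); last by move=> j; rewrite (inj_eq (@lshift_inj _ _)).
  rewrite [X in _ * X](eq_bigr (fun j => `|b j - t i|)); last by move=> j _; rewrite xr distrC.
  rewrite [X in _ * X](eq_bigl predT); last by move=> j; rewrite -val_eqE /=; have := ltn_ord i; lia.
  over.
under [X in _ * X]eq_bigr => i _.
  rewrite big_split_ord /= xr.
  rewrite [X in X * _](eq_bigr (fun j => `|b i - t j|)); last by move=> j _; rewrite xl.
  rewrite [X in X * _](eq_bigl predT); last by move=> j; rewrite -val_eqE /=; have := ltn_ord j; lia.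
  rewrite [X in _ * X](eq_bigr (fun j => `|b i - b j|)); last by move=> j _; rewrite xr.
  rewrite [X in _ * X](eq_bigl (fun j => j != i)); last by move=> j; rewrite (inj_eq (@rshift_inj _ _)).
  over.
rewrite !big_split /= [X in _ * X * _]exchange_big /=.
set A := \prod_i \prod_(j | _) `|t i - t j|; set B := \prod_i \prod_i0 _; set D := \prod_i \prod_(j | _) _.
have A1 : 1 <= A by apply: (disc_ge1 f).
have D1 : 1 <= D by apply: (disc_ge1 F).
have p0 : 0 <= p%:R ^+ n.+1 :> K by rewrite exprn_ge0.
have B0 : 0 <= B by apply: le_trans mixed.
apply: (@le_trans _ _ (B ^+ 2)); first by apply: lerXn2r.
have -> : A * B * (B * D) = B ^+ 2 * (A * D) by ring.
by rewrite ler_peMr ?exprn_ge0 // mulr_ege1.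
Qed.

(** Leibniz expansion of the matrix of Dickson values: the columns of the [t i] carry powers of [U],
    those of the [b i] powers of [U^p]. *)
Let det_upper : `|\det (Vandermonde (n.+1 + n.+1) (\row_i x i))| <=
  (4 * n.+1)%:R ^+ (2 * n.+1) * U ^+ (2 * n.+1 * n.+1 * p.+1).
Proof.
have U0 : 0 < U by apply: lt_trans U1.
pose B (i : 'I_(n.+1 + n.+1)) : K := match fintype.split i with inl _ => U | inr _ => U ^+ p end.
have B1 i : 1 <= B i by rewrite /B; case: fintype.split => _; rewrite ?exprn_ege1 // ltW.
rewrite -det_dickson; apply: (@le_trans _ _ ((n.+1 + n.+1)`!%:R * \prod_j (2 * B j ^+ (n.+1 + n.+1)))).
  apply: normr_det_le => i j; rewrite mxE; case: ifP => _.
    by rewrite normr1 mulr_ege1 ?ler1n ?exprn_ege1.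
  apply: (@le_trans _ _ (2 * B j ^+ i)); last first.
    by rewrite ler_pM2l ?ltr0n // ler_weXn2l // ltnW.
  have := B1 j; rewrite /x /B; case: fintype.split => k B1k.
    by have [? ?] := uU k; rewrite tE; apply: normr_dickson_eval_le.
  have [? ?] := uU k; rewrite bE exprVn; apply: normr_dickson_eval_le; rewrite ?expf_neq0 // ?normrV ?unitfE ?expf_neq0 //.
    by rewrite normrX; apply: lerXn2r; rewrite ?nnegrE // ltW.
  by rewrite -normrV ?unitfE ?expf_neq0 // -exprVn normrX; apply: lerXn2r; rewrite ?nnegrE // ltW.
have -> : \prod_j (2 * B j ^+ (n.+1 + n.+1)) = 2 ^+ (n.+1 + n.+1) * U ^+ (2 * n.+1 * n.+1 * p.+1).
  rewrite big_split_ord /=.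
  under eq_bigr do rewrite /B (unsplitK (inl _)).
  under [X in _ * X]eq_bigr do rewrite /B (unsplitK (inr _)).
  rewrite !prodr_const card_ord !exprMn -!exprM mulrACA -!exprD; congr (_ * _ ^+ _).
  lia.
rewrite mulrA; apply: ler_wpM2r; first by rewrite exprn_ge0 // ltW.
rewrite (_ : n.+1 + n.+1 = 2 * n.+1)%N; last by rewrite addnn mul2n.
rewrite -!natrX -natrM ler_nat (_ : 4 * n.+1 = 2 * n.+1 * 2)%N; last by rewrite mulnAC.
by rewrite expnMn leq_mul2r fact_le_expn orbT.
Qed.

(** Taking the root of order [n.+1] in the two bounds leaves [p] at most [(4 (n+1))^2] times the
    power of [U], while [p] is at least twice [(4 (n+1))^2]. *)
Lemma mahler_lower_bound : 2 <= U ^+ (2 * n.+1 * p.+1).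
Proof.
have U0 : 0 < U by apply: lt_trans U1.
have : p%:R ^+ n.+1 <= ((4 * n.+1)%:R ^+ 2 * U ^+ (2 * n.+1 * p.+1)) ^+ n.+1 :> K.
  apply: (@le_trans _ _ `|\det (Vandermonde (n.+1 + n.+1) (\row_i x i))|).
    by rewrite -(@ler_pXn2r _ 2) ?nnegrE ?exprn_ge0 ?normr_ge0.
  apply: (le_trans det_upper); rewrite exprMn -!exprM (mulnAC (2 * n.+1)).
  exact: lexx.
rewrite ler_pXn2r ?nnegrE ?mulr_ge0 ?exprn_ge0 ?(ltW U0) // => H.
have pb : (4 * n.+1)%:R ^+ 2 * 2 <= p%:R :> K.
  by rewrite -natrX -natrM ler_nat (leq_trans _ p_big) // expnMn mulnC mulnA leq_mul2r orbT.
by move: (le_trans pb H); rewrite ler_pM2l // exprn_gt0 // ltr0n.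
Qed.

End SalemBound.

Local Open Scope classical_set_scope.
Local Open Scope ring_scope.

(** * Quaternion orders and their traces *)

Section IntegralSubring.
Variable K : fieldType.

Definition integral_elements : {pred K} := [pred x | `[< integralOver (intr : int -> K) x >]].

Lemma integral_elementsP x : reflect (integralOver (intr : int -> K) x) (x \in integral_elements).
Proof. exact: asboolP. Qed.

Fact integral_elements_subring : subring_closed integral_elements.
Proof.
split; first by apply/integral_elementsP/integral1.
- by move=> x y /integral_elementsP ix /integral_elementsP iy; apply/integral_elementsP/integral_sub.
- by move=> x y /integral_elementsP ix /integral_elementsP iy; apply/integral_elementsP/integral_mul.
Qed.

HB.instance Definition _ := GRing.isSubringClosed.Build K integral_elements integral_elements_subring.

Lemma integral_eigenvalue n (C : 'M[K]_n) (z : K) :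
  (forall i j, integralOver (intr : int -> K) (C i j)) -> eigenvalue C z ->
  integralOver (intr : int -> K) z.
Proof.
move=> iC; rewrite eigenvalue_root_char => rz.
apply: (integral_root_monic (char_poly_monic C) rz).
have : char_poly C \is a polyOver integral_elements.
  apply: rpred_sum => s _; apply: rpredM.
    by apply: rpredX; rewrite rpredN rpred1.
  apply: rpred_prod => i _; rewrite !mxE; apply: rpredB.
    by apply: rpredMn; apply: polyOverX.
  by rewrite polyOverC; apply/integral_elementsP.
by move=> /polyOverP cS x /(nthP 0)[i _ <-]; apply/integral_elementsP/cS.
Qed.

End IntegralSubring.

Lemma integralOver_rmorph (K L : fieldType) (s : {rmorphism K -> L}) x :
  integralOver (intr : int -> K) x -> integralOver (intr : int -> L) (s x).
Proof.
move=> [p mp rp]; exists p => //.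
have -> : map_poly intr p = map_poly s (map_poly intr p).
  by rewrite -map_poly_comp; apply: eq_map_poly => a /=; rewrite rmorph_int.
by rewrite fmorph_root.
Qed.

Section BaseChangeAlgebra.
Variables (k : fieldExtType rat) (A : falgType k) (R : realType) (s : {rmorphism k -> R}).

Local Notation beta := (@base_change_of k A R s).
Local Notation bmul := (@base_change_mul k A R s).
Local Notation e := (vbasis {:A}).

Lemma base_change_ofD x y : beta (x + y) = beta x + beta y.
Proof. by apply/rowP => i; rewrite !mxE linearD rmorphD. Qed.

Lemma base_change_ofZ c x : beta (c *: x) = s c *: beta x.
Proof. by apply/rowP => i; rewrite !mxE linearZ rmorphM. Qed.

Lemma base_change_of0 : beta 0 = 0.
Proof. by apply/rowP => i; rewrite !mxE linear0 rmorph0. Qed.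

Lemma base_change_of_sum I (r : seq I) (P : pred I) (F : I -> A) :
  beta (\sum_(i <- r | P i) F i) = \sum_(i <- r | P i) beta (F i).
Proof. by elim/big_rec2: _ => [|i y x _ <-]; rewrite ?base_change_of0 ?base_change_ofD. Qed.

Lemma base_change_row_sum (u : base_change A R) : u = \sum_i u 0 i *: beta e`_i.
Proof.
apply/rowP => j; rewrite summxE (bigD1 j) //= !mxE coord_free ?(basis_free (vbasisP _)) // eqxx rmorph1 mulr1.
rewrite big1 ?addr0 // => i ij; rewrite !mxE coord_free ?(basis_free (vbasisP _)) //.
by rewrite (negbTE ij) rmorph0 mulr0.
Qed.

Lemma base_change_mulDl u u' v : bmul (u + u') v = bmul u v + bmul u' v.
Proof.
rewrite -big_split; apply: eq_bigr => i _; rewrite -big_split; apply: eq_bigr => j _.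
by rewrite /= mxE mulrDl scalerDl.
Qed.

Lemma base_change_mulDr u v v' : bmul u (v + v') = bmul u v + bmul u v'.
Proof.
rewrite -big_split; apply: eq_bigr => i _; rewrite -big_split; apply: eq_bigr => j _.
by rewrite /= mxE mulrDr scalerDl.
Qed.

Lemma base_change_mulZl c u v : bmul (c *: u) v = c *: bmul u v.
Proof.
rewrite scaler_sumr; apply: eq_bigr => i _; rewrite scaler_sumr; apply: eq_bigr => j _.
by rewrite /= mxE scalerA mulrA.
Qed.

Lemma base_change_mulZr c u v : bmul u (c *: v) = c *: bmul u v.
Proof.
rewrite scaler_sumr; apply: eq_bigr => i _; rewrite scaler_sumr; apply: eq_bigr => j _.
by rewrite /= mxE scalerA mulrCA.
Qed.

Lemma base_change_mul0r u : bmul u 0 = 0.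
Proof. by have := base_change_mulZr 0 u 0; rewrite !scale0r. Qed.

Lemma base_change_mul0l u : bmul 0 u = 0.
Proof. by have := base_change_mulZl 0 0 u; rewrite !scale0r. Qed.

Lemma base_change_mul_suml I (r : seq I) (P : pred I) (F : I -> base_change A R) v :
  bmul (\sum_(i <- r | P i) F i) v = \sum_(i <- r | P i) bmul (F i) v.
Proof. by elim/big_rec2: _ => [|i y x _ <-]; rewrite ?base_change_mul0l ?base_change_mulDl. Qed.

Lemma base_change_mul_sumr I (r : seq I) (P : pred I) (F : I -> base_change A R) v :
  bmul v (\sum_(i <- r | P i) F i) = \sum_(i <- r | P i) bmul v (F i).
Proof. by elim/big_rec2: _ => [|i y x _ <-]; rewrite ?base_change_mul0r ?base_change_mulDr. Qed.

Lemma base_change_ofM x y : bmul (beta x) (beta y) = beta (x * y).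
Proof.
rewrite /base_change_mul [in RHS](coord_vbasis (memvf x)) [in RHS](coord_vbasis (memvf y)).
rewrite mulr_suml base_change_of_sum; apply: eq_bigr => i _.
rewrite mulr_sumr base_change_of_sum; apply: eq_bigr => j _.
by rewrite !mxE -scalerAl -scalerAr !base_change_ofZ scalerA.
Qed.

Opaque base_change_mul.

Lemma base_change_mulA u v w : bmul u (bmul v w) = bmul (bmul u v) w.
Proof.
pose comb (c : base_change A R) i := c 0 i *: beta e`_i.
have suml (c c' : base_change A R) : bmul (\sum_i comb c i) c' = \sum_i bmul (comb c i) c'.
  exact: base_change_mul_suml.
have sumr (c c' : base_change A R) : bmul c' (\sum_i comb c i) = \sum_i bmul c' (comb c i).
  exact: base_change_mul_sumr.
have basis i j l : bmul (beta e`_i) (bmul (beta e`_j) (beta e`_l)) =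
    bmul (bmul (beta e`_i) (beta e`_j)) (beta e`_l).
  by rewrite !base_change_ofM mulrA.
have third i j : bmul (beta e`_i) (bmul (beta e`_j) w) = bmul (bmul (beta e`_i) (beta e`_j)) w.
  rewrite (base_change_row_sum w) -/(comb w) !(sumr w) base_change_mul_sumr; apply: eq_bigr => l _.
  by rewrite /comb !base_change_mulZr basis.
have second i : bmul (beta e`_i) (bmul v w) = bmul (bmul (beta e`_i) v) w.
  rewrite (base_change_row_sum v) -/(comb v) (suml v) (sumr v) base_change_mul_sumr base_change_mul_suml.
  by apply: eq_bigr => l _; rewrite /comb !(base_change_mulZr, base_change_mulZl) third.
rewrite (base_change_row_sum u) -/(comb u) !(suml u) base_change_mul_suml.
by apply: eq_bigr => l _; rewrite /comb !base_change_mulZl second.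
Qed.

Lemma base_change_mul1l u : bmul (beta 1) u = u.
Proof.
rewrite [in LHS](base_change_row_sum u) base_change_mul_sumr [RHS]base_change_row_sum.
by apply: eq_bigr => i _; rewrite base_change_mulZr base_change_ofM mul1r.
Qed.

(** With [q^2 = b] the norm condition is [a^2 - b = 1]. If [|s a| > 1], then [s b] has a real square
    root [c], and [(q - c)(q + c) = 0] exhibits zero divisors in the base change, where all non-zero
    elements are invertible. *)
Lemma ramified_norm_one_bound (a : k) (q : A) : ramified_at A s ->
  pure_quaternion q -> (a%:A + q) * (a%:A - q) = 1 -> `|s a| <= 1.
Proof.
move=> ram pq nrm.
have qq1 : q * q \in 1%VS by case: pq => [->|[_ //]]; rewrite mulr0 mem0v.
have [b qb] : exists b : k, q * q = b%:A by move/vlineP: qq1.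
have ab : a ^+ 2 - b = 1.
  move: nrm; rewrite mulrDl !mulrBr qb -!scalerAl !mul1r -scalerAr mulr1 addrA subrK scalerA -scalerBl.
  by move=> /eqP; rewrite -[X in _ == X]scale1r -subr_eq0 -scalerBl scaler_eq0 oner_eq0 orbF subr_eq0 => /eqP.
rewrite leNgt; apply/negP => a1.
have sb : 0 < s b.
  have -> : b = a ^+ 2 - 1 by rewrite -ab; ring.
  rewrite rmorphB rmorphXn rmorph1 subr_gt0 -real_normK ?num_real //.
  by rewrite exprn_egt1.
case: pq => [q0|[q1 _]].
  move: qb; rewrite q0 mulr0 => /esym/eqP; rewrite scaler_eq0 oner_eq0 orbF => /eqP b0.
  by rewrite b0 rmorph0 ltxx in sb.
set c := Num.sqrt (s b).
have c2 : c * c = s b by rewrite -expr2 sqr_sqrtr // ltW.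
(* If [q] were [- c'] in the base change, a coordinate where 1 is non-zero would show that [c']
   comes from [k], and [q] would be a scalar. *)
have nz (c' : R) : beta q + c' *: beta 1 != 0.
  apply/negP => /eqP/rowP H.
  have [i i1] : exists i, coord e i 1 != 0.
    apply/existsP; rewrite -negb_forall; apply/negP => /forallP z1.
    have : (1 : A) = 0 by rewrite (coord_vbasis (memvf (1 : A))) big1 // => i _; rewrite (eqP (z1 i)) scale0r.
    by move/eqP; rewrite oner_eq0.
  have [d c'E] : exists d, c' = s d.
    exists (- coord e i q / coord e i 1).
    have := H i; rewrite !mxE fmorph_div rmorphN => /eqP; rewrite addrC addr_eq0 => /eqP <-.
    by rewrite mulfK // fmorph_eq0.
  move/negP: q1; apply; apply/vlineP; exists (- d).

  rewrite (coord_vbasis (memvf q)) {1}(coord_vbasis (memvf (1 : A))) scaler_sumr.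
  apply: eq_bigr => j _; rewrite scalerA; congr (_ *: _).
  apply: (fmorph_inj s); have := H j; rewrite !mxE c'E => /eqP; rewrite addr_eq0 => /eqP ->.
  by rewrite rmorphM rmorphN mulNr.
have prod0 : bmul (beta q + (- c) *: beta 1) (beta q + c *: beta 1) = 0.
  rewrite base_change_mulDl !base_change_mulDr !(base_change_mulZl, base_change_mulZr).
  rewrite !base_change_ofM !mul1r !mulr1 qb base_change_ofZ scalerA mulNr c2 scaleNr.
  by rewrite scaleNr addrA addrK subrr.
have [v [_ vu]] := ram _ (nz (- c)).
have := congr1 (bmul v) prod0; rewrite base_change_mulA vu base_change_mul1l base_change_mul0r.
by apply/eqP/nz.
Qed.

Transparent base_change_mul.

End BaseChangeAlgebra.

(** * Field embeddings from eigenvalues of multiplications *)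

Section FieldEmbeddings.
Variable k : fieldExtType rat.

Local Notation e := (vbasis {:k}).

Definition mult_mx (y : k) : 'M[rat]_(\dim {:k}) := \matrix_(i, j) coord e j (e`_i * y).

Lemma mult_mx_coord (x y : k) :
  (\row_i coord e i x) *m mult_mx y = \row_i coord e i (x * y).
Proof.
apply/rowP => j; rewrite !mxE [in RHS](coord_vbasis (memvf x)) mulr_suml linear_sum.
by apply: eq_bigr => i _; rewrite !mxE -scalerAl linearZ.
Qed.

Lemma mult_mx_sum (c : 'I_(\dim {:k}) -> rat) (x : 'I_(\dim {:k}) -> k) :
  mult_mx (\sum_i c i *: x i) = \sum_i c i *: mult_mx (x i).
Proof.
apply/matrixP => i j; rewrite summxE !mxE mulr_sumr linear_sum.
by apply: eq_bigr => l _; rewrite !mxE -scalerAr linearZ.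
Qed.

Lemma mult_mxB (x y : k) : mult_mx (x - y) = mult_mx x - mult_mx y.
Proof. by apply/matrixP => i j; rewrite !mxE mulrBr linearB. Qed.

Lemma mult_mxM (x y : k) : mult_mx (x * y) = mult_mx x *m mult_mx y.
Proof.
apply/row_matrixP => i; rewrite row_mul.
have rE z : row i (mult_mx z) = \row_j coord e j (e`_i * z) by apply/rowP => j; rewrite !mxE.
by rewrite !rE mult_mx_coord mulrA.
Qed.

Lemma mult_mx1 : mult_mx 1 = 1%:M.
Proof.
by apply/matrixP => i j; rewrite !mxE mulr1 coord_free ?(basis_free (vbasisP _)) // eq_sym.
Qed.

Variable K : numClosedFieldType.
Local Notation "M ^K" := (map_mx (ratr : rat -> K) M) (at level 2).

(* The multiplications by elements of k commute, so every eigenvalue z of one of them belongs to a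
   common eigenvector; the eigenvalues on it form the embedding. *)
Lemma embedding_of_root (c : k) (z : K) : root (map_poly ratr (char_poly (mult_mx c))) z ->
  exists s : {rmorphism k -> K}, s c = z.
Proof.
rewrite map_char_poly -eigenvalue_root_char => ez.
set E := eigenspace (mult_mx c)^K z.
have comm x y : comm_mx (mult_mx x)^K (mult_mx y)^K.
  by rewrite /comm_mx -!map_mxM -!mult_mxM mulrC.
have stE x : stablemx E (mult_mx x)^K by apply: comm_mx_stable_eigenspace.
pose As := [seq conjmx (row_base E) (mult_mx x)^K | x <- e].
have [||v v0 vP] := @common_eigenvector K _ As.
- by rewrite lt0n mxrank_eq0.
- move=> _ _ /mapP[x _ ->] /mapP[y _ ->].
  by rewrite /comm_mx -!conjmxM ?inE ?stablemx_row_base // comm.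
pose w := v *m row_base E.
have w0 : w != 0 by rewrite mulmx_free_eq0 ?row_base_free.
have eigb (i : 'I_(\dim {:k})) : exists a, w *m (mult_mx e`_i)^K = a *: w.
  have iAs : conjmx (row_base E) (mult_mx e`_i)^K \in As.
    by apply/mapP; exists e`_i; rewrite ?mem_nth ?size_tuple.
  move/allP: vP => /(_ _ iAs).
  by rewrite stablemx_restrict // => /sub_rVP[a aE]; exists a; exact: aE.
have [a aE] := choice eigb.
have eig x : exists b, w *m (mult_mx x)^K = b *: w.
  exists (\sum_i ratr (coord e i x) * a i).
  rewrite {1}(coord_vbasis (memvf x)) mult_mx_sum map_mx_sum mulmx_sumr scaler_suml.
  by apply: eq_bigr => i _; rewrite map_mxZ -scalemxAr aE scalerA.
have [s sE] := choice eig.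
have inj b b' : b *: w = b' *: w -> b = b'.
  by move/eqP; rewrite -subr_eq0 -scalerBl scaler_eq0 (negbTE w0) orbF subr_eq0 => /eqP.
have sB : zmod_morphism s.
  move=> x y; apply: inj; rewrite -sE mult_mxB map_mxB mulmxBr !sE scalerBl //.
have sM : monoid_morphism s.
  split; first by apply: inj; rewrite -sE mult_mx1 map_mx1 mulmx1 scale1r.
  move=> x y; apply: inj.
  by rewrite -sE mult_mxM map_mxM mulmxA sE -scalemxAl sE scalerA.
pose sZ := GRing.isZmodMorphism.Build k K s sB.
pose sMm := GRing.isMonoidMorphism.Build k K s sM.
exists (HB.pack s sZ sMm : {rmorphism k -> K}) => /=.
apply: inj; rewrite -sE; apply/eigenspaceP.
by rewrite /w mulmx_sub // eq_row_base.
Qed.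

End FieldEmbeddings.

Lemma countable_falgType (k : fieldExtType rat) (A : falgType k) : countable [set: A].
Proof.
apply/countable_injP.
pose f (x : A) := pickle (\matrix_(i, j) coord (vbasis {:k}) j (coord (vbasis {:A}) i x) : 'M[rat]_(\dim {:A}, \dim {:k})).
exists f => x y _ _ /(pcan_inj pickleK)/matrixP xy.
rewrite (coord_vbasis (memvf x)) (coord_vbasis (memvf y)); apply: eq_bigr => i _; congr (_ *: _).
rewrite (coord_vbasis (memvf (coord _ i x))) (coord_vbasis (memvf (coord _ i y))).
by apply: eq_bigr => j _; have := xy i j; rewrite !mxE => ->.
Qed.

Section FiniteIndex.
Variables (G : groupType) (I H : set G).
Hypotheses (fin : finite_index I H) (I1 : I 1%g).

Lemma countable_of_finite_index : countable I -> countable H.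
Proof.
move=> cI; apply: (@sub_countable _ _ _ (\bigcup_(c in left_coset I @` H) c)).
  apply: subset_card_le => h Hh; exists (left_coset I h); first by exists h.
  by exists 1%g => //; rewrite mulg1.
apply: bigcup_countable; first exact: finite_set_countable.
move=> _ [x _ <-]; exact: (sub_countable (card_image_le _ _) cI).
Qed.

(** Otherwise the cosets of the powers of [h] would be pairwise distinct. *)
Lemma power_in_finite_index (h : G) : (forall i, H (h ^+ i)%g) ->
  exists2 m, (0 < m)%N & I (h ^+ m)%g.
Proof.
move=> Hh; apply: contrapT => noI.
have inj : {in [set: nat] &, injective (fun i => left_coset I (h ^+ i)%g)}.
  suff lt i j : (i < j)%N -> left_coset I (h ^+ i)%g <> left_coset I (h ^+ j)%g.
    by move=> i j _ _ ij; case: (ltngtP i j) => // /lt; rewrite ij.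
  move=> ij cE; apply: noI; exists (j - i)%N; first by rewrite subn_gt0.
  have : left_coset I (h ^+ j)%g (h ^+ j)%g by exists 1%g => //; rewrite mulg1.
  rewrite -cE => -[y Iy]; rewrite -{1}(subnKC (ltnW ij)) expgnDr => /mulgI yE.
  by rewrite -yE.
apply: infinite_nat; rewrite -(eq_finite_set (inj_card_eq inj)).
by apply: sub_finite_set fin => _ [i _ <-]; exists (h ^+ i)%g.
Qed.

End FiniteIndex.

Lemma det22 (R : comPzRingType) (M : 'M[R]_2) : \det M = M 0 0 * M 1 1 - M 0 1 * M 1 0.
Proof.
rewrite (expand_det_row _ 0) !big_ord_recl big_ord0 addr0 /cofactor !det_mx11 !mxE /=.
rewrite !mulrA expr0 expr1 mulr1 mulrN1 mulNr.
by congr (_ * M _ _ - M _ _ * M _ _); apply: val_inj.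
Qed.

Lemma tr22 (R : pzSemiRingType) (M : 'M[R]_2) : \tr M = M 0 0 + M 1 1.
Proof. by rewrite /mxtrace !big_ord_recl big_ord0 addr0; congr (_ + M _ _); apply: val_inj. Qed.

Lemma matrix2P (R : Type) (M N : 'M[R]_2) : M 0 0 = N 0 0 -> M 0 1 = N 0 1 ->
  M 1 0 = N 1 0 -> M 1 1 = N 1 1 -> M = N.
Proof.
move=> H00 H01 H10 H11; apply/matrixP => i j.
have cases (l : 'I_2) : l = 0 \/ l = 1 by case: l => -[|[|//]] ?; [left|right]; apply: val_inj.
by case: (cases i) => ->; case: (cases j) => ->.
Qed.

Lemma mulmx2E (R : pzSemiRingType) (M N : 'M[R]_2) i j : (M *m N) i j = M i 0 * N 0 j + M i 1 * N 1 j.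
Proof. by rewrite !mxE !big_ord_recl big_ord0 addr0; congr (_ + M _ _ * N _ _); apply: val_inj. Qed.

Lemma scalar_mx2E (R : pzSemiRingType) (a : R) :
  [/\ (a%:M : 'M[R]_2) 0 0 = a, (a%:M : 'M[R]_2) 0 1 = 0,
      (a%:M : 'M[R]_2) 1 0 = 0 & (a%:M : 'M[R]_2) 1 1 = a].
Proof. by split; rewrite !mxE /= ?mulr1n ?mulr0n. Qed.

Lemma slmxM (R : realType) (g h : SL2 R) : slmx (g * h)%g = slmx g *m slmx h.
Proof. by []. Qed.

Lemma slmxV (R : realType) (g : SL2 R) : slmx (g^-1)%g = invmx (slmx g).
Proof. by []. Qed.

Lemma tr_conj (R : realType) (g h : SL2 R) : \tr (slmx (g ^ h)%g) = \tr (slmx g).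
Proof.
by rewrite conjgE !slmxM slmxV mxtrace_mulC -mulmxA mulmxV ?mulmx1 // slmx_unit.
Qed.

Lemma char_poly_tr (R : comNzRingType) n (M : 'M[R]_n) : char_poly M^T = char_poly M.
Proof.
rewrite /char_poly -[RHS]det_tr; congr (\det _); apply/matrixP => i j.
by rewrite !mxE eq_sym.
Qed.

Section ArithmeticTraces.
Variables (R : realType) (k : fieldExtType rat) (A : falgType k) (O : set A).
Variables (s0 : {rmorphism k -> R}) (rho : {rmorphism A -> 'M[R]_2}).
Hypotheses (real_k : totally_real R k) (quat : is_quaternion_algebra A).
Hypotheses (ram : ramified_except A s0) (ordO : is_order O).
Hypotheses (rho_inj : injective rho) (rhoZ : forall (a : k) (x : A), rho (a *: x) = s0 a *: rho x).

Local Notation C_ x := (real_complex R x).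
Local Notation "M ^CC" := (map_mx (real_complex R) M) (at level 2).

(** The square of [rho q] is scalar. With non-zero trace, Cayley-Hamilton would force [rho q] itself
    to be scalar and [q] to be central, which a non-zero pure quaternion is not. *)
Lemma trace_pure_quaternion q : pure_quaternion q -> \tr (rho q) = 0.
Proof.
case=> [->|[q1 /vlineP[b qb]]]; first by rewrite rmorph0 mxtrace0.
set M := rho q; apply/eqP/negP => /negP tr0.
have MM : M *m M = (s0 b)%:M.
  by rewrite mulmxE -rmorphM qb rhoZ rmorph1 scalemx1.
have [e00 e01 e10 e11] := scalar_mx2E (s0 b).
have Mscal : M = (M 0 0)%:M.
  have [f00 f01 f10 f11] := scalar_mx2E (M 0 0).
  have E i j := congr1 (fun N : 'M[R]_2 => N i j) MM.
  have := E 0 0; have := E 0 1; have := E 1 0; have := E 1 1.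
  rewrite !mulmx2E e00 e01 e10 e11 => E11 E10 E01 E00.
  move: tr0; rewrite tr22 => tr0.
  have m01 : M 0 1 = 0.
    by apply: (mulIf tr0); rewrite mul0r -E01; ring.
  have m10 : M 1 0 = 0.
    by apply: (mulIf tr0); rewrite mul0r -E10; ring.
  apply: matrix2P; rewrite ?f00 ?f01 ?f10 ?f11 //.
  move: E00 E11; rewrite m01 m10 !mul0r ?mulr0 addr0 add0r => <- E11.
  have : (M 1 1 - M 0 0) * (M 0 0 + M 1 1) = 0 by rewrite mulrDr !mulrBl E11; ring.
  by move=> /eqP; rewrite mulf_eq0 (negbTE tr0) orbF subr_eq0 => /eqP.
case: quat => _ Z1 _; move/negP: q1; apply; rewrite -Z1 memv_cap memvf /=.
apply/centvP => y _; apply: rho_inj; rewrite !rmorphM /= -/M -!mulmxE Mscal.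
by rewrite scalar_mxC.
Qed.

Lemma norm_one_trace x : norm_one O x -> exists a, exists2 q, x = a%:A + q &
  [/\ pure_quaternion q, (a%:A + q) * (a%:A - q) = 1 & \tr (rho x) = s0 (a + a)].
Proof.
move=> [_ [a [q [pq xE nq]]]]; exists a, q => //; split => //; first by rewrite nq scale1r.
rewrite xE rmorphD rhoZ rmorph1 linearD linearZ /= mxtrace1 trace_pure_quaternion // addr0.
by rewrite rmorphD mulr_natr mulr2n.
Qed.

(* Cayley-Hamilton for the left multiplication by x on the generators of O. *)
Lemma order_eigenvalue_integral x (z : R[i]) : O x -> eigenvalue (rho x)^CC z ->
  integralOver (intr : int -> R[i]) z.
Proof.
move=> Ox; case: ordO => O1 OM [s spanS OE].
have Os (i : 'I_(size s)) : O s`_i.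
  rewrite OE; exists (fun j => (i == j)%:R).
    by move=> j; case: eqP => _; apply: integral_nat.
  rewrite (bigD1 i) //= eqxx scale1r big1 ?addr0 // => j ji.
  by rewrite eq_sym (negbTE ji) scale0r.
have xs (i : 'I_(size s)) : exists c : 'I_(size s) -> k, (forall j, ring_of_integers (c j)) /\
    x * s`_i = \sum_j c j *: s`_j.
  have : O (x * s`_i) by apply: OM.
  by rewrite OE => -[c ci ->]; exists c.
have [c cP] := choice xs.
case/eigenvalueP => y yE y0.
pose Y := \matrix_(i < size s) (y *m (rho s`_i)^CC).
pose D : 'M[R[i]]_(size s) := \matrix_(i, j) C_ (s0 (c i j)).
have DY : D *m Y = z *: Y.
  apply/row_matrixP => i; rewrite row_mul [in RHS]linearZ /= !rowK.
  have -> : z *: (y *m (rho s`_i)^CC) = y *m (rho (x * s`_i))^CC.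
    by rewrite rmorphM /= -mulmxE map_mxM mulmxA yE -scalemxAl.
  rewrite (cP i).2 rmorph_sum /= map_mx_sum mulmx_sumr mulmx_sum_row; apply: eq_bigr => j _.
  by rewrite rhoZ map_mxZ -scalemxAr !mxE rowK.
have Y0 : Y != 0.
  apply/negP => /eqP Y0; move/negP: y0; apply.
  have : (1 : A) \in span s by rewrite spanS memvf.
  move/(@coord_span _ _ _ (in_tuple s)) => E1.
  have : y *m (rho 1)^CC = 0.
    rewrite E1 rmorph_sum /= map_mx_sum mulmx_sumr big1 // => i _.
    rewrite rhoZ map_mxZ -scalemxAr; have := congr1 (row i) Y0; rewrite rowK row0.
    by move=> ->; rewrite scaler0.
  by rewrite rmorph1 map_mx1 mulmx1 => ->.
have [j Yj] : exists j, col j Y != 0.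
  apply/existsP; rewrite -negb_forall; apply/negP => /forallP H; move/negP: Y0; apply.
  by apply/eqP/matrixP => i j; move/eqP/matrixP/(_ i 0): (H j); rewrite !mxE.
apply: (@integral_eigenvalue _ _ D^T).
  by move=> i l; rewrite !mxE; do 2 apply: integralOver_rmorph; apply: (cP _).1.
apply/eigenvalueP; exists (col j Y)^T; last by rewrite -trmx0 (inj_eq trmx_inj).
by rewrite -trmx_mul colE mulmxA DY -scalemxAl linearZ.
Qed.

Lemma norm_one_eigenvalue_integral x (z : R[i]) : norm_one O x -> \det (rho x) = 1 ->
  z != 0 -> z + z^-1 = C_ (\tr (rho x)) -> integralOver (intr : int -> R[i]) z.
Proof.
move=> [Ox _] d1 z0 zE; apply: (order_eigenvalue_integral Ox).
have : \det ((rho x)^CC - z%:M) == 0.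
  have [e00 e01 e10 e11] := scalar_mx2E z.
  rewrite det22 ![((rho x)^CC - _) _ _]mxE ![(- z%:M) _ _]mxE e00 e01 e10 e11 !mxE !subr0.
  have : C_ (\det (rho x)) = 1 by rewrite d1 rmorph1.
  move: zE; rewrite det22 tr22 rmorphB rmorphD !rmorphM => zE dE.
  have z2 : z * z + 1 = z * (C_ (rho x 0 0) + C_ (rho x 1 1)) by rewrite -zE mulrDr mulfV.
  apply/eqP; transitivity (z * z + C_ (rho x 0 0) * C_ (rho x 1 1) - C_ (rho x 0 1) * C_ (rho x 1 0)
     - z * (C_ (rho x 0 0) + C_ (rho x 1 1))); first by ring.
  by rewrite -z2 -dE; ring.
case/det0P => v v0; rewrite mulmxBr => /eqP; rewrite subr_eq0 mul_mx_scalar => /eqP vE.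
by apply/eigenvalueP; exists v.
Qed.

(** The trace is [s0 (2 a)], and the roots of the characteristic polynomial of the multiplication by
    [2 a] are its images under the complex embeddings of [k]. These are real since [k] is totally
    real, and ramification bounds them for every embedding but [s0]. *)
Lemma norm_one_trace_conjugates x : norm_one O x ->
  exists2 q : {poly rat}, root (map_poly ratr q) (C_ (\tr (rho x))) &
    forall z : R[i], root (map_poly ratr q) z -> z = C_ (\tr (rho x)) \/
      exists2 r : R, z = C_ r & `|r| <= 2.
Proof.
move=> /norm_one_trace[a [qq xE [pq nq ->]]].
pose f : {rmorphism k -> R[i]} := real_complex R \o s0.
have fZ (c : rat) y : f (c *: y) = ratr c * f y.
  by rewrite -mulr_algl rmorphM -(fmorph_eq_rat (f \o GRing.in_alg k)).
exists (char_poly (mult_mx (a + a))).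
  rewrite map_char_poly -char_poly_tr -eigenvalue_root_char; apply/eigenvalueP.
  exists (\row_i f (vbasis {:k})`_i).
    apply/rowP => i; rewrite !mxE -[C_ _]/(f (a + a)) -rmorphM.
    rewrite [in RHS]mulrC [in RHS](coord_vbasis (memvf (_ * (a + a)))) rmorph_sum /=.
    by apply: eq_bigr => j _; rewrite !mxE; apply: etrans (mulrC _ _) (esym (fZ _ _)).
  apply/negP => /eqP v0; have : f 1 = 0.
    rewrite (coord_vbasis (memvf (1 : k))) rmorph_sum big1 // => i _.
    by have /rowP/(_ i) := v0; rewrite !mxE fZ => ->; rewrite mulr0.
  by move/eqP; rewrite rmorph1 oner_eq0.
move=> z /embedding_of_root[s <-].
have sreal y : s y = C_ (complex.Re (s y)).
  by have := real_k s y; case: (s y) => u v /= ->.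
pose sr y := complex.Re (s y).
have srB : zmod_morphism sr.
  by move=> y y'; apply: complexI; rewrite rmorphB /= -!sreal rmorphB.
have srM : monoid_morphism sr.
  split; first by apply: complexI; rewrite /= -!sreal !rmorph1.
  by move=> y y'; apply: complexI; rewrite rmorphM /= -!sreal rmorphM.
pose srZ := GRing.isZmodMorphism.Build k R sr srB.
pose srMm := GRing.isMonoidMorphism.Build k R sr srM.
pose sR : {rmorphism k -> R} := HB.pack sr srZ srMm.
have [E|/(proj2 ram) ramS] := pselect (sR =1 s0).
  by left; rewrite sreal -[complex.Re _]/(sR _) E.
right; exists (sR (a + a)); first exact: sreal.
have := ramified_norm_one_bound ramS pq nq.
rewrite rmorphD => H; apply: (le_trans (ler_normD _ _)).
by rewrite mulr2n lerD.
Qed.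

End ArithmeticTraces.

Lemma arithmetic_countable (R : realType) (Gam : set (SL2 R)) :
  arithmetic_Fuchsian Gam -> countable Gam.
Proof.
move=> [[G1 GM GV] [k [A [ord [s0 [rho [g [real_k quat ordO [rho_inj rhoZ] [comm _]]]]]]]]].
set H := [set (h ^ g)%g | h in Gam] in comm; set I := image_in_SL2 rho _ in comm.
have O1 : norm_one ord 1.
  case: ordO => O1 _ _; split=> //; exists 1, 0; split; first by left.
    by rewrite scale1r addr0.
  by rewrite addr0 subr0 scale1r mulr1.
have HI1 : (H `&` I) 1%g.
  split; first by exists 1%g => //; rewrite conj1g.
  by exists 1 => //; rewrite rmorph1.
have cH : countable H.
  apply: (countable_of_finite_index comm HI1).
  apply: (@sub_countable _ _ _ ((fun x => insubd (1%g : SL2 R) (rho x)) @` [set: A])).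
    apply: subset_card_le => h [_ [x _ xE]]; exists x => //.
    by apply: val_inj; rewrite insubdK /= xE // -topredE /= det_slmx.
  exact: sub_countable (card_image_le _ _) (countable_falgType A).
apply: (@sub_countable _ _ _ ((fun h => h ^ g^-1)%g @` H)).
  by apply: subset_card_le => h Gh; exists (h ^ g)%g; [exists h|rewrite conjgK].
exact: sub_countable (card_image_le _ _) cH.
Qed.

(** Commensurability only puts some power of a conjugate of [h] into the norm-one group, so
    integrality and the position of the conjugates are first obtained for that power. *)
Lemma arithmetic_trace_conjugates (R : realType) (Gam : set (SL2 R)) (h : SL2 R) :
  arithmetic_Fuchsian Gam -> Gam h ->
  exists2 m, (0 < m)%N &
    (forall z : R[i], z != 0 -> z + z^-1 = real_complex R (\tr (slmx (h ^+ m)%g)) ->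
       integralOver (intr : int -> R[i]) z) /\
    exists2 q : {poly rat}, root (map_poly ratr q) (real_complex R (\tr (slmx (h ^+ m)%g))) &
      forall z : R[i], root (map_poly ratr q) z ->
        z = real_complex R (\tr (slmx (h ^+ m)%g)) \/
        exists2 r : R, z = real_complex R r & `|r| <= 2.
Proof.
move=> [[G1 GM GV] [k [A [ord [s0 [rho [g [real_k [quat ram] ordO [rho_inj rhoZ] [comm _]]]]]]]]] Gh.
set H := [set (h ^ g)%g | h in Gam] in comm; set I := image_in_SL2 rho _ in comm.
have O1 : norm_one ord 1.
  case: ordO => O1 _ _; split=> //; exists 1, 0; split; first by left.
    by rewrite scale1r addr0.
  by rewrite addr0 subr0 scale1r mulr1.
have HI1 : (H `&` I) 1%g.
  split; first by exists 1%g => //; rewrite conj1g.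
  by exists 1 => //; rewrite rmorph1.
have Gexp i : Gam (h ^+ i)%g by elim: i => [//|i IH]; rewrite expgS; apply: GM.
have [i|m m0 [_ [x Ox xE]]] := power_in_finite_index comm HI1 (h := (h ^ g)%g).
  by rewrite -conjXg; exists (h ^+ i)%g.
exists m => //; rewrite -conjXg in xE.
have trE : \tr (slmx (h ^+ m)%g) = \tr (rho x) by rewrite xE tr_conj.
have d1 : \det (rho x) = 1 by rewrite xE det_slmx.
rewrite trE; split; last by eapply norm_one_trace_conjugates; eassumption.
by move=> z z0 zE; eapply norm_one_eigenvalue_integral; eassumption.
Qed.

Lemma minimal_polynomial (k : fieldExtType rat) (K : numFieldType) (s : {rmorphism k -> K}) (y : k) :
  exists f : {poly rat}, [/\ f \is monic, irreducible_poly f,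
    root (map_poly ratr f) (s y) & (size f <= (\dim {:k}).+1)%N].
Proof.
have /polyOver1P[f fE] := minPolyOver 1 y.
have sE : (map_poly ratr f : {poly K}) = map_poly s (minPoly 1 y).
  rewrite fE -map_poly_comp; apply: eq_map_poly => c /=.
  by rewrite -(fmorph_eq_rat (s \o GRing.in_alg k)).
have sizef : size f = (adjoin_degree 1 y).+1.
  by rewrite -(size_map_poly (GRing.in_alg k)) -fE size_minPoly.
exists f; split.
- by rewrite -(map_monic (GRing.in_alg k)) -fE monic_minPoly.
- split; first by rewrite sizef.
  move=> q q1 qf; have := @minPoly_irr _ _ 1%AS y (map_poly (GRing.in_alg k) q).
  have qO : map_poly (GRing.in_alg k) q \is a polyOver 1%AS by apply/polyOver1P; exists q.
  rewrite fE dvdp_map qf => /(_ qO isT); rewrite eqp_map => /orP[//|].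
  by rewrite -(rmorph1 (map_poly (GRing.in_alg k))) eqp_map -size_poly_eq1 (negbTE q1).
- by rewrite sE fmorph_root root_minPoly.
rewrite sizef ltnS; have := dim_Fadjoin 1%AS y; rewrite dimv1 muln1 => <-.
exact: dimvS (subvf _).
Qed.

(** Gauss's lemma: a monic rational factor of a monic integer polynomial has integer
    coefficients. *)
Lemma integral_monic_irreducible (K : numFieldType) (f : {poly rat}) (x : K) :
  f \is monic -> irreducible_poly f -> root (map_poly ratr f) x ->
  integralOver (intr : int -> K) x ->
  exists F : {poly int}, map_poly intr F = f.
Proof.
move=> mf irr fx [G mG Gx].
have ratrE (q : {poly int}) : map_poly (ratr : rat -> K) (map_poly intr q) = map_poly intr q.
  by rewrite -map_poly_comp; apply: eq_map_poly => a /=; rewrite ratr_int.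
have fG : f %| map_poly intr G.
  by apply: (irreducible_dvdp_of_common_root irr fx); rewrite ratrE.
have /dvdpP_rat_int[F [a a0 fF] [r GE]] := fG.
have l1 : lead_coef F * lead_coef r = 1.
  by rewrite -lead_coefM -GE (monicP mG).
exists (lead_coef r *: F).
have := congr1 lead_coef fF; rewrite (monicP mf) lead_coefZ lead_coef_map_inj //; last exact: intr_inj.
move=> aE; rewrite fF map_polyZ /=; congr (_ *: _).
have F0 : (lead_coef F)%:~R != 0 :> rat by apply/eqP => z; move/eqP: aE; rewrite z mulr0 oner_eq0.
by apply: (mulIf F0); rewrite -aE -intrM mulrC l1.
Qed.

Lemma normr_eq1_of_addrV (R : realType) (z : R[i]) (r : R) : z != 0 ->
  z + z^-1 = real_complex R r -> `|r| <= 2 -> `|z| = 1.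
Proof.
move=> z0 zE r2.
have quad : z * z - real_complex R r * z + 1 = 0.
  by rewrite -zE mulrDl mulVf // opprD addrA subrr add0r addNr || (field; rewrite z0).
case: z z0 zE quad => a b z0 zE quad.
have : complex.Re ((a +i* b) * (a +i* b) - real_complex R r * (a +i* b) + 1)%C = 0 by rewrite quad.
have : complex.Im ((a +i* b) * (a +i* b) - real_complex R r * (a +i* b) + 1)%C = 0 by rewrite quad.
rewrite /= => E1 E2.
rewrite normc_def /=.
have -> : a ^+ 2 + b ^+ 2 = 1; last by rewrite sqrtr1.
move: r2; rewrite ler_norml => /andP[r2 r2'].
have [b0|b0] := eqVneq b 0.
  rewrite b0 in E1 E2 *.
  have ar : 2 * a - r = 0.
    apply/eqP; rewrite -sqrf_eq0 eq_le sqr_ge0 andbT.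
    have -> : (2 * a - r) ^+ 2 = r ^+ 2 - 4 by nra.
    by nra.
  nra.
have aE : 2 * a = r.
  by apply: (mulIf b0); nra.
nra.
Qed.

Lemma slmxVE (R : realType) (g : SL2 R) :
  [/\ slmx (g^-1)%g 0 0 = slmx g 1 1, slmx (g^-1)%g 0 1 = - slmx g 0 1,
      slmx (g^-1)%g 1 0 = - slmx g 1 0 & slmx (g^-1)%g 1 1 = slmx g 0 0].
Proof.
have adj : slmx (g^-1)%g = \adj (slmx g) by rewrite slmxV /invmx slmx_unit det_slmx invr1 scale1r.
rewrite adj; split; rewrite !mxE /cofactor det_mx11 !mxE /= ?addn0 ?add0n ?expr0 ?expr1 ?mul1r ?mulN1r ?addn1 ?expr2 ?mulrNN ?mulr1 ?mul1r;
  try (congr (- _)); congr (slmx g _ _); exact: val_inj.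
Qed.

(** Cayley-Hamilton in [SL2] reads [g + g^-1 = tr g], so [dickson_eval] applies with [a = g] and
    [b = g^-1]. *)
Lemma tr_expg_dickson (R : realType) (g : SL2 R) m :
  \tr (slmx (g ^+ m)%g) = (map_poly intr (dickson m)).[\tr (slmx g)].
Proof.
have Vsum (h : SL2 R) : slmx h + slmx (h^-1)%g = (\tr (slmx h))%:M.
  have d1 := det_slmx h.
  have adj : slmx (h^-1)%g = \adj (slmx h) by rewrite slmxV /invmx slmx_unit d1 invr1 scale1r.
  have [e00 e01 e10 e11] := scalar_mx2E (\tr (slmx h)).
  have [i00 i01 i10 i11] := slmxVE h.
  by apply: matrix2P; rewrite ?e00 ?e01 ?e10 ?e11 mxE ?i00 ?i01 ?i10 ?i11 ?subrr // tr22 // addrC.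
have expE (h : SL2 R) i : slmx (h ^+ i)%g = slmx h ^+ i.
  by elim: i => [//|i IH]; rewrite expgS exprS slmxM IH.
have trV (h : SL2 R) : \tr (slmx (h^-1)%g) = \tr (slmx h).
  have := congr1 mxtrace (Vsum h); rewrite linearD /= mxtrace_scalar mulr2n.
  by move/addrI.
pose ev : {rmorphism {poly int} -> R} := horner_morph (fun a : int => mulrC (\tr (slmx g)) (intr a)).
pose phi : {rmorphism {poly int} -> 'M[R]_2} := (@scalar_mx R 2) \o ev.
have := @dickson_eval _ phi (slmx g) (slmx (g^-1)%g) m.
rewrite -!mulmxE -!slmxM mulgV mulVg => /(_ erefl erefl).
have -> : phi 'X = slmx g + slmx (g^-1)%g by rewrite Vsum /phi /= horner_morphX.
move=> /(_ erefl); rewrite -!expE expVgn => E.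
have := congr1 mxtrace E; rewrite mxtrace_scalar linearD /= trV -mulr2n.
by move/eqP; rewrite -subr_eq0 -mulrnBl mulrn_eq0 /= subr_eq0 => /eqP <-.
Qed.

Lemma dickson_horner_ratr (K : numFieldType) (m : nat) (x : K) :
  (map_poly ratr (map_poly intr (dickson m) : {poly rat})).[x] = (map_poly intr (dickson m)).[x].
Proof.
by rewrite -map_poly_comp; congr (_.[_]); apply: eq_map_poly => a /=; rewrite ratr_int.
Qed.

Lemma exists_addrV (R : realType) (t : R[i]) : exists2 u, u != 0 & t = u + u^-1.
Proof.
have sz : size ('X^2 - t *: 'X + 1 : {poly R[i]}) = 3%N.
  rewrite -addrA size_polyDl size_polyXn // (leq_ltn_trans (size_polyD _ _)) //.
  rewrite size_polyN size_poly1 gtn_max; apply/andP; split => //.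
  by apply: leq_ltn_trans (size_scale_leq _ _) _; rewrite size_polyX.
have [|u /rootP] := @closed_rootP _ ('X^2 - t *: 'X + 1 : {poly R[i]}) _; first by rewrite sz.
rewrite !hornerE => uE.
have u0 : u != 0 by apply/negP => /eqP u0; move: uE; rewrite u0 !(mulr0, mul0r, oppr0, add0r, expr0n) /= ?add0r => /eqP; rewrite oner_eq0.
exists u => //; apply: (mulIf u0); rewrite mulrDl mulVf //.
by apply/eqP; rewrite eq_sym -subr_eq0 -uE; apply/eqP; ring.
Qed.

Lemma bernoulli_le (R : realFieldType) (x : R) (l : nat) : 0 <= x -> (1 + x) ^+ l * (1 - l%:R * x) <= 1.
Proof.
move=> x0; elim: l => [|l IH]; first by rewrite expr0 mul0r subr0 mulr1.
apply: le_trans IH; rewrite exprS -mulrA mulrCA ler_wpM2l ?exprn_ge0 ?addr_ge0 //.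
rewrite -natr1; have : 0 <= l%:R :> R by [].
by move: (l%:R) => c c0; nra.
Qed.

(** Bernoulli's inequality turns [2 <= U^N] into [U >= 1 + 1/(2N)], and
    [U + 1/U - 2 = (U - 1)^2 / U]. *)
Lemma addrV_gap (R : realFieldType) (U : R) N : 1 < U -> (0 < N)%N -> 2 <= U ^+ N ->
  (8 * N%:R ^+ 2)^-1 <= U + U^-1 - 2.
Proof.
move=> U1 N0 UN; have U0 : 0 < U by lra.
have N1 : 1 <= N%:R :> R by rewrite ler1n.
pose y : R := (2 * N%:R)^-1.
have y0 : 0 < y by rewrite invr_gt0; lra.
have yN : N%:R * y = 2^-1 by rewrite /y invfM mulrCA mulfV ?mulr1 //; apply/eqP; lra.
have y1 : y <= 2^-1 by rewrite lef_pV2 ?posrE //; lra.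
have Uge : 1 + y <= U.
  rewrite leNgt; apply/negP => Ult.
  have : U ^+ N < (1 + y) ^+ N.
    by rewrite ltr_pXn2r ?nnegrE ?(ltW U0) ?addr_ge0 ?(ltW y0).
  have := bernoulli_le N (ltW y0); rewrite yN.
  by move: UN; set X := U ^+ N; set Y := (_ ^+ N); lra.
have -> : U + U^-1 - 2 = (U - 1) ^+ 2 / U by field; lra.
have -> : (8 * N%:R ^+ 2)^-1 = y ^+ 2 / 2.
  have -> : 8 * N%:R ^+ 2 = (2 * N%:R) ^+ 2 * 2 :> R by ring.
  by rewrite invfM exprVn.
rewrite ler_pdivlMr //; move: y0 y1 Uge; clear; move: y => y y0 y1 Uge.
have yy : y ^+ 2 <= (U - 1) ^+ 2 by nra.
have [U2|U2] := lerP U 2.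
  have : y ^+ 2 * (1 - U / 2) >= 0 by rewrite mulr_ge0 ?sqr_ge0 //; lra.
  by nra.
have : y ^+ 2 <= 4^-1 by nra.
by nra.
Qed.

(** * Gaps between 2 and the traces of squares *)

Section TraceGap.
Variables (R : realType) (Gam : set (SL2 R)) (k : fieldExtType rat) (iota : {rmorphism k -> R}).
Hypotheses (arith : arithmetic_Fuchsian Gam) (ktr : range iota = invariant_trace_field Gam).
Variables (h : SL2 R) (y : k).
Hypotheses (Gh : Gam h) (yE : iota y = \tr (slmx (h ^+ 2)%g)).

Local Notation C_ x := (real_complex R x).
Local Notation n := (\dim {:k}).
Local Notation tau := (\tr (slmx (h ^+ 2)%g)).

(** The eigenvalue [z] of [h^2] is a root of unity of some order [M] and of degree at most [2n], so
    [phi(M) <= 2n] and [M <= 8 n^2]. The gap [2 - tau] is [|1 - z|^2], and [|1 - z| >= 1/M]. *)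
Lemma elliptic_trace_gap j : (0 < j)%N -> (h ^+ j)%g = 1%g -> tau != 2 ->
  ((8 * n ^ 2)%:R ^- 2 : R) <= 2 - tau.
Proof.
move=> j0 hj tau2.
have [f [mf irr fr sf]] := minimal_polynomial (real_complex R \o iota) y.
rewrite /= yE in fr.
have [z z0 zE] := exists_addrV (C_ tau).
have zj : z ^+ j = 1.
  have := tr_expg_dickson (h ^+ 2)%g j; rewrite expgnAC hj expg1n mxtrace1 => E.
  have : z ^+ j + z^-1 ^+ j = 2.
    rewrite -dickson_horner // -zE; have := congr1 (real_complex R) E.
    rewrite rmorph_nat => ->; rewrite -horner_map -map_poly_comp /=.
    by congr (_.[_]); apply: eq_map_poly => a /=; rewrite rmorph_int.
  rewrite exprVn => E2; have zj0 : z ^+ j != 0 by rewrite expf_neq0.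
  apply/eqP; rewrite -subr_eq0 -sqrf_eq0; apply/eqP.
  transitivity (z ^+ j * (z ^+ j + (z ^+ j)^-1 - 2)); first by field.
  by rewrite E2 subrr mulr0.
have [M prz Mj] := prim_order_exists j0 zj.
have z1 : z != 1.
  apply: contra tau2 => /eqP z1; apply/eqP/complexI; rewrite zE z1 invr1 rmorph_nat //.
have M0 := prim_order_gt0 prz.
have nz : `|z| = 1.
  by apply/eqP; rewrite -(@pexpr_eq1 _ _ j) ?normr_ge0 // -normrX zj normr1.
have MB : (M <= 8 * n ^ 2)%N.
  have [|g mg [sg gP]] := @reciprocal_lift (R[i] : numFieldType) (size f).-1 f mf.
    by rewrite prednK // ltnW //; case: irr.
  have gz : root (map_poly ratr g) z by apply: gP => //; rewrite -zE.
  have := totient_le_degree prz (monic_neq0 mg) gz; rewrite sg /= => tl.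
  apply: leq_trans (leq_totient_sqr M0) _.
  have tn : (totient M <= 2 * n)%N by apply: leq_trans tl _; rewrite leq_mul2l; case: (size f) sf.
  apply: (@leq_trans (2 * (2 * n) ^ 2)); first by rewrite leq_mul2l leq_exp2r.
  by rewrite expnMn mulnA.
(* The powers of [z] sum to 0 over a period, so [M] is the absolute value of the sum of the
   [1 - z^i], each of which is at most [M |1 - z|]. *)
have Mz : M%:R <= M%:R ^+ 2 * `|1 - z|.
  have sum0 : \sum_(i < M) z ^+ i = 0.
    have z1' : z - 1 != 0 by rewrite subr_eq0.
    by apply: (mulfI z1'); rewrite mulr0 -subrX1 (prim_expr_order prz) subrr.
  have ME : M%:R = `|\sum_(i < M) (1 - z ^+ i)|.
    by rewrite sumrB sum0 subr0 sumr_const card_ord normr_nat.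
  rewrite [leLHS]ME; apply: le_trans (ler_norm_sum _ _ _) _.
  have -> : M%:R ^+ 2 * `|1 - z| = \sum_(i < M) (M%:R * `|1 - z|).
    by rewrite sumr_const card_ord -[RHS]mulr_natl mulrA expr2.
  apply: ler_sum => i _.
  rewrite -opprB subrX1 -mulNr opprB.
  rewrite normrM mulrC ler_wpM2r //; apply: le_trans (ler_norm_sum _ _ _) _.
  apply: (@le_trans _ _ (\sum_(l < i) 1)); last by rewrite sumr_const card_ord ler_nat ltnW.
  by apply: ler_sum => l _; rewrite normrX nz expr1n.
have dist : `|1 - z| ^+ 2 = C_ (2 - tau).
  have -> : C_ (2 - tau) = 2 - (z + z^-1) by rewrite -zE rmorphB rmorph_nat.
  rewrite sqr_normc.
  have -> : z^-1 = z^*%C by rewrite invc_norm nz expr1n invr1 mul1r.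
  have zz : z * z^*%C = 1 by rewrite -sqr_normc nz expr1n.
  by rewrite rmorphB rmorph1 mulrBl mul1r mulrBr mulr1 zz; ring.
rewrite -lecR -dist; apply: (@le_trans _ _ (M%:R ^- 2)).
  rewrite fmorphV rmorphXn rmorph_nat lef_pV2 ?posrE ?exprn_gt0 ?ltr0n //.
    by rewrite lerXn2r // ?nnegrE ?ler0n // ler_nat.
  by apply: leq_trans MB.
have Mp : 0 < M%:R :> R[i] by rewrite ltr0n.
rewrite -exprVn lerXn2r ?nnegrE ?invr_ge0 ?ler0n ?normr_ge0 //.
by rewrite -(ler_pM2l (exprn_gt0 2 Mp)) expr2 mulfK ?gt_eqF.
Qed.

(** Let [t i = u i + 1 / u i] be the conjugates of [tau]. Their Dickson images are conjugates of the
    trace of the power supplied by commensurability: each is that trace or lies in [[-2, 2]]. So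
    each [|u i|] is [U], [1/U] or 1, and [mahler_lower_bound] applies. *)
Lemma hyperbolic_trace_gap p : prime p -> (32 * n ^ 2 <= p)%N -> 2 < tau ->
  (8 * (2 * n * p.+1)%:R ^+ 2)^-1 <= tau - 2.
Proof.
move=> pp pbig tau2.
have [f [mf irr fr sf]] := minimal_polynomial (real_complex R \o iota) y.
rewrite /= yE in fr.
pose U : R := (tau + Num.sqrt (tau ^+ 2 - 4)) / 2.
have sq0 : 0 < tau ^+ 2 - 4 by nra.
have [q q0 [qE UE]] : exists2 q, 0 < q & q ^+ 2 = tau ^+ 2 - 4 /\ U = (tau + q) / 2.
  by exists (Num.sqrt (tau ^+ 2 - 4)); rewrite ?sqrtr_gt0 // sqr_sqrtr // ltW.
have U1 : 1 < U by rewrite UE; lra.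
have U0 : 0 < U by lra.
have Un : U != 0 by rewrite gt_eqF.
have tauE : tau = U + U^-1.
  have quad : U ^+ 2 - tau * U + 1 = 0.
    rewrite UE; transitivity ((q ^+ 2 - (tau ^+ 2 - 4)) / 4); first by field.
    by rewrite qE subrr mul0r.
  by apply: (mulIf Un); rewrite mulrDl mulVf //; nra.
clear UE qE q q0.
have Gh2 : Gam (h ^+ 2)%g.
  by case: arith => [[G1 GM _] _]; rewrite expg2; apply: GM.
have [m m0 [intE [q qw qP]]] := arithmetic_trace_conjugates arith Gh2.
have wE : C_ (\tr (slmx (h ^+ 2 ^+ m)%g)) = (map_poly intr (dickson m)).[C_ tau].
  rewrite tr_expg_dickson -horner_map -map_poly_comp /=.
  by congr (_.[_]); apply: eq_map_poly => a /=; rewrite rmorph_int.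
have tauC : C_ tau = C_ U + (C_ U)^-1 by rewrite tauE rmorphD fmorphV.
have CU0 : C_ U != 0 by rewrite fmorph_eq0 gt_eqF.
have wU : C_ (\tr (slmx (h ^+ 2 ^+ m)%g)) = C_ U ^+ m + (C_ U) ^- m.
  by rewrite wE tauC dickson_horner // exprVn.
(* Integrality descends from [z^m] to [z], which removes the exponent [m] introduced by
   commensurability. *)
have introot (z : R[i]) : integralOver (intr : int -> R[i]) (z ^+ m) -> integralOver (intr : int -> R[i]) z.
  move=> iz; apply: (@integral_root_monic _ _ _ _ ('X^m - (z ^+ m)%:P)).
  - exact: monicXnsubC.
  - by rewrite /root !hornerE subrr.
  move=> x /(nthP 0)[i _ <-]; rewrite coefB coefXn coefC; apply: integral_sub.
    by case: eqP => _; apply: integral_nat.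
  by case: eqP => _ //; apply: (integral_nat _ 0).
have itau : integralOver (intr : int -> R[i]) (C_ tau).
  rewrite tauC; apply: integral_add; apply: introot; apply: intE.
  - by rewrite expf_neq0.
  - by rewrite wU.
  - by rewrite expf_neq0 // invr_eq0.
  - by rewrite exprVn invrK wU addrC.
have [F FE] := integral_monic_irreducible mf irr fr itau.
have [ts tsE] := closed_field_poly_normal (map_poly intr F : {poly R[i]}).
have FQ : map_poly (ratr : rat -> R[i]) f = map_poly intr F.
  by rewrite -FE -map_poly_comp; apply: eq_map_poly => a /=; rewrite ratr_int.
have mF : (map_poly intr F : {poly R[i]}) \is monic by rewrite -FQ map_monic.
rewrite (monicP mF) scale1r in tsE.
have szts : size f = (size ts).+1.
  by rewrite -(size_map_poly (@ratr R[i])) FQ tsE size_prod_XsubC.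
case: ts szts tsE => [|t0 ts'] szts tsE; first by case: irr; rewrite szts.
set ts := t0 :: ts' in szts tsE; set d := size ts' in szts.
pose t (i : 'I_d.+1) := ts`_i.
have tE : map_poly intr F = \prod_i ('X - (t i)%:P).
  by rewrite tsE (big_nth 0) big_mkord.
have troot i : root (map_poly ratr f) (t i).
  by rewrite FQ tsE root_prod_XsubC mem_nth.
have [i0 ti0] : exists i0, t i0 = C_ tau.
  move: fr; rewrite FQ tsE root_prod_XsubC => /(nthP 0)[i si <-].
  by exists (Ordinal si).
have /choice[u uP] i : exists u, u != 0 /\ t i = u + u^-1.
  by have [u u0 uE] := exists_addrV (t i); exists u.
have fq : f %| q \Po map_poly intr (dickson m).
  apply: (irreducible_dvdp_of_common_root irr fr).
  by rewrite /root map_comp_poly horner_comp dickson_horner_ratr -wE; exact: qw.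
have CU1 : 1 < C_ U by rewrite -(rmorph1 (real_complex R)) ltcR.
have CUp : 0 < C_ U by apply: lt_trans CU1.
have uU i : `|u i| <= C_ U /\ `|(u i)^-1| <= C_ U.
  have [u0 tiE] := uP i.
  have um0 : u i ^+ m != 0 by rewrite expf_neq0.
  have CUV : (C_ U)^-1 <= 1 by rewrite invf_le1 // ltW.
  suff [E|[E|E]] : `|u i| = C_ U \/ `|u i| = (C_ U)^-1 \/ `|u i| = 1.
  - by rewrite normfV E; split=> //; apply: le_trans CUV (ltW CU1).
  - by rewrite normfV E invrK; split=> //; apply: le_trans CUV (ltW CU1).
  - by rewrite normfV E invr1 ltW.
  have Um0 : C_ U ^+ m != 0 by rewrite expf_neq0.
  have eqm (x : R[i]) : 0 <= x -> `|u i| ^+ m = x ^+ m -> `|u i| = x.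
    by move=> x0 /eqP; rewrite eqrXn2 // => /eqP.
  have : root (map_poly ratr q) (u i ^+ m + (u i ^+ m)^-1).
    have : root (map_poly ratr (q \Po map_poly intr (dickson m))) (t i).
      have /dvdpP[g ->] := fq; by rewrite rmorphM rootM troot orbT.
    by rewrite /root map_comp_poly horner_comp dickson_horner_ratr tiE dickson_horner // exprVn.
  case/qP => [|[r rE r2]].
    rewrite wU => /eqP; rewrite -subr_eq0 addrV_sub // mulf_eq0 !subr_eq0 => /orP[/eqP E|/eqP E].
      by left; apply: eqm; rewrite ?ltW // -normrX E ger0_norm // exprn_ge0 // ltW.
    right; left; apply: eqm; first by rewrite invr_ge0 ltW.
    rewrite -normrX exprVn; have -> : u i ^+ m = (C_ U ^+ m)^-1.
      by apply: (mulIf Um0); rewrite mulVf //; apply: invr_inj; rewrite mulrC -E invr1.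
    by rewrite ger0_norm // invr_ge0 exprn_ge0 // ltW.
  right; right; apply: eqm => //; rewrite expr1n -normrX.
  exact: normr_eq1_of_addrV um0 rE r2.
have irrF : irreducible_poly (map_poly intr F : {poly rat}) by rewrite FE.
have dn : (d.+1 <= n)%N by move: sf; rewrite szts.
have ti0' : t i0 = C_ U + (C_ U)^-1 by rewrite ti0 tauC.
have pbig' : (32 * d.+1 ^ 2 <= p)%N.
  by apply: leq_trans pbig; rewrite leq_mul2l leq_exp2r.
have := mahler_lower_bound irrF tE (fun i => (uP i).1) (fun i => (uP i).2) uU CU1 ti0' pp pbig'.
set N := (2 * n * p.+1)%N => bound.
have UN : 2 <= U ^+ N.
  rewrite -lecR rmorph_nat rmorphXn; apply: (le_trans bound).
  by apply: ler_weXn2l; rewrite ?ltW // /N !leq_mul.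
have n0 : (0 < n)%N by apply: leq_trans dn.
rewrite tauE; apply: addrV_gap UN => //.
by rewrite /N !muln_gt0 n0.
Qed.

End TraceGap.

(** * The group SL2(R) and its Haar measure *)

Section Coordinates.
Variable R : realType.
Implicit Types g h : SL2 R.

Definition ga g := slmx g 0 0.
Definition gb g := slmx g 0 1.
Definition gc g := slmx g 1 0.
Definition gd g := slmx g 1 1.

Lemma gdet g : ga g * gd g - gb g * gc g = 1.
Proof. by rewrite -det22 det_slmx. Qed.

Lemma gaM g h : ga (g * h)%g = ga g * ga h + gb g * gc h. Proof. exact: mulmx2E. Qed.
Lemma gbM g h : gb (g * h)%g = ga g * gb h + gb g * gd h. Proof. exact: mulmx2E. Qed.
Lemma gcM g h : gc (g * h)%g = gc g * ga h + gd g * gc h. Proof. exact: mulmx2E. Qed.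
Lemma gdM g h : gd (g * h)%g = gc g * gb h + gd g * gd h. Proof. exact: mulmx2E. Qed.

Lemma gaV g : ga (g^-1)%g = gd g. Proof. by have [] := slmxVE g. Qed.
Lemma gbV g : gb (g^-1)%g = - gb g. Proof. by have [] := slmxVE g. Qed.
Lemma gcV g : gc (g^-1)%g = - gc g. Proof. by have [] := slmxVE g. Qed.
Lemma gdV g : gd (g^-1)%g = ga g. Proof. by have [] := slmxVE g. Qed.

Definition gE := (gaM, gbM, gcM, gdM, gaV, gbV, gcV, gdV).

Lemma ga1 : ga 1%g = 1. Proof. by rewrite /ga /= mxE. Qed.
Lemma gb1 : gb 1%g = 0. Proof. by rewrite /gb /= mxE. Qed.
Lemma gc1 : gc 1%g = 0. Proof. by rewrite /gc /= mxE. Qed.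
Lemma gd1 : gd 1%g = 1. Proof. by rewrite /gd /= mxE. Qed.

Lemma tr_g g : \tr (slmx g) = ga g + gd g. Proof. exact: tr22. Qed.

Lemma SL2_eq g h : ga g = ga h -> gb g = gb h -> gc g = gc h -> gd g = gd h -> g = h.
Proof. by move=> *; apply: val_inj; apply: matrix2P. Qed.

Definition mx4 (a b c d : R) : 'M[R]_2 :=
  \matrix_(i < 2, j < 2) if i == 0 then (if j == 0 then a else b) else (if j == 0 then c else d).

Fact mkSL2_subproof a b c d : a * d - b * c = 1 -> \det (mx4 a b c d) == 1.
Proof. by move=> E; rewrite det22 !mxE /= E. Qed.

Definition mkSL2 a b c d (E : a * d - b * c = 1) : SL2 R := MkSL2 (mkSL2_subproof E).

Lemma mkSL2E a b c d (E : a * d - b * c = 1) :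
  (ga (mkSL2 E) = a) * (gb (mkSL2 E) = b) * (gc (mkSL2 E) = c) * (gd (mkSL2 E) = d).
Proof. by rewrite /ga /gb /gc /gd /= !mxE. Qed.

(* The square of the Hilbert-Schmidt norm; HS2 g = 2 cosh d(i, g i). *)
Definition HS2 g := ga g ^+ 2 + gb g ^+ 2 + gc g ^+ 2 + gd g ^+ 2.

Lemma HS2_ge2 g : 2 <= HS2 g.
Proof.
have := gdet g; rewrite /HS2; move: (ga g) (gb g) (gc g) (gd g) => a b c d E.
have : 0 <= (a - d) ^+ 2 + (b + c) ^+ 2 by rewrite addr_ge0 ?sqr_ge0.
nra.
Qed.

Lemma HS2_gt0 g : 0 < HS2 g.
Proof. by have := HS2_ge2 g; lra. Qed.

Lemma HS2V g : HS2 (g^-1)%g = HS2 g.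
Proof. by rewrite /HS2 !gE !sqrrN; ring. Qed.

Lemma HS2_1 : HS2 1%g = 2.
Proof. by rewrite /HS2 ga1 gb1 gc1 gd1; ring. Qed.

Lemma HS2M g h : HS2 (g * h)%g <= HS2 g * HS2 h.
Proof.
rewrite /HS2 !gE; move: (ga g) (gb g) (gc g) (gd g) (ga h) (gb h) (gc h) (gd h) => a b c d a' b' c' d'.
have cs (x y u v : R) : (x * u + y * v) ^+ 2 <= (x ^+ 2 + y ^+ 2) * (u ^+ 2 + v ^+ 2).
  have : 0 <= (x * v - y * u) ^+ 2 by rewrite sqr_ge0. nra.
have := cs a b a' c'; have := cs a b b' d'; have := cs c d a' c'; have := cs c d b' d'.
nra.
Qed.

Lemma coord_sqr_le g : [/\ ga g ^+ 2 <= HS2 g, gb g ^+ 2 <= HS2 g, gc g ^+ 2 <= HS2 g & gd g ^+ 2 <= HS2 g].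
Proof.
rewrite /HS2; move: (sqr_ge0 (ga g)) (sqr_ge0 (gb g)) (sqr_ge0 (gc g)) (sqr_ge0 (gd g)).
by split; lra.
Qed.

Lemma mx_entry_norm_le (M : 'M[R]_2) i j : `|M i j| <= `|M|.
Proof.
rewrite [leRHS]/Num.norm /= mx_normrE.
exact: (le_bigmax _ (fun i => `|M i.1 i.2|) (i, j)).
Qed.

Lemma mx_norm_le (M : 'M[R]_2) r : 0 <= r -> (forall i j, `|M i j| <= r) -> `|M| <= r.
Proof.
move=> r0 H; rewrite [leLHS]/Num.norm /= mx_normrE.
by apply/bigmax_leP; split => // -[i j] _.
Qed.

Definition near1 (e : R) : set (SL2 R) :=
  [set g | [/\ `|ga g - 1| < e, `|gb g| < e, `|gc g| < e & `|gd g - 1| < e]].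

Lemma open_SL2P (O : set (SL2 R)) : open O -> forall g, O g ->
  exists2 e : R, 0 < e & forall h, `|ga h - ga g| < e -> `|gb h - gb g| < e ->
     `|gc h - gc g| < e -> `|gd h - gd g| < e -> O h.
Proof.
move=> [V oV <-] g /= Vg.
have /nbhs_ballP[e e0 eV] : nbhs (slmx g) V by apply: open_nbhs_nbhs.
exists e => // h ha hb hc hd; apply: eV; split => // i j.
have cases (l : 'I_2) : l = 0 \/ l = 1 by case: l => -[|[|//]] ?; [left|right]; apply: val_inj.
by rewrite /ball /= distrC; case: (cases i) => ->; case: (cases j) => ->.
Qed.

Lemma continuous_slmx : continuous (@slmx R : SL2 R -> 'M[R]_2).
Proof. exact: initial_continuous. Qed.

Lemma continuous_entry i j : continuous (fun g : SL2 R => slmx g i j).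
Proof.
move=> g; apply: (@continuous_comp _ _ _ (@slmx R) (fun M : 'M[R]_2 => M i j)).
  exact: continuous_slmx.
exact: coord_continuous.
Qed.

(** Along an ultrafilter the four bounded entries converge, and the limit still has determinant
    1. *)
Lemma compact_HS2_ball (r : R) : compact [set g | HS2 g <= r].
Proof.
rewrite compact_ultra => F FU Fr.
pose I : set R := `[- r - 1, r + 1]%classic.
have lim (f : SL2 R -> R) : (forall g, f g ^+ 2 <= HS2 g) -> exists l : R, f @ F --> l.
  move=> fH; have FI : F (f @^-1` I).
    apply: (@filterS _ F _ [set g | HS2 g <= r]) => // g /= gr.
    have := fH g; have {}gr : HS2 g <= r by [].
    rewrite /I /= in_itv /=; move: (f g) => x xg; apply/andP; split; nra.
  have : compact I by apply: segment_compact.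
  have UF : UltraFilter (f @ F).
    split=> [|H HP sH]; first exact: fmap_proper_filter.
    apply/seteqP; split=> // A HA; apply: contrapT => nA.
    have : F (f @^-1` (~` A)) by have [|] := in_ultra_setVsetC (f @^-1` A) FU.
    by move=> /sH HnA; have := filter_ex (filterI HA HnA) => -[x []].
  rewrite compact_ultra => /(_ (f @ F) UF FI)[l [_ fl]].
  by exists l.
have [a Ha] := lim _ (fun g => let: And4 H _ _ _ := coord_sqr_le g in H).
have [b Hb] := lim _ (fun g => let: And4 _ H _ _ := coord_sqr_le g in H).
have [c Hc] := lim _ (fun g => let: And4 _ _ H _ := coord_sqr_le g in H).
have [d Hd] := lim _ (fun g => let: And4 _ _ _ H := coord_sqr_le g in H).
have E : a * d - b * c = 1.
  have H1 : (fun g => ga g * gd g - gb g * gc g) @ F --> a * d - b * c.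
    by apply: cvgB; apply: cvgM.
  have H2 : (fun g => ga g * gd g - gb g * gc g) @ F --> (1 : R).
    apply: cvg_near_cst; near=> g; exact: gdet.
  exact: (cvg_unique _ H1 H2).
exists (mkSL2 E); split.
  rewrite /= /HS2 !mkSL2E.
  have H : (HS2 : SL2 R -> R) @ F --> a ^+ 2 + b ^+ 2 + c ^+ 2 + d ^+ 2.
    have sq f (l : R) : f @ F --> l -> (fun g => f g ^+ 2) @ F --> l ^+ 2.
      by move=> fl; rewrite expr2; apply: (cvgM fl fl).
    by apply: (cvgD (cvgD (cvgD (sq _ _ Ha) (sq _ _ Hb)) (sq _ _ Hc)) (sq _ _ Hd)).
  rewrite -(cvg_lim _ H) //; apply: limr_le; first by apply/cvg_ex; exists (a ^+ 2 + b ^+ 2 + c ^+ 2 + d ^+ 2).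
  exact: Fr.
move=> V; rewrite nbhsE => -[W [oW Wg] WV]; apply: filterS WV _.
have [e e0 eO] := open_SL2P oW Wg.
have near (f : SL2 R -> R) l : f @ F --> l -> F [set g | `|f g - l| < e].
  move=> /cvgrPdist_lt/(_ e e0); apply: filterS => g; by rewrite /= distrC.
near=> g; apply: eO; rewrite ?mkSL2E.
- by near: g; apply: near.
- by near: g; apply: near.
- by near: g; apply: near.
- by near: g; apply: near.
Unshelve. all: by end_near.
Qed.

End Coordinates.

Section Measurability.
Variable R : realType.
Local Notation G := (borelSL2 R).

Lemma measurable_entry i j : measurable_fun setT (fun g : G => slmx g i j).
Proof.
apply: (measurability _ (measurable_realfun.RGenOInfty.measurableE R)).
move=> _ [_ [x ->] <-]; rewrite setTI; apply: sub_sigma_algebra.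
by apply: open_comp => // g _; exact: continuous_entry.
Qed.

Lemma measurable_ga : measurable_fun setT (@ga R : G -> R). Proof. exact: measurable_entry. Qed.
Lemma measurable_gb : measurable_fun setT (@gb R : G -> R). Proof. exact: measurable_entry. Qed.
Lemma measurable_gc : measurable_fun setT (@gc R : G -> R). Proof. exact: measurable_entry. Qed.
Lemma measurable_gd : measurable_fun setT (@gd R : G -> R). Proof. exact: measurable_entry. Qed.

(** A countable base of the topology which, as empty boxes are allowed, is stable under
    intersection: it yields both measurability of maps into [SL2] and uniqueness of measures. *)
Definition rational_box (q : rat * rat * rat * rat * rat * rat * rat * rat) : set (SL2 R) :=
  let: (a, a', b, b', c, c', d, d') := q in
  [set g | [/\ ratr a < ga g < ratr a', ratr b < gb g < ratr b',
               ratr c < gc g < ratr c' & ratr d < gd g < ratr d']].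

Lemma rational_boxI p q : exists r, rational_box p `&` rational_box q = rational_box r.
Proof.
move: p q => [[[[[[[a1 a1'] b1] b1'] c1] c1'] d1] d1'] [[[[[[[a2 a2'] b2] b2'] c2] c2'] d2] d2'].
exists (Num.max a1 a2, Num.min a1' a2', Num.max b1 b2, Num.min b1' b2',
        Num.max c1 c2, Num.min c1' c2', Num.max d1 d2, Num.min d1' d2').
have E (u u' v v' : rat) (x : R) : (ratr (Num.max u v) < x < ratr (Num.min u' v')) =
    (ratr u < x < ratr u') && (ratr v < x < ratr v').
  by rewrite maxr_rat minr_rat gt_max lt_min andbACA.
apply/seteqP; split => g /=; rewrite !E.
  by move=> [[-> -> -> ->] [-> -> -> ->]].
by move=> [/andP[-> ->] /andP[-> ->] /andP[-> ->] /andP[-> ->]].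
Qed.

Lemma open_SL2_bigcup (O : set (SL2 R)) : open O ->
  O = \bigcup_(q in [set q | rational_box q `<=` O]) rational_box q.
Proof.
move=> oO; apply/seteqP; split; last by move=> g [q qO]; apply: qO.
move=> g Og; have [e e0 eO] := open_SL2P oO Og.
have app (x : R) : exists q q' : rat, (ratr q < x < ratr q') /\
    forall y : R, ratr q < y < ratr q' -> `|y - x| < e.
  have xl : x - e < x by lra.
  have xr : x < x + e by lra.
  have [q] := rat_in_itvoo xl; have [q'] := rat_in_itvoo xr; rewrite !in_itv /= => /andP[H1 H2] /andP[H3 H4].
  exists q, q'; split => [|y /andP[H5 H6]]; first by apply/andP.
  by rewrite ltr_norml; apply/andP; split; lra.
have [a [a' [Ha Ha']]] := app (ga g); have [b [b' [Hb Hb']]] := app (gb g).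
have [c [c' [Hc Hc']]] := app (gc g); have [d [d' [Hd Hd']]] := app (gd g).
exists (a, a', b, b', c, c', d, d') => //= h [ha hb hc hd].
by apply: eO; [apply: Ha'|apply: Hb'|apply: Hc'|apply: Hd'].
Qed.

Lemma measurable_fun_SL2 d (T : measurableType d) (f : T -> G) :
  measurable_fun setT (@ga R \o f) -> measurable_fun setT (@gb R \o f) ->
  measurable_fun setT (@gc R \o f) -> measurable_fun setT (@gd R \o f) ->
  measurable_fun setT f.
Proof.
move=> ma mb mc md; apply: (@measurability _ _ _ _ _ f (@open (SL2 R))) => //.
move=> _ [W oW <-]; rewrite setTI (open_SL2_bigcup oW) preimage_bigcup bigcup_mkcond.
apply: countable_bigcupT_measurable => [|[[[[[[[a a'] b] b'] c] c'] d'] d'']]; first exact: countableP.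
case: ifP => // _.
have box (u : T -> R) (p q : R) : measurable_fun setT u -> measurable [set t | p < u t < q].
  move=> mu; rewrite (_ : [set t | _] = setT `&` u @^-1` `]p, q[); last first.
    by rewrite setTI; apply/seteqP; split => t /=; rewrite in_itv.
  exact: mu.
rewrite (_ : _ @^-1` _ = [set t | ratr a < ga (f t) < ratr a'] `&` [set t | ratr b < gb (f t) < ratr b']
   `&` [set t | ratr c < gc (f t) < ratr c'] `&` [set t | ratr d' < gd (f t) < ratr d'']).
  by apply: measurableI; [apply: measurableI; [apply: measurableI|]|]; apply: box.
by apply/seteqP; split => t /=; [case|case=> [[[]]]].
Qed.

End Measurability.

Section GroupMeasurability.
Variable R : realType.
Local Notation G := (borelSL2 R).

Lemma measurable_mulg d (T : measurableType d) (f g : T -> G) :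
  measurable_fun setT f -> measurable_fun setT g ->
  measurable_fun setT (fun t => (f t * g t)%g : G).
Proof.
move=> mf mg.
have m (u : G -> R) (h : T -> G) : measurable_fun setT u -> measurable_fun setT h ->
    measurable_fun setT (fun t => u (h t)) by move=> *; apply: measurableT_comp.
have [ma mb mc md] := And4 (@measurable_ga R) (@measurable_gb R) (@measurable_gc R) (@measurable_gd R).
apply: measurable_fun_SL2.
- rewrite (_ : _ \o _ = fun t => ga (f t) * ga (g t) + gb (f t) * gc (g t)); last by apply/funext => t /=; rewrite gE.
  by apply: measurable_funD; apply: measurable_funM; apply: m.
- rewrite (_ : _ \o _ = fun t => ga (f t) * gb (g t) + gb (f t) * gd (g t)); last by apply/funext => t /=; rewrite gE.
  by apply: measurable_funD; apply: measurable_funM; apply: m.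
- rewrite (_ : _ \o _ = fun t => gc (f t) * ga (g t) + gd (f t) * gc (g t)); last by apply/funext => t /=; rewrite gE.
  by apply: measurable_funD; apply: measurable_funM; apply: m.
- rewrite (_ : _ \o _ = fun t => gc (f t) * gb (g t) + gd (f t) * gd (g t)); last by apply/funext => t /=; rewrite gE.
  by apply: measurable_funD; apply: measurable_funM; apply: m.
Qed.

Lemma measurable_invg : measurable_fun setT (fun t : G => (t^-1)%g : G).
Proof.
apply: measurable_fun_SL2.
- rewrite (_ : _ \o _ = @gd R); last by apply/funext => t /=; rewrite gE.
  exact: measurable_gd.
- rewrite (_ : _ \o _ = fun t => - gb t); last by apply/funext => t /=; rewrite gE.
  exact: measurableT_comp (@measurable_gb R).
- rewrite (_ : _ \o _ = fun t => - gc t); last by apply/funext => t /=; rewrite gE.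
  exact: measurableT_comp (@measurable_gc R).
- rewrite (_ : _ \o _ = @ga R); last by apply/funext => t /=; rewrite gE.
  exact: measurable_ga.
Qed.

Lemma measurable_mulgl (g : G) : measurable_fun setT (fun h : G => (g * h)%g : G).
Proof. exact: measurable_mulg. Qed.

Lemma measurable_mulgr (g : G) : measurable_fun setT (fun h : G => (h * g)%g : G).
Proof. exact: measurable_mulg. Qed.

Lemma measurable_HS2 : measurable_fun setT (@HS2 R : G -> R).
Proof.
have sq (u : G -> R) : measurable_fun setT u -> measurable_fun setT (fun t => u t ^+ 2).
  by move=> mu; apply: measurable_funX.
by do !apply: measurable_funD; apply: sq; [exact: measurable_ga|exact: measurable_gb|exact: measurable_gc|exact: measurable_gd].
Qed.

Lemma measurable_preim d d' (T : measurableType d) (T' : measurableType d') (f : T -> T') (B : set T') :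
  measurable_fun setT f -> measurable B -> measurable (f @^-1` B).
Proof. by move=> mf mB; rewrite -[X in measurable X]setTI; exact: mf. Qed.

Lemma measurable_lt (u : G -> R) r : measurable_fun setT u -> measurable [set g | u g < r].
Proof.
move=> mu; rewrite (_ : [set g | _] = u @^-1` `]-oo, r[); first exact: measurable_preim.
by apply/seteqP; split => g /=; rewrite in_itv.
Qed.

Lemma measurable_le (u : G -> R) r : measurable_fun setT u -> measurable [set g | u g <= r].
Proof.
move=> mu; rewrite (_ : [set g | _] = u @^-1` `]-oo, r]); first exact: measurable_preim.
by apply/seteqP; split => g /=; rewrite in_itv.
Qed.

Lemma measurable_HS2_ball r : measurable [set g : G | HS2 g <= r].
Proof. by apply: measurable_le; exact: measurable_HS2. Qed.

Lemma measurable_near1 e : measurable (near1 e : set G).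
Proof.
have m (u : G -> R) (c : R) : measurable_fun setT u -> measurable [set g | `|u g - c| < e].
  by move=> mu; apply: measurable_lt; apply: measurableT_comp => //; apply: measurable_funB.
rewrite (_ : near1 e = [set g | `|ga g - 1| < e] `&` [set g | `|gb g - 0| < e]
   `&` [set g | `|gc g - 0| < e] `&` [set g | `|gd g - 1| < e]).
  by apply: measurableI; [apply: measurableI; [apply: measurableI|]|]; apply: m;
    [exact: measurable_ga|exact: measurable_gb|exact: measurable_gc|exact: measurable_gd].
by apply/seteqP; split => t /=; rewrite !subr0; [case|case=> [[[]]]].
Qed.

Lemma measurable_rational_box q : measurable (rational_box q : set G).
Proof.
case: q => [[[[[[[a a'] b] b'] c] c'] d] d'].
have m (u : G -> R) (p q : R) : measurable_fun setT u -> measurable [set t | p < u t < q].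
  move=> mu; rewrite (_ : [set t | _] = u @^-1` `]p, q[); first exact: measurable_preim.
  by apply/seteqP; split => t /=; rewrite in_itv.
rewrite (_ : rational_box _ = [set t : G | ratr a < ga t < ratr a'] `&` [set t | ratr b < gb t < ratr b']
   `&` [set t | ratr c < gc t < ratr c'] `&` [set t | ratr d < gd t < ratr d']).
  by apply: measurableI; [apply: measurableI; [apply: measurableI|]|]; apply: m;
    [exact: measurable_ga|exact: measurable_gb|exact: measurable_gc|exact: measurable_gd].
by apply/seteqP; split => t /=; [case|case=> [[[]]]].
Qed.

End GroupMeasurability.

(** * Volumes of balls by covering arguments *)

Section Haar.
Variables (R : realType) (mu : {measure set (borelSL2 R) -> \bar R}).
Hypothesis Hmu : haar_measure mu.
Local Notation G := (borelSL2 R).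

Lemma haar_preim (g : G) (B : set G) : measurable B -> mu ((fun h => (g * h)%g) @^-1` B) = mu B.
Proof.
move=> mB; have [_ _ /(_ (g^-1)%g B mB) <-] := Hmu; congr (mu _).
apply/seteqP; split => [h /= Bh|h [x Bx <-]] /=; last by rewrite mulVKg.
by exists (g * h)%g => //; rewrite mulKg.
Qed.

Lemma haar_ball_fin r : (mu [set g | (HS2 g <= r)%R] < +oo)%E.
Proof. by have [_ + _] := Hmu; apply; exact: compact_HS2_ball. Qed.

Lemma haar_HS2_bounded (A : set G) r : measurable A -> A `<=` [set g | HS2 g <= r] -> (mu A < +oo)%E.
Proof.
move=> mA Ar; apply: le_lt_trans (haar_ball_fin r); apply: le_measure => //; rewrite inE //.
exact: measurable_HS2_ball.
Qed.

Lemma HS2_ball_bigcup : \bigcup_n [set g : G | HS2 g <= n%:R] = setT.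
Proof.
apply/seteqP; split => // g _; exists (Num.bound (HS2 g)) => //=.
by rewrite ltW // archi_boundP // ltW // HS2_gt0.
Qed.

(** The measure is repackaged with the sigma-finite structure that Tonelli's theorem asks for. *)
Lemma haar_sigma_finite : exists nu : {sigma_finite_measure set G -> \bar R}, forall A, nu A = mu A.
Proof.
have sf : sigma_finite setT mu.
  exists (fun n => [set g | HS2 g <= n%:R]); first by rewrite HS2_ball_bigcup.
  by move=> n; split; [exact: measurable_HS2_ball|exact: haar_ball_fin].
pose H1 := isSFinite.Build _ _ _ _ (sfinite_measure_sigma_finite sf).
pose H2 := isSigmaFinite.Build _ _ _ _ sf.
pose nu := HB.pack_for {sigma_finite_measure set G -> \bar R} (Measure.sort mu) H1 H2.
by exists nu.
Qed.

(** Choose a representative [g] for every code that occurs in [A]: the elements of [A] with this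
    code lie in [g B], which has the measure of [B]. *)
Lemma haar_code_cover (I : finType) (code : G -> I) (A B : set G) :
  measurable A -> measurable B ->
  (forall g h, A g -> A h -> code g = code h -> B (g^-1 * h)%g) ->
  (mu A <= #|I|%:R%:E * mu B)%E.
Proof.
move=> mA mB AB.
pose C (i : nat) : set G := if pselect (exists2 g, A g & enum_rank (code g) = i :> nat) is left H
  then (fun h : G => ((projT1 (cid2 H))^-1 * h)%g : G) @^-1` B else set0.
have mC i : measurable (C i).
  rewrite /C; case: pselect => // H.
  exact: (measurable_preim (measurable_mulgl _) mB).
have muC i : (mu (C i) <= mu B)%E.
  by rewrite /C; case: pselect => [H|_]; [rewrite haar_preim|rewrite measure0].
have sub : A `<=` \big[setU/set0]_(i < #|I|) C i.
  move=> g Ag; rewrite -bigcup_mkord; exists (enum_rank (code g)); first exact: ltn_ord.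
  rewrite /C; case: pselect => [H|[]]; last by exists g.
  case: (cid2 H) => x Ax cx /=; apply: AB => //.
  by apply: enum_rank_inj; apply: val_inj.
apply: (@le_trans _ _ (mu (\big[setU/set0]_(i < #|I|) C i))).
  by apply: le_measure; rewrite ?inE //; apply: bigsetU_measurable.
apply: (@le_trans _ _ (\sum_(i < #|I|) mu (C i))%E).
  by apply: Boole_inequality.
apply: (@le_trans _ _ (\sum_(i < #|I|) mu B)%E); first by apply: lee_sum => i _.
rewrite big_const_ord; elim: #|I| => [|k IH]; first by rewrite /= mul0e.
by rewrite iterS -natr1 EFinD ge0_muleDl ?lee_fin // mul1e addeC; apply: leeD.
Qed.

(** The code is the cell of the coordinates [u i] in a grid of mesh [del] with [M.+1] cells in each
    direction. *)
Lemma haar_grid_cover n (u : 'I_n -> G -> R) (del : R) (M : nat) (A B : set G) :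
  measurable A -> measurable B -> 0 < del ->
  (forall g i, A g -> 0 <= u i g < del * M.+1%:R) ->
  (forall g h, A g -> A h -> (forall i, `|u i g - u i h| < del) -> B (g^-1 * h)%g) ->
  (mu A <= ((M.+1 ^ n)%N%:R)%:E * mu B)%E.
Proof.
move=> mA mB del0 Au AB.
pose code g : {ffun 'I_n -> 'I_M.+1} := [ffun i => inord (Num.truncn (u i g / del))].
have := @haar_code_cover _ code A B mA mB; rewrite card_ffun !card_ord; apply.
move=> g h Ag Ah E; apply: AB => // i.
have tr x : A x -> (Num.truncn (u i x / del))%:R <= u i x / del < (Num.truncn (u i x / del)).+1%:R.
  by move=> Ax; apply: truncn_itv; rewrite divr_ge0 ?(ltW del0) //; have /andP[] := Au x i Ax.
have inM x : A x -> (Num.truncn (u i x / del) < M.+1)%N.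
  move=> Ax; have /andP[H1 H2] := Au x i Ax.
  by rewrite truncn_lt_nat ?divr_ge0 ?(ltW del0) // ltr_pdivrMr // mulrC.
have {}E : Num.truncn (u i g / del) = Num.truncn (u i h / del).
  have /ffunP/(_ i) := E; rewrite !ffunE => /(congr1 val) /=.
  by rewrite !inordK ?inM.
have /andP[] := tr _ Ag; have /andP[] := tr _ Ah; rewrite E; move: (Num.truncn _) => m.
rewrite !ler_pdivlMr // !ltr_pdivrMr // -natr1 => H1 H2 H3 H4.
by rewrite ltr_norml; apply/andP; split; nra.
Qed.

Lemma haar_full_gt0 (A : set G) : measurable A -> (forall n : nat, exists k : nat,
  (mu [set g | (HS2 g <= n%:R)%R] <= k%:R%:E * mu A)%E) -> (0 < mu A)%E.
Proof.
move=> mA H; rewrite lt0e measure_ge0 andbT; apply/eqP => A0.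
have [/eqP + _ _] := Hmu; apply; rewrite -HS2_ball_bigcup.
have B0 n : mu [set g | HS2 g <= n%:R] = 0%E.
  by have [k] := H n; rewrite A0 mule0 => Hk; apply/eqP; rewrite eq_le Hk measure_ge0.
apply/eqP; rewrite eq_le measure_ge0 andbT.
apply: (@le_trans _ _ (\sum_(n <oo) mu [set g : G | (HS2 g <= n%:R)%R])%E).
  apply: generalized_Boole_inequality => [n|]; first exact: measurable_HS2_ball.
  by apply: bigcup_measurable => n _; exact: measurable_HS2_ball.
by rewrite eseries0.
Qed.

Lemma abs_coord_le (g : SL2 R) r : 0 <= r -> HS2 g <= r ^+ 2 ->
  [/\ `|ga g| <= r, `|gb g| <= r, `|gc g| <= r & `|gd g| <= r].
Proof.
move=> r0 gr; have [Ha Hb Hc Hd] := coord_sqr_le g.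
have H x : x ^+ 2 <= HS2 g -> `|x| <= r.
  by move=> xg; rewrite -(ler_pXn2r (_ : 0 < 2)%N) ?nnegrE // real_normK ?num_real // (le_trans xg gr).
by split; apply: H.
Qed.

Definition gcoord (i : 'I_4) : G -> R :=
  if i == 0 :> nat then @ga R else if i == 1 :> nat then @gb R else if i == 2 :> nat then @gc R else @gd R.

Lemma near1_of_close (g h : SL2 R) (r e del : R) : 0 < del -> 0 <= r ->
  `|ga g| <= r -> `|gb g| <= r -> `|gc g| <= r -> `|gd g| <= r -> 2 * r * del < e ->
  `|ga g - ga h| <= del -> `|gb g - gb h| <= del -> `|gc g - gc h| <= del -> `|gd g - gd h| <= del ->
  near1 e (g^-1 * h)%g.
Proof.
move=> d0 r0 A B C D re a b c d; have E := gdet g.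
have K (x y u v : R) : `|x| <= r -> `|y| <= r -> `|u| <= del -> `|v| <= del -> `|x * u + y * v| < e.
  move=> xr yr ud vd; apply: (le_lt_trans (ler_normD _ _)); rewrite !normrM.
  have := ler_pM (normr_ge0 x) (normr_ge0 u) xr ud; have := ler_pM (normr_ge0 y) (normr_ge0 v) yr vd; lra.
have N x : `|- x| <= del -> `|x| <= del by rewrite normrN.
rewrite -(normrN (_ - _)) opprB in a; rewrite -(normrN (_ - _)) opprB in b.
rewrite -(normrN (_ - _)) opprB in c; rewrite -(normrN (_ - _)) opprB in d.
rewrite -normrN in B; rewrite -normrN in C.
split; rewrite !gE.
- by rewrite (_ : _ - 1 = gd g * (ga h - ga g) + - gb g * (gc h - gc g)); [exact: K|rewrite -E; ring].
- by rewrite (_ : _ + _ = gd g * (gb h - gb g) + - gb g * (gd h - gd g)); [exact: K|ring].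
- by rewrite (_ : _ + _ = - gc g * (ga h - ga g) + ga g * (gc h - gc g)); [exact: K|ring].
- by rewrite (_ : _ - 1 = - gc g * (gb h - gb g) + ga g * (gd h - gd g)); [exact: K|rewrite -E; ring].
Qed.

(** The grid uses all four entries, whence the exponent 4 and, for balls, a growth [r^8]: far from
    sharp, but enough for [X^5] to be integrable. *)
Lemma haar_ball_cover (r e : R) : 1 <= r -> 0 < e -> e <= 1 -> exists2 k : nat, k%:R <= (8 * r ^+ 2 / e) ^+ 4 &
  (mu [set g | (HS2 g <= r ^+ 2)%R] <= k%:R%:E * mu (near1 e))%E.
Proof.
move=> r1 e0 e1; pose del := e / (3 * r).
have r0 : 0 < r by lra.
have del0 : 0 < del by rewrite divr_gt0 // mulr_gt0.
pose M := Num.truncn (2 * r / del).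
have M0 : 0 <= 2 * r / del by rewrite divr_ge0 ?(ltW del0) // mulr_ge0 // ltW.
have /andP[M1 M2] := truncn_itv M0.
have Me : 2 * r / del = 6 * r ^+ 2 / e by rewrite /del; field; lra.
exists (M.+1 ^ 4)%N.
  have B0 : 0 <= 8 * r ^+ 2 / e by rewrite divr_ge0 ?(ltW e0) // mulr_ge0 ?sqr_ge0.
  rewrite natrX lerXn2r ?nnegrE ?ler0n //.
  rewrite -natr1; apply: (@le_trans _ _ (6 * r ^+ 2 / e + 1)); first by rewrite -Me lerD2r.
  rewrite -(@ler_pM2r _ e) // mulrDl !divfK ?gt_eqF //; nra.
apply: (@haar_grid_cover 4 (fun i g => gcoord i g + r) del) => //.
- exact: measurable_HS2_ball.
- exact: measurable_near1.
- move=> g i /(abs_coord_le (ltW r0))[ha hb hc hd].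
  have Hr (x : R) : `|x| <= r -> 0 <= x + r < del * M.+1%:R.
    rewrite ler_norml => /andP[x1 x2]; apply/andP; split; first lra.
    apply: (@le_lt_trans _ _ (2 * r)); first by move: x2; clear; lra.
    by rewrite [ltRHS]mulrC -ltr_pdivrMr.
  by case: i => -[|[|[|[|//]]]] ?; rewrite /gcoord /=; apply: Hr.
- move=> g h /(abs_coord_le (ltW r0))[ha hb hc hd] _ H.
  have {}H i : `|gcoord i g - gcoord i h| <= del.
    by have := H i; rewrite opprD addrACA subrr addr0 => /ltW.
  apply: (@near1_of_close g h r e del) => //; first exact: ltW.
  + by rewrite /del (_ : 2 * r * _ = 2 / 3 * e); [lra|field; lra].
  + exact: (H (@Ordinal 4 0 isT)).
  + exact: (H (@Ordinal 4 1 isT)).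
  + exact: (H (@Ordinal 4 2 isT)).
  + exact: (H (@Ordinal 4 3 isT)).
Qed.

Lemma near1_gt0 e : 0 < e -> (0 < mu (near1 e))%E.
Proof.
move=> e0; wlog e1 : e e0 / e <= 1 => [H|].
  apply: (@lt_le_trans _ _ (mu (near1 (Num.min e 1)))); first by apply: H; rewrite ?lt_min ?e0 ?ge_min ?lexx ?orbT //=.
  apply: le_measure; rewrite ?inE //; try exact: measurable_near1.
  by move=> g [h1 h2 h3 h4]; split; [move: h1|move: h2|move: h3|move: h4]; rewrite lt_min => /andP[].
apply: haar_full_gt0; first exact: measurable_near1.
move=> n; have r1 : 1 <= n.+1%:R :> R by rewrite ler1n.
have [k _ Hk] := haar_ball_cover r1 e0 e1; exists k; apply: le_trans Hk.
apply: le_measure; rewrite ?inE; try exact: measurable_HS2_ball.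
move=> g /= /le_trans; apply; rewrite -natrX ler_nat; nia.
Qed.

Lemma near1_bounded e : e <= 1 -> near1 e `<=` [set g : SL2 R | HS2 g <= 10].
Proof.
move=> e1 g [a b c d] /=; rewrite /HS2.
by move: a b c d; rewrite !ltr_norml => /andP[? ?] /andP[? ?] /andP[? ?] /andP[? ?]; nra.
Qed.

Lemma near1_fin e : e <= 1 -> (mu (near1 e) < +oo)%E.
Proof. move=> e1; apply: haar_HS2_bounded (near1_bounded e1); exact: measurable_near1. Qed.

Lemma haar_ball_growth : exists2 C : R, 0 < C & forall r, 1 <= r ->
  (mu [set g | (HS2 g <= r ^+ 2)%R] <= (C * r ^+ 8)%:E)%E.
Proof.
have f1 : mu (near1 1) \is a fin_num by rewrite ge0_fin_numE ?near1_fin ?measure_ge0.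
have p1 : 0 < fine (mu (near1 1)) by rewrite fine_gt0 // near1_gt0 // near1_fin.
exists (8 ^+ 4 * fine (mu (near1 1))); first by rewrite mulr_gt0 // exprn_gt0.
move=> r r1; have [k kr /le_trans] := haar_ball_cover r1 ltr01 (lexx 1); apply.
rewrite -(fineK f1) -EFinM lee_fin /= divr1 exprMn in kr *.
have := ler_wpM2r (ltW p1) kr; rewrite -exprM /=; lra.
Qed.

(** Near the identity the last entry is determined by the other three, so that three coordinates
    suffice for the grid in [near1_lower]. *)
Lemma gd_close (a b c d a' b' c' d' del : R) : a * d - b * c = 1 -> a' * d' - b' * c' = 1 ->
  3 / 4 < a -> `|d'| <= 5 / 4 -> `|b| <= 1 / 4 -> `|c'| <= 1 / 4 ->
  `|a - a'| < del -> `|b - b'| < del -> `|c - c'| < del -> `|d - d'| <= 4 * del.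
Proof.
move=> E E' a34 hd hb hc Ha Hb Hc.
have -> : d - d' = (- d' * (a - a') + b * (c - c') + c' * (b - b')) / a.
  have a0 : a != 0 by apply/eqP; lra.
  rewrite -[LHS](mulfK a0); congr (_ / _).
  transitivity ((1 + b * c) - d' * a); last by rewrite -E'; ring.
  by rewrite -E; ring.
have a0 : 0 < a by lra.
rewrite normrM normfV ler_pdivrMr ?normr_gt0 ?gt_eqF // (gtr0_norm a0).
have del0 : 0 <= del := ltW (le_lt_trans (normr_ge0 _) Ha).
apply: (@le_trans _ _ (4 * del * (3 / 4))); last by apply: ler_wpM2l; lra.
apply: (le_trans (ler_normD _ _)); rewrite normrM.
have := ler_normD (- d' * (a - a')) (b * (c - c')); rewrite !normrM normrN.
have := ler_pM (normr_ge0 _) (normr_ge0 _) hd (ltW Ha); have := ler_pM (normr_ge0 _) (normr_ge0 _) hb (ltW Hc).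
have := ler_pM (normr_ge0 _) (normr_ge0 _) hc (ltW Hb); lra.
Qed.

Lemma near1_quarter_close (g h : SL2 R) (del e : R) : 0 < del -> 10 * del < e ->
  near1 (1 / 4) g -> near1 (1 / 4) h ->
  `|ga g - ga h| < del -> `|gb g - gb h| < del -> `|gc g - gc h| < del -> near1 e (g^-1 * h)%g.
Proof.
move=> del0 de [ha hb hc hd] [ha' hb' hc' hd'] Ha Hb Hc.
have N1 (x : R) : `|x - 1| < 1 / 4 -> `|x| <= 5 / 4.
  by rewrite ltr_norml ler_norml => /andP[? ?]; apply/andP; split; lra.
have N0 (x : R) : `|x| < 1 / 4 -> `|x| <= 5 / 4 by lra.
have D4 (x : R) : `|x| < del -> `|x| <= 4 * del by lra.
have a34 : 3 / 4 < ga g by move: ha; rewrite ltr_norml => /andP[? ?]; lra.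
have Hd := gd_close (gdet g) (gdet h) a34 (N1 _ hd') (ltW hb) (ltW hc') Ha Hb Hc.
apply: (@near1_of_close g h (5 / 4) e (4 * del)); [lra|lra|exact: N1|exact: N0|exact: N0|exact: N1|lra|exact: D4|exact: D4|exact: D4|exact: Hd].
Qed.

(** A fixed neighbourhood of 1 is covered by [O(e^(-3))] translates of [near1 e]. The exponent 3,
    the dimension of the group, enters the final exponent of the degree. *)
Lemma near1_lower : exists2 c : R, 0 < c & forall e, 0 < e -> e <= 1 -> ((c * e ^+ 3)%:E <= mu (near1 e))%E.
Proof.
pose q : R := 1 / 4.
have q1 : q <= 1 by rewrite /q; lra.
have f1 : mu (near1 q) \is a fin_num by rewrite ge0_fin_numE ?near1_fin ?measure_ge0.
have p1 : 0 < fine (mu (near1 q)) by rewrite fine_gt0 // near1_gt0 ?near1_fin // /q; lra.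
exists (fine (mu (near1 q)) / 33 ^+ 3); first by rewrite divr_gt0 // exprn_gt0.
move=> e e0 e1; pose del := e / 32.
have del0 : 0 < del by rewrite divr_gt0.
pose M := Num.truncn (1 / del).
have M0 : 0 <= 1 / del by rewrite divr_ge0 // ltW.
have /andP[M1 M2] := truncn_itv M0.
have cover : (mu (near1 q) <= ((M.+1 ^ 3)%N%:R)%:E * mu (near1 e))%E.
  apply: (@haar_grid_cover 3 (fun i g => gcoord (widen_ord (leqnSn 3) i) g - (i == 0 :> nat)%:R + q) del) => //.
  - exact: measurable_near1.
  - exact: measurable_near1.
  - move=> g i [ha hb hc _].
    have Hr (x : R) : `|x| < q -> 0 <= x + q < del * M.+1%:R.
      rewrite ltr_norml => /andP[x1 x2]; apply/andP; split; first lra.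
      by apply: (@lt_trans _ _ 1); [move: x2; rewrite /q; lra|rewrite mulrC -ltr_pdivrMr].
    by case: i => -[|[|[|//]]] ? /=; rewrite /gcoord /= ?subr0; apply: Hr.
  - move=> g h [ha hb hc hd] [ha' hb' hc' hd'] H.
    have {}H (i : 'I_3) : `|gcoord (widen_ord (leqnSn 3) i) g - gcoord (widen_ord (leqnSn 3) i) h| < del.
      have := H i; set u := gcoord _ g; set w := gcoord _ h; set s := _%:R.
      by rewrite (_ : _ - (w - s + q) = u - w) //; ring.
    have Ha := H (@Ordinal 3 0 isT); have Hb := H (@Ordinal 3 1 isT); have Hc := H (@Ordinal 3 2 isT).
    by apply: (@near1_quarter_close g h del) => //; rewrite /del; lra.
have k1 : (M.+1 ^ 3)%N%:R <= (33 / e) ^+ 3.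
  rewrite natrX lerXn2r ?nnegrE ?ler0n ?divr_ge0 ?(ltW e0) //.
  rewrite -natr1; apply: (@le_trans _ _ (1 / del + 1)); first by rewrite lerD2r.
  rewrite (_ : 1 / del = 32 / e); last by rewrite /del; field; lra.
  by rewrite -(@ler_pM2r _ e) // mulrDl !divfK ?gt_eqF //; lra.
have f2 : mu (near1 e) \is a fin_num by rewrite ge0_fin_numE ?near1_fin ?measure_ge0.
move: cover; rewrite -(fineK f1) -(fineK f2) -EFinM !lee_fin => cover.
rewrite /= mulrAC ler_pdivrMr ?exprn_gt0 //.
have p2 : 0 <= fine (mu (near1 e)) by rewrite fine_ge0 // measure_ge0.
have := le_trans cover (ler_wpM2r p2 k1); rewrite exprMn exprVn.
rewrite mulrAC ler_pdivlMr ?exprn_gt0 //; lra.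
Qed.

Lemma haar_integral_mull (g : G) (f : G -> \bar R) : measurable_fun setT f -> (forall x, 0 <= f x)%E ->
  (\int[mu]_x f (g * x)%g = \int[mu]_x f x)%E.
Proof.
move=> mf f0; have mg := @measurable_mulgl R g.
transitivity (\int[pushforward mu (fun h : G => (g * h)%g : G)]_x f x)%E.
  by rewrite (ge0_integral_pushforward mg).
by apply: eq_measure_integral => A mA _; rewrite /= /pushforward haar_preim.
Qed.

End Haar.

(** * Unimodularity of SL2(R), deduced from left invariance *)

Section Tonelli.
Variables (R : realType) (mu : {sigma_finite_measure set (borelSL2 R) -> \bar R}).
Local Notation G := (borelSL2 R).

Lemma tonelliG (f : G -> G -> \bar R) : measurable_fun setT (fun p : G * G => f p.1 p.2) ->
  (forall x y, 0 <= f x y)%E ->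
  (\int[mu]_x \int[mu]_y f x y = \int[mu]_y \int[mu]_x f x y)%E.
Proof. by move=> mf f0; apply: (fubini_tonelli (fun p : G * G => f p.1 p.2)) => // -[]. Qed.

Lemma measurable_integralG (f : G -> G -> \bar R) : measurable_fun setT (fun p : G * G => f p.1 p.2) ->
  (forall x y, 0 <= f x y)%E -> measurable_fun setT (fun x => \int[mu]_y f x y)%E.
Proof.
move=> mf f0; apply: (measurable_fun_fubini_tonelli_F (fun p : G * G => f p.1 p.2)) => // -[].
Qed.

Hypothesis Hmu : haar_measure mu.

(** Left translations and two exchanges of integrals. Right translates of [f] appear, and this is
    what compares [mu] with its right translates. *)
Lemma haar_integral_mulV (f h : G -> \bar R) : measurable_fun setT f -> measurable_fun setT h ->
  (forall x, 0 <= f x)%E -> (forall x, 0 <= h x)%E ->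
  ((\int[mu]_x f x) * (\int[mu]_x h x) = \int[mu]_x (h (x^-1)%g * \int[mu]_y f (y * x)%g))%E.
Proof.
move=> mf mh f0 h0.
have m1 : measurable_fun setT (fst : G * G -> G) by exact: measurable_fst.
have m2 : measurable_fun setT (snd : G * G -> G) by exact: measurable_snd.
have mV : measurable_fun setT (fun p : G * G => (p.1^-1)%g : G).
  by apply: measurableT_comp m1; exact: measurable_invg.
transitivity (\int[mu]_x \int[mu]_y (f x * h (x^-1 * y)%g))%E.
  rewrite muleC -ge0_integralZl //; last exact: integral_ge0.
  apply: eq_integral => x _; rewrite muleC -(haar_integral_mull Hmu (x^-1)%g mh h0).
  by rewrite ge0_integralZl //; apply: measurableT_comp mh _; exact: measurable_mulgl.
rewrite tonelliG; last by move=> x y; rewrite mule_ge0.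
  transitivity (\int[mu]_y \int[mu]_x (f (y * x)%g * h (x^-1)%g))%E.
    apply: eq_integral => y _.
    rewrite -(haar_integral_mull Hmu y) //; last by move=> x; rewrite mule_ge0.
      by apply: eq_integral => x _; rewrite invgM mulgVK.
    apply: emeasurable_funM => //; apply: measurableT_comp mh _.
    exact: (measurable_mulg (@measurable_invg R)).
  rewrite tonelliG; last by move=> x y; rewrite mule_ge0.
    apply: eq_integral => x _; rewrite -ge0_integralZl //; last first.
      by apply: measurableT_comp mf _; exact: measurable_mulgr.
    by apply: eq_integral => y _; rewrite muleC.
  apply: emeasurable_funM; last exact: measurableT_comp mh (measurableT_comp (@measurable_invg R) m2).
  exact: measurableT_comp mf (measurable_mulg m1 m2).
apply: emeasurable_funM; first exact: measurableT_comp mf m1.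
exact: measurableT_comp mh (measurable_mulg mV m2).
Qed.

(** The measure of [E x^-1]; it will turn out not to depend on [x]. *)
Definition kap (E : set G) (x : G) := mu ((fun y : G => (y * x)%g) @^-1` E).

Lemma kapE (E : set G) x : measurable E -> kap E x = (\int[mu]_y (\1_E (y * x)%g)%:E)%E.
Proof.
move=> mE; rewrite /kap -[in LHS](setIT (_ @^-1` _)) -integral_indic //.
by apply: (measurable_preim _ mE); exact: measurable_mulgr.
Qed.

Lemma measurable_kap (E : set G) : measurable E -> measurable_fun setT (kap E).
Proof.
move=> mE; rewrite (_ : kap E = fun x => \int[mu]_y (\1_E (y * x)%g)%:E)%E; last first.
  by apply/funext => x; rewrite kapE.
apply: (@measurable_integralG (fun x y : G => (\1_E (y * x)%g)%:E)) => //.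
apply/measurable_EFinP; apply: (@measurableT_comp _ _ _ _ _ _ (\1_E : G -> R)); first exact: measurable_indic.
by apply: measurable_mulg; [exact: measurable_snd|exact: measurable_fst].
Qed.

Lemma integral_kap (E F : set G) : measurable E -> measurable F ->
  (\int[mu]_(x in F) kap E x = mu E * mu ((fun x : G => (x^-1)%g) @^-1` F))%E.
Proof.
move=> mE mF; set F' := _ @^-1` F.
have mF' : measurable F' by apply: (measurable_preim _ mF); exact: measurable_invg.
have := @haar_integral_mulV (fun x => (\1_E x)%:E) (fun x => (\1_F' x)%:E).
rewrite !integral_indic // !setIT => -> //; last first.
- by apply/measurable_EFinP; exact: measurable_indic.
- by apply/measurable_EFinP; exact: measurable_indic.
rewrite integral_mkcond; apply: eq_integral => x _; rewrite -kapE // patchE /F' !indicE.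
have -> : ((x^-1)%g \in [set y | F (y^-1)%g]) = (x \in F) by apply/idP/idP; rewrite !inE /= invgK.
by case: ifP => _; rewrite ?mul1e ?mul0e.
Qed.

Lemma rational_box_bounded q : exists r, rational_box q `<=` [set g : SL2 R | HS2 g <= r].
Proof.
case: q => [[[[[[[a a'] b] b'] c] c'] d] d'].
pose m : R := `|ratr a| + `|ratr a'| + `|ratr b| + `|ratr b'| + `|ratr c| + `|ratr c'| + `|ratr d| + `|ratr d'|.
exists (4 * m ^+ 2) => g [ha hb hc hd]; rewrite /= /HS2.
have K (x : R) (p p' : rat) : ratr p < x < ratr p' -> `|ratr p| + `|ratr p'| <= m -> x ^+ 2 <= m ^+ 2.
  move=> /andP[x1 x2] pm; rewrite -(real_normK (num_real x)) lerXn2r ?nnegrE ?(le_trans _ pm) ?addr_ge0 //.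
  rewrite ler_norml; have := ler_norm (ratr p' : R); have := ler_norm (- ratr p : R); rewrite normrN.
  have := normr_ge0 (ratr p : R); have := normr_ge0 (ratr p' : R); move: pm; clear -x1 x2 => *; apply/andP; split; lra.
have Na (p : rat) := normr_ge0 (ratr p : R).
have Ga := K _ _ _ ha; have Gb := K _ _ _ hb; have Gc := K _ _ _ hc; have Gd := K _ _ _ hd.
have := Na a; have := Na a'; have := Na b; have := Na b'; have := Na c; have := Na c'; have := Na d; have := Na d'.
rewrite /m in Ga Gb Gc Gd *; move: {K Na ha hb hc hd} Ga Gb Gc Gd.
move: `|ratr a| `|ratr a'| `|ratr b| `|ratr b'| `|ratr c| `|ratr c'| `|ratr d| `|ratr d'| => A A' B B' C C' D D' Ga Gb Gc Gd *.
have {}Ga := Ga ltac:(lra); have {}Gb := Gb ltac:(lra); have {}Gc := Gc ltac:(lra); have {}Gd := Gd ltac:(lra).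
move: Ga Gb Gc Gd; set m2 := _ ^+ 2; clear; lra.
Qed.

Lemma kap_box_fin q x : (kap (rational_box q) x < +oo)%E.
Proof.
have [r rq] := rational_box_bounded q.
apply: (haar_HS2_bounded Hmu (r := r * HS2 x)).
  by apply: (measurable_preim (measurable_mulgr _)); exact: measurable_rational_box.
move=> y /= /rq /= yr; rewrite -(mulgK x y) (le_trans (HS2M _ _)) // HS2V.
by apply: ler_wpM2r => //; rewrite ltW // HS2_gt0.
Qed.

Lemma rational_box_fin q : (mu (rational_box q) < +oo)%E.
Proof.
have [r rq] := rational_box_bounded q.
by apply: (haar_HS2_bounded Hmu _ rq); exact: measurable_rational_box.
Qed.

Lemma rational_box_generate (E : set G) : measurable E -> <<s range (@rational_box R) >> E.
Proof.
apply: smallest_sub; first exact: smallest_sigma_algebra.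
move=> W oW; rewrite (open_SL2_bigcup oW) bigcup_mkcond.
apply: (@countable_bigcupT_measurable _ (g_sigma_algebraType (range (@rational_box R)))) => [|q].
  exact: countableP.
by case: ifP => _; [apply: sub_sigma_algebra; exists q|exact: (@measurable0 _ (g_sigma_algebraType (range (@rational_box R))))].
Qed.

Lemma haar_unique_box (m1 m2 : {measure set G -> \bar R}) :
  (forall q, m1 (rational_box q) = m2 (rational_box q)) -> (forall q, m1 (rational_box q) < +oo)%E ->
  forall E, measurable E -> m1 E = m2 E.
Proof.
move=> m12 fin E mE.
pose b (k : nat) := @rational_box R (- k%:R, k%:R, - k%:R, k%:R, - k%:R, k%:R, - k%:R, k%:R).
refine (@g_sigma_algebra_measure_unique _ _ (borelSL2 R) (range (@rational_box R)) _ b _ _ m1 m2 _ _ _ E _).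
- by move=> _ [q _ <-]; exact: measurable_rational_box.
- by move=> k; eexists.
- apply/seteqP; split => // g _; exists (Num.bound (1 + HS2 g)) => //=.
  set k := Num.bound _; have kb : 1 + HS2 g < k%:R.
    by rewrite archi_boundP // addr_ge0 // ltW // HS2_gt0.
  have [ha hb hc hd] := coord_sqr_le g.
  have K (x : R) : x ^+ 2 <= HS2 g -> ratr (- k%:R) < x < ratr k%:R.
    by rewrite rmorphN !rmorph_nat => xg; apply/andP; split; nra.
  by split; apply: K.
- move=> _ _ [p _ <-] [q _ <-]; have [r ->] := rational_boxI R p q; by exists r.
- by move=> _ [q _ <-].
- by move=> k; exact: fin.
- exact: rational_box_generate.
Qed.

Lemma rational_box_pos : exists q, (0 < mu (rational_box q))%E.
Proof.
apply: contrapT => H; have [/eqP + _ _] := Hmu; apply.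
have null q : mu (rational_box q) = 0%E.
  by apply/eqP; rewrite eq_le measure_ge0 andbT leNgt; apply/negP => qp; apply: H; exists q.
transitivity (@mzero _ G R setT) => //.
by apply: haar_unique_box => //; exact: rational_box_fin.
Qed.

Definition modular (x : G) (d : R) := 0 < d /\ forall E : set G, measurable E -> kap E x = (d%:E * mu E)%E.

Lemma kapM (E : set G) x y : measurable E -> kap E (x * y)%g = kap ((fun h : G => (h * y)%g : G) @^-1` E) x.
Proof. by move=> mE; rewrite /kap; congr (mu _); apply/seteqP; split => h /=; rewrite mulgA. Qed.

Lemma modularM x y d e : modular x d -> modular y e -> modular (x * y)%g (d * e).
Proof.
move=> [d0 Hd] [e0 He]; split; first exact: mulr_gt0.
move=> E mE; rewrite kapM // Hd; last by apply: (measurable_preim _ mE); exact: measurable_mulgr.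
by rewrite EFinM -muleA -He.
Qed.

Lemma modularV x d : modular x d -> modular (x^-1)%g d^-1.
Proof.
move=> [d0 Hd]; split=> [|E mE]; first by rewrite invr_gt0.
set F := (fun h : G => (h * x^-1)%g) @^-1` E.
have mF : measurable F by apply: (measurable_preim _ mE); exact: measurable_mulgr.
have := Hd F mF; rewrite /kap (_ : _ @^-1` F = E); last first.
  by apply/seteqP; split => h; rewrite /F /= mulgK.
by move=> ->; rewrite muleA -EFinM mulVf ?gt_eqF // mul1e.
Qed.

Lemma modular_inj x d e : modular x d -> modular x e -> d = e.
Proof.
move=> [d0 Hd] [e0 He]; have [q q0] := rational_box_pos; have qf := rational_box_fin q.
have mq := @measurable_rational_box R q; have := Hd _ mq; rewrite He //.
have f1 : mu (rational_box q) \is a fin_num by rewrite ge0_fin_numE.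
have p1 : 0 < fine (mu (rational_box q)) by rewrite fine_gt0 // q0.
rewrite -(fineK f1) -!EFinM => -[/(mulIf _) ->] //; by rewrite gt_eqF.
Qed.

(** By [integral_kap], [mu E' * kap E] and [mu E * kap E'] have the same integral over every
    measurable part of a ball, hence agree almost everywhere. Countably many boxes make this
    simultaneous, and the boxes determine the measure [E |-> kap E x]. *)
Lemma modular_ae : {ae mu, forall x, exists d, modular x d}.
Proof.
pose qt := (nat * ((rat * rat * rat * rat * rat * rat * rat * rat) * (rat * rat * rat * rat * rat * rat * rat * rat)))%type.
pose P (t : qt) (x : G) := HS2 x <= t.1%:R ->
   (mu (rational_box t.2.1) * kap (rational_box t.2.2) x = mu (rational_box t.2.2) * kap (rational_box t.2.1) x)%E.
have aeP t : {ae mu, forall x, P t x}.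
  case: t => n [p q]; rewrite /P /=.
  have mp := @measurable_rational_box R p; have mq := @measurable_rational_box R q.
  pose D : set G := [set x | HS2 x <= n%:R].
  have mD : measurable D by exact: measurable_HS2_ball.
  have mDV (F : set G) : measurable F -> measurable ((fun x : G => (x^-1)%g : G) @^-1` F).
    by move=> mF; apply: (measurable_preim _ mF); exact: measurable_invg.
  have I E E' F : measurable E -> measurable E' -> measurable F ->
      (\int[mu]_(x in F) (mu E' * kap E x) = mu E' * mu E * mu ((fun x : G => (x^-1)%g) @^-1` F))%E.
    move=> mE mE' mF; rewrite ge0_integralZl ?integral_kap ?muleA //.
    exact: measurable_funTS (measurable_kap mE).
  have : ae_eq mu D (fun x => mu (rational_box p) * kap (rational_box q) x)%E
      (fun x => mu (rational_box q) * kap (rational_box p) x)%E.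
    apply: integral_ae_eq => //.
    - apply/integrableP; split.
        by apply: emeasurable_funM => //; exact: measurable_funTS (measurable_kap mq).
      under eq_integral do rewrite gee0_abs ?mule_ge0 //.
      rewrite I // lte_mul_pinfty ?mule_ge0 //.
        by rewrite fin_numM // ge0_fin_numE // rational_box_fin.
      apply: le_lt_trans (haar_ball_fin Hmu n%:R); apply: le_measure; rewrite ?inE //.
        exact: mDV.
      by move=> x; rewrite /D /= HS2V.
    - by apply: emeasurable_funM => //; exact: measurable_funTS (measurable_kap mp).
    - by move=> E _ mE; rewrite !I // [(mu (rational_box p) * _)%E]muleC.
  by apply: filterS => x.
have [q q0] := rational_box_pos.
have H : {ae mu, forall x, forall k : nat, if (unpickle k : option qt) is Some t then P t x else True}.
  by apply: ae_foralln => k; case: unpickle => [t|]; [exact: aeP|exact: filterE].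
apply: filterS H => x H.
have {}H t : P t x by have := H (pickle t); rewrite pickleK.
have {}H p : (mu (rational_box q) * kap (rational_box p) x = mu (rational_box p) * kap (rational_box q) x)%E.
  apply: (H (Num.bound (HS2 x), (q, p))) => /=.
  by rewrite ltW // archi_boundP // ltW // HS2_gt0.
have f1 : mu (rational_box q) \is a fin_num by rewrite ge0_fin_numE // rational_box_fin.
have p1 : 0 < fine (mu (rational_box q)) by rewrite fine_gt0 // q0 rational_box_fin.
have [a aq] : exists a : R, kap (rational_box q) x = a%:E.
  by exists (fine (kap (rational_box q) x)); rewrite fineK // ge0_fin_numE ?kap_box_fin // measure_ge0.
have a0 : 0 <= a by rewrite -lee_fin -aq measure_ge0.
pose d := a / fine (mu (rational_box q)).
have d0 : 0 <= d by rewrite divr_ge0 // ltW.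
have K p : kap (rational_box p) x = (d%:E * mu (rational_box p))%E.
  have := H p; rewrite aq -(fineK f1) => E.
  have : ((fine (mu (rational_box q)))^-1%:E * ((fine (mu (rational_box q)))%:E * kap (rational_box p) x) =
     (fine (mu (rational_box q)))^-1%:E * (mu (rational_box p) * a%:E))%E by rewrite E.
  rewrite muleA -EFinM mulVf ?gt_eqF // mul1e => ->.
  by rewrite /d EFinM [(mu _ * _)%E]muleC muleA [(_^-1%:E * _)%E]muleC.
have mx := @measurable_mulgr R x.
have Kall E : measurable E -> kap E x = (d%:E * mu E)%E.
  move=> mE.
  have := @haar_unique_box (pushforward mu (fun h : G => (h * x)%g : G)) (mscale (NngNum d0) mu) _ _ E mE.
  move=> /(_ mx) H'; apply: H' => p; first exact: K.
  exact: kap_box_fin.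
exists d; split => //; rewrite lt_neqAle d0 andbT eq_sym; apply/eqP => dz.
have [/eqP + _ _] := Hmu; apply; have := Kall setT measurableT.
by rewrite dz mul0e /kap preimage_setT.
Qed.

(** Elements with a modular factor are closed under products and inverses and fill the complement of
    a null set. For [x] without such a factor, the translate by [x] of this complement would lie in
    the null set, and by invariance the whole group would be null. *)
Lemma modular_ex x : exists d, modular x d.
Proof.
have [N [mN N0 HN]] := modular_ae.
have HN' y : ~ N y -> exists d, modular y d by move=> Ny; apply: contrapT => H; apply: Ny; exact: HN.
apply: contrapT => nx.
have sub : (fun h : G => (x^-1 * h)%g : G) @^-1` (~` N) `<=` N.
  move=> h /= /HN'[d Hd]; apply: contrapT => /HN'[e He]; apply: nx.
  have := modularM He (modularV Hd); rewrite invgM invgK mulgA mulgV mul1g.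
  by exists (e * d^-1).
have : mu (~` N) = 0%E.
  apply/eqP; rewrite eq_le measure_ge0 andbT -(haar_preim Hmu (x^-1)%g); last exact: measurableC.
  rewrite -N0; apply: le_measure => //; rewrite inE //.
  by apply: (measurable_preim (measurable_mulgl _)); exact: measurableC.
move=> NC0; have [/eqP + _ _] := Hmu; apply; apply/eqP; rewrite eq_le measure_ge0 andbT.
have := @measureU2 _ _ _ mu _ _ mN (measurableC mN).
rewrite setUv => /le_trans; apply; rewrite -[leRHS](adde0 0%E).
by apply: leeD; [rewrite -N0|rewrite -NC0].
Qed.

(** Conjugation does not change the factor [d], so [d = d^4] with [d > 0]. *)
Lemma modular_conj a u : (a * u * a^-1)%g = (u ^+ 4)%g -> modular u 1.
Proof.
move=> E; have [d Hd] := modular_ex u; have [e He] := modular_ex a.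
have H1 := modularM (modularM He Hd) (modularV He).
have H2 : modular (u ^+ 4)%g (d * d * d * d).
  by rewrite !expgS expg0 mulg1 !mulgA; do 3 apply: modularM => //.
move: H1; rewrite E => /(modular_inj H2) => H.
have [d0 _] := Hd; have [e0 _] := He.
suff -> : 1 = d by [].
have {}H : d * d * d * d = d by rewrite H; field; rewrite gt_eqF.
have : d * ((d - 1) * (d ^+ 2 + d + 1)) = 0.
  by transitivity (d * d * d * d - d); [ring|rewrite H subrr].
move/eqP; rewrite !mulf_eq0 gt_eqF //= => /orP[/eqP|/eqP]; first lra.
have : 0 < d ^+ 2 + d + 1 by rewrite !addr_gt0 ?exprn_gt0.
by move=> /[swap] ->; rewrite ltxx.
Qed.

(** Upper and lower unipotents are conjugate to their fourth powers by diagonal matrices, and they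
    generate the group. *)
Lemma unimodular x : modular x 1.
Proof.
pose P (g : G) := modular g 1.
have PM g h : P g -> P h -> P (g * h)%g by move=> Pg Ph; have := modularM Pg Ph; rewrite mulr1.
have PV g : P g -> P (g^-1)%g by move=> Pg; have := modularV Pg; rewrite invr1.
have da : (2 : R) * 2^-1 - 0 * 0 = 1 by field.
have da' : (2^-1 : R) * 2 - 0 * 0 = 1 by field.
have dU t : (1 : R) * 1 - t * 0 = 1 by ring.
have dL t : (1 : R) * 1 - 0 * t = 1 by ring.
have PU t : P (mkSL2 (dU t)).
  apply: (@modular_conj (mkSL2 da)).
  by apply: SL2_eq; rewrite !expgS expg0 mulg1 !gE !mkSL2E; field.
have PL t : P (mkSL2 (dL t)).
  apply: (@modular_conj (mkSL2 da')).
  by apply: SL2_eq; rewrite !expgS expg0 mulg1 !gE !mkSL2E; field.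
have Pc g : gc g != 0 -> P g.
  move=> c0.
  pose p := (ga g - 1) / gc g; pose q := (gd g - 1) / gc g.
  have -> : g = (mkSL2 (dU p) * mkSL2 (dL (gc g)) * mkSL2 (dU q))%g.
    have E := gdet g; rewrite /p /q.
    apply: SL2_eq; rewrite !gE !mkSL2E; try by field.
    rewrite (_ : gb g = (ga g * gd g - 1) / gc g); first by field.
    by rewrite -E; field.
  exact: (PM _ _ (PM _ _ (PU p) (PL _)) (PU q)).
have [c0|c0] := eqVneq (gc x) 0; last exact: Pc.
have Plx : P (mkSL2 (dL 1%R) * x)%g.
  apply: Pc; rewrite gE !mkSL2E c0; apply/eqP => H.
  have := gdet x; rewrite c0; have -> : ga x = 0 by lra.
  by lra.
by have := PM _ _ (PV _ (PL 1%R)) Plx; rewrite mulKg.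
Qed.

Lemma haar_preimr (g : G) (B : set G) : measurable B -> mu ((fun h => (h * g)%g) @^-1` B) = mu B.
Proof. by move=> mB; have [_ /(_ B mB)] := unimodular g; rewrite mul1e. Qed.

(** Once [kap E x] is [mu E], [integral_kap] compares the measure of [B] with that of its inverse; a
    box of positive finite measure is cancelled. *)
Lemma haar_preimV (B : set G) : measurable B -> mu ((fun h => (h^-1)%g) @^-1` B) = mu B.
Proof.
move=> mB; have [q q0] := rational_box_pos.
have f1 : mu (rational_box q) \is a fin_num by rewrite ge0_fin_numE // rational_box_fin.
have p1 : 0 < fine (mu (rational_box q)) by rewrite fine_gt0 // q0 rational_box_fin.
have mq := @measurable_rational_box R q.
have := integral_kap mq mB; rewrite -{1}(fineK f1).
under eq_integral do rewrite /kap haar_preimr //.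
rewrite -(fineK f1) => E.
have : ((fine (mu (rational_box q)))^-1%:E * \int[mu]_(x in B) cst (fine (mu (rational_box q)))%:E x =
   (fine (mu (rational_box q)))^-1%:E * ((fine (mu (rational_box q)))%:E * mu ((fun h => (h^-1)%g) @^-1` B)))%E by rewrite -E.
by rewrite integral_cst // !muleA -!EFinM mulVf ?gt_eqF // !mul1e.
Qed.

End Tonelli.

(** * Weighted integrals and averages *)

Section Weighted.
Context d (T : measurableType d) (R : realType) (mu : {measure set T -> \bar R}).

Definition mbounded (u : T -> R) := measurable_fun setT u /\ exists M : R, forall x, `|u x| <= M.

Lemma mbounded_cst c : mbounded (fun=> c).
Proof. by split; [exact: measurable_cst|exists `|c|]. Qed.

Lemma mboundedD u v : mbounded u -> mbounded v -> mbounded (fun x => u x + v x).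
Proof.
move=> [mu' [M HM]] [mv [N HN]]; split; first exact: measurable_funD.
by exists (M + N) => x; rewrite (le_trans (ler_normD _ _)) // lerD.
Qed.

Lemma mboundedM u v : mbounded u -> mbounded v -> mbounded (fun x => u x * v x).
Proof.
move=> [mu' [M HM]] [mv [N HN]]; split; first exact: measurable_funM.
by exists (M * N) => x; rewrite normrM ler_pM.
Qed.

Lemma mboundedZ c u : mbounded u -> mbounded (fun x => c * u x).
Proof. by apply: mboundedM; exact: mbounded_cst. Qed.

Lemma mboundedN u : mbounded u -> mbounded (fun x => - u x).
Proof.
move=> [mu' [M HM]]; split; first exact: measurableT_comp.
by exists M => x; rewrite normrN.
Qed.

Lemma mboundedB u v : mbounded u -> mbounded v -> mbounded (fun x => u x - v x).
Proof. by move=> Hu Hv; apply: mboundedD => //; exact: mboundedN. Qed.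

Lemma mbounded_norm u : mbounded u -> mbounded (fun x => `|u x|).
Proof.
move=> [mu' [M HM]]; split; first exact: measurableT_comp.
by exists M => x; rewrite normr_id.
Qed.

Lemma mboundedX u n : mbounded u -> mbounded (fun x => u x ^+ n).
Proof.
move=> Hu; elim: n => [|n IH]; first exact: mbounded_cst.
by under eq_fun do rewrite exprS; exact: mboundedM.
Qed.

Lemma mbounded_indic (A : set T) : measurable A -> mbounded (\1_A).
Proof.
move=> mA; split; first exact: measurable_indic.
by exists 1 => x; rewrite indicE; case: (_ \in _); rewrite /= ?normr1 ?normr0.
Qed.

Definition weight (w : T -> R) := (forall x, 0 <= w x) /\ mu.-integrable setT (EFin \o w).

Definition wint (w u : T -> R) : R := \int[mu]_x (w x * u x).

Variable w : T -> R.
Hypothesis wP : weight w.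

Lemma weight_measurable : measurable_fun setT w.
Proof. by have [_ /measurable_int/measurable_EFinP] := wP. Qed.

Lemma weight_integrable u : mbounded u -> mu.-integrable setT (EFin \o (fun x => w x * u x)).
Proof.
move=> [mu' [M HM]]; have [w0 iw] := wP.
apply: (@le_integrable _ _ _ mu setT measurableT _ (fun x => M%:E * (EFin \o w) x)%E).
- by apply/measurable_EFinP; apply: measurable_funM => //; exact: weight_measurable.
- move=> x _; rewrite /= lee_fin !normrM [`|w x|]ger0_norm // mulrC.
  by apply: ler_wpM2r => //; rewrite (le_trans (HM x)) // ler_norm.
- exact: integrableZl.
Qed.

Lemma wintD u v : mbounded u -> mbounded v -> wint w (fun x => u x + v x) = wint w u + wint w v.
Proof.
move=> Hu Hv; rewrite /wint -RintegralD //; try exact: weight_integrable.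
by apply: eq_Rintegral => x _; rewrite mulrDr.
Qed.

Lemma wintZ c u : mbounded u -> wint w (fun x => c * u x) = c * wint w u.
Proof.
move=> Hu; rewrite /wint -RintegralZl //; try exact: weight_integrable.
by apply: eq_Rintegral => x _; rewrite mulrCA.
Qed.

Lemma wintN u : mbounded u -> wint w (fun x => - u x) = - wint w u.
Proof.
by move=> Hu; rewrite -mulN1r -wintZ //; apply: eq_Rintegral => x _; rewrite mulN1r.
Qed.

Lemma wintB u v : mbounded u -> mbounded v -> wint w (fun x => u x - v x) = wint w u - wint w v.
Proof. by move=> Hu Hv; rewrite wintD ?wintN //; exact: mboundedN. Qed.

Lemma le_wint u v : mbounded u -> mbounded v -> (forall x, 0 < w x -> u x <= v x) -> wint w u <= wint w v.
Proof.
move=> Hu Hv uv; apply: le_Rintegral => //; try exact: weight_integrable.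
move=> x _; have [w0 _] := wP; have := w0 x; rewrite le_eqVlt => /predU1P[<-|wx]; first by rewrite !mul0r.
by rewrite ler_pM2l // uv.
Qed.

Lemma eq_wint u v : (forall x, 0 < w x -> u x = v x) -> wint w u = wint w v.
Proof.
move=> uv; apply: eq_Rintegral => x _; have [w0 _] := wP; have := w0 x.
by rewrite le_eqVlt => /predU1P[<-|/uv ->]; rewrite ?mul0r.
Qed.

Lemma wint_cst c : wint w (fun=> c) = c * wint w (fun=> 1).
Proof. by rewrite -wintZ; [apply: eq_Rintegral => x _; rewrite mulr1|exact: mbounded_cst]. Qed.

Lemma wint_ge0 u : (forall x, 0 < w x -> 0 <= u x) -> 0 <= wint w u.
Proof.
move=> u0; apply: Rintegral_ge0 => x _; have [w0 _] := wP; have := w0 x.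
by rewrite le_eqVlt => /predU1P[<-|wx]; rewrite ?mul0r // mulr_ge0 // u0.
Qed.

Lemma wint_norm u : mbounded u -> `|wint w u| <= wint w (fun x => `|u x|).
Proof.
move=> Hu; rewrite ler_norml -wintN; last exact: mbounded_norm.
have Hn := mbounded_norm Hu.
apply/andP; split; apply: le_wint => //; try exact: mboundedN.
  by move=> x _; rewrite lerNl -normrN ler_norm.
by move=> x _; exact: ler_norm.
Qed.

Lemma wint_EFin u : mbounded u -> (wint w u)%:E = (\int[mu]_x (w x * u x)%:E)%E.
Proof. by move=> Hu; rewrite /wint /Rintegral fineK //; exact: integrable_fin_num (weight_integrable Hu). Qed.

Lemma wint_cauchy_schwarz u v : mbounded u -> mbounded v ->
  wint w (fun x => u x * v x) ^+ 2 <= wint w (fun x => u x ^+ 2) * wint w (fun x => v x ^+ 2).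
Proof.
move=> Hu Hv; set a := wint w (fun x => u x ^+ 2); set b := wint w (fun x => u x * v x); set c := wint w (fun x => v x ^+ 2).
(* Kept homogeneous in [s] and [t], so that it also settles the case [c = 0]. *)
have Q (s t : R) : 0 <= s ^+ 2 * a + 2 * s * t * b + t ^+ 2 * c.
  have -> : s ^+ 2 * a + 2 * s * t * b + t ^+ 2 * c = wint w (fun x => (s * u x + t * v x) ^+ 2).
    have Ha := mboundedX 2 Hu; have Hb := mboundedM Hu Hv; have Hc := mboundedX 2 Hv.
    rewrite -!wintZ // -!wintD //; try by do ?apply: mboundedD; exact: mboundedZ.
    by apply: eq_wint => x _; ring.
  by apply: wint_ge0 => x _; exact: sqr_ge0.
have a0 : 0 <= a by have := Q 1 0; lra.
have c0 : 0 <= c by have := Q 0 1; lra.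
have [c00|cn] := eqVneq c 0.
  have [-> |bn] := eqVneq b 0; first by rewrite expr0n mulr_ge0.
  have := Q 1 (- (a + 1) / (2 * b)); rewrite c00 mulr0 addr0.
  rewrite (_ : _ + _ = - 1); last by field.
  lra.
have cp : 0 < c by rewrite lt_def cn.
have := Q c (- b); nra.
Qed.

End Weighted.

Section WeightedFubini.
Variables (R : realType) (mu : {sigma_finite_measure set (borelSL2 R) -> \bar R}).
Local Notation G := (borelSL2 R).

Definition mbounded2 (u : G -> G -> R) := measurable_fun setT (fun p : G * G => u p.1 p.2) /\
  exists M : R, forall x y, `|u x y| <= M.

Lemma mbounded2_l u x : mbounded2 u -> mbounded (u x).
Proof.
move=> [mu' [M HM]]; split; last by exists M.
exact: (measurableT_comp mu' (measurable_pair1 x)).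
Qed.

Lemma mbounded2_comp (u : G -> R) (f : G -> G -> G) : mbounded u ->
  measurable_fun setT (fun p : G * G => f p.1 p.2) -> mbounded2 (fun x y => u (f x y)).
Proof. by move=> [mu' [M HM]] mf; split; [exact: measurableT_comp mu' mf|exists M => x y]. Qed.

Lemma mbounded_wint (w : G -> R) u : weight mu w -> mbounded2 u -> mbounded (fun x => wint mu w (u x)).
Proof.
move=> Hw Hu; have [mu' [M HM]] := Hu; have [w0 iw] := Hw; have mw := weight_measurable Hw.
split; last first.
  exists (`|M| * wint mu w (fun=> 1)) => x.
  apply: (le_trans (wint_norm Hw (mbounded2_l _ Hu))); rewrite -(wint_cst Hw).
  apply: (le_wint Hw); [exact: mbounded_norm (mbounded2_l _ Hu)|exact: mbounded_cst|].
  by move=> y _; rewrite (le_trans (HM x y)) // ler_norm.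
rewrite (_ : (fun x => _) = fun x => fine (\int[mu]_y (w y * (u x y + M))%:E)%E - M * wint mu w (fun=> 1)); last first.
  apply/funext => x; rewrite -(wint_EFin Hw) /=; last by apply: mboundedD; [exact: mbounded2_l|exact: mbounded_cst].
  rewrite (wintD Hw) ?(wint_cst Hw M) ?addrK //; [exact: mbounded2_l|exact: mbounded_cst].
apply: measurable_funB => //; apply: measurableT_comp; first exact: fine_measurable.
apply: (@measurable_integralG _ mu (fun x y => (w y * (u x y + M))%:E)%E) => [|x y].
  apply/measurable_EFinP; apply: measurable_funM; last exact: measurable_funD.
  exact: measurableT_comp mw measurable_snd.
by rewrite lee_fin mulr_ge0 //; have := HM x y; rewrite ler_norml => /andP[]; lra.
Qed.

End WeightedFubini.

Section HaarMaps.
Variables (R : realType) (mu : {sigma_finite_measure set (borelSL2 R) -> \bar R}).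
Hypothesis Hmu : haar_measure mu.
Local Notation G := (borelSL2 R).

Definition preserves (phi : G -> G) := measurable_fun setT phi /\
  forall B, measurable B -> mu (phi @^-1` B) = mu B.

Lemma preserves_mull g : preserves (fun h => (g * h)%g).
Proof. by split; [exact: measurable_mulgl|move=> B mB; exact: haar_preim]. Qed.

Lemma preserves_mulr g : preserves (fun h => (h * g)%g).
Proof. by split; [exact: measurable_mulgr|move=> B mB; exact: haar_preimr]. Qed.

Lemma preservesV : preserves (fun h => (h^-1)%g).
Proof. by split; [exact: measurable_invg|move=> B mB; exact: haar_preimV]. Qed.

Lemma preserves_comp phi psi : preserves phi -> preserves psi -> preserves (phi \o psi).
Proof.
move=> [mp Hp] [mq Hq]; split=> [|B mB]; first exact: measurableT_comp mp mq.
by rewrite comp_preimage Hq ?Hp //; exact: (measurable_preim mp mB).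
Qed.

Lemma preserves_integral phi (f : G -> \bar R) : preserves phi -> measurable_fun setT f ->
  (\int[mu]_x f (phi x) = \int[mu]_x f x)%E.
Proof.
move=> [mp Hp] mf.
have K (h : G -> \bar R) : measurable_fun setT h -> (forall x, 0 <= h x)%E ->
    (\int[mu]_x h (phi x) = \int[mu]_x h x)%E.
  move=> mh h0; transitivity (\int[pushforward mu phi]_x h x)%E.
    by rewrite (ge0_integral_pushforward mp).
  by apply: eq_measure_integral => A mA _; rewrite /= /pushforward Hp.
rewrite integralE [RHS]integralE; congr (_ - _)%E.
  rewrite -(K f^\+%E (measurable_funepos mf) (funepos_ge0 _)).
  by apply: eq_integral => x _; rewrite !funeposE.
rewrite -(K f^\-%E (measurable_funeneg mf) (funeneg_ge0 _)).
by apply: eq_integral => x _; rewrite !funenegE.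
Qed.

Lemma preserves_Rintegral phi (f : G -> R) : preserves phi -> measurable_fun setT f ->
  \int[mu]_x f (phi x) = \int[mu]_x f x.
Proof.
move=> Hp mf; rewrite /Rintegral -(preserves_integral Hp (f := fun x => (f x)%:E)) //.
exact/measurable_EFinP.
Qed.

Lemma preserves_weight phi k : preserves phi -> weight mu k -> weight mu (fun x => k (phi x)).
Proof.
move=> Hp [k0 ik]; split => //.
have mk : measurable_fun setT k by exact: weight_measurable (conj k0 ik).
have mkp : measurable_fun setT (fun x => k (phi x)) by have [mp _] := Hp; exact: measurableT_comp mk mp.
have [_ fk] := integrableP _ _ _ ik.
apply/integrableP; split; first exact/measurable_EFinP.
apply: le_lt_trans fk; rewrite le_eqVlt; apply/orP; left; apply/eqP.
apply: (@preserves_integral phi (fun x => `|(k x)%:E|)%E) => //.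
by apply: measurableT_comp => //; exact/measurable_EFinP.
Qed.

Definition avg (k f : G -> R) (g : G) : R := wint mu k (fun h => f (g * h)%g).

Lemma mbounded_translate (f : G -> R) (g : G) : mbounded f -> mbounded (fun h : G => f (g * h)%g).
Proof. by move=> [mf [M HM]]; split; [exact: measurableT_comp mf (measurable_mulgl g)|exists M => x]. Qed.

Lemma measurable_mul2 : measurable_fun setT (fun p : G * G => (p.1 * p.2)%g : G).
Proof. by apply: measurable_mulg; [exact: measurable_fst|exact: measurable_snd]. Qed.

Lemma mbounded_avg k f : weight mu k -> mbounded f -> mbounded (avg k f).
Proof.
move=> Hk Hf; apply: (mbounded_wint Hk).
by apply: (mbounded2_comp (f := fun x y => (x * y)%g) Hf); exact: measurable_mul2.
Qed.

Lemma avgE k f g : weight mu k -> mbounded f -> avg k f g = wint mu (fun h => k (g^-1 * h)%g) f.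
Proof.
move=> Hk [mf _]; rewrite /avg /wint.
rewrite -(@preserves_Rintegral _ (fun h => k (g^-1 * h)%g * f h) (preserves_mull g)).
  by apply: eq_Rintegral => h _; rewrite mulKg.
apply: measurable_funM => //.
exact: measurableT_comp (weight_measurable Hk) (measurable_mulgl _).
Qed.

Lemma avg_translate k f g x : avg k (fun h => f (g * h)%g) x = avg k f (g * x)%g.
Proof. by rewrite /avg; apply: eq_Rintegral => h _; rewrite mulgA. Qed.

Lemma avg_inv k f g : (forall x, f (g * x)%g = f x) -> forall x, avg k f (g * x)%g = avg k f x.
Proof. by move=> H x; rewrite -avg_translate /avg; apply: eq_Rintegral => h _; rewrite H. Qed.

Fact sl2_tr_subproof (g : G) : ga g * gd g - gc g * gb g = 1.
Proof. by rewrite -(gdet g); ring. Qed.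
Definition sl2_tr (g : G) : G := mkSL2 (sl2_tr_subproof g).

Lemma sl2_trM g h : sl2_tr (g * h)%g = (sl2_tr h * sl2_tr g)%g.
Proof. by apply: SL2_eq; rewrite !(mkSL2E, gE); ring. Qed.

Lemma sl2_trV g : sl2_tr (g^-1)%g = ((sl2_tr g)^-1)%g.
Proof. by apply: SL2_eq; rewrite !(mkSL2E, gE). Qed.

Fact rotJ_subproof : (0 : R) * 0 - 1 * (-1) = 1. Proof. by ring. Qed.
Definition rotJ : G := mkSL2 rotJ_subproof.

Lemma preserves_tr : preserves sl2_tr.
Proof.
have -> : sl2_tr = (fun h => (h * rotJ)%g) \o (fun h => (rotJ^-1 * h)%g) \o (fun h => (h^-1)%g).
  by apply/funext => h; apply: SL2_eq; rewrite /= !(mkSL2E, gE); ring.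
apply: preserves_comp preservesV.
by apply: preserves_comp; [exact: preserves_mulr|exact: preserves_mull].
Qed.

Definition rotation (k : G) := ga k = gd k /\ gb k = - gc k.

Lemma rotation_sqr k : rotation k -> ga k ^+ 2 + gc k ^+ 2 = 1.
Proof. by move=> [E1 E2]; rewrite -(gdet k) -E1 E2; ring. Qed.

Lemma HS2_rotl k g : rotation k -> HS2 (k * g)%g = HS2 g.
Proof.
move=> Hk; have E := rotation_sqr Hk; have [E1 E2] := Hk; rewrite /HS2 !gE E2 -E1.
transitivity ((ga k ^+ 2 + gc k ^+ 2) * HS2 g); last by rewrite E mul1r.
by rewrite /HS2; ring.
Qed.

Lemma HS2_rotr k g : rotation k -> HS2 (g * k)%g = HS2 g.
Proof.
move=> Hk; have E := rotation_sqr Hk; have [E1 E2] := Hk; rewrite /HS2 !gE E2 -E1.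
transitivity ((ga k ^+ 2 + gc k ^+ 2) * HS2 g); last by rewrite E mul1r.
by rewrite /HS2; ring.
Qed.

Lemma HS2_tr g : HS2 (sl2_tr g) = HS2 g.
Proof. by rewrite /HS2 !mkSL2E; ring. Qed.

(** By the polar decomposition the transpose lies in [K g K]; both factors can be the same rotation,
    the one with first row proportional to [(a + d, c - b)]. *)
Lemma rotation_tr g : exists2 k : G, rotation k & sl2_tr g = (k * g * k)%g.
Proof.
have E := gdet g.
pose N2 := (ga g + gd g) ^+ 2 + (gb g - gc g) ^+ 2.
have N2p : 0 < N2.
  have -> : N2 = HS2 g + 2 * (ga g * gd g - gb g * gc g) by rewrite /N2 /HS2; ring.
  by rewrite E; have := HS2_gt0 g; lra.
pose N := Num.sqrt N2.
have Np : 0 < N by rewrite sqrtr_gt0.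
have NN : N ^+ 2 = N2 by rewrite sqr_sqrtr // ltW.
have D : ((ga g + gd g) / N) * ((ga g + gd g) / N) - ((gc g - gb g) / N) * (- (gc g - gb g) / N) = 1.
  transitivity (N2 / N ^+ 2); last by rewrite NN divff // gt_eqF.
  by rewrite /N2; field; rewrite gt_eqF.
exists (mkSL2 D); first by split; rewrite !mkSL2E //; field; rewrite gt_eqF.
apply: (mulgI (mkSL2 D)^-1%g); rewrite !mulgA mulVg mul1g.
have N0 : N != 0 by rewrite gt_eqF.
by apply: SL2_eq; rewrite !gE !mkSL2E; field.
Qed.

Section Commute.
Variables (p q : R -> R).
Let k (g : G) := p (HS2 g).
Let k' (g : G) := q (HS2 g).
Hypotheses (Hk : weight mu k) (Hk' : weight mu k').

Let conv (a b : G -> R) (w : G) := (\int[mu]_x (a x * b (x^-1 * w)%g)%:E)%E.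

Let mab (a b : G -> R) w : measurable_fun setT a -> measurable_fun setT b ->
  measurable_fun setT (fun x => (a x * b (x^-1 * w)%g)%:E).
Proof.
move=> ma mb; apply/measurable_EFinP; apply: measurable_funM => //; apply: measurableT_comp mb _.
by apply: measurable_mulg => //; exact: measurable_invg.
Qed.

Let convC w : conv k k' w = conv k' k w.
Proof.
have mk := weight_measurable Hk; have mk' := weight_measurable Hk'.
transitivity (conv k k' (sl2_tr w)).
  have [r Hr ->] := rotation_tr w.
  rewrite /conv -[RHS](preserves_integral (preserves_mull r) (mab _ mk mk')).
  apply: eq_integral => x _; rewrite /k /k' HS2_rotl //; congr ((_ * q _)%:E).
  rewrite invgM !mulgA mulgVK (HS2_rotr _ Hr); reflexivity.
rewrite /conv -[LHS](preserves_integral preserves_tr (mab _ mk mk')).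
transitivity (\int[mu]_x (k x * k' (w * x^-1)%g)%:E)%E.
  by apply: eq_integral => x _; rewrite /k /k' HS2_tr -sl2_trV -sl2_trM HS2_tr.
rewrite -[RHS](preserves_integral (preserves_comp (preserves_mull w) preservesV) (mab _ mk' mk)).
by apply: eq_integral => x _; rewrite /= invgM invgK mulgVK mulrC.
Qed.

(** Gelfand's trick. Transposition reverses products and preserves Haar measure and the functions of
    [HS2], while [w] and its transpose differ by rotations; so the convolution of two such kernels
    does not depend on their order. *)
Lemma avgC f g : mbounded f -> avg k (avg k' f) g = avg k' (avg k f) g.
Proof.
have mk := weight_measurable Hk; have mk' := weight_measurable Hk'.
have [k0 _] := Hk; have [k0' _] := Hk'.
(* Adding a constant makes [f] nonnegative, so that Tonelli's theorem can exchange the integrals. *)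
wlog f0 : f / forall x, 0 <= f x => [H|].
  move=> Hf; have [mf [M HM]] := Hf.
  have Hc := mbounded_cst G (M : R).
  have HfM : mbounded (fun x => f x + M) by exact: mboundedD.
  have := H (fun x => f x + M) _ HfM.
  have E a b : weight mu a -> weight mu b -> avg a (avg b (fun x => f x + M)) g =
      avg a (avg b f) g + M * wint mu a (fun=> 1) * wint mu b (fun=> 1).
    move=> Ha Hb; rewrite mulrAC -(wint_cst Ha) -(wintD Ha); last exact: mbounded_cst.
      apply: (eq_wint Ha) => x _; rewrite /avg (wintD Hb) ?(wint_cst Hb M) //.
      exact: mbounded_translate.
    by apply: mbounded_translate; exact: mbounded_avg.
  rewrite (E _ _ Hk Hk') (E _ _ Hk' Hk) => /(_ _)/wrap[x|].
    by have := HM x; rewrite ler_norml => /andP[]; lra.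
  by rewrite [M * wint mu k' _ * _]mulrAC; exact: addIr.
move=> Hf; have [mf [M HM]] := Hf.
have K a b : weight mu a -> weight mu b ->
    (avg a (avg b f) g)%:E = (\int[mu]_y ((f (g * y)%g)%:E * conv a b y))%E.
  move=> Ha Hb; have ma := weight_measurable Ha; have mb := weight_measurable Hb.
  have [a0 _] := Ha; have [b0 _] := Hb.
  have mF : measurable_fun setT (fun p : G * G => (a p.1 * b (p.1^-1 * p.2)%g * f (g * p.2)%g)%:E).
    apply/measurable_EFinP; apply: measurable_funM; last first.
      exact: measurableT_comp mf (measurableT_comp (measurable_mulgl g) measurable_snd).
    apply: measurable_funM; first exact: measurableT_comp ma measurable_fst.
    apply: measurableT_comp mb _; apply: measurable_mulg; last exact: measurable_snd.
    exact: measurableT_comp (@measurable_invg R) measurable_fst.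
  transitivity (\int[mu]_x \int[mu]_y (a x * b (x^-1 * y)%g * f (g * y)%g)%:E)%E.
    rewrite /avg (wint_EFin Ha); last exact: (mbounded_translate _ (mbounded_avg Hb Hf)).
    apply: eq_integral => x _; rewrite EFinM (wint_EFin Hb); last exact: mbounded_translate.
    have m1 : measurable_fun setT (fun y => (b y * f (g * x * y)%g)%:E).
      by apply/measurable_EFinP; apply: measurable_funM => //; have [] := mbounded_translate (g * x)%g Hf.
    rewrite -(preserves_integral (preserves_mull (x^-1)%g) m1) -ge0_integralZl //; last first.
    - by rewrite lee_fin.
    - by move=> y _; rewrite lee_fin mulr_ge0.
    - by have [mp _] := preserves_mull (x^-1)%g; exact: measurableT_comp m1 mp.
    by apply: eq_integral => y _; rewrite -EFinM mulrA -[(g * x * _)%g]mulgA mulVKg.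
  rewrite (tonelliG _ mF); last by move=> x y; rewrite lee_fin !mulr_ge0.
  apply: eq_integral => y _; rewrite /conv -ge0_integralZl //; last first.
  - by rewrite lee_fin.
  - by move=> x _; rewrite lee_fin mulr_ge0.
  - exact: mab.
  by apply: eq_integral => x _; rewrite -EFinM mulrC.
suff : (avg k (avg k' f) g)%:E = (avg k' (avg k f) g)%:E by case.
rewrite (K _ _ Hk Hk') (K _ _ Hk' Hk).
by apply: eq_integral => y _; rewrite convC.
Qed.

End Commute.

End HaarMaps.

(** * Calculus on the upper half-plane *)

Section HalfPlane.
Variable R : realType.
Local Notation G := (borelSL2 R).
Local Notation H2 := (@upper_half_plane R).
Implicit Types (z : R * R) (h : G) (f : R * R -> R) (b : bool).

Definition dvec b : R * R := if b then (1, 0) else (0, 1).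
Definition dd b f : R * R -> R := fun z => 'D_(dvec b) f z.

Lemma nbhs_H2 z : H2 z -> \forall w \near z, H2 w.
Proof.
move=> z0; apply/nbhs_ballP; exists z.2 => //= w [_ /=].
by rewrite /upper_half_plane /= /ball /= ltr_norml => /andP[_]; rewrite ltrBlDr ltrDl.
Qed.

Lemma eq_H2_near f g : (forall z, H2 z -> f z = g z) -> forall z, H2 z -> \forall w \near z, f w = g w.
Proof. by move=> fg z /nbhs_H2; apply: filterS => w /fg. Qed.

Lemma derivable_line f z (v : R * R) t : derivable f (t *: v + z) v <-> derivable (fun s : R => f (s *: v + z)) t 1.
Proof.
rewrite /derivable; set g1 := fun e : R => e^-1 *: _; set g2 := fun e : R => e^-1 *: _.
suff -> : g1 = g2 by [].
by apply/funext => e; rewrite /g1 /g2 /= [e *: 1]mulr1 scalerDl addrA.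
Qed.

Lemma derive_line f z (v : R * R) t : 'D_v f (t *: v + z) = 'D_1 (fun s : R => f (s *: v + z)) t.
Proof.
rewrite /derive; set g1 := fun e : R => e^-1 *: _; set g2 := fun e : R => e^-1 *: _.
suff -> : g1 = g2 by [].
by apply/funext => e; rewrite /g1 /g2 /= [e *: 1]mulr1 scalerDl addrA.
Qed.

Lemma is_derive_quot f z (v : R * R) (l : R) : (forall e : R, f (e *: v + z) = f z + e * l) -> is_derive z v f l.
Proof.
move=> H; have E : (fun e : R => e^-1 *: ((f \o shift z) (e *: v) - f z)) @ (0 : R)^' --> l.
  apply: cvg_near_cst; near=> e.
  rewrite /= H addrC addKr /GRing.scale /= mulKf //.
  by near: e; exact: nbhs_dnbhs_neq.
by apply: DeriveDef; [apply/cvg_ex; exists l|exact: (cvg_lim _ E)].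
Unshelve. all: by end_near. Qed.

(** With [w = h i], [PA + i PB] is [(d - i c)(z - conj w)]. Hence [4 y / Pz], the kernel [Xz] below,
    is [cosh(d(z, w)/2)^(-2)], a rational function of [z]. *)
Definition PA z h := gd h * z.1 + gc h * z.2 - gb h.
Definition PB z h := gd h * z.2 - gc h * z.1 + ga h.
Definition Pz z h := PA z h ^+ 2 + PB z h ^+ 2.
Definition Nz z h := Num.sqrt (Pz z h).

Lemma PzE z h : Pz z h = (gd h * z.1 - gb h) ^+ 2 + (ga h - gc h * z.1) ^+ 2
   + z.2 ^+ 2 * (gc h ^+ 2 + gd h ^+ 2) + 2 * z.2.
Proof.
rewrite -[2 * z.2](mulr1 (2 * z.2)); rewrite -[X in 2 * z.2 * X](gdet h).
by rewrite /Pz /PA /PB; ring.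
Qed.

Lemma Pz_gt0 z h : H2 z -> 0 < Pz z h.
Proof.
rewrite /upper_half_plane /= => z0; rewrite PzE ltr_wpDl ?mulr_gt0 //.
apply: addr_ge0; first by apply: addr_ge0; exact: sqr_ge0.
by apply: mulr_ge0; [exact: sqr_ge0|apply: addr_ge0; exact: sqr_ge0].
Qed.

Lemma Nz_gt0 z h : H2 z -> 0 < Nz z h.
Proof. by move=> z0; rewrite sqrtr_gt0 Pz_gt0. Qed.

Lemma Nz_sqr z h : H2 z -> Nz z h ^+ 2 = Pz z h.
Proof. by move=> z0; rewrite sqr_sqrtr // ltW // Pz_gt0. Qed.

Lemma norm_le_Nz z h x : H2 z -> x ^+ 2 <= Pz z h -> `|x| <= Nz z h.
Proof.
move=> z0 xP; rewrite -(ler_pXn2r (_ : 0 < 2)%N) ?nnegrE ?normr_ge0 ?(ltW (Nz_gt0 _ z0)) //.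
by rewrite real_normK ?num_real // Nz_sqr.
Qed.

Lemma Nz_coord z h : H2 z -> [/\ `|PA z h| <= Nz z h, `|PB z h| <= Nz z h,
  `|gc h| <= z.2^-1 * Nz z h & `|gd h| <= z.2^-1 * Nz z h].
Proof.
move=> z0; have y0 : 0 < z.2 := z0.
have E := PzE z h; have := sqr_ge0 (PA z h); have := sqr_ge0 (PB z h).
have := sqr_ge0 (gd h * z.1 - gb h); have := sqr_ge0 (ga h - gc h * z.1).
have := mulr_ge0 (sqr_ge0 z.2) (sqr_ge0 (gc h)); have := mulr_ge0 (sqr_ge0 z.2) (sqr_ge0 (gd h)).
have K x : (z.2 * x) ^+ 2 <= Pz z h -> `|x| <= z.2^-1 * Nz z h.
  by move=> /(norm_le_Nz z0); rewrite normrM (gtr0_norm y0) => H; rewrite mulrC ler_pdivlMr // mulrC.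
move=> h1 h2 h3 h4 h5 h6; split; [| |apply: K|apply: K]; rewrite ?exprMn; try apply: norm_le_Nz => //.
- by rewrite /Pz lerDl.
- by rewrite /Pz lerDr.
- by rewrite E; lra.
- by rewrite E; lra.
Qed.

(** Boxes of size proportional to the height: on them [Pz] varies by a bounded factor, uniformly in
    [h]. *)
Definition close z0 z := `|z.1 - z0.1| <= z0.2 / 4 /\ `|z.2 - z0.2| <= z0.2 / 4.

Lemma close_H2 z0 z : H2 z0 -> close z0 z -> H2 z.
Proof.
rewrite /upper_half_plane /= => H0 [_]; rewrite ler_norml => /andP[]; lra.
Qed.

Lemma close_refl z : H2 z -> close z z.
Proof. by rewrite /upper_half_plane /= => H0; split; rewrite subrr normr0 divr_ge0 // ltW. Qed.

Lemma close_Pz z0 z h : H2 z0 -> close z0 z -> Pz z0 h / 4 <= Pz z h <= 4 * Pz z0 h.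
Proof.
move=> H0 [H1 H2']; have y0 : 0 < z0.2 := H0.
have sq x : `|x| <= z0.2 / 4 -> x ^+ 2 <= z0.2 ^+ 2 / 16.
  by rewrite ler_norml => /andP[x1 x2]; nra.
have H1' := sq _ H1; have H2'' := sq _ H2'.
pose q := gc h ^+ 2 + gd h ^+ 2.
have q0 : 0 <= q by rewrite addr_ge0 ?sqr_ge0.
have qP : q * z0.2 ^+ 2 <= Pz z0 h.
  rewrite PzE -/q; have := sqr_ge0 (gd h * z0.1 - gb h); have := sqr_ge0 (ga h - gc h * z0.1); lra.
pose al := gd h * (z.1 - z0.1) + gc h * (z.2 - z0.2).
pose be := gd h * (z.2 - z0.2) - gc h * (z.1 - z0.1).
have E : al ^+ 2 + be ^+ 2 = q * ((z.1 - z0.1) ^+ 2 + (z.2 - z0.2) ^+ 2) by rewrite /al /be /q; ring.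
have D : al ^+ 2 + be ^+ 2 <= Pz z0 h / 8.
  rewrite E; apply: (@le_trans _ _ (q * (z0.2 ^+ 2 / 8))); last lra.
  by rewrite ler_wpM2l //; lra.
have EP : Pz z h = (PA z0 h + al) ^+ 2 + (PB z0 h + be) ^+ 2 by rewrite /Pz /PA /PB /al /be; ring.
rewrite EP; move: D; rewrite /Pz; move: (PA z0 h) (PB z0 h) => A B D.
have := sqr_ge0 (A + 2 * al); have := sqr_ge0 (B + 2 * be).
have := sqr_ge0 (A - al); have := sqr_ge0 (B - be); have := sqr_ge0 A; have := sqr_ge0 B.
by move=> *; apply/andP; split; nra.
Qed.

Lemma close_Nz z0 z h : H2 z0 -> close z0 z -> Nz z0 h / 2 <= Nz z h /\ Nz z h <= 2 * Nz z0 h.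
Proof.
move=> H0 Hc; have /andP[P1 P2] := close_Pz h H0 Hc; have Hz := close_H2 H0 Hc.
have N0 := Nz_gt0 h H0; have N1 := Nz_gt0 h Hz; have E0 := Nz_sqr h H0; have E1 := Nz_sqr h Hz.
by split; rewrite leNgt; apply/negP => ?; nra.
Qed.

(** Kernels bounded by [O(Nz^w)] locally uniformly in [z], as are their partial derivatives up to
    order [n], with the same weight. The class is stable under sums and products and made for
    differentiation under the integral sign. *)
Fixpoint dom (n : nat) (w : int) (k : R * R -> G -> R) : Prop :=
  [/\ forall z, H2 z -> measurable_fun setT (k z),
      forall z0, H2 z0 -> exists C : R, forall z h, close z0 z -> `|k z h| <= C * Nz z0 h ^ w
    & if n is m.+1 then (forall b z h, H2 z -> derivable (k ^~ h) z (dvec b)) /\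
         forall b, dom m w (fun z h => dd b (k ^~ h) z) else True].

Lemma dom_congr n w k k' : (forall z h, H2 z -> k z h = k' z h) -> dom n w k -> dom n w k'.
Proof.
elim: n k k' => [|n IH] k k' E /= [km kb kd]; split => //.
- move=> z Hz; have -> : k' z = k z by apply/funext => h; rewrite E.
  exact: km.
- move=> z0 Hz0; have [C HC] := kb z0 Hz0; exists C => z h Hc.
  by rewrite -E ?HC //; exact: close_H2 Hc.
- move=> z Hz; have -> : k' z = k z by apply/funext => h; rewrite E.
  exact: km.
- move=> z0 Hz0; have [C HC] := kb z0 Hz0; exists C => z h Hc.
  by rewrite -E ?HC //; exact: close_H2 Hc.
have nE z h : H2 z -> \forall w \near z, k w h = k' w h.
  by move=> Hz; apply: eq_H2_near Hz => y Hy; exact: E.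
have [kd1 kd2] := kd; split.
  by move=> b z h Hz; apply: near_eq_derivable (kd1 b z h Hz); exact: nE.
by move=> b; apply: IH (kd2 b) => z h Hz; apply: near_eq_derive; exact: nE.
Qed.

Lemma domW n w k : dom n.+1 w k -> dom n w k.
Proof.
elim: n k => [|n IH] k [km kb [kd1 kd2]]; split => //; split => // b.
by apply: IH; exact: kd2.
Qed.

Lemma dom_dd n w k b : dom n.+1 w k -> dom n w (fun z h => dd b (k ^~ h) z).
Proof. by move=> [_ _ [_ +]]; exact. Qed.

Lemma dom_le1 n w k : dom n.+1 w k -> dom 1 w k.
Proof. by elim: n k => // n IH k Hk; apply: IH; exact: domW. Qed.

Lemma dom_derivable n w k b z h : dom n.+1 w k -> H2 z -> derivable (k ^~ h) z (dvec b).
Proof. by move=> [_ _ [kd _]]; exact: kd. Qed.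

Lemma domD n w k k' : dom n w k -> dom n w k' -> dom n w (fun z h => k z h + k' z h).
Proof.
elim: n k k' => [|n IH] k k' /= [km kb kd] [km' kb' kd']; split => //.
1,3: by move=> z Hz; apply: measurable_funD; [exact: km|exact: km'].
1,2: by move=> z0 Hz0; have [C HC] := kb z0 Hz0; have [C' HC'] := kb' z0 Hz0; exists (C + C') => z h Hc;
  rewrite (le_trans (ler_normD _ _)) // mulrDl lerD ?HC ?HC'.
have [kd1 kd2] := kd; have [kd1' kd2'] := kd'; split.
  by move=> b z h Hz; apply: derivableD; [exact: kd1|exact: kd1'].
move=> b; apply: dom_congr (IH _ _ (kd2 b) (kd2' b)) => z h Hz.
by rewrite /dd deriveD //; [exact: kd1|exact: kd1'].
Qed.

Lemma domM n w w' k k' : dom n w k -> dom n w' k' -> dom n (w + w') (fun z h => k z h * k' z h).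
Proof.
elim: n k k' => [|n IH] k k' /= => Dk Dk'; have [km kb kd] := Dk; have [km' kb' kd'] := Dk'; split => //.
1,3: by move=> z Hz; apply: measurable_funM; [exact: km|exact: km'].
1,2: by move=> z0 Hz0; have [C HC] := kb z0 Hz0; have [C' HC'] := kb' z0 Hz0; exists (C * C') => z h Hc;
  rewrite normrM expfzDr ?gt_eqF ?Nz_gt0 // mulrACA ler_pM ?HC ?HC'.
have [kd1 kd2] := kd; have [kd1' kd2'] := kd'; split.
  by move=> b z h Hz; apply: derivableM; [exact: kd1|exact: kd1'].
move=> b.
have D1 := IH _ _ (domW Dk) (kd2' b); have D2 := IH _ _ (kd2 b) (domW Dk').
apply: dom_congr (domD D1 D2) => z h Hz.
rewrite /dd deriveM /GRing.scale /=; [by rewrite [k' z h * _]mulrC|exact: kd1|exact: kd1'].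
Qed.

Lemma dom_const n w (u : G -> R) : measurable_fun setT u ->
  (forall z0, H2 z0 -> exists C : R, forall h, `|u h| <= C * Nz z0 h ^ w) -> dom n w (fun _ h => u h).
Proof.
elim: n u => [|n IH] u mu ub /=; split => //; try by move=> z0 /ub[C HC]; exists C => z h _.
split; first by move=> b z h _; exact: derivable_cst.
move=> b; apply: (@dom_congr _ _ (fun _ _ => 0)); first by move=> z h _; rewrite /dd derive_cst.
apply: IH => // z0 _; exists 0 => h; by rewrite normr0 mul0r.
Qed.

Lemma dom_cst n c : dom n 0 (fun _ _ => c).
Proof. by apply: dom_const => // z0 _; exists `|c| => h; rewrite expr0z mulr1. Qed.

Lemma dom_gc n : dom n 1 (fun _ h => gc h).
Proof.
apply: dom_const; first exact: measurable_gc.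
by move=> z0 H0; exists (z0.2^-1) => h; rewrite expr1z; have [] := Nz_coord h H0.
Qed.

Lemma dom_gd n : dom n 1 (fun _ h => gd h).
Proof.
apply: dom_const; first exact: measurable_gd.
by move=> z0 H0; exists (z0.2^-1) => h; rewrite expr1z; have [] := Nz_coord h H0.
Qed.

Lemma domZ n w c k : dom n w k -> dom n w (fun z h => c * k z h).
Proof. by move=> Hk; rewrite -[w]add0r; apply: domM => //; exact: dom_cst. Qed.

Lemma is_derive_y b z : is_derive z (dvec b) (fun z => z.2) (if b then 0 else 1).
Proof. by apply: is_derive_quot => t; case: b; rewrite /= /GRing.scale /= ?mulr0 ?mulr1 addrC. Qed.

Lemma is_derive_dd b f z l : is_derive z (dvec b) f l -> dd b f z = l.
Proof. by case. Qed.

Definition dA b h := if b then gd h else gc h.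
Definition dB b h := if b then - gc h else gd h.

Lemma is_derive_PA b z h : is_derive z (dvec b) (PA ^~ h) (dA b h).
Proof. by apply: is_derive_quot => t; rewrite /PA; case: b; rewrite /= /GRing.scale /=; ring. Qed.

Lemma is_derive_PB b z h : is_derive z (dvec b) (PB ^~ h) (dB b h).
Proof. by apply: is_derive_quot => t; rewrite /PB; case: b; rewrite /= /GRing.scale /=; ring. Qed.

Definition dP b z h := 2 * (PA z h * dA b h + PB z h * dB b h).

Lemma is_derive_Pz b z h : is_derive z (dvec b) (Pz ^~ h) (dP b z h).
Proof.
have [A1 A2] := is_derive_PA b z h; have [B1 B2] := is_derive_PB b z h.
rewrite (_ : Pz ^~ h = (PA ^~ h) * (PA ^~ h) + (PB ^~ h) * (PB ^~ h)); last first.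
  by apply/funext => w; rewrite /Pz !expr2.
apply: DeriveDef; first exact: (derivableD (derivableM A1 A1) (derivableM B1 B1)).
rewrite (deriveD (derivableM A1 A1) (derivableM B1 B1)) (deriveM A1 A1) (deriveM B1 B1) A2 B2.
rewrite /GRing.scale /= /dP; move: (PA z h) (PB z h) (dA b h) (dB b h) => p q r t; ring.
Qed.

Lemma is_derive_Pinv b z h : H2 z -> is_derive z (dvec b) (fun z => (Pz z h)^-1) (- (dP b z h * ((Pz z h)^-1 * (Pz z h)^-1))).
Proof.
move=> Hz; have P0 : Pz z h != 0 by rewrite gt_eqF ?Pz_gt0.
have [D1 D2] := is_derive_Pz b z h.
apply: DeriveDef; first exact: derivableV.
by rewrite deriveV // D2 /GRing.scale /= expr2 invfM; ring.
Qed.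

Lemma measurable_PA z : measurable_fun setT (PA z).
Proof.
apply: measurable_funB; last exact: measurable_gb.
by apply: measurable_funD; apply: measurable_funM => //; [exact: measurable_gd|exact: measurable_gc].
Qed.

Lemma measurable_PB z : measurable_fun setT (PB z).
Proof.
apply: measurable_funD; last exact: measurable_ga.
by apply: measurable_funB; apply: measurable_funM => //; [exact: measurable_gd|exact: measurable_gc].
Qed.

Lemma measurable_Pz z : measurable_fun setT (Pz z).
Proof. by apply: measurable_funD; apply: measurable_funX; [exact: measurable_PA|exact: measurable_PB]. Qed.

Lemma dom_dA n b : dom n 1 (fun _ h => dA b h).
Proof. by case: b; [exact: dom_gd|exact: dom_gc]. Qed.

Lemma dom_dB n b : dom n 1 (fun _ h => dB b h).
Proof.
case: b; last exact: dom_gd.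
by apply: dom_congr (domZ (-1) (dom_gc n)) => z h _; rewrite mulN1r.
Qed.

Lemma dom_y n : dom n 0 (fun z _ => z.2).
Proof.
have bd z0 : H2 z0 -> exists C : R, forall (z : R * R) h, close z0 z -> `|z.2| <= C * Nz z0 h ^ 0.
  move=> H0; exists (2 * z0.2) => z h Hc; rewrite expr0z mulr1.
  have Hz := close_H2 H0 Hc; case: Hc => _; rewrite ler_norml => /andP[_ H].
  have y0 : 0 < z0.2 := H0; have y1 : 0 < z.2 := Hz.
  by rewrite gtr0_norm //; lra.
case: n => [|n]; split => //; split; first by move=> b z h _; have [] := is_derive_y b z.
move=> b; apply: (@dom_congr _ _ (fun _ _ => if b then 0 else 1)); last exact: dom_cst.
by move=> z h _; rewrite /dd; have [_ ->] := is_derive_y b z.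
Qed.

Lemma dom_PA n : dom n 1 PA.
Proof.
have bd z0 : H2 z0 -> exists C : R, forall z h, close z0 z -> `|PA z h| <= C * Nz z0 h ^ 1.
  move=> H0; exists 2 => z h Hc; rewrite expr1z.
  have [_ ] := close_Nz h H0 Hc; apply: le_trans.
  by have [] := Nz_coord h (close_H2 H0 Hc).
case: n => [|n]; split => //; try by move=> *; exact: measurable_PA.
split; first by move=> b z h _; have [] := is_derive_PA b z h.
move=> b; apply: (@dom_congr _ _ (fun _ h => dA b h)); last exact: dom_dA.
by move=> z h _; rewrite /dd; have [_ ->] := is_derive_PA b z h.
Qed.

Lemma dom_PB n : dom n 1 PB.
Proof.
have bd z0 : H2 z0 -> exists C : R, forall z h, close z0 z -> `|PB z h| <= C * Nz z0 h ^ 1.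
  move=> H0; exists 2 => z h Hc; rewrite expr1z.
  have [_ ] := close_Nz h H0 Hc; apply: le_trans.
  by have [] := Nz_coord h (close_H2 H0 Hc).
case: n => [|n]; split => //; try by move=> *; exact: measurable_PB.
split; first by move=> b z h _; have [] := is_derive_PB b z h.
move=> b; apply: (@dom_congr _ _ (fun _ h => dB b h)); last exact: dom_dB.
by move=> z h _; rewrite /dd; have [_ ->] := is_derive_PB b z h.
Qed.

Lemma dom_dP n b : dom n 2 (dP b).
Proof.
apply: domZ; apply: domD.
  by apply: (@domM n 1 1); [exact: dom_PA|exact: dom_dA].
by apply: (@domM n 1 1); [exact: dom_PB|exact: dom_dB].
Qed.

Lemma dom_Pinv n : dom n (- 2%:Z) (fun z h => (Pz z h)^-1).
Proof.
have bd z0 : H2 z0 -> exists C : R, forall z h, close z0 z -> `|(Pz z h)^-1| <= C * Nz z0 h ^ (- 2%:Z).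
  move=> H0; exists 4 => z h Hc; have Hz := close_H2 H0 Hc.
  rewrite ger0_norm ?invr_ge0 ?(ltW (Pz_gt0 _ _)) // -exprnN Nz_sqr //.
  have /andP[H _] := close_Pz h H0 Hc.
  rewrite (_ : 4 * (Pz z0 h)^-1 = (Pz z0 h / 4)^-1); last by rewrite invfM invrK mulrC.
  by rewrite lef_pV2 ?posrE ?divr_gt0 ?Pz_gt0.
have ms z : H2 z -> measurable_fun setT (fun h => (Pz z h)^-1).
  move=> Hz.
  rewrite (_ : (fun h => _) = (fun x => powR x (-1)) \o Pz z); last first.
    by apply/funext => h /=; rewrite powRN powRr1 // ltW // Pz_gt0.
  by apply: measurableT_comp; [exact: measurable_powR|exact: measurable_Pz].
elim: n => [|n IH]; split => //; split; first by move=> b z h Hz; have [] := is_derive_Pinv b h Hz.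
move=> b; apply: (@dom_congr _ _ (fun z h => -1 * (dP b z h * ((Pz z h)^-1 * (Pz z h)^-1)))).
  by move=> z h Hz; rewrite /dd; have [_ ->] := is_derive_Pinv b h Hz; rewrite mulN1r.
by apply: domZ; apply: (@domM n 2 (- 2%:Z + - 2%:Z)); [exact: dom_dP|exact: domM].
Qed.

Definition Xz z h := 4 * z.2 * (Pz z h)^-1.

Lemma dom_Xz n S : dom n (- (2 * S)%:Z) (fun z h => Xz z h ^+ S).
Proof.
have D1 : dom n (- 2%:Z) Xz.
  rewrite -[- 2%:Z]add0r; apply: domM (dom_Pinv n); apply: domZ; exact: dom_y.
elim: S => [|S IH]; first by apply: dom_congr (dom_cst n 1) => z h _; rewrite expr0.
rewrite mulnS PoszD opprD; apply: dom_congr (domM D1 IH) => z h _.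
by rewrite exprS.
Qed.

Lemma is_derive_Xz b z h : H2 z ->
  is_derive z (dvec b) (Xz ^~ h) (Xz z h * ((if b then 0 else 1) / z.2 - dP b z h / Pz z h)).
Proof.
move=> Hz; have y0 : z.2 != 0 by rewrite gt_eqF.
have P0 : Pz z h != 0 by rewrite gt_eqF ?Pz_gt0.
have D1 := is_derive_y b z; have D2 := is_derive_Pinv b h Hz.
rewrite (_ : Xz ^~ h = (cst 4 * (fun z => z.2)) * (fun z => (Pz z h)^-1)) //.
apply: is_derive_eq; rewrite /GRing.scale /= /Xz.
rewrite [(cst 4 * _) z]/=; move: (dP b z h) (if b then 0 else 1 : R) => dp i.
transitivity (4 * z.2 * - (dp * ((Pz z h)^-1 / Pz z h)) + (Pz z h)^-1 * (4 * i + z.2 * 0)); first by [].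
by field; rewrite ?P0 ?y0.
Qed.

Definition logd S b h z := S%:R * ((if b then 0 else 1) / z.2 - dP b z h / Pz z h).

Lemma is_derive_XzX S b z h : H2 z ->
  is_derive z (dvec b) (fun z => Xz z h ^+ S) (Xz z h ^+ S * logd S b h z).
Proof.
move=> Hz; have D := is_derive_Xz b h Hz.
rewrite (_ : (fun z => _) = (Xz ^~ h) ^+ S); last first.
  by apply/funext => w; elim: S => [|S IH]; rewrite ?expr0 // !exprS IH.
apply: is_derive_eq; rewrite /GRing.scale /= /logd.
by case: S => [|S]; [rewrite !mul0r mulr0|rewrite exprSr /=; ring].
Qed.

Definition gq h := gc h ^+ 2 + gd h ^+ 2.

Lemma is_derive_dP b z h : is_derive z (dvec b) (fun z => dP b z h) (2 * gq h).
Proof.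
apply: is_derive_quot => e; rewrite /dP /PA /PB /dA /dB /gq; case: b; rewrite /= /GRing.scale /=; ring.
Qed.

Lemma is_derive_logd S b z h : H2 z -> is_derive z (dvec b) (logd S b h)
  (S%:R * (- (if b then 0 else 1) / z.2 ^+ 2 - (2 * gq h / Pz z h - (dP b z h / Pz z h) ^+ 2))).
Proof.
move=> Hz; have y0 : z.2 != 0 by rewrite gt_eqF.
have P0 : Pz z h != 0 by rewrite gt_eqF ?Pz_gt0.
have D1 := is_derive_dP b z h; have D2 := is_derive_Pinv b h Hz; have D3 := is_derive_y b z.
have [Dy1 Dy2] := D3.
have D4 : is_derive z (dvec b) (fun z => z.2^-1) (- (if b then 0 else 1) / z.2 ^+ 2).
  apply: DeriveDef; first exact: derivableV.
  by rewrite deriveV // Dy2 /GRing.scale /= mulrC mulrN mulNr.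
rewrite (_ : logd S b h = S%:R \*: ((if b then 0 else 1) \*: (fun z => z.2^-1) - (fun z => dP b z h) * (fun z => (Pz z h)^-1))) //.
apply: is_derive_eq; rewrite /GRing.scale /=; congr (_ * _).
by move: (dP b z h) (Pz z h) P0 (gq h) => dp p p0 q; case: b {D1 D2 D3 D4 Dy1 Dy2}; field; rewrite ?p0 ?y0.
Qed.

(** [X^S] is a function of the distance between [z] and [h i]. The second derivatives go through
    logarithmic derivatives and simplify by [|grad P|^2 = 4 P (c^2 + d^2)] and the value of the
    derivative of [P] in [y]. *)
Lemma laplace_Xz S z h : H2 z ->
  z.2 ^+ 2 * (dd true (dd true (fun z => Xz z h ^+ S)) z + dd false (dd false (fun z => Xz z h ^+ S)) z)
  = S%:R * (S%:R - 1) * Xz z h ^+ S - S%:R ^+ 2 * Xz z h ^+ S.+1.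
Proof.
move=> Hz; have y0 : z.2 != 0 by rewrite gt_eqF.
have P0 : Pz z h != 0 by rewrite gt_eqF ?Pz_gt0.
have D2 b : dd b (dd b (fun z => Xz z h ^+ S)) z = Xz z h ^+ S * (logd S b h z ^+ 2 +
    S%:R * (- (if b then 0 else 1) / z.2 ^+ 2 - (2 * gq h / Pz z h - (dP b z h / Pz z h) ^+ 2))).
  transitivity (dd b (fun z => Xz z h ^+ S * logd S b h z) z).
    apply: near_eq_derive; apply: eq_H2_near Hz => w Hw.
    exact: is_derive_dd (is_derive_XzX S b h Hw).
  have [E1 E2] := is_derive_XzX S b h Hz; have [L1 L2] := is_derive_logd S b h Hz.
  rewrite /dd (deriveM E1 L1) E2 L2 /GRing.scale /=; move: (logd S b h z) => l; ring.
rewrite !D2 [Xz z h ^+ S.+1]exprS.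
have E1 : dP true z h ^+ 2 + dP false z h ^+ 2 = 4 * Pz z h * gq h by rewrite /dP /Pz /gq /dA /dB; ring.
have E2 : dP false z h = 2 * (z.2 * gq h + 1).
  rewrite -[X in _ + X](gdet h) /dP /PA /PB /gq /dA /dB; ring.
have -> : Xz z h * Xz z h ^+ S = (4 * z.2 / Pz z h) * Xz z h ^+ S by [].
transitivity (Xz z h ^+ S * (z.2 ^+ 2 * (S%:R ^+ 2 * (dP true z h ^+ 2 + dP false z h ^+ 2) / Pz z h ^+ 2
   + S%:R ^+ 2 * (z.2^-1 ^+ 2 - 2 * z.2^-1 * dP false z h / Pz z h)
   + S%:R * (- 1 / z.2 ^+ 2 - 4 * gq h / Pz z h + (dP true z h ^+ 2 + dP false z h ^+ 2) / Pz z h ^+ 2)))).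
  rewrite /logd; move: (dP true z h) (dP false z h) (gq h) (Pz z h) P0 (Xz z h ^+ S) => d1 d2 q p p0 X.
  by field; rewrite ?p0 ?y0.
rewrite E1 E2; move: (gq h) (Pz z h) P0 (Xz z h ^+ S) => q p p0 X.
by field; rewrite ?p0 ?y0.
Qed.

Lemma Cn_congr n f g : (forall z, H2 z -> f z = g z) -> Cn_on_H2 n f -> Cn_on_H2 n g.
Proof.
have C (f0 g0 : R * R -> R) : (forall z, H2 z -> f0 z = g0 z) -> (forall z, H2 z -> {for z, continuous f0}) ->
    forall z, H2 z -> {for z, continuous g0}.
  move=> E cf z Hz; rewrite /prop_for /continuous_at -(E z Hz); apply: cvg_trans (cf z Hz).
  apply: near_eq_cvg; have := eq_H2_near E Hz; apply: filterS => w ->; by [].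
elim: n f g => [|n IH] f g fg /= [cf df]; split; try exact: C fg cf; first by [].
have [d1 d2 c1 c2] := df; split.
- by move=> z Hz; apply: near_eq_derivable (d1 z Hz); exact: (eq_H2_near fg Hz).
- by move=> z Hz; apply: near_eq_derivable (d2 z Hz); exact: (eq_H2_near fg Hz).
- by apply: IH c1 => z Hz; apply: near_eq_derive; exact: (eq_H2_near fg Hz).
- by apply: IH c2 => z Hz; apply: near_eq_derive; exact: (eq_H2_near fg Hz).
Qed.

(** * Differentiation under the integral sign on the half-plane *)

Section DomIntegral.
Variable (mu : {measure set G -> \bar R}) (f : G -> R) (w : int).
Hypotheses (Hf : mbounded f) (Hw : forall z, H2 z -> weight mu (fun h => Nz z h ^ w)).

Definition Fint (k : R * R -> G -> R) z : R := \int[mu]_h (k z h * f h).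

Lemma dom_bound n k z0 : dom n w k -> H2 z0 -> exists2 C : R, 0 <= C & forall z h, close z0 z -> `|k z h * f h| <= C * Nz z0 h ^ w.
Proof.
move=> Dk Hz0; have [C HC] : exists C : R, forall z h, close z0 z -> `|k z h| <= C * Nz z0 h ^ w.
  by case: n Dk => [|n] [_ + _]; apply.
have [_ [M HM]] := Hf; exists (`|C| * `|M|) => [|z h Hc]; first by rewrite mulr_ge0.
have N0 : 0 <= Nz z0 h ^ w by rewrite exprz_ge0 // sqrtr_ge0.
rewrite normrM mulrAC; apply: ler_pM => //; last by rewrite (le_trans (HM h)) // ler_norm.
by rewrite (le_trans (HC z h Hc)) // ler_wpM2r ?ler_norm.
Qed.

Lemma dom_measurable n k z : dom n w k -> H2 z -> measurable_fun setT (fun h => k z h * f h).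
Proof.
move=> Dk Hz; have [mf _] := Hf; apply: measurable_funM => //.
by case: n Dk => [|n] [km _ _]; exact: km.
Qed.

Lemma dom_weight_integrable z C : H2 z -> mu.-integrable setT (EFin \o (fun h => C * Nz z h ^ w)).
Proof.
move=> Hz; have := weight_integrable (Hw Hz) (mbounded_cst G C).
by congr (integrable _ _ _); apply/funext => h; rewrite /= mulrC.
Qed.

Lemma dom_integrable n k z : dom n w k -> H2 z -> mu.-integrable setT (EFin \o (fun h => k z h * f h)).
Proof.
move=> Dk Hz; have [C C0 HC] := dom_bound Dk Hz.
apply: le_integrable (dom_weight_integrable C Hz) => //.
  by apply/measurable_EFinP; exact: dom_measurable Dk Hz.
move=> h _; rewrite /= lee_fin (le_trans (HC z h (close_refl Hz))) //.
exact: ler_norm.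
Qed.

Lemma Fint_bound n k z0 : dom n w k -> H2 z0 -> exists2 C : R, 0 <= C & forall z, close z0 z -> `|Fint k z| <= C.
Proof.
move=> Dk Hz; have [C C0 HC] := dom_bound Dk Hz.
exists (\int[mu]_h (C * Nz z0 h ^ w)) => [|z Hc].
  by apply: Rintegral_ge0 => h _; rewrite mulr_ge0 // exprz_ge0 // sqrtr_ge0.
have Hz' := close_H2 Hz Hc.
apply: (le_trans (le_normr_Rintegral measurableT (dom_integrable Dk Hz'))).
apply: le_Rintegral => //; last by move=> h _; exact: HC.
- have := integrable_abse (dom_integrable Dk Hz').
  by congr (integrable _ _ _); apply/funext => h.
- exact: dom_weight_integrable.
Qed.

Lemma close_line b z t : H2 z -> `|t| <= z.2 / 4 -> close z (t *: dvec b + z).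
Proof.
move=> Hz tz; have y0 : 0 <= z.2 / 4 by rewrite divr_ge0 // ltW.
by case: b; split; rewrite /= /GRing.scale /= ?mulr1 ?mulr0 ?add0r ?addrK // subrr normr0.
Qed.

(** The partial derivative is an ordinary derivative along [t |-> t v + z]; the bound contained in
    [dom] is the dominating function for [|t| < y/4]. *)
Lemma Fint_derive b k z : dom 1 w k -> H2 z -> is_derive z (dvec b) (Fint k) (Fint (fun z h => dd b (k ^~ h) z) z).
Proof.
move=> Dk Hz; have e0 : 0 < z.2 / 4 by rewrite divr_gt0.
pose e := z.2 / 4; pose v := dvec b.
pose phi (t : R) (h : G) := k (t *: v + z) h * f h.
have [C C0 HC] := dom_bound (dom_dd b Dk) Hz.
have tc (t : R) : `]- e, e[%classic t -> close z (t *: v + z).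
  by rewrite /= in_itv /= => /andP[t1 t2]; apply: close_line => //; rewrite ler_norml !ltW.
have tH (t : R) : `]- e, e[%classic t -> H2 (t *: v + z) by move=> /tc; exact: close_H2.
have I0 : `]- e, e[%classic (0 : R) by rewrite /= in_itv /= oppr_lt0 e0.
have H1 (t : R) : `]- e, e[%classic t -> mu.-integrable setT (EFin \o phi t).
  by move=> /tH; exact: dom_integrable Dk.
have dk (t : R) h : `]- e, e[%classic t -> is_derive t 1 (fun s : R => k (s *: v + z) h) (dd b (k ^~ h) (t *: v + z)).
  move=> /tH Ht; apply: DeriveDef.
    exact: (proj1 (derivable_line (k ^~ h) z v t) (@dom_derivable 0 w k b _ h Dk Ht)).
  exact: esym (derive_line (k ^~ h) z v t).
have dphi (t : R) h : `]- e, e[%classic t -> is_derive t 1 (phi ^~ h) (dd b (k ^~ h) (t *: v + z) * f h).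
  move=> /(dk _ h) D; have -> : phi ^~ h = (fun s => k (s *: v + z) h) * cst (f h) by [].
  by apply: is_derive_eq; rewrite /GRing.scale /= mulr0 add0r mulrC.
have H2' (t : R) h : `]- e, e[%classic t -> setT h -> derivable (phi ^~ h) t 1.
  by move=> /dphi H _; have [] := H h.
have H3 h : 0 <= C * Nz z h ^ w by rewrite mulr_ge0 // exprz_ge0 // sqrtr_ge0.
have H4 (t : R) h : `]- e, e[%classic t -> setT h -> `|partial1of2 phi t h| <= C * Nz z h ^ w.
  move=> Ht _; rewrite partial1of2E; have [_ ->] := dphi t h Ht.
  by apply: HC; exact: tc.
have Dd := derivable_under_integral measurableT I0 H1 H2' H3 (dom_weight_integrable C Hz) H4.
have Dv := differentiation_under_integral measurableT I0 H1 H2' H3 (dom_weight_integrable C Hz) H4.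
have zE : z = 0 *: v + z by rewrite scale0r add0r.
apply: DeriveDef.
  by rewrite zE; exact: (proj2 (derivable_line (Fint k) z v 0) Dd).
rewrite [in LHS]zE (derive_line (Fint k) z v 0) -derive1E Dv; apply: eq_Rintegral => h _; rewrite partial1of2E.
by have [_ ->] := dphi 0 h I0; rewrite -zE.
Qed.

Lemma Fint_line b k z z' (s C : R) : dom 1 w k -> H2 z -> 0 <= C -> 0 <= s ->
  (forall t : R, 0 <= t <= s -> close z (t *: dvec b + z')) ->
  (forall z1, close z z1 -> `|Fint (fun z h => dd b (k ^~ h) z) z1| <= C) ->
  `|Fint k (s *: dvec b + z') - Fint k z'| <= C * s.
Proof.
move=> Dk Hz C0 s0 cl HC; pose phi (t : R) := Fint k (t *: dvec b + z').
pose dphi (t : R) := Fint (fun z h => dd b (k ^~ h) z) (t *: dvec b + z').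
have D (t : R) : 0 <= t <= s -> is_derive t 1 phi (dphi t).
  move=> /cl/(close_H2 Hz) Ht; have [E1 E2] := Fint_derive b Dk Ht.
  apply: DeriveDef; first exact: (proj1 (derivable_line (Fint k) z' (dvec b) t) E1).
  exact: etrans (esym (derive_line (Fint k) z' (dvec b) t)) E2.
have [||c] := @MVT_segment R phi dphi 0 s s0.
- by move=> x; rewrite in_itv /= => /andP[x1 x2]; apply: D; rewrite !ltW.
- apply: derivable_within_continuous => x; rewrite in_itv /= => Hx.
  by have [] := D x Hx.
rewrite in_itv /= /phi scale0r add0r subr0 => Hc ->.
by rewrite normrM (ger0_norm s0) ler_wpM2r // HC //; exact: cl.
Qed.

(** Bounded partial derivatives give continuity: the mean value theorem is applied along a
    horizontal and a vertical segment, through the corner between [z] and the nearby point. *)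
Lemma Fint_continuous k z : dom 1 w k -> H2 z -> {for z, continuous (Fint k)}.
Proof.
move=> Dk Hz.
have [C1 C10 HC1] := Fint_bound (dom_dd true Dk) Hz; have [C2 C20 HC2] := Fint_bound (dom_dd false Dk) Hz.
have y0 : 0 < z.2 := Hz.
have line b C z' z'' : 0 <= C -> (forall z1, close z z1 -> `|Fint (fun z h => dd b (k ^~ h) z) z1| <= C) ->
   close z z' -> close z z'' -> (if b then z'.2 = z''.2 else z'.1 = z''.1) ->
   `|Fint k z' - Fint k z''| <= C * `|if b then z'.1 - z''.1 else z'.2 - z''.2|.
  move=> C0 HC; wlog le : z' z'' / (if b then z''.1 <= z'.1 else z''.2 <= z'.2).
    move=> H c1 c2 e; have tot := le_total (if b then z''.1 else z''.2) (if b then z'.1 else z'.2).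
    have [le|le] := orP tot; first by apply: H => //; case: (b) le.
    rewrite distrC (_ : `|if b then _ else _| = `|if b then z''.1 - z'.1 else z''.2 - z'.2|); last by case: (b); rewrite distrC.
    by apply: H => //; [case: (b) le|case: (b) e].
  move=> [a1 a2] [b1 b2] e; pose s := if b then z'.1 - z''.1 else z'.2 - z''.2.
  have s0 : 0 <= s by rewrite /s; case: (b) le; rewrite subr_ge0.
  rewrite -/s (ger0_norm s0).
  have -> : z' = s *: dvec b + z''.
    rewrite /s /dvec; move: e; clear; case: z' => x' y'; case: z'' => x'' y''.
    case: b => /= ->; apply/eqP; by rewrite xpair_eqE /= /GRing.scale /= mulr1 mulr0 add0r subrK !eqxx.
  apply: (@Fint_line b k z z'' s C Dk Hz C0 s0 _ HC) => t /andP[t0 ts].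
  move: a1 a2 b1 b2 t0 ts; rewrite /close /s /dvec; clear; rewrite !ler_norml.
  move=> /andP[? ?] /andP[? ?] /andP[? ?] /andP[? ?] ?.
  by case: b => ts; split; rewrite /= /GRing.scale /= ?mulr1 ?mulr0 ?add0r; apply/andP; split; lra.
apply/cvgrPdist_le => e e0.
suff : nbhs z [set t | `|Fint k z - Fint k t| <= e] by [].
apply/nbhs_ballP; pose d := Num.min (z.2 / 4) (e / (C1 + C2 + 1)).
have d0 : 0 < d by rewrite lt_min !divr_gt0 // ltr_wpDl ?addr_ge0.
exists d => //= z' [/= b1 b2].
have h1 : `|z'.1 - z.1| < d by rewrite distrC.
have h2 : `|z'.2 - z.2| < d by rewrite distrC.
have cz' : close z z' by split; apply: ltW; [move: h1|move: h2]; rewrite lt_min => /andP[].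
have cz'' : close z (z.1, z'.2) by case: cz' => c1 c2; split; rewrite //= subrr normr0 divr_ge0 // ltW.
have L1 := line true C1 z' (z.1, z'.2) C10 HC1 cz' cz'' erefl.
have L2 := line false C2 (z.1, z'.2) z C20 HC2 cz'' (close_refl Hz) erefl.
rewrite /= in L1 L2; rewrite distrC -(subrKA (Fint k (z.1, z'.2))).
apply: (le_trans (ler_normD _ _)).
have de : d * (C1 + C2 + 1) <= e by rewrite -ler_pdivlMr ?ge_min ?lexx ?orbT // ltr_wpDl ?addr_ge0.
have := ler_wpM2l C10 (ltW h1); have := ler_wpM2l C20 (ltW h2); lra.
Qed.

Lemma Fint_Cn n k : dom n.+1 w k -> Cn_on_H2 n (Fint k).
Proof.
elim: n k => [|n IH] k Dk; first by split => // z Hz; exact: Fint_continuous.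
have D1 := dom_le1 Dk.
split; first by move=> z Hz; exact: Fint_continuous.
split.
- by move=> z Hz; have [] := Fint_derive true D1 Hz.
- by move=> z Hz; have [] := Fint_derive false D1 Hz.
- apply: Cn_congr (IH _ (dom_dd true Dk)) => z Hz.
  by rewrite -(is_derive_dd (Fint_derive true D1 Hz)).
- apply: Cn_congr (IH _ (dom_dd false Dk)) => z Hz.
  by rewrite -(is_derive_dd (Fint_derive false D1 Hz)).
Qed.

Lemma Fint_derive2 b k z : dom 2 w k -> H2 z ->
  dd b (dd b (Fint k)) z = Fint (fun z h => dd b (dd b (k ^~ h)) z) z.
Proof.
move=> Dk Hz; transitivity (dd b (Fint (fun z h => dd b (k ^~ h) z)) z).
  apply: near_eq_derive; apply: eq_H2_near Hz => z' Hz'.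
  exact: is_derive_dd (Fint_derive b (domW Dk) Hz').
exact: is_derive_dd (Fint_derive b (dom_dd b Dk) Hz).
Qed.

End DomIntegral.

End HalfPlane.

(** * The averaging operators and the Laplacian *)

Section Kernel.
Variables (R : realType) (mu : {sigma_finite_measure set (borelSL2 R) -> \bar R}).
Hypothesis Hmu : haar_measure mu.
Local Notation G := (borelSL2 R).
Local Notation H2 := (@upper_half_plane R).
Implicit Types (g h : G) (z : R * R).

Definition Xg g : R := 4 / (2 + HS2 g).

Lemma HS2_2_gt0 g : 0 < 2 + HS2 g.
Proof. by have := HS2_gt0 g; lra. Qed.

Lemma Xg_gt0 g : 0 < Xg g.
Proof. by rewrite divr_gt0 // HS2_2_gt0. Qed.

Lemma Xg_le1 g : Xg g <= 1.
Proof. by rewrite ler_pdivrMr ?HS2_2_gt0 // mul1r; have := HS2_ge2 g; lra. Qed.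

Lemma XgV g : Xg (g^-1)%g = Xg g.
Proof. by rewrite /Xg HS2V. Qed.

Lemma measurable_Xg : measurable_fun setT Xg.
Proof.
rewrite (_ : Xg = fun g => 4 * (powR (2 + HS2 g) (-1))); last first.
  by apply/funext => g; rewrite powRN powRr1 // ltW // HS2_2_gt0.
apply: measurable_funM => //.
apply: (measurableT_comp (@measurable_powR R (-1))).
by apply: measurable_funD => //; exact: measurable_HS2.
Qed.

Let B (n : nat) : set G := [set g | HS2 g <= (2 ^+ n) ^+ 2].

(** The smallest dyadic ball containing [g] already accounts for [X^5], since [X g] is at most
    [16 / 4^n] for its index [n]. *)
Lemma Xg5_dyadic g : ((Xg g ^+ 5)%:E <= \sum_(n <oo) (4 ^+ 10 / 4 ^+ (5 * n) * \1_(B n) g)%:E)%E.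
Proof.
have t0 n : (0 <= (4 ^+ 10 / 4 ^+ (5 * n) * \1_(B n) g)%:E :> \bar R)%E.
  by rewrite lee_fin mulr_ge0 // ?divr_ge0 ?exprn_ge0 // indicE.
have [n [gn gn']] : exists n : nat, HS2 g <= (2 ^+ n) ^+ 2 /\ 4 ^+ n < 4 * HS2 g.
  have ex : exists n : nat, HS2 g <= (2 ^+ n) ^+ 2.
    exists (Num.bound (HS2 g)).
    have H := archi_boundP (ltW (HS2_gt0 g)); apply: (le_trans (ltW H)).
    rewrite -exprM mulnC exprM -natrX -natrX ler_nat.
    by rewrite ltnW // (leq_trans (ltn_expl _ (isT : 1 < 4)%N)).
  case: (ex_minnP ex) => n Hn Hmin; exists n; split => //.
  case: n Hn Hmin => [|n] Hn Hmin; first by rewrite expr0; have := HS2_ge2 g; lra.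
  rewrite exprS ltr_pM2l // ltNge; apply/negP => H.
  have := Hmin n; rewrite -exprM mulnC exprM (_ : 2 ^+ 2 = 4); last by ring.
  by rewrite H => /(_ isT); rewrite ltnn.
apply: (@le_trans _ _ (4 ^+ 10 / 4 ^+ (5 * n) * \1_(B n) g)%:E).
  rewrite indicE mem_set // mulr1 lee_fin.
  have -> : 4 ^+ 10 / 4 ^+ (5 * n) = (16 / 4 ^+ n) ^+ 5 :> R.
    rewrite expr_div_n -exprM mulnC (_ : 16 = 4 ^+ 2 :> R) ?exprM //; last by ring.
    by rewrite -!exprM.
  rewrite lerXn2r ?nnegrE ?(ltW (Xg_gt0 _)) ?divr_ge0 ?exprn_ge0 //.
  rewrite /Xg ler_pdivrMr ?HS2_2_gt0 // mulrAC ler_pdivlMr ?exprn_gt0 //.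
  by have := HS2_gt0 g; lra.
rewrite [leRHS](nneseries_split _ n.+1) // add0n.
apply: le_trans (leeDl _ _); last by apply: nneseries_ge0 => k _ _; exact: t0.
by rewrite big_mkord big_ord_recr /= leeDr // sume_ge0.
Qed.

(** The ball of index [n] has volume at most [C 4^(4n)] and carries the weight [4^(-5n)] up to a
    constant, so the series is dominated by a geometric one. The crude growth exponent 8 is the
    reason for the condition [5 <= S]. *)
Lemma weight_Xg S : (5 <= S)%N -> weight mu (fun g => Xg g ^+ S).
Proof.
move=> S5; split; first by move=> g; rewrite exprn_ge0 // ltW // Xg_gt0.
have mX n : measurable_fun setT (fun g => Xg g ^+ n) by apply: measurable_funX; exact: measurable_Xg.
apply: (@le_integrable _ _ _ mu setT measurableT _ (EFin \o (fun g => Xg g ^+ 5))).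
- exact/measurable_EFinP.
- move=> g _; rewrite /= lee_fin !normrX gtr0_norm ?Xg_gt0 //.
  by rewrite -(subnKC S5) exprD ler_piMr ?exprn_ge0 ?exprn_ile1 ?Xg_le1 // ltW ?Xg_gt0.
have [C C0 HC] := haar_ball_growth Hmu.
apply/integrableP; split; first exact/measurable_EFinP.
have mB n : measurable (B n) by exact: measurable_HS2_ball.
have mt n : measurable_fun setT (fun g => (4 ^+ 10 / 4 ^+ (5 * n) * \1_(B n) g)%:E).
  by apply/measurable_EFinP; apply: measurable_funM => //; exact: measurable_indic.
have t0 n g : (0 <= (4 ^+ 10 / 4 ^+ (5 * n) * \1_(B n) g)%:E :> \bar R)%E.
  by rewrite lee_fin mulr_ge0 // ?divr_ge0 ?exprn_ge0 // indicE.
apply: (@le_lt_trans _ _ (\int[mu]_g \sum_(n <oo) (4 ^+ 10 / 4 ^+ (5 * n) * \1_(B n) g)%:E)%E).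
  apply: ge0_le_integral => //.
  - by apply: measurableT_comp => //; exact/measurable_EFinP.
  - by apply: ge0_emeasurable_sum => // n g _ _; exact: t0.
  - move=> g _; rewrite /= ger0_norm ?exprn_ge0 ?(ltW (Xg_gt0 _)) //; exact: Xg5_dyadic.
rewrite integral_nneseries //.
(* The bound is put in the form [M / 2^(n+1)], whose sum over [n] is at most [M]. *)
apply: (@le_lt_trans _ _ (\sum_(n <oo) (2 * (4 ^+ 10 * C) / (2 ^ n.+1)%:R)%:E)%E); last first.
  apply: le_lt_trans (ltry (2 * (4 ^+ 10 * C))); apply: epsilon_trick0.
  by rewrite !mulr_ge0 ?exprn_ge0 // ltW.
apply: lee_nneseries => [n _ _|n _]; first by apply: integral_ge0 => g _; exact: t0.
under eq_integral do rewrite EFinM.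
rewrite ge0_integralZl //; last by apply/measurable_EFinP; exact: measurable_indic.
rewrite integral_indic // setIT.
have n1 : 1 <= 2 ^+ n :> R by rewrite exprn_ege1 // ler1n.
apply: (@le_trans _ _ ((4 ^+ 10 / 4 ^+ (5 * n))%:E * (C * (2 ^+ n) ^+ 8)%:E)%E).
  by apply: lee_wpmul2l; [rewrite lee_fin divr_ge0 ?exprn_ge0|exact: HC].
rewrite -EFinM lee_fin.
have E4 : (2 ^+ n) ^+ 8 = 4 ^+ (4 * n) :> R.
  by rewrite -exprM (_ : 4 = 2 ^+ 2 :> R) -?exprM; [congr (_ ^+ _); lia|ring].
have En : 4 ^+ (5 * n) = 4 ^+ (4 * n) * 4 ^+ n :> R by rewrite -exprD; congr (_ ^+ _); lia.
have p4 : 0 < 4 ^+ (4 * n) :> R by rewrite exprn_gt0.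
have p1 : 0 < 4 ^+ n :> R by rewrite exprn_gt0.
have q4 : 2 ^+ n <= 4 ^+ n :> R by rewrite lerXn2r ?nnegrE //; lra.
rewrite E4 En natrX [2 ^+ n.+1]exprS (_ : _ / _ * _ = 4 ^+ 10 * C / 4 ^+ n); last by field; rewrite ?gt_eqF.
rewrite (_ : 2 * _ / _ = 4 ^+ 10 * C / 2 ^+ n); last by field; rewrite gt_eqF // exprn_gt0.
by rewrite ler_wpM2l ?mulr_ge0 ?exprn_ge0 ?(ltW C0) // lef_pV2 // posrE exprn_gt0.
Qed.

Definition mS S : R := \int[mu]_g Xg g ^+ S.

Lemma mSE S : mS S = wint mu (fun g => Xg g ^+ S) (fun=> 1).
Proof. by apply: eq_Rintegral => g _; rewrite mulr1. Qed.

Lemma mS_gt0 S : (5 <= S)%N -> 0 < mS S.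
Proof.
move=> S5; have HX := weight_Xg S5.
have fN : mu (near1 1) \is a fin_num by rewrite ge0_fin_numE ?near1_fin ?measure_ge0.
have p1 : 0 < fine (mu (near1 1)) by rewrite fine_gt0 // near1_gt0 // near1_fin.
apply: (@lt_le_trans _ _ (12^-1 ^+ S * fine (mu (near1 1)))); first by rewrite mulr_gt0 ?exprn_gt0.
rewrite -lee_fin mSE (wint_EFin HX) ?EFinM ?fineK //; last exact: mbounded_cst.
rewrite -[X in (_ * mu X)%E]setIT -integral_indic //; last exact: measurable_near1.
rewrite -ge0_integralZl //; last first.
  by apply/measurable_EFinP; apply: measurable_indic; exact: measurable_near1.
apply: ge0_le_integral => //.
- by apply/measurable_EFinP; apply: measurable_funM => //; apply: measurable_indic; exact: measurable_near1.
- by apply/measurable_EFinP; apply: measurable_funM => //; exact: weight_measurable HX.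
move=> g _; rewrite -EFinM lee_fin mulr1 indicE; case: (boolP (_ \in _)) => [|_].
  rewrite inE mulr1 => /(near1_bounded (lexx 1)) /= g10.
  rewrite lerXn2r ?nnegrE ?(ltW (Xg_gt0 _)) // /Xg ler_pdivlMr ?HS2_2_gt0 //; lra.
by rewrite mulr0 exprn_ge0 // ltW // Xg_gt0.
Qed.

Definition kX S g : R := Xg g ^+ S / mS S.

Lemma weight_kX S : (5 <= S)%N -> weight mu (kX S).
Proof.
move=> S5; have [X0 iX] := weight_Xg S5; split.
  by move=> g; rewrite divr_ge0 // ltW // mS_gt0.
have := integrableZl measurableT (mS S)^-1 iX.
by congr (integrable _ _ _); apply/funext => g; rewrite /kX /= -EFinM mulrC.
Qed.

Lemma wint_kX S u : (5 <= S)%N -> mbounded u -> wint mu (kX S) u = (mS S)^-1 * wint mu (fun g => Xg g ^+ S) u.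
Proof.
move=> S5 Hu; rewrite /wint -RintegralZl //; last exact: (weight_integrable (weight_Xg S5) Hu).
by apply: eq_Rintegral => g _; rewrite /kX; ring.
Qed.

Lemma wint_kX1 S : (5 <= S)%N -> wint mu (kX S) (fun=> 1) = 1.
Proof.
by move=> S5; rewrite wint_kX // -?mSE ?mulVf ?gt_eqF ?mS_gt0 //; exact: mbounded_cst.
Qed.

Lemma kXV S g : kX S (g^-1)%g = kX S g.
Proof. by rewrite /kX XgV. Qed.

Definition T S (f : G -> R) := avg mu (kX S) f.

Lemma mbounded_T S f : (5 <= S)%N -> mbounded f -> mbounded (T S f).
Proof. by move=> S5; apply: mbounded_avg => //; exact: weight_kX. Qed.

Lemma TC S S' f g : (5 <= S)%N -> (5 <= S')%N -> mbounded f -> T S (T S' f) g = T S' (T S f) g.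
Proof.
move=> S5 S5'; have k1 := weight_kX S5; have k2 := weight_kX S5'.
exact: (avgC Hmu (p := fun t => (4 / (2 + t)) ^+ S / mS S) (q := fun t => (4 / (2 + t)) ^+ S' / mS S') k1 k2).
Qed.

Fact gz_subproof z : 0 < z.2 -> Num.sqrt z.2 * (Num.sqrt z.2)^-1 - z.1 / Num.sqrt z.2 * 0 = 1.
Proof. by move=> z0; rewrite mulr0 subr0 divff // gt_eqF // sqrtr_gt0. Qed.

(** The affine map with slope [y] and constant term [x], which takes [i] to [z = x + i y]. Outside
    the half-plane the value is a mere default. *)
Definition gz z : G := if pselect (0 < z.2) is left H then mkSL2 (gz_subproof H) else 1%g.

Lemma gzE z : H2 z -> [/\ ga (gz z) = Num.sqrt z.2, gb (gz z) = z.1 / Num.sqrt z.2,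
  gc (gz z) = 0 & gd (gz z) = (Num.sqrt z.2)^-1].
Proof. by rewrite /gz => z0; case: pselect => // H; rewrite !mkSL2E. Qed.

Lemma sqrt_sqr z : H2 z -> 0 < Num.sqrt z.2 /\ z.2 = Num.sqrt z.2 ^+ 2.
Proof. by move=> z0; rewrite sqrtr_gt0 sqr_sqrtr // ltW. Qed.

Lemma HS2_gz z h : H2 z -> 2 + HS2 ((gz z)^-1 * h)%g = Pz z h / z.2.
Proof.
move=> Hz; have [s0 E] := sqrt_sqr Hz; have [Ea Eb Ec Ed] := gzE Hz.
rewrite PzE /HS2 !gE Ea Eb Ec Ed.
move: E s0; set s := Num.sqrt z.2; move=> -> s0; field.
by rewrite gt_eqF.
Qed.

Lemma Xg_gz z h : H2 z -> Xg ((gz z)^-1 * h)%g = Xz z h.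
Proof.
move=> Hz; rewrite /Xg HS2_gz // /Xz; have y0 : 0 < z.2 := Hz.
by rewrite invfM invrK; ring.
Qed.

Lemma moebiusE g z : H2 z -> let D := (gc g * z.1 + gd g) ^+ 2 + (gc g * z.2) ^+ 2 in
  0 < D /\ moebius g z = (((ga g * z.1 + gb g) * (gc g * z.1 + gd g) + ga g * gc g * z.2 ^+ 2) / D, z.2 / D).
Proof.
move=> Hz D; have y0 : 0 < z.2 := Hz.
have D0 : 0 < D.
  have E := gdet g; rewrite /D; have [c0|c0] := eqVneq (gc g) 0.
    rewrite c0 !mul0r add0r expr0n addr0 exprn_even_gt0 //=.
    by apply/eqP => d0; move: E; rewrite c0 d0; lra.
  by rewrite ltr_wpDl ?sqr_ge0 // exprn_even_gt0 //= mulf_neq0 // gt_eqF.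
split => //; rewrite /moebius /= -/(ga g) -/(gb g) -/(gc g) -/(gd g) !mul0r !subr0 !addr0 ?add0r.
have -> : (gc g * z.1 + gd g) ^+ 2 + (gc g * z.2) ^+ 2 = D by [].
congr (_, _); first by field; rewrite gt_eqF.
rewrite -[z.2 in RHS]mulr1 -(gdet g); field; by rewrite gt_eqF.
Qed.

Lemma moebius_H2 g z : H2 z -> H2 (moebius g z).
Proof. by move=> Hz; have [D0 ->] := moebiusE g Hz; rewrite /upper_half_plane /= divr_gt0. Qed.

Definition zi : R * R := (0, 1).

Lemma H2i : H2 zi. Proof. by rewrite /upper_half_plane /=. Qed.

Lemma moebius_i g : moebius g zi = ((ga g * gc g + gb g * gd g) / (gc g ^+ 2 + gd g ^+ 2), (gc g ^+ 2 + gd g ^+ 2)^-1)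
  /\ 0 < gc g ^+ 2 + gd g ^+ 2.
Proof.
have [D0 ->] := moebiusE g H2i; rewrite /= in D0 *.
have E : (gc g * 0 + gd g) ^+ 2 + (gc g * 1) ^+ 2 = gc g ^+ 2 + gd g ^+ 2 by ring.
rewrite E in D0 *; split => //; congr (_, _); last by rewrite mul1r.
by congr (_ / _); ring.
Qed.

Lemma moebius_gz z : H2 z -> moebius (gz z) zi = z.
Proof.
move=> Hz; have [-> _] := moebius_i (gz z); have [s0 E] := sqrt_sqr Hz; have [-> -> -> ->] := gzE Hz.
case: z Hz E s0 => x y /= Hz; set s := Num.sqrt y => -> s0.
by congr (_, _); field; rewrite gt_eqF.
Qed.

Lemma HS2_rotation g : HS2 g = 2 -> rotation g.
Proof.
move=> E; have D := gdet g; have H : (ga g - gd g) ^+ 2 + (gb g + gc g) ^+ 2 = 0.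
  transitivity (HS2 g - 2 * (ga g * gd g - gb g * gc g)); first by rewrite /HS2; ring.
  by rewrite D E; ring.
have := sqr_ge0 (ga g - gd g); have := sqr_ge0 (gb g + gc g) => h1 h2.
have /eqP : (ga g - gd g) ^+ 2 = 0 by lra.
have /eqP : (gb g + gc g) ^+ 2 = 0 by lra.
by rewrite !sqrf_eq0 => /eqP h3 /eqP h4; split; lra.
Qed.

(** The decomposition into affine maps and rotations; rotations are recognised by [HS2 = 2]. *)
Lemma gz_rotation g : exists2 k, rotation k & g = (gz (moebius g zi) * k)%g.
Proof.
exists ((gz (moebius g zi))^-1 * g)%g; last by rewrite mulVKg.
have Hz := moebius_H2 g H2i; apply: HS2_rotation.
have := HS2_gz g Hz; set r := HS2 _ => E; have [Ez q0] := moebius_i g.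
suff : Pz (moebius g zi) g / (moebius g zi).2 = 4 by rewrite -E => ?; lra.
rewrite Ez /Pz /PA /PB /= invrK; move: q0 {E r Ez Hz}; set q := gc g ^+ 2 + gd g ^+ 2 => q0.
have A : gd g * ((ga g * gc g + gb g * gd g) / q) + gc g * q^-1 - gb g = 2 * gc g / q.
  transitivity ((gd g * (ga g * gc g + gb g * gd g) + gc g * (ga g * gd g - gb g * gc g) - gb g * q
     + gc g * (1 - (ga g * gd g - gb g * gc g))) / q); first by field; rewrite gt_eqF.
  rewrite gdet subrr mulr0 addr0 mulr1; congr (_ / _).
  by transitivity (gc g * (ga g * gd g - gb g * gc g) + gc g); [rewrite /q; ring|rewrite gdet; ring].
have B2 : gd g * q^-1 - gc g * ((ga g * gc g + gb g * gd g) / q) + ga g = 2 * gd g / q.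
  transitivity ((gd g * (ga g * gd g - gb g * gc g) - gc g * (ga g * gc g + gb g * gd g) + ga g * q
     + gd g * (1 - (ga g * gd g - gb g * gc g))) / q); first by field; rewrite gt_eqF.
  rewrite gdet subrr mulr0 addr0 mulr1; congr (_ / _).
  by transitivity (gd g * (ga g * gd g - gb g * gc g) + gd g); [rewrite /q; ring|rewrite gdet; ring].
rewrite A B2 (_ : _ * q = 4 * (gc g ^+ 2 + gd g ^+ 2) / q); last by field; rewrite gt_eqF.
by rewrite -/q mulfK // gt_eqF.
Qed.

Lemma moebius_mul_i g h : moebius (g * h)%g zi = moebius g (moebius h zi).
Proof.
have Hz := moebius_H2 h H2i.
have [E1 q1] := moebius_i (g * h)%g; have [E2 q2] := moebius_i h.
have [D E3] := moebiusE g Hz; rewrite E1 E3; move: D; rewrite E2 /=.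
set q := gc h ^+ 2 + gd h ^+ 2; have q0 : q != 0 by rewrite gt_eqF.
set x := (ga h * gc h + gb h * gd h) / q.
have Dh := gdet h.
have EQ : ((gc g * x + gd g) ^+ 2 + (gc g * q^-1) ^+ 2) = (gc (g * h)%g ^+ 2 + gd (g * h)%g ^+ 2) / q.
  transitivity (((gc g * (ga h * gc h + gb h * gd h) + gd g * q) ^+ 2 + (gc g * (ga h * gd h - gb h * gc h)) ^+ 2) / q ^+ 2).
    by rewrite Dh mulr1 /x; field.
  transitivity ((gc (g * h)%g ^+ 2 + gd (g * h)%g ^+ 2) * q / q ^+ 2); last by field.
  by rewrite !gE /q; congr (_ / _); ring.
rewrite EQ => _; congr (_, _); last by rewrite invfM invrK mulrCA mulVf // mulr1.
rewrite invfM invrK [(_^-1 * q)%R]mulrC mulrA; congr (_ / _).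
transitivity (((ga g * (ga h * gc h + gb h * gd h) + gb g * q) * (gc g * (ga h * gc h + gb h * gd h) + gd g * q)
   + ga g * gc g * (ga h * gd h - gb h * gc h) ^+ 2) / q); last by rewrite Dh /x; field.
by rewrite !gE -[LHS](mulfK q0); congr (_ / _); rewrite /q; ring.
Qed.

Lemma gz_moebius g z : H2 z -> exists2 k, rotation k & (g * gz z)%g = (gz (moebius g z) * k)%g.
Proof.
move=> Hz; have [k Hk E] := gz_rotation (g * gz z)%g.
by exists k => //; rewrite {1}E moebius_mul_i moebius_gz.
Qed.

Lemma rotation_invariant (F : G -> R) : (forall g k, rotation k -> F (g * k)%g = F g) ->
  forall g, F g = F (gz (moebius g zi)).
Proof. by move=> H g; have [k Hk {1}->] := gz_rotation g; exact: H. Qed.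

Definition TT S (f : G -> R) z := T S f (gz z).

Lemma Xz_Nz S z h : H2 z -> Nz z h ^ (- (2 * S)%:Z) = (4 * z.2) ^- S * Xg ((gz z)^-1 * h)%g ^+ S.
Proof.
move=> Hz; have y0 : 0 < z.2 := Hz; rewrite Xg_gz // -exprnN exprM Nz_sqr // /Xz [(4 * z.2 / _) ^+ S]exprMn exprVn.
by rewrite mulrA mulVf ?mul1r // gt_eqF // exprn_gt0 // mulr_gt0.
Qed.

Lemma weight_Nz S z : (5 <= S)%N -> H2 z -> weight mu (fun h => Nz z h ^ (- (2 * S)%:Z)).
Proof.
move=> S5 Hz; have y0 : 0 < z.2 := Hz.
have [X0 iX] := preserves_weight (preserves_mull Hmu (gz z)^-1%g) (weight_Xg S5).
have -> : (fun h => Nz z h ^ (- (2 * S)%:Z)) = (fun h => (4 * z.2) ^- S * Xg ((gz z)^-1 * h)%g ^+ S).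
  by apply/funext => h; exact: Xz_Nz.
split; first by move=> h; rewrite mulr_ge0 // invr_ge0 exprn_ge0 // mulr_ge0 // ltW.
exact: (integrableZl measurableT ((4 * z.2) ^- S) iX).
Qed.

Lemma TTE S f z : (5 <= S)%N -> mbounded f -> H2 z -> TT S f z = (mS S)^-1 * Fint mu f (fun z h => Xz z h ^+ S) z.
Proof.
move=> S5 Hf Hz; rewrite /TT /T avgE //; last exact: weight_kX.
have Hw := preserves_weight (preserves_mull Hmu (gz z)^-1%g) (weight_Xg S5).
rewrite /Fint -RintegralZl //.
  by apply: eq_Rintegral => h _; rewrite /kX Xg_gz //; ring.
have := weight_integrable Hw Hf; congr (integrable _ _ _); apply/funext => h /=.
by rewrite Xg_gz.
Qed.

Lemma smooth_TT S f : (5 <= S)%N -> mbounded f -> smooth_on_H2 (TT S f).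
Proof.
move=> S5 Hf n; apply: (@Cn_congr _ _ (Fint mu (fun h => (mS S)^-1 * f h) (fun z h => Xz z h ^+ S))).
  move=> z Hz; rewrite TTE // /Fint -RintegralZl //.
    by apply: eq_Rintegral => h _; ring.
  exact: (dom_integrable Hf (fun z => @weight_Nz S z S5) (@dom_Xz R 1 S) Hz).
apply: (Fint_Cn (mboundedZ _ Hf) (fun z => @weight_Nz S z S5)); exact: dom_Xz.
Qed.

Lemma laplace_Fint S f z : (5 <= S)%N -> mbounded f -> H2 z ->
  laplace_beltrami (Fint mu f (fun z h => Xz z h ^+ S)) z =
  S%:R * (1 - S%:R) * Fint mu f (fun z h => Xz z h ^+ S) z + S%:R ^+ 2 * Fint mu f (fun z h => Xz z h ^+ S.+1) z.
Proof.
move=> S5 Hf Hz; have HN := fun z => @weight_Nz S z S5; have D := @dom_Xz R 2 S.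
have HN' := fun z => @weight_Nz S.+1 z (leqW S5).
have I0 := dom_integrable Hf HN D Hz; have I1 := dom_integrable Hf HN' (@dom_Xz R 2 S.+1) Hz.
have Ib b := dom_integrable Hf HN (dom_dd b (dom_dd b D)) Hz.
have E b := Fint_derive2 Hf HN b D Hz.
rewrite /laplace_beltrami (E true : dx (dx _) z = _) (E false : dy (dy _) z = _).
rewrite /Fint -(RintegralD measurableT (Ib true) (Ib false)).
rewrite -(RintegralZl _ measurableT); last first.
  exact: (integrableD measurableT (Ib true) (Ib false)).
rewrite -(RintegralZl (S%:R * (1 - S%:R)) measurableT I0) -(RintegralZl (S%:R ^+ 2) measurableT I1).
have IZ c S' : mu.-integrable setT (EFin \o (fun h => Xz z h ^+ S' * f h)) ->
    mu.-integrable setT (EFin \o (fun h => c * (Xz z h ^+ S' * f h))).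
  by move=> /(integrableZl measurableT c); congr (integrable _ _ _); apply/funext.
rewrite -(RintegralD measurableT (IZ _ _ I0) (IZ _ _ I1)).
apply: eq_Rintegral => h _; rewrite -mulrDl mulrA mulNr laplace_Xz //; ring.
Qed.

Lemma laplace_congr (f g : R * R -> R) z : (forall z, H2 z -> f z = g z) -> H2 z ->
  laplace_beltrami f z = laplace_beltrami g z.
Proof.
move=> fg Hz.
have E b : dd b (dd b f) z = dd b (dd b g) z.
  apply: near_eq_derive; apply: eq_H2_near Hz => w Hw.
  by apply: near_eq_derive; exact: eq_H2_near fg _ Hw.
have E1 : dx (dx f) z = dx (dx g) z := E true.
have E2 : dy (dy f) z = dy (dy g) z := E false.
by rewrite /laplace_beltrami E1 E2.
Qed.

(** Apply the formula for the Laplacian to the average of the constant 1, which is constant. *)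
Lemma mS_rec S : (5 <= S)%N -> S%:R * mS S.+1 = (S%:R - 1) * mS S.
Proof.
move=> S5; have H1 := mbounded_cst G (1 : R); have S0 : S%:R != 0 :> R by rewrite pnatr_eq0; lia.
have E S' : (5 <= S')%N -> forall z, H2 z -> Fint mu (fun=> 1) (fun z h => Xz z h ^+ S') z = mS S'.
  move=> S5' z Hz; have := TTE S5' H1 Hz; rewrite /TT /T /avg wint_kX1 // => H.
  by apply: (mulfI (_ : (mS S')^-1 != 0)); [rewrite invr_eq0 gt_eqF // mS_gt0|rewrite -H mulVf // gt_eqF // mS_gt0].
have := laplace_Fint S5 H1 H2i; rewrite (E S S5 zi H2i) (E S.+1 (leqW S5) zi H2i).
rewrite (laplace_congr (E S S5) H2i) /laplace_beltrami.
have Z : dx (fun _ : R * R => mS S) = fun=> 0 by apply/funext => z; rewrite /dx derive_cst.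
have Z' : dy (fun _ : R * R => mS S) = fun=> 0 by apply/funext => z; rewrite /dy derive_cst.
rewrite Z Z' /dx /dy !derive_cst addr0 mulr0 => H.
apply: (mulfI S0); move: H; rewrite expr2; move: (mS S) (mS S.+1) => a b H.
by rewrite -[RHS]addr0 H; ring.
Qed.

Lemma laplace_TT S f z : (5 <= S)%N -> mbounded f -> H2 z ->
  laplace_beltrami (TT S f) z = S%:R * (S%:R - 1) * (TT S.+1 f z - TT S f z).
Proof.
move=> S5 Hf Hz; have S0 : S%:R != 0 :> R by rewrite pnatr_eq0; lia.
have Hf' := mboundedZ (mS S)^-1 Hf.
have FZ c S' z' : (5 <= S')%N -> H2 z' -> Fint mu (fun h => c * f h) (fun z h => Xz z h ^+ S') z' =
    c * Fint mu f (fun z h => Xz z h ^+ S') z'.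
  move=> S5' Hz'; rewrite /Fint -RintegralZl //; first by apply: eq_Rintegral => h _; ring.
  exact: (dom_integrable Hf (fun z => @weight_Nz S' z S5') (@dom_Xz R 1 S') Hz').
rewrite (@laplace_congr _ (Fint mu (fun h => (mS S)^-1 * f h) (fun z h => Xz z h ^+ S))) //; last first.
  by move=> z' Hz'; rewrite TTE // FZ.
rewrite laplace_Fint // !FZ ?(leqW S5) // !TTE ?(leqW S5) //.
have m0 := mS_gt0 S5; have m1 := mS_gt0 (leqW S5).
have -> : (mS S.+1)^-1 = S%:R / ((S%:R - 1) * mS S) by rewrite -mS_rec // invfM mulrA mulfV // mul1r.
have S1 : S%:R - 1 != 0 :> R by rewrite subr_eq0 pnatr_eq1; lia.
move: (Fint _ _ _ _) (Fint _ _ _ _) => a b; field.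
by rewrite S1 gt_eqF.
Qed.

End Kernel.

(** * Integration on the quotient *)

Section Enumeration.
Variables (T : choiceType) (Gam : set T).

Definition enumerates (e : nat -> option T) := [/\ forall n c, e n = Some c -> Gam c,
  forall c, Gam c -> exists n, e n = Some c & forall n m c, e n = Some c -> e m = Some c -> n = m].

Lemma enumeration_ex : countable Gam -> exists e, enumerates e.
Proof.
move=> cG.
have /countable_injP[i Hi] := cG.
exists (fun n => if pselect (exists2 c, Gam c & i c = n) is left H then Some (projT1 (cid2 H)) else None); split.
- by move=> n c; case: pselect => // H [<-]; case: (cid2 H).
- move=> c Gc; exists (i c); case: pselect => [H|[]]; last by exists c.
  by case: (cid2 H) => c' Gc' E /=; congr Some; apply: Hi; rewrite ?inE.
- move=> n m c; case: pselect => // H [E1]; case: pselect => // H' [E2].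
  by move: E1 E2; case: (cid2 H) => a Ga Ea /=; case: (cid2 H') => b Gb Eb /= E1 E2; rewrite -Ea -Eb E1 E2.
Qed.

End Enumeration.

(** All that the analysis uses of the group. [Gam] acts on the left here, so [D] will be the inverse
    of a fundamental domain for [G/Gam]; [e0] is an injectivity radius valid at every point, and
    [rho] bounds representatives of the orbits. *)
Record lattice (R : realType) (mu : {measure set (borelSL2 R) -> \bar R}) (Gam : set (SL2 R))
    (D : set (borelSL2 R)) (v e0 rho : R) : Prop := Lattice {
  lat_haar : haar_measure mu;
  lat_subgroup : is_subgroup Gam;
  lat_countable : countable Gam;
  lat_measurable : measurable D;
  lat_volume : mu D = v%:E;
  lat_cover : forall g, exists2 c, Gam c & D (c * g)%g;
  lat_unique : forall g c c', Gam c -> Gam c' -> D (c * g)%g -> D (c' * g)%g -> c = c';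
  lat_e0_gt0 : 0 < e0;
  lat_e0_le1 : e0 <= 1;
  lat_inj : forall x c, Gam c -> near1 e0 (x^-1 * c * x)%g -> c = 1%g;
  lat_cocompact : forall g, exists2 c, Gam c & HS2 (c * g)%g <= rho }.

Section Lattice.
Variables (R : realType) (mu : {sigma_finite_measure set (borelSL2 R) -> \bar R}).
Local Notation G := (borelSL2 R).
Variables (Gam : set (SL2 R)) (D : set G) (v e0 rho : R).
Hypothesis L : lattice mu Gam D v e0 rho.
Let Hmu := lat_haar L.
Let HG := lat_subgroup L.
Let cG := lat_countable L.
Let mD := lat_measurable L.
Let vD : mu D = v%:E := lat_volume L.
Let Dex := lat_cover L.
Let Duniq := lat_unique L.
Let e0_gt0 := lat_e0_gt0 L.
Let e0_le1 := lat_e0_le1 L.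
Let Hinj := lat_inj L.
Implicit Types (g h : G) (f u : G -> R).

Definition ginv f := forall c g, Gam c -> f (c * g)%g = f g.

Let GamM a b : Gam a -> Gam b -> Gam (a * b)%g. Proof. by have [_ + _] := HG; apply. Qed.
Let GamV a : Gam a -> Gam (a^-1)%g. Proof. by have [_ _] := HG; apply. Qed.

Let e := projT1 (cid (enumeration_ex cG)).
Let eP : enumerates Gam e. Proof. exact: projT2 (cid (enumeration_ex cG)). Qed.

Let term (s : G -> G) (phi : G -> \bar R) n : \bar R :=
  if e n is Some c then (\int[mu]_h ((\1_D h)%:E * phi (s c * h)%g))%E else 0%E.

Let Dn (s : G -> G) n : set G := if e n is Some c then (fun h : G => ((s c)^-1 * h)%g : G) @^-1` D else set0.

(** The sum runs over [Gam] through a bijection [s]; the identity and the inversion are the two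
    cases needed to compare an unfolded integral with its mirror image. *)
Lemma unfold_gen (s : G -> G) (phi : G -> \bar R) : (forall c, Gam c -> Gam (s c)) ->
  (forall c, Gam c -> exists2 c', Gam c' & s c' = c) -> (forall a b, s a = s b -> a = b) ->
  measurable_fun setT phi -> (forall x, 0 <= phi x)%E ->
  (\int[mu]_h phi h = \sum_(n <oo) term s phi n)%E.
Proof.
move=> sG ssurj sinj mphi phi0; have [e1 e2 e3] := eP.
have mDn n : measurable (Dn s n).
  by rewrite /Dn; case: (e n) => // c; exact: (measurable_preim (measurable_mulgl _) mD).
have tr : trivIset setT (Dn s).
  apply/trivIsetP => n m _ _ nm; apply/seteqP; split => // h []; rewrite /Dn.
  case En : (e n) => [c|//]; case Em : (e m) => [c'|//] /= Dc Dc'.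
  move/eqP: nm; apply; apply: (e3 _ _ c) => //; rewrite Em; congr Some; apply: sinj; apply: (can_inj invgK).
  by apply: (Duniq _ _ Dc' Dc); apply: GamV; apply: sG; [exact: e1 Em|exact: e1 En].
have cov : \bigcup_n Dn s n = setT.
  apply/seteqP; split => // h _; have [c Gc Dc] := Dex h.
  have [c' Gc' E] := ssurj _ (GamV Gc); have [n En] := e2 c' Gc'.
  by exists n => //; rewrite /Dn En /= E invgK.
rewrite -{1}cov ge0_integral_bigcup //; last exact: measurable_funTS.
apply: eq_eseriesr => n _; rewrite integral_mkcond /term /Dn; case En : (e n) => [c|]; last first.
  by rewrite integral0_eq // => x _; rewrite patchE in_set0.
have mphi' : measurable_fun setT (phi \_ ((fun h : G => ((s c)^-1 * h)%g) @^-1` D)).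
  by apply/(measurable_restrictT _ _).1 => //; [exact: (measurable_preim (measurable_mulgl _) mD)|exact: measurable_funTS].
rewrite -(preserves_integral (preserves_mull Hmu (s c)) mphi').
apply: eq_integral => h _; rewrite epatch_indic /= muleC !indicE.
by congr ((_ : bool)%:R%:E * _)%E; apply/idP/idP; rewrite !inE /= mulKg.
Qed.

Lemma measurable_term2 (s : G -> G) (Psi : G -> G -> \bar R) n :
  measurable_fun setT (fun p : G * G => Psi p.1 p.2) -> (forall x y, 0 <= Psi x y)%E ->
  measurable_fun setT (fun g => term s (Psi g) n).
Proof.
move=> mP P0; rewrite /term; case: (e n) => [c|]; last exact: measurable_cst.
apply: (@measurable_integralG _ mu (fun g h => (\1_D h)%:E * Psi g (s c * h)%g)%E) => [|x y]; last first.
  by rewrite mule_ge0 // lee_fin indicE.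
apply: emeasurable_funM.
  by apply/measurable_EFinP; apply: (@measurableT_comp _ _ _ _ _ _ (\1_D : G -> R)); [exact: measurable_indic|exact: measurable_snd].
exact: (measurableT_comp mP (measurable_fun_pair measurable_fst (measurableT_comp (measurable_mulgl (s c)) measurable_snd))).
Qed.

(** Both sides unfold to sums over [Gam] of integrals over [D x D]; invariance matches the term of
    [c] on one side with that of [c^-1] on the other. *)
Lemma unfold_sym (Psi : G -> G -> \bar R) :
  measurable_fun setT (fun p : G * G => Psi p.1 p.2) -> (forall x y, 0 <= Psi x y)%E ->
  (forall c g h, Gam c -> Psi (c * g)%g (c * h)%g = Psi g h) ->
  (\int[mu]_g ((\1_D g)%:E * \int[mu]_h Psi g h) = \int[mu]_g ((\1_D g)%:E * \int[mu]_h Psi h g))%E.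
Proof.
move=> mP P0 Pinv; have [e1 e2 e3] := eP.
have mP' : measurable_fun setT (fun p : G * G => Psi p.2 p.1).
  exact: (measurableT_comp mP (measurable_fun_pair measurable_snd measurable_fst)).
have term0 s Q n : (forall x, 0 <= Q x)%E -> (0 <= term s Q n)%E.
  by move=> Q0; rewrite /term; case: (e n) => // c; apply: integral_ge0 => h _; rewrite mule_ge0 // lee_fin indicE.
have mD1 : measurable_fun setT (fun g : G => (\1_D g)%:E : \bar R).
  by apply/measurable_EFinP; exact: measurable_indic.
have D0 g : (0 <= (\1_D g)%:E :> \bar R)%E by rewrite lee_fin indicE.
have K (Q : G -> G -> \bar R) s : measurable_fun setT (fun p : G * G => Q p.1 p.2) -> (forall x y, 0 <= Q x y)%E ->
    (forall c, Gam c -> Gam (s c)) ->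
    (forall c, Gam c -> exists2 c', Gam c' & s c' = c) -> (forall a b, s a = s b -> a = b) ->
    (\int[mu]_g ((\1_D g)%:E * \int[mu]_h Q g h) = \sum_(n <oo) \int[mu]_g ((\1_D g)%:E * term s (Q g) n))%E.
  move=> mQ Q0 s1 s2 s3; rewrite -integral_nneseries //; last 2 first.
  - by move=> n; apply: emeasurable_funM => //; exact: measurable_term2.
  - by move=> n g _; rewrite mule_ge0 // term0.
  apply: eq_integral => g _; rewrite (unfold_gen s1 s2 s3); last 2 first.
  - exact: (measurableT_comp mQ (measurable_pair1 g)).
  - by move=> x.
  by rewrite -nneseriesZl // => n _; exact: term0.
have s1 c : Gam c -> exists2 c', Gam c' & c' = c by exists c.
have s2 c : Gam c -> exists2 c', Gam c' & (c'^-1)%g = c by exists (c^-1)%g; [exact: GamV|rewrite invgK].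
have s3 (a b : G) : (a^-1)%g = (b^-1)%g -> a = b by move/(can_inj invgK).
rewrite (K Psi id mP P0 (fun c Gc => Gc) s1 (fun a b E => E)).
rewrite (K (fun g h => Psi h g) (fun c : G => (c^-1)%g) mP' (fun x y => P0 y x) GamV s2 s3).
apply: eq_eseriesr => n _; rewrite /term; case En : (e n) => [c|]; last by rewrite !integral0_eq // => x _; rewrite mule0.
have Gc := e1 _ _ En.
transitivity (\int[mu]_g \int[mu]_h ((\1_D g)%:E * ((\1_D h)%:E * Psi g (c * h)%g)))%E.
  apply: eq_integral => g _; rewrite ge0_integralZl //; last by move=> h _; rewrite mule_ge0.
  apply: emeasurable_funM => //.
  exact: (measurableT_comp (measurableT_comp mP (measurable_pair1 g)) (measurable_mulgl c)).
rewrite tonelliG; last 2 first.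
- apply: emeasurable_funM; first exact: measurableT_comp mD1 measurable_fst.
  apply: emeasurable_funM; first exact: measurableT_comp mD1 measurable_snd.
  exact: (measurableT_comp mP (measurable_fun_pair measurable_fst (measurableT_comp (measurable_mulgl c) measurable_snd))).
- by move=> g h; rewrite !mule_ge0.
apply: eq_integral => h _; rewrite -ge0_integralZl //; last 2 first.
- apply: emeasurable_funM => //.
  exact: (measurableT_comp (measurableT_comp mP (measurable_pair2 h)) (measurable_mulgl _)).
- by move=> g _; rewrite mule_ge0.
apply: eq_integral => g _; rewrite muleCA; congr (_ * (_ * _))%E.
by rewrite -[in LHS](mulVKg c g) Pinv.
Qed.

Lemma weight_indic (A : set G) : measurable A -> (mu A < +oo)%E -> weight mu (\1_A : G -> R).
Proof.
move=> mA fA; split; first by move=> g; rewrite indicE.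
apply/integrableP; split; first by apply/measurable_EFinP; exact: measurable_indic.
suff -> : (\int[mu]_x `|(EFin \o (\1_A : G -> R)) x| = mu A)%E by [].
rewrite -[X in mu X](setIT A) -integral_indic //; apply: eq_integral => x _.
by rewrite /= ger0_norm // indicE.
Qed.

Lemma weight_D : weight mu (\1_D : G -> R).
Proof.
by apply: weight_indic => //; rewrite vD ltry.
Qed.

Definition ID (u : G -> R) := wint mu (\1_D) u.

Lemma ID1 : ID (fun=> 1) = v.
Proof.
have : (ID (fun=> 1))%:E = v%:E; last by case.
rewrite /ID (wint_EFin weight_D); last exact: mbounded_cst.
rewrite -vD -[X in mu X]setIT -integral_indic //.
by apply: eq_integral => h _; rewrite mulr1.
Qed.

Section Symmetric.
Variable k : G -> R.
Hypotheses (Hk : weight mu k) (kV : forall g, k (g^-1)%g = k g).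

Let avg_sym_ge0 f u : mbounded f -> mbounded u -> (forall x, 0 <= f x) -> (forall x, 0 <= u x) -> ginv f -> ginv u ->
  ID (fun g => avg mu k f g * u g) = ID (fun g => f g * avg mu k u g).
Proof.
move=> Hf Hu f0 u0 fi ui; have [k0 _] := Hk; have mk := weight_measurable Hk.
have [mf _] := Hf; have [mu' _] := Hu.
have mk2 : measurable_fun setT (fun p : G * G => k (p.1^-1 * p.2)%g).
  apply: measurableT_comp mk _; apply: measurable_mulg; last exact: measurable_snd.
  exact: measurableT_comp (@measurable_invg R) measurable_fst.
pose Psi g h : \bar R := (k (g^-1 * h)%g * (f h * u g))%:E.
have P0 g h : (0 <= Psi g h)%E by rewrite lee_fin !mulr_ge0.
have mP : measurable_fun setT (fun p : G * G => Psi p.1 p.2).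
  apply/measurable_EFinP; apply: measurable_funM => //.
  by apply: measurable_funM; [exact: measurableT_comp mf measurable_snd|exact: measurableT_comp mu' measurable_fst].
have Pi c g h : Gam c -> Psi (c * g)%g (c * h)%g = Psi g h.
  by move=> Gc; rewrite /Psi fi // ui // invgM !mulgA mulgVK.
have Hkg g := preserves_weight (preserves_mull Hmu g^-1%g) Hk.
have E (a b : G -> R) g : mbounded a -> (0 <= b g) -> (forall x, 0 <= a x) ->
    (\int[mu]_h (k (g^-1 * h)%g * (a h * b g))%:E)%E = (avg mu k a g * b g)%:E.
  move=> Ha b0 a0; rewrite avgE // mulrC EFinM (wint_EFin (Hkg g) Ha) -ge0_integralZl //.
  - by apply: eq_integral => h _; rewrite -EFinM; congr (_%:E); ring.
  - apply/measurable_EFinP; apply: measurable_funM; last by case: Ha.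
    exact: (weight_measurable (Hkg g)).
  - by move=> h _; rewrite lee_fin mulr_ge0.
have Hb a b : mbounded a -> mbounded b -> mbounded (fun g => avg mu k a g * b g).
  by move=> Ha Hb'; apply: mboundedM => //; exact: mbounded_avg.
suff : (ID (fun g => avg mu k f g * u g))%:E = (ID (fun g => f g * avg mu k u g))%:E by case.
rewrite /ID !(wint_EFin weight_D); [|by apply: mboundedM => //; exact: mbounded_avg|exact: Hb].
transitivity (\int[mu]_g ((\1_D g)%:E * \int[mu]_h Psi g h))%E.
  by apply: eq_integral => g _; rewrite E // EFinM.
rewrite unfold_sym //; apply: eq_integral => g _; rewrite EFinM; congr (_ * _)%E.
rewrite mulrC -E //; apply: eq_integral => h _; rewrite /Psi -kV invgM invgK.
by congr (_%:E); ring.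
Qed.

Lemma avgD f u g : mbounded f -> mbounded u -> avg mu k (fun x => f x + u x) g = avg mu k f g + avg mu k u g.
Proof. by move=> Hf Hu; rewrite /avg (wintD Hk) //; exact: mbounded_translate. Qed.

Lemma avgZ c f g : mbounded f -> avg mu k (fun x => c * f x) g = c * avg mu k f g.
Proof. by move=> Hf; rewrite /avg (wintZ Hk) //; exact: mbounded_translate. Qed.

Lemma IDD f u : mbounded f -> mbounded u -> ID (fun x => f x + u x) = ID f + ID u.
Proof. exact: (wintD weight_D). Qed.

(** The symmetry of the kernel and [unfold_sym] settle nonnegative functions. Adding constants to
    [f] and [u], and bilinearity of the difference of the two sides, give the general case. *)
Lemma avg_sym f u : mbounded f -> mbounded u -> ginv f -> ginv u ->
  ID (fun g => avg mu k f g * u g) = ID (fun g => f g * avg mu k u g).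
Proof.
move=> Hf Hu fi ui; have [_ [M HM]] := Hf; have [_ [N HN]] := Hu.
have bnd (a : G -> R) c : (forall x, `|a x| <= c) -> forall x, 0 <= a x + `|c|.
  move=> H x; have := H x; rewrite ler_norml => /andP[H1 _]; have := ler_norm c; lra.
have Hc c : mbounded (fun=> c : R) := mbounded_cst G c.
have ci c : ginv (fun=> c) by [].
have Hf' := mboundedD Hf (Hc `|M|); have Hu' := mboundedD Hu (Hc `|N|).
have fi' : ginv (fun x => f x + `|M|) by move=> c g Gc; rewrite fi.
have ui' : ginv (fun x => u x + `|N|) by move=> c g Gc; rewrite ui.
have ma a : mbounded a -> mbounded (avg mu k a) := mbounded_avg Hk.
have S11 := avg_sym_ge0 Hf' Hu' (bnd _ _ HM) (bnd _ _ HN) fi' ui'.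
have S01 := avg_sym_ge0 (Hc `|M|) Hu' (fun=> normr_ge0 M) (bnd _ _ HN) (@ci _) ui'.
have S10 := avg_sym_ge0 Hf' (Hc `|N|) (bnd _ _ HM) (fun=> normr_ge0 N) fi' (@ci _).
have S00 := avg_sym_ge0 (Hc `|M|) (Hc `|N|) (fun=> normr_ge0 M) (fun=> normr_ge0 N) (@ci _) (@ci _).
pose Bf a b := ID (fun g => avg mu k a g * b g) - ID (fun g => a g * avg mu k b g).
have subD4 (x y z w : R) : x + y - (z + w) = (x - z) + (y - w) by ring.
have Bl a b c : mbounded a -> mbounded b -> mbounded c -> Bf (fun x => a x + b x) c = Bf a c + Bf b c.
  move=> Ha Hb Hc'; rewrite -[RHS]subD4; congr (_ - _).
    etransitivity; last exact: IDD (mboundedM (ma _ Ha) Hc') (mboundedM (ma _ Hb) Hc').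
    by apply: (eq_wint weight_D) => g _; rewrite avgD // mulrDl.
  etransitivity; last exact: IDD (mboundedM Ha (ma _ Hc')) (mboundedM Hb (ma _ Hc')).
  by apply: (eq_wint weight_D) => g _; rewrite mulrDl.
have Br a b c : mbounded a -> mbounded b -> mbounded c -> Bf c (fun x => a x + b x) = Bf c a + Bf c b.
  move=> Ha Hb Hc'; rewrite -[RHS]subD4; congr (_ - _).
    etransitivity; last exact: IDD (mboundedM (ma _ Hc') Ha) (mboundedM (ma _ Hc') Hb).
    by apply: (eq_wint weight_D) => g _; rewrite mulrDr.
  etransitivity; last exact: IDD (mboundedM Hc' (ma _ Ha)) (mboundedM Hc' (ma _ Hb)).
  by apply: (eq_wint weight_D) => g _; rewrite avgD // mulrDr.
have B0 a b : ID (fun g => avg mu k a g * b g) = ID (fun g => a g * avg mu k b g) -> Bf a b = 0.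
  by rewrite /Bf => ->; rewrite subrr.
have A1 := Bl _ _ _ Hf (Hc `|M|) Hu'; rewrite (B0 _ _ S11) (B0 _ _ S01) in A1.
have A2 := Bl _ _ _ Hf (Hc `|M|) (Hc `|N|); rewrite (B0 _ _ S10) (B0 _ _ S00) in A2.
have A3 := Br _ _ _ Hu (Hc `|N|) Hf.
have K (x y z : R) : 0 = x + 0 -> 0 = y + 0 -> x = z + y -> z = 0.
  by move=> E1 E2 E3; rewrite addr0 in E1; rewrite addr0 in E2; rewrite -E1 -E2 addr0 in E3.
by apply/eqP; rewrite -subr_eq0; apply/eqP; exact: (K _ _ _ A1 A2 A3).
Qed.

End Symmetric.

(** Small enough for the quotients [b' b^-1] of its elements to stay in [near1 e0]. *)
Definition Bin : set G := near1 (e0 / 16).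

Let dist_le (x y a d : R) : `|x - a| < d -> `|y - a| < d -> `|x - y| <= 2 * d.
Proof.
move=> xa ya; rewrite (_ : x - y = (x - a) - (y - a)); last by ring.
by apply: (le_trans (ler_normB _ _)); move: `|x - a| `|y - a| xa ya => p q; lra.
Qed.
Let norm_near1 (x d : R) : d <= 1 / 16 -> `|x - 1| < d -> `|x| <= 17 / 16.
Proof. by move=> d1; rewrite ltr_norml ler_norml => /andP[? ?]; apply/andP; split; lra. Qed.

Lemma Bin_inj (b b' : G) : Bin b -> Bin b' -> near1 e0 (b' * b^-1)%g.
Proof.
move=> [a1 a2 a3 a4] [b1 b2 b3 b4].
have h1 := e0_gt0; have d1 : e0 / 16 <= 1 / 16 by rewrite ler_pM2r ?e0_le1.
have d8 : 2 * (e0 / 16) = e0 / 8 by field.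
have K0 (x : R) : `|x| < e0 / 16 -> `|x - 0| < e0 / 16 by rewrite subr0.
have small (x : R) : `|x| < e0 / 16 -> `|x| <= 17 / 16 by move: d1; lra.
have W (x y w z : R) : `|x| <= e0 / 8 -> `|y| <= e0 / 8 -> `|w| <= 17 / 16 -> `|z| <= 17 / 16 -> `|x * w + y * z| < e0.
  move=> x1 y1 w1 z1; apply: (le_lt_trans (ler_normD _ _)); rewrite !normrM.
  have := ler_pM (normr_ge0 x) (normr_ge0 w) x1 w1; have := ler_pM (normr_ge0 y) (normr_ge0 z) y1 z1; lra.
have E := gdet b; split; rewrite !gE.
- rewrite (_ : _ - 1 = (ga b' - ga b) * gd b + (gb b' - gb b) * (- gc b)); last by rewrite -E; ring.
  by apply: W; rewrite ?normrN -?d8; [exact: dist_le b1 a1|exact: dist_le (K0 _ b2) (K0 _ a2)|exact: norm_near1 a4|exact: small].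
- rewrite (_ : _ + _ = (ga b' - ga b) * (- gb b) + (gb b' - gb b) * ga b); last by ring.
  by apply: W; rewrite ?normrN -?d8; [exact: dist_le b1 a1|exact: dist_le (K0 _ b2) (K0 _ a2)|exact: small|exact: norm_near1 a1].
- rewrite (_ : _ + _ = (gc b' - gc b) * gd b + (gd b' - gd b) * (- gc b)); last by ring.
  by apply: W; rewrite ?normrN -?d8; [exact: dist_le (K0 _ b3) (K0 _ a3)|exact: dist_le b4 a4|exact: norm_near1 a4|exact: small].
- rewrite (_ : _ - 1 = (gc b' - gc b) * (- gb b) + (gd b' - gd b) * ga b); last by rewrite -E; ring.
  by apply: W; rewrite ?normrN -?d8; [exact: dist_le (K0 _ b3) (K0 _ a3)|exact: dist_le b4 a4|exact: small|exact: norm_near1 a1].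
Qed.

Lemma measurable_Bin : measurable Bin.
Proof. exact: measurable_near1. Qed.

(** By the injectivity radius [y Bin] meets each orbit at most once, so an integral over it is at
    most the integral over the quotient. *)
Lemma fold_le (y : G) (N : G -> \bar R) : measurable_fun setT N -> (forall x, 0 <= N x)%E ->
  (forall c g, Gam c -> N (c * g)%g = N g) ->
  (\int[mu]_h ((\1_Bin h)%:E * N (y * h)%g) <= \int[mu]_h ((\1_D h)%:E * N h))%E.
Proof.
move=> mN N0 Ni; have [e1 e2 e3] := eP.
pose phi h : \bar R := ((\1_Bin (y^-1 * h)%g)%:E * N h)%E.
have B0 h : (0 <= (\1_Bin h)%:E :> \bar R)%E by rewrite lee_fin indicE.
have D0 h : (0 <= (\1_D h)%:E :> \bar R)%E by rewrite lee_fin indicE.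
have mB : measurable_fun setT (fun g : G => (\1_Bin g)%:E : \bar R).
  by apply/measurable_EFinP; apply: measurable_indic; exact: measurable_Bin.
have mphi : measurable_fun setT phi.
  by apply: emeasurable_funM => //; exact: measurableT_comp mB (measurable_mulgl _).
have -> : (\int[mu]_h ((\1_Bin h)%:E * N (y * h)%g) = \int[mu]_h phi h)%E.
  rewrite -(preserves_integral (preserves_mull Hmu y) mphi).
  by apply: eq_integral => h _; rewrite /phi mulKg.
rewrite (unfold_gen (s := id)) //; [|by move=> c Gc; exists c|by move=> x; rewrite mule_ge0].
pose E n : set G := if e n is Some c then D `&` ((fun h : G => (y^-1 * (c * h))%g : G) @^-1` Bin) else set0.
have mE n : measurable (E n).
  rewrite /E; case: (e n) => // c; apply: measurableI => //.
  apply: (measurable_preim _ measurable_Bin).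
  exact: measurableT_comp (measurable_mulgl _) (measurable_mulgl _).
have trE : trivIset setT E.
  apply/trivIsetP => n m _ _ nm; apply/seteqP; split => // h []; rewrite /E.
  case En : (e n) => [c|//]; case Em : (e m) => [c'|//] /= [_ Bc] [_ Bc'].
  move/eqP: nm; apply; apply: (e3 _ _ c) => //; rewrite Em; congr Some.
  have := Bin_inj Bc Bc'; rewrite !invgM !invgK !mulgA => H.
  have : near1 e0 (y^-1 * (c' * c^-1) * y)%g by move: H; rewrite -[(_ * h * _)%g]mulgA mulgV mulg1 !mulgA.
  have Gcc : Gam (c' * c^-1)%g by apply: GamM; [exact: e1 Em|apply: GamV; exact: e1 En].
  by move=> /(Hinj Gcc) E1; rewrite -[c'](mulgVK c) E1 mul1g.
apply: (@le_trans _ _ (\sum_(n <oo) \int[mu]_(h in E n) N h)%E).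
  apply: lee_nneseries => [n _ _|n _].
    by rewrite /term; case: (e n) => // c; apply: integral_ge0 => h _; rewrite !mule_ge0.
  rewrite /term /E; case En : (e n) => [c|]; last by rewrite integral_set0.
  rewrite [leRHS]integral_mkcond le_eqVlt; apply/orP; left; apply/eqP.
  apply: eq_integral => h _; rewrite epatch_indic /= /phi Ni; last exact: e1 En.
  by rewrite !indicE in_setI muleA -EFinM muleC -natrM mulnb.
rewrite -ge0_integral_bigcup //; last exact: measurable_funTS.
rewrite integral_mkcond; apply: ge0_le_integral => //.
- by move=> h _; rewrite epatch_indic /= mule_ge0 // lee_fin indicE.
- apply/(measurable_restrictT _ _).1; last exact: measurable_funTS.
  by apply: bigcup_measurable.
- by apply: emeasurable_funM => //; apply/measurable_EFinP; exact: measurable_indic.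
move=> h _; rewrite epatch_indic /= muleC lee_wpmul2r // lee_fin !indicE ler_nat.
case: (boolP (h \in \bigcup_n E n)) => //; rewrite inE => -[n _]; rewrite /E.
by case: (e n) => // c [Dh _]; rewrite mem_set.
Qed.

Lemma fold_le_real (y : G) (N : G -> R) : mbounded N -> (forall x, 0 <= N x) -> ginv N ->
  wint mu (\1_Bin) (fun h => N (y * h)%g) <= ID N.
Proof.
move=> HN N0 Ni; have [mN _] := HN.
have HB : weight mu (\1_Bin : G -> R).
  have h1 := e0_gt0; have h2 := e0_le1; have e16 : e0 / 16 <= 1 by lra.
  exact: (weight_indic measurable_Bin (near1_fin Hmu e16)).
rewrite -lee_fin (wint_EFin HB); last exact: mbounded_translate.
rewrite /ID (wint_EFin weight_D) //.
under eq_integral do rewrite EFinM.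
under [leRHS]eq_integral do rewrite EFinM.
apply: (@fold_le y (fun h => (N h)%:E)) => [||c g Gc]; first exact/measurable_EFinP.
  by move=> x; rewrite lee_fin.
by rewrite Ni.
Qed.

Lemma Bin_le_v : (mu Bin <= v%:E)%E.
Proof.
have := @fold_le 1%g (fun=> 1%E) (measurable_cst _) (fun=> lee01) (fun _ _ _ => erefl).
have E (A : set G) : measurable A -> (\int[mu]_h ((\1_A h)%:E * 1) = mu A)%E.
  by move=> mA; rewrite -[X in mu X](setIT A) -integral_indic //; apply: eq_integral => h _; rewrite mule1.
by rewrite (E _ measurable_Bin) (E _ mD) vD.
Qed.

End Lattice.

(** * The Harnack inequality and the maximum principle *)

Section Harnack.
Variables (R : realType) (mu : {sigma_finite_measure set (borelSL2 R) -> \bar R}).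
Hypothesis Hmu : haar_measure mu.
Local Notation G := (borelSL2 R).
Implicit Types (g h : G) (f u : G -> R).

(* [(1+x)^2] dominates the largest eigenvalue of [h h^T], whose trace is [HS2 h] and determinant [1]. *)
Lemma HS2_mulr_le g h (x : R) : 0 <= x -> HS2 h <= 2 + x ^+ 2 -> HS2 (g * h)%g <= (1 + x) ^+ 2 * HS2 g.
Proof.
move=> x0; have E := gdet h; rewrite /HS2 !gE.
move: (ga g) (gb g) (gc g) (gd g) (ga h) (gb h) (gc h) (gd h) E => a b c d p q r w E H.
have row (A B : R) : (A * p + B * r) ^+ 2 + (A * q + B * w) ^+ 2 <= (1 + x) ^+ 2 * (A ^+ 2 + B ^+ 2).
  pose P := p ^+ 2 + q ^+ 2; pose Q := r ^+ 2 + w ^+ 2; pose M := p * r + q * w; pose s := (1 + x) ^+ 2.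
  have dt : P * Q - M ^+ 2 = 1 by rewrite -[RHS](expr1n _ 2) -E /P /Q /M; ring.
  have PQ : P + Q <= 2 + x ^+ 2 by rewrite /P /Q; lra.
  have s1 : (s - P) * (s - Q) - M ^+ 2 >= 0.
    have s0 : 0 <= s by rewrite sqr_ge0.
    have : s * (P + Q) <= s * (2 + x ^+ 2) by apply: ler_wpM2l.
    have : 0 <= x ^+ 2 * (3 + 2 * x) by rewrite mulr_ge0 ?sqr_ge0 //; lra.
    have -> : (s - P) * (s - Q) - M ^+ 2 = s ^+ 2 - s * (P + Q) + (P * Q - M ^+ 2) by ring.
    have -> : x ^+ 2 * (3 + 2 * x) = s ^+ 2 + 1 - s * (2 + x ^+ 2) by rewrite /s; ring.
    lra.
  have sm : 0 <= (s - P) + (s - Q) by rewrite /s; have := sqr_ge0 x; lra.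
  rewrite -subr_ge0 -/s.
  have -> : s * (A ^+ 2 + B ^+ 2) - ((A * p + B * r) ^+ 2 + (A * q + B * w) ^+ 2) =
    (s - P) * A ^+ 2 - 2 * M * A * B + (s - Q) * B ^+ 2 by rewrite /P /Q /M; ring.
  move: s1 sm; move: (s - P) (s - Q) => U V s1; rewrite le_eqVlt => /orP[/eqP sm|sm].
    have M0 := sqr_ge0 M; have UV : V = - U by lra.
    have U0 : U ^+ 2 <= 0 by rewrite UV in s1; lra.
    have /eqP : U ^+ 2 = 0 by apply/eqP; rewrite eq_le U0 sqr_ge0.
    rewrite sqrf_eq0 => /eqP Uz; rewrite UV Uz in s1 *.
    have /eqP : M ^+ 2 = 0 by apply/eqP; rewrite eq_le sqr_ge0 andbT; lra.
    by rewrite sqrf_eq0 => /eqP ->; lra.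
  rewrite -(pmulr_rge0 _ sm).
  have -> : (U + V) * (U * A ^+ 2 - 2 * M * A * B + V * B ^+ 2) =
    (U * A - M * B) ^+ 2 + (V * B - M * A) ^+ 2 + (U * V - M ^+ 2) * (A ^+ 2 + B ^+ 2) by ring.
  by rewrite !addr_ge0 ?sqr_ge0 // mulr_ge0 // addr_ge0 ?sqr_ge0.
have := row a b; have := row c d; move: ((1 + x) ^+ 2) => s; lra.
Qed.

Lemma Xg_mulr_le g h (c : R) : 1 <= c -> HS2 (g * h)%g <= c * HS2 g -> Xg g <= c * Xg (g * h)%g.
Proof.
move=> c1 H; have g0 := HS2_2_gt0 g; have h0 := HS2_2_gt0 (g * h)%g.
by rewrite /Xg mulrA ler_pdivrMr // mulrAC ler_pdivlMr //; nra.
Qed.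

Lemma kX_mulr_le S g h (c : R) : (5 <= S)%N -> 1 <= c -> HS2 (g * h)%g <= c * HS2 g ->
  kX mu S g <= c ^+ S * kX mu S (g * h)%g.
Proof.
move=> S5 c1 H; have m0 := mS_gt0 Hmu S5; rewrite /kX mulrA ler_pM2r ?invr_gt0 // -exprMn.
have c0 : 0 <= c by lra.
have x0 (y : G) : 0 <= Xg y by rewrite ltW // Xg_gt0.
have cx : 0 <= c * Xg (g * h)%g by exact: (mulr_ge0 c0 (x0 _)).
by rewrite lerXn2r ?nnegrE ?x0 ?cx //; exact: (Xg_mulr_le c1 H).
Qed.

Lemma kX_translate S g b h : kX mu S ((g * b)^-1 * h)%g = kX mu S ((g^-1 * h)^-1 * b)%g.
Proof. by rewrite -kXV; congr (kX mu S _); rewrite !invgM !invgK mulgA. Qed.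

Let Wt S g : (5 <= S)%N -> weight mu (fun h => kX mu S (g^-1 * h)%g).
Proof. by move=> S5; exact: (preserves_weight (preserves_mull Hmu g^-1%g) (weight_kX Hmu S5)). Qed.

(** Moving the base point by [b] changes the kernel by a factor at most [c^S], and therefore also
    the average of a nonnegative function. *)
Lemma T_harnack S f b (c : R) : (5 <= S)%N -> 1 <= c -> (forall g, HS2 (g * b)%g <= c * HS2 g) ->
  mbounded f -> (forall x, 0 <= f x) -> forall g, T mu S f g <= c ^+ S * T mu S f (g * b)%g.
Proof.
move=> S5 c1 Hc Hf f0 g; have Hk := weight_kX Hmu S5; rewrite /T !avgE // /wint.
rewrite -RintegralZl //; last exact: (weight_integrable (Wt _ S5) Hf).
apply: le_Rintegral => //.
- exact: (weight_integrable (Wt _ S5) Hf).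
- rewrite [X in _.-integrable _ X](_ : _ = EFin \o (fun h => kX mu S ((g * b)^-1 * h)%g * (c ^+ S * f h))).
    exact: (weight_integrable (Wt _ S5) (mboundedZ (c ^+ S) Hf)).
  by apply/funext => h /=; rewrite mulrCA.
move=> h _; rewrite mulrA ler_wpM2r // kX_translate -kXV.
exact: kX_mulr_le.
Qed.

Lemma T_equi S f b (c : R) : (5 <= S)%N -> 1 <= c -> (forall g, HS2 (g * b)%g <= c * HS2 g) ->
  (forall g, HS2 (g * b^-1)%g <= c * HS2 g) ->
  mbounded f -> forall g, `|T mu S f (g * b)%g - T mu S f g| <= (c ^+ S - 1) * T mu S (fun x => `|f x|) g.
Proof.
move=> S5 c1 Hc HcV Hf g; have Hk := weight_kX Hmu S5; have Hn := mbounded_norm Hf.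
have c0 : 0 <= c ^+ S - 1 by rewrite subr_ge0 exprn_ege1.
rewrite /T !avgE // /wint -RintegralB //; [|exact: (weight_integrable (Wt _ S5) Hf)..].
have I1 : mu.-integrable setT (EFin \o (fun h => kX mu S ((g * b)^-1 * h)%g * f h - kX mu S (g^-1 * h)%g * f h)).
  rewrite (_ : _ \o _ = (EFin \o (fun h => kX mu S ((g * b)^-1 * h)%g * f h)%R) \- (EFin \o (fun h => kX mu S (g^-1 * h)%g * f h)%R))%E.
    by apply: integrableB => //; exact: (weight_integrable (Wt _ S5) Hf).
  by apply/funext => h /=; rewrite EFinB.
apply: (le_trans (le_normr_Rintegral _ I1)) => //.
rewrite -RintegralZl //; last exact: (weight_integrable (Wt _ S5) Hn).
apply: le_Rintegral => //.
- exact: integrable_norm I1.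
- rewrite [X in _.-integrable _ X](_ : _ = EFin \o (fun h => kX mu S (g^-1 * h)%g * ((c ^+ S - 1) * `|f h|))).
    exact: (weight_integrable (Wt _ S5) (mboundedZ (c ^+ S - 1) Hn)).
  by apply/funext => h /=; rewrite mulrCA.
move=> h _ /=; rewrite -mulrBl normrM mulrA ler_wpM2r // kX_translate -[kX mu S (g^-1 * h)%g]kXV.
set y := (_^-1)%g.
have A := kX_mulr_le (g := y) (h := b) S5 c1 (Hc _).
have := kX_mulr_le (g := (y * b)%g) (h := (b^-1)%g) S5 c1 (HcV _); rewrite mulgK => B.
have k0 : 0 <= kX mu S y by have [k0 _] := Hk.
move: A B k0; move: (kX mu S y) (kX mu S (y * b)%g) => p q A B p0.
have cS : 1 <= c ^+ S by lra.
rewrite ler_norml; apply/andP; split; last by lra.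
rewrite -mulNr opprB; have q0 : 0 <= q by move: A; rewrite -subr_ge0 => A; nra.
nra.
Qed.

Lemma exp_sub1_small n (e : R) : 0 < e -> exists2 x, 0 < x <= 1 & ((1 + x) ^+ 2) ^+ n - 1 <= e.
Proof.
move=> e0; have K m (x : R) : 0 <= x -> x <= 1 -> (1 + x) ^+ m <= 1 + x * (2 ^+ m - 1).
  move=> x0 x1; elim: m => [|m IH]; first by rewrite !expr0 subrr mulr0 addr0.
  have p : 1 <= (2 : R) ^+ m by rewrite exprn_ege1 //; lra.
  rewrite exprS; apply: (@le_trans _ _ ((1 + x) * (1 + x * (2 ^+ m - 1)))); first by rewrite ler_wpM2l //; lra.
  rewrite exprS; move: (2 ^+ m) p => y p.
  rewrite -subr_ge0 (_ : _ - _ = x * (1 - x) * (y - 1)); last by ring.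
  by rewrite !mulr_ge0 //; lra.
have p : 1 <= (2 : R) ^+ (2 * n) by rewrite exprn_ege1 //; lra.
exists (Num.min 1 (e / 2 ^+ (2 * n))).
  by rewrite ge_min lexx /= andbT lt_min ltr01 divr_gt0 // (lt_le_trans _ p).
set x := Num.min _ _.
have x0 : 0 <= x by rewrite /x le_min ler01 divr_ge0 // ?(ltW e0) // (le_trans _ p).
have x1 : x <= 1 by rewrite /x ge_min lexx.
have x2 : x * 2 ^+ (2 * n) <= e by rewrite -ler_pdivlMr ?(lt_le_trans _ p) // /x ge_min lexx orbT.
rewrite -exprM; have := K (2 * n)%N x x0 x1; lra.
Qed.

(** Continuity under right translation, uniform in the base point. The condition on [h] means that
    [h i] is close to [i]; all rotations satisfy it, so such functions descend to the half-plane
    ([unif_rotr]). *)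
Definition unif f := forall e : R, 0 < e -> exists2 x : R, 0 < x &
  forall g h, HS2 h <= 2 + x ^+ 2 -> `|f (g * h)%g - f g| <= e.

Lemma T_norm_le S f g : (5 <= S)%N -> mbounded f -> `|T mu S f g| <= T mu S (fun x => `|f x|) g.
Proof. by move=> S5 Hf; apply: (wint_norm (weight_kX Hmu S5)); exact: mbounded_translate. Qed.

Lemma T_le S f u g : (5 <= S)%N -> mbounded f -> mbounded u -> (forall x, f x <= u x) -> T mu S f g <= T mu S u g.
Proof.
move=> S5 Hf Hu fu; apply: (le_wint (weight_kX Hmu S5)) => [||x _]; try exact: mbounded_translate.
exact: fu.
Qed.

Lemma T_cst S c g : (5 <= S)%N -> T mu S (fun=> c) g = c.
Proof. by move=> S5; rewrite /T /avg wint_cst ?wint_kX1 ?mulr1 //; exact: weight_kX. Qed.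

Lemma TD S f u c : (5 <= S)%N -> mbounded f -> mbounded u ->
  T mu S (fun x => f x + c * u x) = fun g => T mu S f g + c * T mu S u g.
Proof.
move=> S5 Hf Hu; apply/funext => g; have Hk := weight_kX Hmu S5; rewrite /T /avg wintD //.
- by rewrite wintZ //; exact: mbounded_translate.
- exact: mbounded_translate.
- by apply: mboundedZ; exact: mbounded_translate.
Qed.

Lemma T_bound S f (M : R) g : (5 <= S)%N -> mbounded f -> (forall x, `|f x| <= M) -> `|T mu S f g| <= M.
Proof.
move=> S5 Hf HM; apply: (le_trans (T_norm_le _ S5 Hf)); rewrite -[leRHS](T_cst M g S5).
by apply: T_le => //; [exact: mbounded_norm|exact: mbounded_cst].
Qed.

Lemma T_unif S (M e : R) : (5 <= S)%N -> 0 < e -> exists2 x : R, 0 < x &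
  forall f, mbounded f -> (forall x, `|f x| <= M) -> forall g h, HS2 h <= 2 + x ^+ 2 -> `|T mu S f (g * h)%g - T mu S f g| <= e.
Proof.
move=> S5 e0; pose M' := Num.max M 1; have M'0 : 0 < M' by rewrite /M' lt_max ltr01 orbT.
have [x /andP[x0 x1] Hx] := exp_sub1_small S (divr_gt0 e0 M'0).
exists x => // f Hf HM g h Hh; have c1 : 1 <= (1 + x) ^+ 2 by nra.
apply: (le_trans (T_equi S5 c1 _ _ Hf g)); try by move=> y; apply: HS2_mulr_le; rewrite ?HS2V // ltW.
have a0 : 0 <= ((1 + x) ^+ 2) ^+ S - 1 by rewrite subr_ge0 exprn_ege1.
have b0 : T mu S (fun x => `|f x|) g <= M'.
  apply: (le_trans (ler_norm _)); apply: T_bound => //; first exact: mbounded_norm.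
  by move=> y; rewrite normr_id (le_trans (HM y)) // /M' le_max lexx.
apply: (@le_trans _ _ ((((1 + x) ^+ 2) ^+ S - 1) * M')); first exact: ler_wpM2l.
by rewrite -ler_pdivlMr.
Qed.

Lemma continuous_HS2_translate (g : SL2 R) : continuous (fun h : SL2 R => HS2 (g^-1 * h)%g : R).
Proof.
have cM (u w : SL2 R -> R) : continuous u -> continuous w -> continuous (fun h => u h * w h).
  by move=> cu cw h; apply: continuousM; [exact: cu|exact: cw].
have cD (u w : SL2 R -> R) : continuous u -> continuous w -> continuous (fun h => u h + w h).
  by move=> cu cw h; apply: continuousD; [exact: cu|exact: cw].
have cE (c : R) i j : continuous (fun h : SL2 R => c * slmx h i j).
  by apply: cM; [move=> h; exact: cst_continuous|exact: continuous_entry].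
have -> : (fun h => HS2 (g^-1 * h)%g : R) = fun h => let q (a b : R) i := a * slmx h 0 i + b * slmx h 1 i in
    q (ga g^-1%g) (gb g^-1%g) 0 * q (ga g^-1%g) (gb g^-1%g) 0 +
    q (ga g^-1%g) (gb g^-1%g) 1 * q (ga g^-1%g) (gb g^-1%g) 1 +
    q (gc g^-1%g) (gd g^-1%g) 0 * q (gc g^-1%g) (gd g^-1%g) 0 +
    q (gc g^-1%g) (gd g^-1%g) 1 * q (gc g^-1%g) (gd g^-1%g) 1.
  by apply/funext => h; rewrite /HS2 gaM gbM gcM gdM !expr2.
by apply: (cD); [apply: (cD); [apply: (cD)|]|]; apply: (cM); apply: (cD); exact: cE.
Qed.

Lemma nbhs_HS2 (g : SL2 R) (x : R) : 0 < x -> nbhs g [set h : SL2 R | HS2 (g^-1 * h)%g <= 2 + x ^+ 2].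
Proof.
move=> x0; have := @continuous_HS2_translate g g; rewrite /continuous_at /= mulVg HS2_1 => /cvgrPdist_le /(_ (x ^+ 2)) H.
have : 0 < x ^+ 2 by rewrite exprn_gt0.
move/H; apply: filterS => h /=; rewrite ler_norml => /andP[H1 _]; lra.
Qed.

Lemma unif_continuous (f : SL2 R -> R) : unif f -> continuous f.
Proof.
move=> uf g; rewrite /continuous_at; apply/(@cvgrPdist_le R R (SL2 R) (nbhs g) _ f (f g)) => e /uf[x x0 H].
apply: filterS (nbhs_HS2 g x0) => h /= Hh; rewrite distrC.
by have := H g _ Hh; rewrite mulVKg.
Qed.

Lemma unif_rotr f : unif f -> forall g k, rotation k -> f (g * k)%g = f g.
Proof.
move=> uf g k Hk; apply/eqP; rewrite -subr_eq0 -normr_le0; apply/ler_addgt0Pl => e e0; rewrite addr0.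
have [x x0 H] := uf e e0; apply: H.
by rewrite -[k]mul1g HS2_rotr // HS2_1 lerDl sqr_ge0.
Qed.

End Harnack.

Section SecondDerivative.
Variable R : realType.
Local Notation H2 := (@upper_half_plane R).

(** Were the second derivative positive, the first would be positive just to the right of 0, and the
    function would exceed its maximum there. *)
Lemma second_derivative_at_max (phi : R -> R) (r : R) : 0 < r ->
  (forall t : R, `|t| < r -> derivable phi t 1) -> derivable (fun t => 'D_1 phi t) 0 1 ->
  (forall t : R, `|t| < r -> phi t <= phi 0) -> 'D_1 (fun t => 'D_1 phi t) 0 <= 0.
Proof.
move=> r0 dphi d2 mx; rewrite leNgt; apply/negP => l0.
have inr t : t \in `]-r, r[ -> `|t| < r by rewrite in_itv /= ltr_norml.
have [_ D0] : is_derive (0 : R) 1 phi 0.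
  apply: (@derive1_at_max _ phi (-r) r) => [|t /inr||t /inr]; [lra|exact: dphi|by rewrite in_itv /=; apply/andP; split; lra|exact: mx].
have := d2; rewrite /derivable => /cvg_ex[l Hl].
have E : 'D_1 (fun t => 'D_1 phi t) 0 = l by rewrite /derive; apply/cvg_lim.
rewrite E in l0; move/cvgrPdist_lt: Hl => /(_ _ l0) /nbhs_ballP[d /= d0 Hd].
have pos t : 0 < t -> t < d -> 0 < 'D_1 phi t.
  move=> t0 td; have : `|l - t^-1 *: ('D_1 phi (t *: (1 : R) + 0) - 'D_1 phi 0)| < l.
    by apply: Hd; [rewrite /ball /= sub0r normrN gtr0_norm|rewrite gt_eqF].
  rewrite D0 subr0 addr0 /GRing.scale /= mulr1 ltr_norml => /andP[_]; rewrite ltrBlDl ltrDr.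
  by rewrite pmulr_rgt0 // invr_gt0.
pose t := Num.min (d / 2) (r / 2).
have t0 : 0 < t by rewrite lt_min !divr_gt0.
have td : t < d by rewrite /t gt_min; apply/orP; left; lra.
have tr : t < r by rewrite /t gt_min; apply/orP; right; lra.
have [c] : exists2 c, c \in `]0, t[ & phi t - phi 0 = 'D_1 phi c * (t - 0).
  apply: (MVT t0) => [x|].
    by rewrite in_itv /= => /andP[x0 xt]; apply: derivableP; apply: dphi; rewrite gtr0_norm // (lt_trans xt).
  apply: derivable_within_continuous => x; rewrite in_itv /= => /andP[x0 xt].
  by apply: dphi; rewrite ger0_norm // (le_lt_trans xt).
rewrite in_itv /= => /andP[c0 ct]; rewrite subr0 => F.
have : 0 < phi t - phi 0 by rewrite F mulr_gt0 // pos // (lt_trans ct).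
by have := mx t; rewrite gtr0_norm // => /(_ tr); lra.
Qed.

Lemma laplace_at_max (E : R * R -> R) z : Cn_on_H2 2 E -> H2 z -> (forall w, H2 w -> E w <= E z) ->
  0 <= laplace_beltrami E z.
Proof.
move=> [cE [dEx dEy [_ [dxx _ _ _]] [_ [_ dyy _ _]]]] Hz mx; have z0 : 0 < z.2 := Hz.
have K (v : R * R) : (forall t : R, `|t| < z.2 -> H2 (t *: v + z)) -> (forall w, H2 w -> derivable E w v) ->
    derivable (fun w => 'D_v E w) z v -> 'D_v (fun w => 'D_v E w) z <= 0.
  move=> Hv dE d2; have ez : z = 0 *: v + z by rewrite scale0r add0r.
  have F : (fun s : R => 'D_v E (s *: v + z)) = fun s => 'D_1 (fun s : R => E (s *: v + z)) s.
    by apply/funext => s; exact: derive_line.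
  rewrite {1}ez (@derive_line _ (fun w => 'D_v E w) z v 0) F.
  apply: (second_derivative_at_max z0) => [t tz||t tz].
  - by apply: (proj1 (@derivable_line _ E z v t)); exact: dE (Hv _ tz).
  - by rewrite -F; apply: (proj1 (@derivable_line _ (fun w => 'D_v E w) z v 0)); rewrite -ez.
  - by rewrite -ez; exact: mx (Hv _ tz).
have Kx := K (1, 0) _ dEx (dxx z Hz); have Ky := K (0, 1) _ dEy (dyy z Hz).
have y2 := sqr_ge0 z.2.
rewrite /laplace_beltrami /dx /dy mulNr -mulrN; apply: mulr_ge0 => //.
rewrite oppr_ge0; have : 'D_(1, 0) (fun w => 'D_(1, 0) E w) z <= 0 /\ 'D_(0, 1) (fun w => 'D_(0, 1) E w) z <= 0; last first.
  by move=> [A B]; have := lerD A B; rewrite addr0.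
split; [apply: Kx|apply: Ky] => t; rewrite ltr_norml => /andP[t1 t2]; rewrite /upper_half_plane /= /GRing.scale /=; lra.
Qed.

Lemma derivable_lincomb (f u : R * R -> R) c z v : derivable f z v -> derivable u z v ->
  derivable (fun w => f w + c * u w) z v /\ 'D_v (fun w => f w + c * u w) z = 'D_v f z + c * 'D_v u z.
Proof.
move=> df du; have dcu : derivable (c \*: u) z v by exact: derivableZ.
have -> : (fun w => f w + c * u w) = f + c \*: u by [].
by split; [exact: derivableD|rewrite deriveD // deriveZ].
Qed.

Lemma Cn_lincomb n (f u : R * R -> R) c : Cn_on_H2 n f -> Cn_on_H2 n u -> Cn_on_H2 n (fun z => f z + c * u z).
Proof.
elim: n f u => [|n IH] f u [cf Hf] [cu Hu].
  by split=> // z Hz; apply: continuousD; [exact: cf|apply: continuousM; [exact: cst_continuous|exact: cu]].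
split; first by move=> z Hz; apply: continuousD; [exact: cf|apply: continuousM; [exact: cst_continuous|exact: cu]].
move: Hf Hu => [fx fy fxC fyC] [ux uy uxC uyC]; split.
- by move=> z Hz; case: (derivable_lincomb c (fx z Hz) (ux z Hz)).
- by move=> z Hz; case: (derivable_lincomb c (fy z Hz) (uy z Hz)).
- apply: (Cn_congr _ (IH _ _ fxC uxC)) => z Hz.
  by case: (derivable_lincomb c (fx z Hz) (ux z Hz)).
- apply: (Cn_congr _ (IH _ _ fyC uyC)) => z Hz.
  by case: (derivable_lincomb c (fy z Hz) (uy z Hz)).
Qed.

Lemma laplace_lincomb (f u : R * R -> R) c z : Cn_on_H2 2 f -> Cn_on_H2 2 u -> H2 z ->
  laplace_beltrami (fun z => f z + c * u z) z = laplace_beltrami f z + c * laplace_beltrami u z.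
Proof.
move=> [_ [fx fy [_ [fxx _ _ _]] [_ [_ fyy _ _]]]] [_ [ux uy [_ [uxx _ _ _]] [_ [_ uyy _ _]]]] Hz.
have K v : (forall w, H2 w -> derivable f w v) -> (forall w, H2 w -> derivable u w v) ->
    derivable (fun w => 'D_v f w) z v -> derivable (fun w => 'D_v u w) z v ->
    'D_v (fun w => 'D_v (fun z => f z + c * u z) w) z =
    'D_v (fun w => 'D_v f w) z + c * 'D_v (fun w => 'D_v u w) z.
  move=> df du df2 du2; case: (derivable_lincomb c df2 du2) => _ <-.
  apply: near_eq_derive; first exact: (eq_H2_near (fun w Hw => proj2 (derivable_lincomb c (df w Hw) (du w Hw)))).
rewrite /laplace_beltrami /dx /dy (K _ fx ux (fxx z Hz) (uxx z Hz)) (K _ fy uy (fyy z Hz) (uyy z Hz)).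
have E4 (y a b a' b' : R) : y * (a + c * b + (a' + c * b')) = y * (a + a') + c * (y * (b + b')) by ring.
exact: E4.
Qed.

End SecondDerivative.

Section MaxPrinciple.
Variables (R : realType) (mu : {sigma_finite_measure set (borelSL2 R) -> \bar R}).
Local Notation G := (borelSL2 R).
Local Notation H2 := (@upper_half_plane R).
Implicit Types (g h : G) (f u w : G -> R).

Lemma pow_quadratic (y : R) n : 0 <= y -> n%:R * (n%:R - 1) / 2 * y ^+ 2 <= (1 + y) ^+ n.
Proof.
move=> y0; suff : 1 + n%:R * y + n%:R * (n%:R - 1) / 2 * y ^+ 2 <= (1 + y) ^+ n.
  have ny : 0 <= n%:R * y :> R by rewrite mulr_ge0.
  by apply: le_trans; rewrite lerDr; lra.
elim: n => [|n IH]; first by rewrite expr0; lra.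
have y1 : 0 <= 1 + y by lra.
rewrite [(1 + y) ^+ _]exprS; apply: le_trans (ler_wpM2l y1 IH).
have : 0 <= n%:R * (n%:R - 1) / 2 * y ^+ 3.
  case: n {IH} => [|n]; first by rewrite mul0r mul0r mul0r.
  by rewrite mulr_ge0 ?exprn_ge0 // divr_ge0 // mulr_ge0 // subr_ge0 ler1n.
rewrite -(natr1 n); move: (n%:R : R) => a H; rewrite -subr_ge0.
by rewrite (_ : _ - _ = a * (a - 1) / 2 * y ^+ 3) //; field.
Qed.

Lemma unif_lincomb f u (c : R) : unif f -> unif u -> unif (fun g => f g + c * u g).
Proof.
move=> uf uu e e0; have c0 : 0 < `|c| + 1 by have := normr_ge0 c; lra.
have [x x0 Hx] := uf (e / 2) (divr_gt0 e0 (ltr0Sn R 1)).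
have [y y0 Hy] := uu (e / 2 / (`|c| + 1)) (divr_gt0 (divr_gt0 e0 (ltr0Sn R 1)) c0).
exists (Num.min x y) => [|g h H]; first by rewrite lt_min x0.
have m0 : 0 < Num.min x y by rewrite lt_min x0.
have H1 : HS2 h <= 2 + x ^+ 2.
  apply: (le_trans H); rewrite lerD2l lerXn2r ?nnegrE ?(ltW x0) ?(ltW m0) //; by rewrite ge_min lexx.
have H2 : HS2 h <= 2 + y ^+ 2.
  apply: (le_trans H); rewrite lerD2l lerXn2r ?nnegrE ?(ltW y0) ?(ltW m0) //; by rewrite ge_min lexx orbT.
rewrite opprD addrACA -mulrBr; apply: (le_trans (ler_normD _ _)); rewrite normrM.
have A := Hx g h H1; have B := Hy g h H2.
have : `|c| * `|u (g * h)%g - u g| <= e / 2.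
  apply: (@le_trans _ _ ((`|c| + 1) * (e / 2 / (`|c| + 1)))); last by rewrite mulrC divfK ?gt_eqF.
  by apply: ler_pM => //; rewrite lerDl.
by move: A; lra.
Qed.

Section Concentration.
Hypothesis Hmu : haar_measure mu.

(** Iterating [mS_rec] shows that the masses decrease only like [1/n], which the exponential
    concentration of the kernels has to beat. *)
Lemma mS_shift n : mS mu 5 * 4 = (n%:R + 4) * mS mu (n + 5).
Proof.
elim: n => [|n IH]; first by rewrite add0r mulrC.
rewrite IH addSn; have := @mS_rec R mu Hmu (n + 5)%N (leq_addl _ _).
rewrite -(natr1 n) natrD; move: (n%:R : R) (mS mu (n + 5)) (mS mu (n + 5).+1) => a b c E.
by rewrite (_ : a + 1 + 4 = a + 5%:R) ?E; ring.
Qed.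

(** The normalised kernels concentrate at the rotations: where [HS2 h] exceeds [2 + x^2] one has
    [X^n <= (1 + y)^(-n)], and this beats the linear growth of [mS 5 / mS (n + 5)]. *)
Lemma T_concentrate w (e : R) N0 : 0 < e -> mbounded w -> unif w ->
  exists2 N, (N0 <= N)%N & forall g, `|T mu N w g - w g| <= e.
Proof.
move=> e0 Hw uw; have [_ [M0 HM0]] := Hw; pose M := `|M0| + 1.
have M1 : 0 < M by rewrite /M; have := normr_ge0 M0; lra.
have HM x : `|w x| <= M by apply: (le_trans (HM0 x)); rewrite /M; have := ler_norm M0; lra.
have [x x0 Hx] := uw (e / 2) (divr_gt0 e0 (ltr0Sn R 1)).
pose y := x ^+ 2 / 4; have y0 : 0 < y by rewrite divr_gt0 // exprn_gt0.
pose m := Num.bound (4 * M / (e * y ^+ 2)); pose n := (m + N0 + 5)%N.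
have n1 : 4 * M / (e * y ^+ 2) <= n%:R - 1.
  have := archi_boundP (_ : 0 <= 4 * M / (e * y ^+ 2)); rewrite -/m => /(_ _) H.
  apply: (@le_trans _ _ m%:R); first by rewrite ltW // H // divr_ge0 ?mulr_ge0 ?exprn_ge0 // ltW.
  by rewrite /n !natrD; have := ler0n R N0; lra.
have n4 : 4 <= n%:R :> R by rewrite ler_nat /n; lia.
have S5 : (5 <= n + 5)%N by rewrite leq_addl.
have p0 := mS_gt0 Hmu (leqnn 5); have q0 := mS_gt0 Hmu S5.
exists (n + 5)%N => [|g]; first by rewrite /n; lia.
have Hk := weight_kX Hmu S5; have Hk5 := weight_kX Hmu (leqnn 5).
have -> : T mu (n + 5) w g - w g = wint mu (kX mu (n + 5)) (fun h => w (g * h)%g - w g).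
  rewrite /T /avg wintB //; [|exact: mbounded_translate|exact: mbounded_cst].
  by rewrite (wint_cst Hk) wint_kX1 // mulr1.
have Hb : mbounded (fun h => `|w (g * h)%g - w g|).
  by apply: mbounded_norm; apply: mboundedB; [exact: mbounded_translate|exact: mbounded_cst].
apply: (@le_trans _ _ (wint mu (kX mu (n + 5)) (fun h => `|w (g * h)%g - w g|))).
  by apply: wint_norm => //; apply: mboundedB; [exact: mbounded_translate|exact: mbounded_cst].
(* The far part is integrated against [kX 5] instead of [kX (n + 5)]: the quotient of these kernels
   is [X^n] times the quotient of the masses. *)
pose K := 2 * M * ((1 + y) ^- n * (mS mu 5 / mS mu (n + 5))).
have K0 : 0 <= K by rewrite !mulr_ge0 ?invr_ge0 ?exprn_ge0 // ?ltW //; lra.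
apply: (@le_trans _ _ (wint mu (kX mu (n + 5)) (fun=> e / 2) + wint mu (kX mu 5) (fun=> K))).
  have I1 := weight_integrable Hk (mbounded_cst G (e / 2)).
  have I2 := weight_integrable Hk5 (mbounded_cst G K).
  rewrite /wint -RintegralD //; apply: le_Rintegral => //; first exact: (weight_integrable Hk Hb).
    rewrite (_ : _ \o _ = (EFin \o (fun h => kX mu (n + 5) h * (e / 2))%R) \+ (EFin \o (fun h => kX mu 5 h * K)%R))%E.
      exact: integrableD.
    by apply/funext => h /=; rewrite EFinD.
  move=> h _ /=; have k0 := proj1 Hk h; have k50 := proj1 Hk5 h.
  case: (leP (HS2 h) (2 + x ^+ 2)) => Hh.
    by rewrite -[leLHS]addr0; apply: lerD; [apply: ler_wpM2l => //; exact: Hx|exact: mulr_ge0].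
  rewrite -[leLHS]add0r; apply: lerD; first by apply: mulr_ge0 => //; lra.
  have B : `|w (g * h)%g - w g| <= 2 * M.
    by rewrite mulrDl mul1r; apply: (le_trans (ler_normB _ _)); exact: lerD.
  have C : Xg h ^+ n <= (1 + y) ^- n.
    rewrite -exprVn lerXn2r ?nnegrE ?(ltW (Xg_gt0 _)) ?invr_ge0 //; first by lra.
    rewrite /Xg -[leRHS]mul1r ler_pdivrMr ?HS2_2_gt0 // mulrAC ler_pdivlMr; last by lra.
    by rewrite mul1r /y mulrDr mulr1 mulrCA divff // mulr1; lra.
  have X5 : 0 <= Xg h ^+ 5 by rewrite exprn_ge0 // ltW // Xg_gt0.
  pose Z := Xg h ^+ 5 * (2 * M) / mS mu (n + 5).
  have Z0 : 0 <= Z by apply: divr_ge0; [apply: mulr_ge0 => //; lra|exact: ltW].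
  have E1 : kX mu (n + 5) h * (2 * M) = Xg h ^+ n * Z by rewrite /kX /Z exprD; ring.
  have E2 : kX mu 5 h * K = (1 + y) ^- n * Z.
    have y1 : 1 + y != 0 by rewrite gt_eqF //; lra.
    by rewrite /kX /K /Z; field; rewrite !gt_eqF // exprn_gt0 //; lra.
  by apply: (le_trans (ler_wpM2l k0 B)); rewrite E1 E2; exact: ler_wpM2r.
rewrite (wint_cst Hk) (wint_cst Hk5) (wint_kX1 Hmu S5) (wint_kX1 Hmu (leqnn 5)) !mulr1.
have KK : K <= e / 2 -> e / 2 + K <= e by move=> ?; lra.
apply: KK.
have Y : 0 < (1 + y) ^+ n by rewrite exprn_gt0 //; lra.
rewrite /K (_ : mS mu 5 / mS mu (n + 5) = (n%:R + 4) / 4); last first.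
  by apply/eqP; rewrite eqr_div ?(gt_eqF q0) ?pnatr_eq0 //; apply/eqP; exact: mS_shift.
rewrite (_ : 2 * M * _ = (M * (n%:R + 4) / 2) / (1 + y) ^+ n); last by field; rewrite gt_eqF.
rewrite ler_pdivrMr //.
have P := @pow_quadratic y n (ltW y0).
apply: le_trans (ler_wpM2l (_ : 0 <= e / 2) P); last by lra.
move: n1; rewrite ler_pdivrMr; last by rewrite mulr_gt0 // exprn_gt0.
move: n4; move: (n%:R : R) => a a4 n1.
apply: (@le_trans _ _ (a / 4 * (4 * M))); first by nra.
apply: (@le_trans _ _ (a / 4 * ((a - 1) * (e * y ^+ 2)))); first by rewrite ler_wpM2l //; lra.
by rewrite le_eqVlt; apply/orP; left; apply/eqP; field.
Qed.

End Concentration.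
End MaxPrinciple.

(** * Averages of eigenfunctions, by the maximum principle *)

Section Factors.
Variable R : realType.

(** On an eigenfunction of the Laplacian with eigenvalue [l], the factor of [T S] divided by that of
    [T (S + m)], as predicted by [Delta T_S = S (S - 1) (T_(S+1) - T_S)]. *)
Fixpoint cmul (l : R) (m S : nat) : R :=
  if m is m'.+1 then S%:R * (S%:R - 1) / (S%:R * (S%:R - 1) + l) * cmul l m' S.+1 else 1.

Lemma cmul_gt0 (l : R) m S : 0 <= l -> (5 <= S)%N -> 0 < cmul l m S.
Proof.
move=> l0; elim: m S => [|m IH] S S5 //=.
have S0 : 0 < S%:R * (S%:R - 1) :> R by rewrite mulr_gt0 ?subr_gt0 ?ltr0n ?ltr1n //; lia.
by rewrite mulr_gt0 ?IH ?(leqW S5) // divr_gt0 // ltr_wpDr.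
Qed.

(** The product of the [1 + l / (S (S - 1))] dominates 1 plus the sum, and the sum telescopes. For
    [S = 6] and [m] tending to infinity this is the bound [1 / (1 + l/5)]. *)
Lemma cmul_le (l : R) m S : 0 <= l -> (5 <= S)%N ->
  cmul l m S * (1 + l * ((S%:R - 1)^-1 - (S%:R + m%:R - 1)^-1)) <= 1.
Proof.
move=> l0; elim: m S => [|m IH] S S5 /=; first by rewrite addr0 subrr mulr0 addr0 mulr1.
have a5 : 5 <= S%:R :> R by rewrite ler_nat.
have := IH S.+1 (leqW S5); have := cmul_gt0 m l0 (leqW S5); move: (cmul l m S.+1) => c c0.
rewrite -(natr1 S) -(natr1 m) addrK (_ : S%:R + 1 + m%:R - 1 = S%:R + m%:R); last by ring.
rewrite (_ : S%:R + (m%:R + 1) - 1 = S%:R + m%:R); last by ring.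
have b0 : 0 <= m%:R :> R by [].
move: a5 b0; move: (S%:R : R) (m%:R : R) => a b a5 b0 Hc.
apply: le_trans Hc; rewrite mulrAC mulrC ler_pM2l //.
have d0 : 0 < a * (a - 1) by rewrite mulr_gt0 //; lra.
rewrite mulrAC ler_pdivrMr; last by lra.
pose x := a^-1; pose q := (a + b)^-1.
have q0 : 0 <= q by rewrite invr_ge0; lra.
have qx : q <= x by rewrite lef_pV2 ?posrE; lra.
have E : (a - 1)^-1 = x + (a * (a - 1))^-1 by rewrite /x; field; rewrite !gt_eqF //; lra.
rewrite E -/x -/q; set p := (a * (a - 1))^-1.
have pd : a * (a - 1) * p = 1 by rewrite divff // gt_eqF.
rewrite (_ : _ * (1 + l * (x + p - q)) = a * (a - 1) * (1 + l * (x - q)) + l * (a * (a - 1) * p)); last by ring.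
rewrite pd mulr1 -subr_ge0.
rewrite (_ : _ - _ = l * (l * (x - q))); last by ring.
by rewrite !mulr_ge0 // subr_ge0.
Qed.

End Factors.

Section Eigenfunction.
Variables (R : realType) (mu : {sigma_finite_measure set (borelSL2 R) -> \bar R}).
Local Notation G := (borelSL2 R).
Local Notation H2 := (@upper_half_plane R).
Implicit Types (g h : G) (f u : G -> R).
Variables (Gam : set (SL2 R)) (D : set G) (v e0 rho : R).
Hypothesis L : lattice mu Gam D v e0 rho.
Let Hmu := lat_haar L.

Lemma attains_max f : ginv Gam f -> unif f -> exists g0, forall g, f g <= f g0.
Proof.
move=> fi uf; have [||g0 _ H] := @compact_EVT_max _ R (f : SL2 R -> R) _ _ (@compact_HS2_ball R rho).
- by have [c _ Hc] := lat_cocompact L 1%g; exists (c * 1)%g.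
- by apply: continuous_subspaceT; exact: unif_continuous.
exists g0 => g; have [c Gc Hc] := lat_cocompact L g; rewrite -(fi c g Gc); apply: H.
by rewrite inE.
Qed.

Lemma ginv_T S f : ginv Gam f -> ginv Gam (T mu S f).
Proof. by move=> fi c g Gc; apply: avg_inv => x; exact: fi. Qed.

Lemma TZ S f c : (5 <= S)%N -> mbounded f -> T mu S (fun x => c * f x) = fun g => c * T mu S f g.
Proof. by move=> S5 Hf; apply/funext => g; exact: (avgZ (weight_kX Hmu S5)). Qed.

Lemma unif_T S f : (5 <= S)%N -> mbounded f -> unif (T mu S f).
Proof.
move=> S5 Hf e e0'; have [_ [M HM]] := Hf; have [x x0 Hx] := @T_unif R mu Hmu S M e S5 e0'.
by exists x => // g h Hh; exact: Hx.
Qed.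

Lemma unifZ f (c : R) : unif f -> unif (fun g => c * f g).
Proof.
move=> uf; have -> : (fun g => c * f g) = (fun g => 0 + c * f g) by apply/funext => g; rewrite add0r.
by apply: unif_lincomb => // e e0'; exists 1 => // g h _; rewrite subrr normr0 ltW.
Qed.

Section Fixed.
Variables (w : G -> R) (lam : R).
Let W z := w (gz z).
Hypotheses (Hw : mbounded w) (wi : ginv Gam w) (uw : unif w) (smooth_W : smooth_on_H2 W)
  (laplace_W : forall z, H2 z -> laplace_beltrami W z = lam * W z).

Let W_moebius g : W (moebius g (zi R)) = w g.
Proof. by rewrite /W -rotation_invariant //; exact: unif_rotr uw. Qed.

(** At a maximum of [T S w - c w] the positive Laplacian of this function is nonnegative. The
    relation between [c] and [c'] makes it [S (S - 1)] times the difference of the two quantities to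
    be compared there. *)
Lemma eigen_step S c c' M : (6 <= S)%N -> c * (S%:R * (S%:R - 1) + lam) = S%:R * (S%:R - 1) * c' ->
  (forall g, T mu S.+1 w g - c' * w g <= M) -> forall g, T mu S w g - c * w g <= M.
Proof.
move=> S6 Ec HM g; have S5 : (5 <= S)%N by exact: ltnW.
pose f g := T mu S w g + (- c) * w g.
have uf : unif f by apply: unif_lincomb; [exact: unif_T|exact: uw].
have fi : ginv Gam f by move=> c0 x Gc; rewrite /f wi // ginv_T.
have [g0 Hg0] := attains_max fi uf.
suff : f g0 <= M by move=> H; apply: le_trans H; rewrite -mulNr; exact: Hg0.
pose z0 := moebius g0 (zi R); have Hz0 : H2 z0 by exact: moebius_H2 (H2i R).
have Ef z : f (gz z) = TT mu S w z + (- c) * W z by [].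
have Ez : f g0 = f (gz z0) by apply: (@rotation_invariant _ f) => x k Hk; exact: (unif_rotr uf).
have Cf : Cn_on_H2 2 (fun z => TT mu S w z + (- c) * W z).
  by apply: Cn_lincomb; [exact: smooth_TT|exact: smooth_W].
have H : forall u : R * R, H2 u -> TT mu S w u + - c * W u <= TT mu S w z0 + - c * W z0.
  by move=> u Hu; rewrite -!Ef -Ez; exact: Hg0.
have S0 : 0 < S%:R * (S%:R - 1) :> R by rewrite mulr_gt0 ?subr_gt0 ?ltr0n ?ltr1n //; lia.
have := HM (gz z0); rewrite Ez Ef -/(TT mu S.+1 w z0) -/(W z0).
have := laplace_at_max Cf Hz0 H; rewrite (laplace_lincomb (- c) (smooth_TT Hmu S5 Hw 2) (smooth_W 2) Hz0).
rewrite (laplace_TT Hmu S5 Hw Hz0) (laplace_W Hz0).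
move: (TT mu S w z0) (TT mu S.+1 w z0) (W z0) => p q r A B.
move: A; rewrite (_ : _ + _ = S%:R * (S%:R - 1) * (q - c' * r - (p - c * r)) + (S%:R * (S%:R - 1) * c' - c * (S%:R * (S%:R - 1) + lam)) * r); last by ring.
by rewrite Ec subrr mul0r addr0 pmulr_rge0 //; lra.
Qed.

Lemma eigen_nonneg_pos : (exists g, 0 < w g) -> 0 <= lam.
Proof.
move=> [g1 Hg1]; have [g0 Hg0] := attains_max wi uw.
pose z0 := moebius g0 (zi R); have Hz0 : H2 z0 by exact: moebius_H2 (H2i R).
have Ez : w g0 = W z0 by rewrite -(W_moebius g0).
have := @laplace_at_max _ W z0 (smooth_W 2) Hz0; rewrite laplace_W // -Ez => H.
by rewrite -(pmulr_lge0 _ (lt_le_trans Hg1 (Hg0 g1))); apply: H => z _; exact: Hg0.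
Qed.

Lemma eigen_descent m S M : 0 <= lam -> (6 <= S)%N -> (forall g, T mu (S + m) w g - w g <= M) ->
  forall g, T mu S w g - cmul lam m S * w g <= M.
Proof.
move=> l0; elim: m S => [|m IH] S S6 H g; first by have := H g; rewrite addn0 /= mul1r.
have S0 : 0 < S%:R * (S%:R - 1) :> R by rewrite mulr_gt0 ?subr_gt0 ?ltr0n ?ltr1n //; lia.
apply: (eigen_step S6 (c' := cmul lam m S.+1)) => [|x].
  by rewrite /= mulrAC divfK // gt_eqF // ltr_wpDr.
by apply: IH (leqW S6) _ _ => y; rewrite addSnnS.
Qed.

End Fixed.

Section Eigenvalue.
Variables (w : G -> R) (lam : R).
Hypotheses (Hw : mbounded w) (wi : ginv Gam w) (uw : unif w) (smooth_W : smooth_on_H2 (fun z => w (gz z)))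
  (laplace_W : forall z, H2 z -> laplace_beltrami (fun z => w (gz z)) z = lam * w (gz z))
  (w0 : exists g, w g != 0).
(** The function [- w], written as a linear combination so that the lemmas on these apply. *)
Let nw g := w g + (- 2) * w g.

Let nwE g : nw g = - w g. Proof. by rewrite /nw; ring. Qed.
Let Hn : mbounded nw. Proof. by apply: mboundedD => //; exact: mboundedZ. Qed.
Let ni : ginv Gam nw. Proof. by move=> c g Gc; rewrite /nw wi. Qed.
Let un : unif nw. Proof. exact: unif_lincomb. Qed.
Let sn : smooth_on_H2 (fun z => nw (gz z)).
Proof. by move=> n; apply: Cn_lincomb; exact: smooth_W. Qed.
Let ln z : H2 z -> laplace_beltrami (fun z => nw (gz z)) z = lam * nw (gz z).
Proof. by move=> Hz; rewrite (laplace_lincomb (-2) (smooth_W 2) (smooth_W 2) Hz) laplace_W // /nw; ring. Qed.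

Lemma eigen_nonneg : 0 <= lam.
Proof.
have [g Hg] := w0; case: (ltrgtP (w g) 0) => H; last by rewrite H eqxx in Hg.
- by apply: (eigen_nonneg_pos ni un sn ln); exists g; rewrite nwE oppr_gt0.
- by apply: (eigen_nonneg_pos wi uw smooth_W laplace_W); exists g.
Qed.

(** [T N w] is close to [w] for large [N]; descending from [N] to 6, for [w] and for [- w], traps
    [T 6 w] near a multiple of [w]. *)
Lemma eigen_close (eta : R) m0 : 0 < eta ->
  exists2 m, (m0 <= m)%N & forall g, `|T mu 6 w g - cmul lam m 6 * w g| <= eta.
Proof.
move=> e0'; have l0 := eigen_nonneg; have [N HN H] := T_concentrate Hmu (m0 + 6) e0' Hw uw.
exists (N - 6)%N => [|g]; first by lia.
have E : (6 + (N - 6))%N = N by lia.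
rewrite ler_norml; apply/andP; split.
- have A : T mu 6 nw g - cmul lam (N - 6) 6 * nw g <= eta.
    apply: (eigen_descent Hn ni un sn ln l0 (leqnn 6)) => x; rewrite E nwE.
    rewrite (TD Hmu) //; last by lia.
    by have := H x; rewrite ler_norml => /andP[]; lra.
  by move: A; rewrite (TD Hmu) // nwE; move: (cmul _ _ _) => y; lra.
- apply: (eigen_descent Hw wi uw smooth_W laplace_W l0 (leqnn 6)) => x; rewrite E.
  by have := H x; rewrite ler_norml => /andP[].
Qed.

End Eigenvalue.

Section CommonEigenvector.
Variables (w : G -> R) (tau tau7 : R).
Hypotheses (Hw : mbounded w) (wi : ginv Gam w) (T6 : forall g, T mu 6 w g = tau * w g)
  (T7 : forall g, T mu 7 w g = tau7 * w g) (t0 : tau != 0) (w0 : exists g, w g != 0).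
Let lam := 30 * (tau7 / tau - 1).
Let w' := fun g => tau^-1 * w g.

Let Hw' : mbounded w'. Proof. exact: mboundedZ. Qed.

Let wE : w = T mu 6 w'.
Proof. by rewrite TZ //; apply/funext => g; rewrite T6 mulrA mulVf // mul1r. Qed.

Let uw : unif w. Proof. by rewrite wE; exact: unif_T. Qed.

Let W z := w (gz z).

Let WE : W = TT mu 6 w'.
Proof. by apply/funext => z; rewrite /W wE. Qed.

Let smooth_W : smooth_on_H2 W.
Proof. by rewrite WE; exact: smooth_TT. Qed.

Let laplace_W z : H2 z -> laplace_beltrami W z = lam * W z.
Proof.
move=> Hz; rewrite WE laplace_TT // -WE /TT TZ // T7 /W /lam.
by move: (w _) => a; field.
Qed.

Lemma eigen_laplace : laplace_eigenvalue Gam lam.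
Proof.
exists W; split => //.
- move=> g z Gg Hz; rewrite /W; have [k Hk E] := gz_moebius g Hz.
  by rewrite -(unif_rotr uw (gz (moebius g z)) Hk) -E wi.
- have [g Hg] := w0; exists (moebius g (zi R)); first exact: moebius_H2 (H2i R).
  by rewrite /W -rotation_invariant //; exact: unif_rotr uw.
Qed.

Lemma common_nonneg : 0 <= lam.
Proof. exact: eigen_nonneg wi uw smooth_W laplace_W w0. Qed.

Let tau_close (eta : R) m0 : 0 < eta -> exists2 m, (m0 <= m)%N & `|tau - cmul lam m 6| <= eta.
Proof.
move=> e0'; have [g Hg] := w0; have w1 : 0 < `|w g| by rewrite normr_gt0.
have [m Hm H] := eigen_close Hw wi uw smooth_W laplace_W w0 m0 (mulr_gt0 e0' w1).
by exists m => //; rewrite -(ler_pM2r w1) -normrM mulrBl -T6.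
Qed.

(** [tau] is approximated by [cmul lam m 6] with [m] arbitrarily large, and [cmul_le] bounds these
    products. *)
Lemma eigen_contraction : `|tau| * (1 + lam / 5) <= 1.
Proof.
have l0 := common_nonneg; apply/ler_addgt0Pl => e e1.
pose eta := e / (2 + lam / 5); have d0 : 0 < 2 + lam / 5 by lra.
have eta0 : 0 < eta by rewrite divr_gt0.
have [m Hm Hc] := tau_close (Num.bound (lam / eta)) eta0.
have K (a b : R) : a = 5 -> b = 5 + m%:R -> cmul lam m 6 * (1 + lam * (a^-1 - b^-1)) <= 1 ->
    cmul lam m 6 * (1 + lam * (5^-1 - (5 + m%:R)^-1)) <= 1 by move=> -> ->.
have := @cmul_gt0 R lam m 6 l0 (leqW (leqnn 5)).
have : cmul lam m 6 * (1 + lam * (5^-1 - (5 + m%:R)^-1)) <= 1.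
  by apply: K (@cmul_le R lam m 6 l0 (leqW (leqnn 5))); ring.
have m1 : lam / eta < m%:R.
  have := archi_boundP (_ : 0 <= lam / eta) => /(_ (divr_ge0 l0 (ltW eta0))) H.
  by apply: (lt_le_trans H); rewrite ler_nat.
have b0 : 0 <= m%:R :> R by [].
move: Hc m1 b0; move: (cmul lam m 6) (m%:R : R) => c b Hc m1 b0 C1 c0.
have m2 : lam * (5 + b)^-1 <= eta.
  rewrite ler_pdivrMr; last by lra.
  move: m1; rewrite ltr_pdivrMr // mulrDr; nra.
have q1 : (5 + b)^-1 <= 5^-1 by rewrite lef_pV2 ?posrE; lra.
have c1 : c <= 1.
  have : 0 <= lam * (5^-1 - (5 + b)^-1) by rewrite mulr_ge0 // subr_ge0.
  by nra.
have tc : `|tau| <= c + eta.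
  have := ler_normD (tau - c) c; rewrite subrK (gtr0_norm c0) => H; apply: (le_trans H); lra.
have A : c * (1 + lam / 5) <= 1 + eta.
  have -> : c * (1 + lam / 5) = c * (1 + lam * (5^-1 - (5 + b)^-1)) + c * (lam * (5 + b)^-1) by ring.
  have : c * (lam * (5 + b)^-1) <= 1 * eta by apply: ler_pM; rewrite ?(ltW c0) // mulr_ge0 // invr_ge0; lra.
  lra.
have ee : eta * (2 + lam / 5) = e by rewrite divfK // gt_eqF.
have : `|tau| * (1 + lam / 5) <= (c + eta) * (1 + lam / 5) by apply: ler_wpM2r => //; lra.
lra.
Qed.

(** For [lam = 0] the products are 1, so [tau = 1]. Then the maximum of [w] minus [w] is a
    nonnegative function fixed by [T 6] with a zero, and Harnack's inequality makes it vanish. *)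
Lemma eigen0_const : lam = 0 -> exists c, forall g, w g = c.
Proof.
move=> lz; have c1 m S : (6 <= S)%N -> cmul 0 m S = 1.
  elim: m S => [|m IH] S S6 //=; rewrite IH ?(leqW S6) // addr0 mulr1 divff //.
  by rewrite gt_eqF // mulr_gt0 ?subr_gt0 ?ltr0n ?ltr1n //; lia.
have t1 : tau = 1.
  apply/eqP; rewrite -subr_eq0 -normr_le0; apply/ler_addgt0Pl => e /(tau_close 0)[m _].
  by rewrite lz c1 // addr0.
have [g0 Hg0] := attains_max wi uw; exists (w g0) => g.
pose f x := w g0 + -1 * w x.
have Hf : mbounded f by apply: mboundedD; [exact: mbounded_cst|exact: mboundedZ].
have f0 x : 0 <= f x by rewrite /f mulN1r subr_ge0.
have Tf x : T mu 6 f x = f x.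
  by rewrite /f (TD Hmu) ?T_cst ?T6 ?t1 ?mul1r //; exact: mbounded_cst.
pose b := (g^-1 * g0)%g.
have b1 : 1 <= HS2 b by have := HS2_ge2 b; lra.
have := T_harnack Hmu (S := 6) (b := b) isT b1 (fun x => _) Hf f0 g.
rewrite !Tf /b mulVKg {2}/f mulN1r subrr mulr0 => H.
have {}H : f g <= 0 by apply: H => x; rewrite mulrC HS2M.
by apply/eqP; rewrite eq_sym -subr_eq0 -mulN1r -/(f g) eq_le H f0.
Qed.

End CommonEigenvector.
End Eigenfunction.

(** * The spectral gap *)

Lemma ultra_fmap (T : Type) (F : set_system nat) (f : nat -> T) : UltraFilter F -> UltraFilter (f @ F).
Proof.
move=> FU; split=> [|H HP sH]; first exact: fmap_proper_filter.
apply/seteqP; split=> // A HA; apply: contrapT => nA.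
have : F (f @^-1` (~` A)) by have [|] := in_ultra_setVsetC (f @^-1` A) FU.
by move=> /sH HnA; have := filter_ex (filterI HA HnA) => -[x []].
Qed.

Section Spectral.
Variables (R : realType) (mu : {sigma_finite_measure set (borelSL2 R) -> \bar R}).
Local Notation G := (borelSL2 R).
Implicit Types (g h : G) (f u w : G -> R).
Variables (Gam : set (SL2 R)) (D : set G) (v e0 rho : R).
Hypothesis L : lattice mu Gam D v e0 rho.
Let Hmu := lat_haar L.
Local Notation Tm S := (T mu S).

Definition Hs f := mbounded f /\ ginv Gam f.
Definition ip f u := ID mu D (fun g => f g * u g).

Lemma Hs_T S f : (5 <= S)%N -> Hs f -> Hs (Tm S f).
Proof. by move=> S5 [Hf fi]; split; [exact: mbounded_T|exact: ginv_T]. Qed.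

Lemma Hs_lin f u c : Hs f -> Hs u -> Hs (fun g => f g + c * u g).
Proof.
move=> [Hf fi] [Hu ui]; split; first by apply: mboundedD => //; exact: mboundedZ.
by move=> x g Gx; rewrite fi // ui.
Qed.

Lemma Hs_cst c : Hs (fun=> c). Proof. by split; first exact: mbounded_cst. Qed.

Lemma ipC f u : ip f u = ip u f.
Proof. by apply: (eq_wint (weight_D L)) => g _; rewrite mulrC. Qed.

Lemma ip_linl f u c w : Hs f -> Hs u -> Hs w -> ip (fun g => f g + c * u g) w = ip f w + c * ip u w.
Proof.
move=> [Hf _] [Hu _] [Hw _]; rewrite /ip /ID -(wintZ (weight_D L)); last exact: mboundedM.
rewrite -(wintD (weight_D L)); [|exact: mboundedM|by apply: mboundedZ; exact: mboundedM].
by apply: (eq_wint (weight_D L)) => g _; ring.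
Qed.

Lemma ip_linr f u c w : Hs f -> Hs u -> Hs w -> ip w (fun g => f g + c * u g) = ip w f + c * ip w u.
Proof. by move=> *; rewrite ipC ip_linl // !(ipC w). Qed.

Lemma ip_ge0 f : 0 <= ip f f.
Proof. by apply: (wint_ge0 (weight_D L)) => g _; rewrite -expr2 sqr_ge0. Qed.

Lemma ip_cauchy_schwarz f u : Hs f -> Hs u -> ip f u ^+ 2 <= ip f f * ip u u.
Proof. by move=> [Hf _] [Hu _]; exact: (wint_cauchy_schwarz (weight_D L)). Qed.

Lemma v_gt0 : 0 < v.
Proof.
have := Bin_le_v L; rewrite -lte_fin; apply: lt_le_trans; apply: near1_gt0 => //.
by have := lat_e0_gt0 L; rewrite /Bin => ?; rewrite divr_gt0.
Qed.

Lemma ip_sup f u (a b : R) : Hs f -> Hs u -> (forall x, `|f x| <= a) -> (forall x, `|u x| <= b) -> `|ip f u| <= v * (a * b).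
Proof.
move=> [Hf _] [Hu _] fa ub; have Hfu := mboundedM Hf Hu.
apply: (le_trans (wint_norm (weight_D L) Hfu)).
have -> : v * (a * b) = wint mu \1_D (fun=> a * b) by rewrite (wint_cst (weight_D L)) -/(ID mu D _) (ID1 L) mulrC.
apply: (le_wint (weight_D L)) => [||x _]; [exact: mbounded_norm|exact: mbounded_cst|].
by rewrite normrM ler_pM.
Qed.

Lemma T_sym S f u : (5 <= S)%N -> Hs f -> Hs u -> ip (Tm S f) u = ip f (Tm S u).
Proof. by move=> S5 [Hf fi] [Hu ui]; exact: (avg_sym L (weight_kX Hmu S5) (@kXV _ mu S)). Qed.

Lemma T_jensen S f g : (5 <= S)%N -> mbounded f -> Tm S f g ^+ 2 <= Tm S (fun x => f x * f x) g.
Proof.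
move=> S5 Hf; have Hk := weight_kX Hmu S5; have Ht := mbounded_translate g Hf.
have := wint_cauchy_schwarz Hk Ht (mbounded_cst G 1).
rewrite (_ : wint mu (kX mu S) (fun x => 1 ^+ 2) = 1); last first.
  by rewrite -[RHS](wint_kX1 Hmu S5); apply: (eq_wint Hk) => x _; exact: expr1n.
rewrite mulr1 /T /avg => H; apply: le_trans H.
by rewrite le_eqVlt; apply/orP; left; apply/eqP; congr (_ ^+ 2); apply: (eq_wint Hk) => x _; rewrite mulr1.
Qed.

Lemma T_contr S f : (5 <= S)%N -> Hs f -> ip (Tm S f) (Tm S f) <= ip f f.
Proof.
move=> S5 Hf'; have [Hf fi] := Hf'; have Hff : Hs (fun x => f x * f x) by split; [exact: mboundedM|move=> c g Gc; rewrite fi].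
have HT := Hs_T S5 Hff.
have -> : ip f f = ip (Tm S (fun x => f x * f x)) (fun=> 1).
  rewrite T_sym //; last exact: Hs_cst.
  by apply: (eq_wint (weight_D L)) => g _; rewrite T_cst // mulr1.
apply: (le_wint (weight_D L)) => [||g _]; first by apply: mboundedM; exact: mbounded_T.
  by apply: mboundedM; [exact: HT.1|exact: mbounded_cst].
by rewrite mulr1 -expr2 T_jensen.
Qed.

(** Harnack's inequality replaces the value at [g] by the values on [g Bin], and [fold_le_real]
    bounds the integral over this set by the integral over the quotient. *)
Lemma T_sup S : (5 <= S)%N -> exists2 K, 0 < K & forall f, Hs f -> forall g, `|Tm S f g| <= K * ID mu D (fun x => `|f x|).
Proof.
move=> S5; have h1 := lat_e0_gt0 L; have h2 := lat_e0_le1 L.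
have e16 : e0 / 16 <= 1 by lra.
have B0 : (0 < mu (Bin e0))%E by apply: near1_gt0 => //; rewrite divr_gt0.
have Bf : (mu (Bin e0) < +oo)%E by exact: near1_fin.
have HB := weight_indic (measurable_Bin e0) Bf.
pose m := wint mu (\1_(Bin e0)) (fun=> 1 : R).
have m0 : 0 < m.
  rewrite -lte_fin /m (wint_EFin HB); last exact: mbounded_cst.
  suff -> : (\int[mu]_x (\1_(Bin e0) x * 1)%:E)%E = mu (Bin e0) by [].
  rewrite -[X in mu X]setIT -integral_indic //; last exact: measurable_Bin.
  by apply: eq_integral => h _; rewrite mulr1.
exists (10 ^+ S / m) => [|f [Hf fi] g]; first by rewrite divr_gt0 ?exprn_gt0.
have Hn := mbounded_norm Hf; have ni : ginv Gam (fun x => `|f x|) by move=> c x Gc; rewrite fi.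
apply: (le_trans (T_norm_le Hmu _ S5 Hf)).
have HT := mbounded_T Hmu S5 Hn.
rewrite mulrAC ler_pdivlMr // mulrC.
have -> : m * Tm S (fun x => `|f x|) g = wint mu \1_(Bin e0) (fun=> Tm S (fun x => `|f x|) g).
  by rewrite (wint_cst HB) mulrC.
apply: (@le_trans _ _ (wint mu \1_(Bin e0) (fun h => 10 ^+ S * Tm S (fun x => `|f x|) (g * h)%g))).
  apply: (le_wint HB) => [||h]; first exact: mbounded_cst.
    by apply: mboundedZ; exact: (mbounded_translate g).
  rewrite indicE; case: (boolP (h \in Bin e0)); rewrite ?ltxx // inE => hB _.
  have h10 : HS2 h <= 10 by exact: near1_bounded e16 _ hB.
  apply: (T_harnack Hmu) => // [|x]; first by lra.
  by apply: (le_trans (HS2M _ _)); rewrite mulrC ler_wpM2r // ltW // HS2_gt0.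
rewrite (wintZ HB); last exact: (mbounded_translate g).
rewrite ler_wpM2l ?exprn_ge0 //.
apply: (le_trans (fold_le_real L g HT _ (ginv_T mu S ni))).
  by move=> x; apply: (wint_ge0 (weight_kX Hmu S5)) => y _.
have -> : ID mu D (Tm S (fun x => `|f x|)) = ip (Tm S (fun x => `|f x|)) (fun=> 1).
  by apply: (eq_wint (weight_D L)) => x _; rewrite mulr1.
rewrite T_sym //; last exact: Hs_cst.
rewrite le_eqVlt; apply/orP; left; apply/eqP.
by apply: (eq_wint (weight_D L)) => x _; rewrite T_cst // mulr1.
Qed.

Lemma T_sup2 S : (5 <= S)%N -> exists2 K, 0 < K & forall f, Hs f -> forall g, Tm S f g ^+ 2 <= K * ip f f.
Proof.
move=> S5; have [K K0 HK] := T_sup S5; have v0 := v_gt0.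
exists (K ^+ 2 * v) => [|f Hf g]; first by rewrite mulr_gt0 ?exprn_gt0.
have Hn : Hs (fun x => `|f x|) by split; [exact: mbounded_norm Hf.1|move=> c x Gc; rewrite Hf.2].
have H1 : ID mu D (fun x => `|f x|) ^+ 2 <= v * ip f f.
  have := ip_cauchy_schwarz Hn (Hs_cst 1).
  rewrite (_ : ip _ (fun=> 1) = ID mu D (fun x => `|f x|)); last by apply: (eq_wint (weight_D L)) => x _; rewrite mulr1.
  rewrite (_ : ip (fun=> 1) _ = v); last by rewrite -(ID1 L); apply: (eq_wint (weight_D L)) => x _; rewrite mulr1.
  rewrite (_ : ip (fun x => `|f x|) _ = ip f f) 1?mulrC //.
  by apply: (eq_wint (weight_D L)) => x _; rewrite -normrM ger0_norm // -expr2 sqr_ge0.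
have a0 : 0 <= ID mu D (fun x => `|f x|) by apply: (wint_ge0 (weight_D L)).
rewrite -mulrA -real_normK ?num_real //.
apply: (@le_trans _ _ (K ^+ 2 * ID mu D (fun x => `|f x|) ^+ 2)); last by rewrite ler_wpM2l ?sqr_ge0.
by rewrite -exprMn lerXn2r ?nnegrE ?mulr_ge0 ?(ltW K0) //; exact: HK.
Qed.

(** Arzela-Ascoli along an ultrafilter: pointwise limits exist, and equicontinuity over the compact
    set of representatives makes the convergence uniform. *)
Lemma ultra_limit (u_ : nat -> G -> R) (M : R) : (forall n, ginv Gam (u_ n)) -> (forall n g, `|u_ n g| <= M) ->
  (forall e : R, 0 < e -> exists2 x : R, 0 < x & forall n g h, HS2 h <= 2 + x ^+ 2 -> `|u_ n (g * h)%g - u_ n g| <= e) ->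
  exists2 u, ginv Gam u & forall (e : R) N, 0 < e -> exists2 n, (N <= n)%N & forall g, `|u_ n g - u g| <= e.
Proof.
move=> ui uM equi; have [F [FU Fe]] := ultraFilterLemma (F := \oo) _.
have lim g : exists l : R, u_ n g @[n --> F] --> l.
  have UF := ultra_fmap (fun n => u_ n g) FU.
  have : compact (`[- M, M]%classic : set R) by exact: segment_compact.
  rewrite compact_ultra => /(_ _ UF)[|l [_ Hl]]; last by exists l.
  have : F [set n | (`[- M, M]%classic : set R) (u_ n g)]; last by [].
  by apply: filterE => n /=; have := uM n g; rewrite in_itv /= ler_norml.
pose u g := projT1 (cid (lim g)).
have Hu g : u_ n g @[n --> F] --> u g by exact: projT2 (cid (lim g)).
have near1 g e : 0 < e -> \forall n \near F, `|u g - u_ n g| <= e by move=> ee; move/cvgrPdist_le: (Hu g) => /(_ e ee).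
have uinv : ginv Gam u.
  move=> c g Gc; apply: (cvg_unique _ (Hu (c * g)%g)) => //.
  have E : (fun n => u_ n (c * g)%g) = (fun n => u_ n g) by apply/funext => n; rewrite ui.
  by rewrite /= E; exact: Hu.
exists u => // e N ee; have e4 : 0 < e / 5 by rewrite divr_gt0.
have [x x0 Hx] := equi _ e4.
have uequi g h : HS2 h <= 2 + x ^+ 2 -> `|u (g * h)%g - u g| <= e / 5 * 3.
  move=> Hh; have := near1 g _ e4; have := near1 (g * h)%g _ e4 => A B.
  have [n [An Bn]] := filter_ex (filterI A B).
  have := Hx n g h Hh; move: An Bn; rewrite !ler_norml => /andP[? ?] /andP[? ?] /andP[? ?].
  by apply/andP; split; lra.
have comp := @compact_HS2_ball R rho; move/compact_near_coveringP: comp => comp.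
have HF : \forall n \near F, [set g : SL2 R | HS2 g <= rho] `<=` (fun g => `|u_ n g - u g| <= e).
  apply: (comp nat F (fun n g => `|u_ n g - u g| <= e)) => g _.
  exists ([set h : SL2 R | HS2 (g^-1 * h)%g <= 2 + x ^+ 2], [set n | `|u g - u_ n g| <= e / 5]).
    by split; [exact: nbhs_HS2|exact: near1].
  move=> [h n] /= [Hh Hn]; have := Hx n g _ Hh; have := uequi g _ Hh; rewrite mulVKg.
  by move: Hn; rewrite !ler_norml => /andP[? ?] /andP[? ?] /andP[? ?]; apply/andP; split; lra.
have FN : F [set n | (N <= n)%N] by apply: Fe; exists N.
have [n [Hn nN]] := filter_ex (filterI HF FN); exists n => // g.
have [c Gc Hc] := lat_cocompact L g.
by have := Hn _ Hc; rewrite ui // uinv.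
Qed.

Lemma mbounded_unif_limit u : (forall e : R, 0 < e -> exists2 f, mbounded f & forall g, `|u g - f g| <= e) -> mbounded u.
Proof.
move=> H; have /choice[f Hf] : forall n : nat, exists f : G -> R, mbounded f /\ forall g, `|u g - f g| <= (n.+1%:R : R)^-1.
  move=> n; by have [|f Hf Hu] := H (n.+1%:R^-1); [by rewrite invr_gt0|exists f].
split; last first.
  have [[_ [M HM]] Hu] := Hf 0%N; exists (M + 1) => g.
  have := Hu g; have := HM g; have := ler_normD (f 0%N g) (u g - f 0%N g); rewrite addrC subrK invr1; lra.
apply: (@measurable_fun_cvg _ _ _ setT f u) => [n|g _]; first exact: (Hf n).1.1.
apply/cvgrPdist_le => e ee; near=> n; have [_ Hu] := Hf n; apply: (le_trans (Hu g)).
rewrite invf_ple ?posrE //; apply: (@le_trans _ _ n%:R); last by rewrite ler_nat.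
by near: n; exact: nbhs_infty_ger.
Unshelve. all: end_near. Qed.

Lemma T_unif2 S (e : R) : (5 <= S)%N -> 0 < e -> exists2 x : R, 0 < x &
  forall f, Hs f -> ip f f = 1 -> forall g h, HS2 h <= 2 + x ^+ 2 -> `|Tm S f (g * h)%g - Tm S f g| <= e.
Proof.
move=> S5 ee; have [K K0 HK] := T_sup2 S5; pose s := Num.sqrt K; have s0 : 0 < s by rewrite sqrtr_gt0.
have [x /andP[x0 x1] Hx] := exp_sub1_small S (divr_gt0 ee s0).
exists x => // f Hf nf g h Hh; have c1 : 1 <= (1 + x) ^+ 2 by nra.
apply: (le_trans (T_equi Hmu S5 c1 _ _ Hf.1 g)); try by move=> y; apply: HS2_mulr_le; rewrite ?HS2V // ltW.
have a0 : 0 <= ((1 + x) ^+ 2) ^+ S - 1 by rewrite subr_ge0 exprn_ege1.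
have Hn : Hs (fun x => `|f x|) by split; [exact: mbounded_norm Hf.1|move=> c y Gc; rewrite Hf.2].
have nn : ip (fun x => `|f x|) (fun x => `|f x|) = 1.
  by rewrite -nf; apply: (eq_wint (weight_D L)) => y _; rewrite -normrM ger0_norm // -expr2 sqr_ge0.
have b0 : Tm S (fun x => `|f x|) g <= s.
  apply: (le_trans (ler_norm _)).
  rewrite -(ler_pXn2r (_ : 0 < 2)%N) ?nnegrE ?sqrtr_ge0 // real_normK ?num_real // sqr_sqrtr; last exact: ltW.
  by have := HK _ Hn g; rewrite nn mulr1.
apply: (@le_trans _ _ ((((1 + x) ^+ 2) ^+ S - 1) * s)); first exact: ler_wpM2l.
by rewrite -ler_pdivlMr.
Qed.

(** The bound by [b] is tested on [f + w / b], which is [Q f / b], and positivity of [Q] at [w]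
    drops one term. So a function that nearly attains the supremum is nearly an eigenvector. *)
Lemma psd_bound f w Qf Qw (b : R) : Hs f -> Hs w -> Hs Qf -> Hs Qw -> 0 < b ->
  ip Qw f = ip Qf w -> w = (fun g => Qf g + (- b) * f g) -> 0 <= ip Qw w ->
  ip (fun g => Qf g + b^-1 * Qw g) (fun g => f g + b^-1 * w g) <=
    b * ip (fun g => f g + b^-1 * w g) (fun g => f g + b^-1 * w g) ->
  ip w w <= b * (b * ip f f - ip Qf f).
Proof.
move=> Hf Hw HQf HQw b0 QC wE qw; have Hfw := Hs_lin b^-1 Hf Hw.
have EW : ip Qf w = b * ip f w + ip w w.
  have -> : ip w w = ip (fun g => Qf g + (- b) * f g) w by rewrite -wE.
  by rewrite (ip_linl (- b) HQf Hf Hw); ring.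
rewrite (ip_linl b^-1 HQf HQw Hfw) (ip_linl b^-1 Hf Hw Hfw) (ip_linr b^-1 Hf Hw Hf) (ip_linr b^-1 Hf Hw Hw).
rewrite (ip_linr b^-1 Hf Hw HQf) (ip_linr b^-1 Hf Hw HQw) QC (ipC w f) EW.
move: (ip Qw w) qw (ip Qf f) (ip f f) (ip f w) (ip w w) => p p0 qf ff fw ww H.
have bb : b * b^-1 = 1 by rewrite mulfV // gt_eqF.
have c0 : 0 <= b^-1 ^+ 2 * p by rewrite mulr_ge0 ?sqr_ge0.
have H1 : b^-1 * ww <= b * ff - qf.
  have E1 : b * (ff + b^-1 * fw + b^-1 * (fw + b^-1 * ww)) = b * ff + (b * b^-1) * (2 * fw + b^-1 * ww) by ring.
  have E2 : qf + b^-1 * (b * fw + ww) + b^-1 * (b * fw + ww + b^-1 * p) =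
    qf + (b * b^-1) * (2 * fw) + 2 * (b^-1 * ww) + b^-1 ^+ 2 * p by ring.
  by move: H; rewrite E1 E2 bb !mul1r; lra.
have := ler_wpM2l (ltW b0) H1; by rewrite mulrA bb mul1r.
Qed.

(** * Existence of a maximal eigenvector *)

Section TopEigenvector.
Variables (Q : (G -> R) -> G -> R) (V : (G -> R) -> Prop).
Let S6 : (5 <= 6)%N. Proof. by []. Qed.
Hypotheses (HQ : forall f, Hs f -> Hs (Q f))
  (Qlin : forall f u c, Hs f -> Hs u -> Q (fun g => f g + c * u g) = fun g => Q f g + c * Q u g)
  (Qsym : forall f u, Hs f -> Hs u -> ip (Q f) u = ip f (Q u))
  (Qpos : forall f, Hs f -> 0 <= ip (Q f) f)
  (Qbd : exists2 M, 0 < M & forall f m, Hs f -> (forall g, `|f g| <= m) -> forall g, `|Q f g| <= M * m)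
  (Qsup : exists2 N, 0 < N & forall f m, Hs f -> (forall g, `|Tm 6 f g| <= m) -> ip (Q f) f <= N * m ^+ 2)
  (QT : forall f, Hs f -> Q (Tm 6 f) = Tm 6 (Q f)).
Hypotheses (VH : forall f, V f -> Hs f)
  (Vlin : forall f u c, V f -> V u -> V (fun g => f g + c * u g))
  (VT : forall f, V f -> V (Tm 6 f)) (VQ : forall f, V f -> V (Q f))
  (Vcl : forall u, (forall e : R, 0 < e -> exists2 f, V f & forall g, `|u g - f g| <= e) -> V u)
  (Vpos : exists2 f, V f & 0 < ip (Q f) f).

Let q_le : exists2 N, 0 < N & forall f, Hs f -> ip (Q f) f <= N * ip f f.
Proof.
have [N N0 HN] := Qsup; have [K K0 HK] := T_sup2 S6.
exists (N * K) => [|f Hf]; first by rewrite mulr_gt0.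
pose s := Num.sqrt (K * ip f f).
have sE : s ^+ 2 = K * ip f f by rewrite sqr_sqrtr // mulr_ge0 ?ip_ge0 // ltW.
have Hs' g : `|Tm 6 f g| <= s.
  rewrite -(ler_pXn2r (_ : 0 < 2)%N) ?nnegrE ?sqrtr_ge0 // real_normK ?num_real // sE.
  exact: HK.
by have := HN f s Hf Hs'; rewrite sE mulrA.
Qed.

Let scale f (c : R) : V f -> V (fun g => c * f g).
Proof.
move=> Vf; have -> : (fun g => c * f g) = (fun g => f g + (c - 1) * f g) by apply/funext => g; ring.
exact: Vlin.
Qed.

Let E := [set x : R | exists f, [/\ V f, ip f f = 1 & x = ip (Q f) f]].
Let beta := sup E.

Let ip_scale f u (c : R) : Hs f -> Hs u -> ip (fun g => c * f g) u = c * ip f u.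
Proof.
move=> Hf Hu; have -> : (fun g => c * f g) = (fun g => f g + (c - 1) * f g) by apply/funext => g; ring.
by rewrite ip_linl //; ring.
Qed.

Let Q_scale f (c : R) : Hs f -> Q (fun g => c * f g) = fun g => c * Q f g.
Proof.
move=> Hf; have -> : (fun g => c * f g) = (fun g => f g + (c - 1) * f g) by apply/funext => g; ring.
by rewrite Qlin //; apply/funext => g; ring.
Qed.

Let normalise f : V f -> 0 < ip f f -> exists f', [/\ V f', ip f' f' = 1 & ip (Q f) f = ip f f * ip (Q f') f'].
Proof.
move=> Vf n0; have Hf := VH Vf; pose s := Num.sqrt (ip f f).
have s0 : 0 < s by rewrite sqrtr_gt0.
have sE : s ^+ 2 = ip f f by rewrite sqr_sqrtr // ltW.
have Hsf : Hs (fun g => s^-1 * f g) by apply: VH; exact: scale.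
exists (fun g => s^-1 * f g); split; first exact: scale.
- by rewrite ip_scale // ipC ip_scale // -sE; field; rewrite gt_eqF.
- rewrite (Q_scale _ Hf) (ip_scale _ (HQ Hf) Hsf) (ipC (Q f) (fun g => s^-1 * f g)) (ip_scale _ Hf (HQ Hf)) (ipC f (Q f)).
  by rewrite -sE; field; rewrite gt_eqF.
Qed.

Let Esup : has_sup E.
Proof.
have [f Vf qf] := Vpos; have [N N0 HN] := q_le; split.
  have n0 : 0 < ip f f by rewrite -(pmulr_rgt0 _ N0); apply: lt_le_trans qf (HN _ (VH Vf)).
  by have [f' [Vf' n1 _]] := normalise Vf n0; exists (ip (Q f') f'); exists f'.
by exists N => x [u [Vu nu ->]]; have := HN _ (VH Vu); rewrite nu mulr1.
Qed.

Let beta_max f : V f -> ip (Q f) f <= beta * ip f f.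
Proof.
move=> Vf; have := ip_ge0 f; rewrite le_eqVlt => /orP[/eqP n0|n0].
  by have [N _ HN] := q_le; have := HN _ (VH Vf); rewrite -n0 !mulr0.
have [f' [Vf' n1 ->]] := normalise Vf n0; rewrite mulrC ler_pM2r //.
by apply: (ub_le_sup Esup.2); exists f'.
Qed.

Let beta_gt0 : 0 < beta.
Proof.
have [f Vf qf] := Vpos; have := lt_le_trans qf (beta_max Vf); have := ip_ge0 f.
by rewrite le_eqVlt => /orP[/eqP <-|n0]; [rewrite mulr0 ltxx|rewrite pmulr_lgt0].
Qed.

Let maximizing (n : nat) : exists f, [/\ V f, ip f f = 1 & beta - n.+1%:R^-1 < ip (Q f) f].
Proof.
have n0 : (0 : R) < n.+1%:R^-1 by rewrite invr_gt0.
have [x [f [Vf nf ->]] H] := sup_adherent n0 Esup.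
by exists f.
Qed.

(** A maximising sequence [f n] has no reason to converge, but the [T 6 (f n)] have a uniform limit
    point. It is an eigenvector because [Q - beta] commutes with [T 6], which turns smallness in
    mean square into uniform smallness. *)
Lemma top_eigenvector : exists u b, [/\ V u, exists g, u g != 0, 0 < b, forall g, Q u g = b * u g &
  forall f, V f -> ip (Q f) f <= b * ip f f].
Proof.
have [f Hf] := choice maximizing.
have Vf n : V (f n) by have [] := Hf n.
have nf n : ip (f n) (f n) = 1 by have [] := Hf n.
have qf n : beta - n.+1%:R^-1 < ip (Q (f n)) (f n) by have [] := Hf n.
have HF n := VH (Vf n).
have [K K0 HK] := T_sup2 S6; have [M M0 HM] := Qbd; have [N N0 HN] := Qsup.
pose w n := fun g => Q (f n) g + (- beta) * f n g.
have Vw n : V (w n) by apply: Vlin => //; exact: VQ.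
have wn n : ip (w n) (w n) <= beta * n.+1%:R^-1.
  have Hq := VH (VQ (Vf n)); have Hqw := VH (VQ (Vw n)).
  apply: (@le_trans _ _ (beta * (beta * ip (f n) (f n) - ip (Q (f n)) (f n)))).
    apply: (psd_bound (HF n) (VH (Vw n)) Hq Hqw beta_gt0) => //.
    - by rewrite (Qsym (VH (Vw n)) (HF n)) ipC.
    - exact: (Qpos (VH (Vw n))).
    - rewrite -(Qlin _ (HF n) (VH (Vw n))).
      by apply: beta_max; exact: Vlin.
  by rewrite nf mulr1 (ler_pM2l beta_gt0) lerBlDr -lerBlDl; exact: ltW (qf n).
pose u_ n := Tm 6 (f n).
have Vu n : V (u_ n) by exact: VT.
have sq (x y : R) : 0 <= y -> x ^+ 2 <= y -> `|x| <= Num.sqrt y.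
  move=> y0 xy; rewrite -(ler_pXn2r (_ : 0 < 2)%N) ?nnegrE ?sqrtr_ge0 //.
  by rewrite real_normK ?num_real // sqr_sqrtr.
have uM n g : `|u_ n g| <= Num.sqrt K.
  by apply: sq; [exact: ltW|have := HK _ (HF n) g; rewrite nf mulr1].
have equi e : 0 < e -> exists2 x : R, 0 < x & forall n g h, HS2 h <= 2 + x ^+ 2 -> `|u_ n (g * h)%g - u_ n g| <= e.
  by move=> ee; have [x x0 Hx] := T_unif2 S6 ee; exists x => // n; apply: Hx.
have [u ui Hu] := ultra_limit (fun n => (VH (Vu n)).2) uM equi.
have VU : V u.
  apply: Vcl => e ee; have [n _ Hn] := Hu e 0%N ee; exists (u_ n) => // g.
  by rewrite distrC.
have HU := VH VU; have b0 := beta_gt0.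
have small (C e : R) : 0 <= C -> 0 < e -> exists n0 : nat, forall n, (n0 <= n)%N -> C * n.+1%:R^-1 <= e.
  move=> C0 ee; exists (Num.bound (C / e)) => n Hn; rewrite ler_pdivrMr ?ltr0Sn // mulrC -ler_pdivrMr //.
  apply: (@le_trans _ _ (Num.bound (C / e))%:R); first by rewrite ltW // archi_boundP // divr_ge0 // ltW.
  by rewrite ler_nat leqW.
exists u, beta; split => //.
(* If the limit were zero, [T 6 (f n)] would be uniformly small for some large [n], and by [Qsup] so
   would [ip (Q (f n)) (f n)], which is close to [beta > 0]. *)
- apply: contrapT => nu; have uz g : u g = 0.
    by apply/eqP; apply: contrapT => /negP ug; apply: nu; exists g.
  have [n0 Hn0] := small 1 (beta / 2) ler01 (divr_gt0 b0 (ltr0Sn R 1)).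
  pose d := Num.sqrt (beta / 4 / N).
  have d0 : 0 < d by rewrite sqrtr_gt0 !divr_gt0.
  have [n Hn Hd] := Hu d n0 d0.
  have Hd' g : `|Tm 6 (f n) g| <= d by have := Hd g; rewrite uz subr0.
  have := HN _ _ (HF n) Hd'; rewrite sqr_sqrtr; last by rewrite !divr_ge0 // ltW.
  rewrite [N * _]mulrC divfK ?gt_eqF // => H1; move: b0 (qf n) (Hn0 n Hn) H1; rewrite mul1r.
  by move: (ip _ _) (n.+1%:R^-1) (beta) => x y z; lra.
- move=> g; apply/eqP; rewrite -subr_eq0 -normr_le0; apply/ler_addgt0Pl => e ee; rewrite addr0.
  have e3 : 0 < e / 2 by rewrite divr_gt0.
  have Mb : 0 < M + beta by rewrite addr_gt0.
  have [n0 Hn0] := small (K * beta) ((e / 2) ^+ 2) (mulr_ge0 (ltW K0) (ltW b0)) (exprn_gt0 2 e3).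
  have [n Hn Hd] := Hu (e / 2 / (M + beta)) n0 (divr_gt0 e3 Mb).
  have A : `|Q (u_ n) g - beta * u_ n g| <= e / 2.
    have -> : Q (u_ n) g - beta * u_ n g = Tm 6 (w n) g.
      rewrite /w (TD Hmu _ S6 (VH (VQ (Vf n))).1 (HF n).1) /u_ QT //.
      by rewrite mulNr.
    rewrite -(ler_pXn2r (_ : 0 < 2)%N) ?nnegrE ?(ltW e3) // real_normK ?num_real //.
    apply: (le_trans (HK _ (VH (Vw n)) g)); apply: le_trans (Hn0 n Hn).
    by rewrite -mulrA ler_pM2l.
  have Hdiff : Hs (fun x => u x + (-1) * u_ n x) by apply: Hs_lin => //; exact: VH (Vu n).
  have B : `|Q u g - Q (u_ n) g| <= M * (e / 2 / (M + beta)).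
    have := HM _ (e / 2 / (M + beta)) Hdiff.
    rewrite (Qlin (-1) HU (VH (Vu n))) => /(_ _ g); rewrite mulN1r; apply => x.
    by rewrite mulN1r distrC.
  have C : `|beta * u_ n g - beta * u g| <= beta * (e / 2 / (M + beta)).
    by rewrite -mulrBr normrM gtr0_norm // ler_pM2l.
  have E1 : M * (e / 2 / (M + beta)) + beta * (e / 2 / (M + beta)) = e / 2.
    by rewrite -mulrDl mulrC divfK // gt_eqF.
  have -> : Q u g - beta * u g = (Q u g - Q (u_ n) g) + (Q (u_ n) g - beta * u_ n g) + (beta * u_ n g - beta * u g) by ring.
  apply: (le_trans (ler_normD _ _)); apply: (le_trans (lerD (ler_normD _ _) (lexx _))); lra.
Qed.

End TopEigenvector.
End Spectral.

Section Gap.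
Variables (R : realType) (mu : {sigma_finite_measure set (borelSL2 R) -> \bar R}).
Local Notation G := (borelSL2 R).
Implicit Types (g h : G) (f u w : G -> R).
Variables (Gam : set (SL2 R)) (D : set G) (v e0 rho : R).
Hypothesis L : lattice mu Gam D v e0 rho.
Let Hmu := lat_haar L.
Local Notation Tm S := (T mu S).
Local Notation Hs := (Hs Gam).
Local Notation ip := (ip mu D).
Local Notation ID := (ID mu D).

Let S6 : (5 <= 6)%N. Proof. by []. Qed.
Let S7 : (5 <= 7)%N. Proof. by []. Qed.

Lemma ID_ip f : ID f = ip f (fun=> 1).
Proof. by apply: (eq_wint (weight_D L)) => x _; rewrite mulr1. Qed.

Lemma ID_T S f : (5 <= S)%N -> Hs f -> ID (Tm S f) = ID f.
Proof.
move=> S5 Hf; rewrite !ID_ip (T_sym L S5 Hf (Hs_cst Gam 1)).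
by apply: (eq_wint (weight_D L)) => x _; rewrite T_cst.
Qed.

Lemma ID_lin f u c : Hs f -> Hs u -> ID (fun g => f g + c * u g) = ID f + c * ID u.
Proof. by move=> Hf Hu; rewrite !ID_ip (ip_linl L c Hf Hu (Hs_cst Gam 1)). Qed.

Lemma Hs_unif_limit u : (forall e : R, 0 < e -> exists2 f, Hs f & forall g, `|u g - f g| <= e) -> Hs u.
Proof.
move=> H; split; first by apply: mbounded_unif_limit => e /H[f [Hf _]]; exists f.
move=> c g Gc; apply/eqP; rewrite -subr_eq0 -normr_le0; apply/ler_addgt0Pl => e ee; rewrite addr0.
have [|f [_ fi] Hf] := H (e / 2); first by rewrite divr_gt0.
have := Hf (c * g)%g; have := Hf g; rewrite fi // !ler_norml => /andP[? ?] /andP[? ?].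
by apply/andP; split; lra.
Qed.

Definition V0 f := Hs f /\ ID f = 0.

Lemma V0_lin f u c : V0 f -> V0 u -> V0 (fun g => f g + c * u g).
Proof. by move=> [Hf f0] [Hu u0]; split; [exact: Hs_lin|rewrite ID_lin // f0 u0 mulr0 addr0]. Qed.

Lemma V0_T S f : (5 <= S)%N -> V0 f -> V0 (Tm S f).
Proof. by move=> S5 [Hf f0]; split; [exact: (Hs_T L)|rewrite ID_T]. Qed.

Lemma V0_closed u : (forall e : R, 0 < e -> exists2 f, V0 f & forall g, `|u g - f g| <= e) -> V0 u.
Proof.
move=> H; have Hu : Hs u by apply: Hs_unif_limit => e /H[f [Hf _]]; exists f.
split => //; apply/eqP; rewrite -normr_le0; apply/ler_addgt0Pl => e ee; rewrite addr0.
have v0 := v_gt0 L; have [|f [Hf f0] Hd] := H (e / v); first by rewrite divr_gt0.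
have -> : ID u = ID (fun g => u g + (-1) * f g) by rewrite ID_lin // f0 mulr0 addr0.
rewrite ID_ip; have Hd' : Hs (fun g => u g + (-1) * f g) by exact: Hs_lin.
have b1 g : `|u g + -1 * f g| <= e / v by rewrite mulN1r.
apply: (le_trans (ip_sup L Hd' (Hs_cst Gam 1) b1 (fun=> _ : `|1| <= 1))); first by rewrite normr1.
by rewrite mulr1 mulrC divfK // gt_eqF.
Qed.

Let TD' S f u c : (5 <= S)%N -> Hs f -> Hs u -> Tm S (fun g => f g + c * u g) = fun g => Tm S f g + c * Tm S u g.
Proof. by move=> S5 [Hf _] [Hu _]; exact: TD. Qed.

Let TZ' S f c : (5 <= S)%N -> Hs f -> Tm S (fun g => c * f g) = fun g => c * Tm S f g.
Proof. by move=> S5 [Hf _]; exact: (TZ L). Qed.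

Let TC' f : Hs f -> Tm 7 (Tm 6 f) = Tm 6 (Tm 7 f).
Proof. by move=> [Hf _]; apply/funext => g; exact: TC. Qed.

Let HT S f : (5 <= S)%N -> Hs f -> Hs (Tm S f). Proof. exact: (Hs_T L). Qed.

Let Tbd S f m : (5 <= S)%N -> Hs f -> (forall g, `|f g| <= m) -> forall g, `|Tm S f g| <= m.
Proof. by move=> S5 [Hf _] Hm g; exact: T_bound. Qed.

Lemma ip_T7_ge f : Hs f -> - ip f f <= ip (Tm 7 f) f.
Proof.
move=> Hf; have := ip_cauchy_schwarz L (HT S7 Hf) Hf; have := T_contr L S7 Hf; have := ip_ge0 L f.
move: (ip f f) (ip (Tm 7 f) (Tm 7 f)) (ip (Tm 7 f) f) => a b c a0 ba cab.
have : c ^+ 2 <= a ^+ 2 by rewrite (le_trans cab) // expr2 ler_wpM2r.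
rewrite -subr_ge0 subr_sqr => H; rewrite lerNl leNgt; apply/negP => ac; move: H; rewrite leNgt => /negP; apply.
by rewrite pmulr_rlt0; lra.
Qed.

Section Contradiction.
Variables (l : R) (f0 : G -> R).
Hypotheses (l0 : 0 <= l) (Hl : forall m, m != 0 -> laplace_eigenvalue Gam m -> l <= m)
  (Vf0 : V0 f0) (Hf0 : ip f0 f0 < (1 + l / 5) ^+ 2 * ip (Tm 6 f0) (Tm 6 f0)).

(** The square of [T 6] is positive, so [top_eigenvector] applies to it; since [f0] violates the
    gap, so does the top eigenvalue. *)
Lemma square_eigenvector : exists u b, [/\ V0 u, exists g, u g != 0, 1 < b * (1 + l / 5) ^+ 2 &
  Tm 6 (Tm 6 u) = fun g => b * u g].
Proof.
have n0 : 0 < ip (Tm 6 f0) (Tm 6 f0).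
  rewrite lt_neqAle (ip_ge0 L) andbT; apply/eqP => E; move: Hf0; rewrite -E mulr0.
  by rewrite ltNge (ip_ge0 L).
have [|||||||||||||u [b [Vu u0 b0 Eu bmax]]] := @top_eigenvector R mu Gam D v e0 rho L (fun f => Tm 6 (Tm 6 f)) V0.
- by move=> f Hf; exact: HT S6 (HT S6 Hf).
- by move=> f u c Hf Hu; rewrite !TD' //; exact: HT.
- by move=> f u Hf Hu; rewrite !(T_sym L) //; exact: HT.
- by move=> f Hf; rewrite (T_sym L) ?(ip_ge0 L) //; exact: HT.
- by exists 1 => // f m Hf Hm g; rewrite mul1r; exact: Tbd S6 (HT S6 Hf) (Tbd S6 Hf Hm) g.
- exists v; first exact: v_gt0 L.
  move=> f m Hf Hm; rewrite (T_sym L) //; last exact: HT.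
  by apply: (le_trans (ler_norm _)); rewrite expr2; exact: (ip_sup L (HT S6 Hf) (HT S6 Hf)).
- by [].
- by move=> f [].
- exact: V0_lin.
- by move=> f; exact: V0_T.
- by move=> f Vf; exact: V0_T S6 (V0_T S6 Vf).
- exact: V0_closed.
- by exists f0 => //; rewrite (T_sym L) //; [exact: HT Vf0.1|exact: Vf0.1].
exists u, b; split => //; last by apply/funext.
have := bmax _ Vf0; rewrite (T_sym L S6 (HT S6 Vf0.1) Vf0.1) => H.
rewrite -(ltr_pM2r n0) mul1r; apply: (le_lt_trans H).
by rewrite -mulrA ltr_pM2l.
Qed.

Section Second.
Variables (b : R) (u1 : G -> R).
Hypotheses (b0 : 0 < b) (Vu1 : V0 u1) (u1n : exists g, u1 g != 0) (Eu1 : Tm 6 (Tm 6 u1) = fun g => b * u1 g).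

Let V1 f := V0 f /\ Tm 6 (Tm 6 f) = fun g => b * f g.
(** [T 7] is bounded below by -1, so this operator is positive; it has the same eigenvectors as
    [T 7]. *)
Let B f := fun g => Tm 7 f g + 2 * f g.

Let BH f : Hs f -> Hs (B f). Proof. by move=> Hf; apply: Hs_lin => //; exact: HT. Qed.

Let Blin f u c : Hs f -> Hs u -> B (fun g => f g + c * u g) = fun g => B f g + c * B u g.
Proof. by move=> Hf Hu; rewrite /B (TD' c S7 Hf Hu); apply/funext => g; ring. Qed.

Let BT f : Hs f -> B (Tm 6 f) = Tm 6 (B f).
Proof. by move=> Hf; rewrite /B (TD' 2 S6 (HT S7 Hf) Hf) TC'. Qed.

Let Bsym f u : Hs f -> Hs u -> ip (B f) u = ip f (B u).
Proof.
move=> Hf Hu; rewrite /B (ip_linl L 2 (HT S7 Hf) Hf Hu) (ip_linr L 2 (HT S7 Hu) Hu Hf).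
by rewrite (T_sym L S7 Hf Hu).
Qed.

Let Bge f : Hs f -> ip f f <= ip (B f) f.
Proof. by move=> Hf; rewrite /B (ip_linl L 2 (HT S7 Hf) Hf Hf); have := ip_T7_ge Hf; lra. Qed.

Let Bbd f m : Hs f -> (forall g, `|f g| <= m) -> forall g, `|B f g| <= 3 * m.
Proof.
move=> Hf Hm g; rewrite /B; apply: (le_trans (ler_normD _ _)); rewrite normrM.
have := Tbd S7 Hf Hm g; have := Hm g; rewrite (ger0_norm (_ : 0 <= 2)) //; lra.
Qed.

Let V0B f : V0 f -> V0 (B f).
Proof. by move=> Vf; apply: V0_lin => //; exact: V0_T. Qed.

Let V1_lin f u c : V1 f -> V1 u -> V1 (fun g => f g + c * u g).
Proof.
move=> [Vf Ef] [Vu Eu]; split; first exact: V0_lin.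
by rewrite (TD' c S6 Vf.1 Vu.1) (TD' c S6 (HT S6 Vf.1) (HT S6 Vu.1)) Ef Eu; apply/funext => g; ring.
Qed.

Let V1_T f : V1 f -> V1 (Tm 6 f).
Proof. by move=> [Vf Ef]; split; [exact: V0_T|rewrite Ef (TZ' b S6 Vf.1)]. Qed.

Let V1_B f : V1 f -> V1 (B f).
Proof.
move=> [Vf Ef]; split; first exact: V0B.
rewrite -(BT Vf.1) -(BT (HT S6 Vf.1)) Ef /B (TZ' b S7 Vf.1).
by apply/funext => g; ring.
Qed.

Let V1_closed u : (forall e : R, 0 < e -> exists2 f, V1 f & forall g, `|u g - f g| <= e) -> V1 u.
Proof.
move=> H; have Vu : V0 u by apply: V0_closed => e /H[f [Vf _] Hf]; exists f.
split => //; apply/funext => g; apply/eqP; rewrite -subr_eq0 -normr_le0.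
apply/ler_addgt0Pl => e ee; rewrite addr0.
have b1 : 0 < 1 + b by have h := b0; lra.
have [|f [Vf Ef] Hd] := H (e / (1 + b)); first by rewrite divr_gt0.
have Hdf : Hs (fun g => u g + (-1) * f g) by apply: Hs_lin; [exact: Vu.1|exact: Vf.1].
have d1 x : `|u x + -1 * f x| <= e / (1 + b) by rewrite mulN1r.
have := Tbd S6 (HT S6 Hdf) (Tbd S6 Hdf d1) g.
rewrite (TD' (-1) S6 Vu.1 Vf.1) (TD' (-1) S6 (HT S6 Vu.1) (HT S6 Vf.1)) Ef => A.
have -> : Tm 6 (Tm 6 u) g - b * u g = (Tm 6 (Tm 6 u) g + -1 * (b * f g)) + (- b) * (u g - f g) by ring.
apply: (le_trans (ler_normD _ _)); rewrite normrM normrN (gtr0_norm b0).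
have := ler_wpM2l (ltW b0) (Hd g).
have E1 : e / (1 + b) + b * (e / (1 + b)) = e by field; rewrite gt_eqF.
move: A E1; lra.
Qed.

(** On the eigenspace of the square of [T 6] the operator [T_6 B T_6] equals [b B]. The outer
    factors give it the form that [top_eigenvector] requires, where a quadratic form must be
    controlled by the size of [T 6 f]. *)
Lemma commuting_eigenvector : exists u t7, [/\ V1 u, exists g, u g != 0 & forall g, Tm 7 u g = t7 * u g].
Proof.
have n1 : 0 < ip u1 u1.
  rewrite lt_neqAle (ip_ge0 L) andbT; apply/eqP => E; have [g Hg] := u1n.
  have [K K0 HK] := T_sup2 L S6.
  have Tz x : Tm 6 u1 x = 0.
    apply/eqP; rewrite -sqrf_eq0 eq_le sqr_ge0 andbT.
    by have := HK _ Vu1.1 x; rewrite -E mulr0.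
  have : Tm 6 (Tm 6 u1) g = 0.
    by rewrite (_ : Tm 6 u1 = fun=> 0) ?T_cst //; apply/funext => x; exact: Tz.
  by rewrite Eu1 => /eqP; rewrite mulf_eq0 (negbTE Hg) gt_eqF.
have [|||||||||||||u [c [[Vu Eu] u0 c0 Ec _]]] := @top_eigenvector R mu Gam D v e0 rho L (fun f => Tm 6 (B (Tm 6 f))) V1.
- by move=> f Hf; apply: HT => //; apply: BH; exact: HT.
- move=> f u c Hf Hu; have H1 := HT S6 Hf; have H2 := HT S6 Hu.
  by rewrite (TD' c S6 Hf Hu) (Blin c H1 H2) (TD' c S6 (BH H1) (BH H2)).
- move=> f u Hf Hu; have H1 := HT S6 Hf; have H2 := HT S6 Hu.
  by rewrite (T_sym L S6 (BH H1) Hu) (Bsym H1 H2) (T_sym L S6 Hf (BH H2)).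
- move=> f Hf; have H1 := HT S6 Hf; rewrite (T_sym L S6 (BH H1) Hf).
  exact: le_trans (ip_ge0 L _) (Bge H1).
- exists 3 => // f m Hf Hm; apply: Tbd => //; first by apply: BH; exact: HT.
  by apply: Bbd; [exact: HT|exact: Tbd].
- exists (v * 3); first by rewrite mulr_gt0 // (v_gt0 L).
  move=> f m Hf Hm; have H1 := HT S6 Hf; rewrite (T_sym L S6 (BH H1) Hf).
  apply: (le_trans (ler_norm _)); rewrite expr2 -mulrA (mulrA 3).
  exact: (ip_sup L (BH H1) H1 (Bbd H1 Hm) Hm).
- by move=> f Hf; rewrite BT //; exact: HT.
- by move=> f [[]].
- exact: V1_lin.
- exact: V1_T.
- by move=> f Vf; apply: V1_T; apply: V1_B; exact: V1_T.
- exact: V1_closed.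
- exists u1; first by split.
  have H1 := HT S6 Vu1.1; rewrite (T_sym L S6 (BH H1) Vu1.1); apply: lt_le_trans (Bge H1).
  rewrite (T_sym L S6 Vu1.1 H1) Eu1 -[ip _ _](ipC L).
  rewrite (_ : (fun g => b * u1 g) = fun g => u1 g + (b - 1) * u1 g); last by apply/funext => g; ring.
  by rewrite (ip_linl L (b - 1) Vu1.1 Vu1.1 Vu1.1) -[X in X + _]mul1r -mulrDl addrC subrK mulr_gt0.
exists u, (c / b - 2); split => // g.
have := Ec g; rewrite -(BT (HT S6 Vu.1)) Eu /B (TZ' b S7 Vu.1) => H.
apply: (mulfI (_ : b != 0)); first by rewrite gt_eqF.
have -> : b * ((c / b - 2) * u g) = c * u g - 2 * (b * u g) by field; rewrite gt_eqF.
by rewrite -H; ring.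
Qed.

(** For one of the two [s] with [s^2 = b], [T 6 u + s u] is non-zero; it is an eigenvector of [T 6]
    and [T 7], hence of the Laplacian. Having mean zero it is not constant, so its eigenvalue is
    non-zero and at least [l], and [eigen_contraction] bounds [b]. *)
Lemma gap_contradiction : b * (1 + l / 5) ^+ 2 <= 1.
Proof.
have [u [t7 [[Vu Eu] u0 E7]]] := commuting_eigenvector.
pose s0 := Num.sqrt b; have s00 : 0 < s0 by rewrite sqrtr_gt0.
have sE : s0 ^+ 2 = b by rewrite sqr_sqrtr // ltW.
have Hu := Vu.1; have HTu := HT S6 Hu.
have [s [ss sn]] : exists s : R, s ^+ 2 = b /\ exists g, Tm 6 u g + s * u g != 0.
  apply: contrapT => H; have Z s : s ^+ 2 = b -> forall g, Tm 6 u g + s * u g = 0.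
    move=> sb g; apply/eqP; apply: contrapT => /negP Hg; apply: H; exists s; split => //.
    by exists g.
  have [g /eqP Hg] := u0; apply: Hg.
  have A := Z s0 sE g; have B1 := Z (- s0) (etrans (sqrrN s0) sE) g.
  have : s0 * u g = 0 by lra.
  by move/eqP; rewrite mulf_eq0 gt_eqF //= => /eqP.
pose w g := Tm 6 u g + s * u g.
have Vw : V0 w by apply: V0_lin => //; exact: V0_T.
have w6 g : Tm 6 w g = s * w g.
  by rewrite /w (TD' s S6 HTu Hu) Eu -ss; ring.
have w7 g : Tm 7 w g = t7 * w g.
  rewrite /w (TD' s S7 HTu Hu) (TC' Hu) E7.
  rewrite (_ : Tm 7 u = fun g => t7 * u g); last by apply/funext.
  by rewrite (TZ' t7 S6 Hu); ring.
have s1 : s != 0 by rewrite -sqrf_eq0 ss gt_eqF.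
have lam0 := common_nonneg L Vw.1.1 Vw.1.2 w6 w7 s1 sn.
have := eigen_contraction L Vw.1.1 Vw.1.2 w6 w7 s1 sn.
have := eigen_laplace L Vw.1.1 Vw.1.2 w6 w7 s1 sn.
have := @eigen0_const R mu Gam D v e0 rho L w s t7 Vw.1.1 Vw.1.2 w6 w7 s1 sn.
move: lam0; set lam := 30 * _ => lam0 Hc Hlap Hcon.
have ln : lam != 0.
  apply/eqP => /Hc[c wc]; have [g Hg] := sn; have := Vw.2.
  rewrite (_ : w = fun=> c); last by apply/funext.
  rewrite /ID (wint_cst (weight_D L)) -/(ID _) (ID1 L) => /eqP.
  by rewrite mulf_eq0 (gt_eqF (v_gt0 L)) orbF => /eqP cz; move: Hg; rewrite -/(w g) wc cz eqxx.
have ll := Hl ln Hlap.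
have H1 : `|s| * (1 + l / 5) <= 1.
  by apply: le_trans Hcon; apply: ler_wpM2l => //; lra.
rewrite -ss -(real_normK (num_real s)) -exprMn -[leRHS](expr1n _ 2).
have l5 : 0 <= 1 + l / 5 by have h := l0; lra.
by rewrite lerXn2r ?nnegrE ?mulr_ge0.
Qed.

End Second.
End Contradiction.

Theorem spectral_gap (l : R) f : 0 <= l -> (forall m, m != 0 -> laplace_eigenvalue Gam m -> l <= m) ->
  Hs f -> ID f = 0 -> (1 + l / 5) ^+ 2 * ip (Tm 6 f) (Tm 6 f) <= ip f f.
Proof.
move=> l0 Hl Hf f0; rewrite leNgt; apply/negP => H.
have Vf : V0 f by split.
have [u [b [Vu u0 b1 Eu]]] := square_eigenvector Vf H.
have b0 : 0 < b.
  have sq : 0 < (1 + l / 5) ^+ 2 by rewrite exprn_gt0 //; lra.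
  by rewrite -(pmulr_lgt0 _ sq) (lt_trans ltr01).
by have := gap_contradiction l0 Hl b0 Vu u0 Eu; rewrite leNgt b1.
Qed.

End Gap.

(** * The diameter of the quotient *)

Section SmallSteps.
Variable R : realType.
Local Notation G := (borelSL2 R).

Fact upper_subproof (x : R) : 1 * 1 - x * 0 = 1. Proof. by ring. Qed.
Fact lower_subproof (x : R) : 1 * 1 - 0 * x = 1. Proof. by ring. Qed.
Definition upper x : G := mkSL2 (upper_subproof x).
Definition lower x : G := mkSL2 (lower_subproof x).

(** The group is generated by unipotents, and a unipotent is a power of one with parameter at most
    1, for which [HS2 <= 3]. *)
Lemma small_steps (P : G -> Prop) : P 1%g -> (forall g s, P g -> HS2 s <= 10 -> P (g * s)%g) -> forall g, P g.
Proof.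
move=> P1 Ps.
have gen (E : R -> G) : (forall x y, E (x + y) = (E x * E y)%g) -> (forall x, HS2 (E x) = 2 + x ^+ 2) ->
    forall g x, P g -> P (g * E x)%g.
  move=> EM EH g x Pg; pose n := (Num.bound `|x|).+1.
  have n0 : (n%:R : R) != 0 by rewrite pnatr_eq0.
  have y1 : `|x / n%:R| <= 1.
    rewrite normrM normfV [`|n%:R|]ger0_norm // ler_pdivrMr ?ltr0n // mul1r.
    by apply: (le_trans (ltW (archi_boundP (normr_ge0 x)))); rewrite ler_nat.
  have K (m : nat) : P (g * E (m%:R * (x / n%:R))%R)%g.
    elim: m => [|m IH].
      have -> : E (0%:R * (x / n%:R))%R = 1%g; last by rewrite mulg1.
      apply: (@mulgI _ (E 0)).
      by rewrite mulg1 -EM mul0r addr0.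
    rewrite -natr1 mulrDl mul1r EM mulgA; apply: Ps IH _; rewrite EH.
    have : (x / n%:R) ^+ 2 <= 1 by rewrite -(real_normK (num_real _)) -[leRHS](expr1n _ 2) lerXn2r ?nnegrE.
    lra.
  by have := K n; rewrite mulrC divfK.
have Pu : forall g x, P g -> P (g * upper x)%g.
  apply: gen => [x y|x]; first by apply: SL2_eq; rewrite ?gE !mkSL2E; ring.
  by rewrite /HS2 !mkSL2E; ring.
have Pl : forall g x, P g -> P (g * lower x)%g.
  apply: gen => [x y|x]; first by apply: SL2_eq; rewrite ?gE !mkSL2E; ring.
  by rewrite /HS2 !mkSL2E; ring.
have Pc g : gc g != 0 -> P g.
  move=> c0; have -> : g = (1 * upper ((ga g - 1) / gc g) * lower (gc g) * upper ((gd g - 1) / gc g))%g.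
    have E : gb g = (ga g * gd g - 1) / gc g by rewrite -(gdet g); field.
    by apply: SL2_eq; rewrite mul1g !gE !mkSL2E; rewrite ?E; field.
  exact: Pu (Pl _ _ (Pu _ _ P1)).
move=> g; have [c0|] := eqVneq (gc g) 0; last exact: Pc.
rewrite -[g](mulgK (lower 1)); have -> : ((lower 1)^-1)%g = lower (-1) by apply: SL2_eq; rewrite !gE !mkSL2E; ring.
apply: Pl; apply: Pc; rewrite gE !mkSL2E c0 mul0r add0r mulr1.
by apply/eqP => d0; have := gdet g; rewrite c0 d0 !mulr0 subrr => /eqP; rewrite eq_sym oner_eq0.
Qed.

End SmallSteps.

Section Propagation.
Variables (R : realType) (mu : {sigma_finite_measure set (borelSL2 R) -> \bar R}).
Local Notation G := (borelSL2 R).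
Implicit Types (g h u : G) (f : G -> R).
Hypothesis Hmu : haar_measure mu.

Lemma rotJ_HS2 g h : HS2 (g * h)%g + HS2 (g * (rotJ R * h))%g = HS2 g * HS2 h.
Proof. by rewrite /HS2 !gE !mkSL2E; ring. Qed.

Let kH h : kX mu 6 h * HS2 h = 5 * kX mu 5 h - 2 * kX mu 6 h.
Proof.
have m5 := mS_gt0 Hmu (leqnn 5); have m6 := mS_gt0 Hmu (leqW (leqnn 5)).
have E : 5 * mS mu 6 = 4 * mS mu 5 by have := mS_rec Hmu (leqnn 5) => ->; congr (_ * _); ring.
have X : Xg h * HS2 h = 4 - 2 * Xg h by rewrite /Xg; field; rewrite gt_eqF // HS2_2_gt0.
have X6 : Xg h ^+ 6 * HS2 h = Xg h ^+ 5 * (4 - 2 * Xg h) by rewrite -X exprS; ring.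
rewrite /kX mulrAC X6 [Xg h ^+ 6]exprS.
rewrite (_ : mS mu 5 = 5 / 4 * mS mu 6); last by rewrite (_ : mS mu 6 = 4 / 5 * mS mu 5); lra.
by field; rewrite gt_eqF.
Qed.

Let Wt6 := weight_kX Hmu (leqW (leqnn 5)).
Let Wt5 := weight_kX Hmu (leqnn 5).

Let int_kH : mu.-integrable setT (EFin \o (fun h => kX mu 6 h * HS2 h)).
Proof.
rewrite (_ : _ \o _ = (EFin \o (fun h => kX mu 5 h * 5)%R) \- (EFin \o (fun h => kX mu 6 h * 2)%R))%E.
  apply: integrableB => //; [exact: (weight_integrable Wt5 (mbounded_cst G 5))|exact: (weight_integrable Wt6 (mbounded_cst G 2))].
by apply/funext => h /=; rewrite kH EFinB ![(_%:R * _)%R]mulrC.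
Qed.

Let Rint_kH : \int[mu]_h (kX mu 6 h * HS2 h) = 3.
Proof.
under eq_Rintegral do rewrite kH ![_%:R * _]mulrC.
rewrite RintegralB //; [|exact: (weight_integrable Wt5 (mbounded_cst G 5))|exact: (weight_integrable Wt6 (mbounded_cst G 2))].
rewrite -/(wint mu (kX mu 5) (fun=> 5)) -/(wint mu (kX mu 6) (fun=> 2)) (wint_cst Wt5) (wint_cst Wt6).
by rewrite (wint_kX1 Hmu (leqnn 5)) (wint_kX1 Hmu (leqW (leqnn 5))); ring.
Qed.

Let int_kHg g : mu.-integrable setT (EFin \o (fun h => kX mu 6 h * HS2 (g * h)%g)).
Proof.
have k0 := proj1 Wt6.
apply: (@le_integrable _ _ _ mu setT measurableT _ (EFin \o (fun h => HS2 g * (kX mu 6 h * HS2 h)))).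
- apply/measurable_EFinP; apply: measurable_funM; first exact: weight_measurable Wt6.
  exact: measurableT_comp (@measurable_HS2 R) (measurable_mulgl g).
- move=> h _ /=; rewrite lee_fin.
  have a0 : 0 <= kX mu 6 h * HS2 (g * h)%g by rewrite mulr_ge0 // ltW // HS2_gt0.
  have b0 : 0 <= HS2 g * (kX mu 6 h * HS2 h).
    by apply: mulr_ge0; [|apply: mulr_ge0 => //]; rewrite ltW // HS2_gt0.
  by rewrite (ger0_norm a0) (ger0_norm b0) mulrCA ler_wpM2l // HS2M.
- rewrite (_ : _ \o _ = (fun h => (HS2 g)%:E * (EFin \o (fun h => kX mu 6 h * HS2 h)%R) h)%E).
    exact: integrableZl.
  by apply/funext => h /=; rewrite EFinM.
Qed.

(** The kernel is invariant under rotations, so [HS2 (g h)] may be averaged over [h] and [rotJ h],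
    where it becomes [HS2 g * HS2 h / 2]; the moment of [HS2] itself is 3. *)
Lemma Rint_kHg g : \int[mu]_h (kX mu 6 h * HS2 (g * h)%g) = 3 / 2 * HS2 g.
Proof.
have mm : measurable_fun setT (fun h => kX mu 6 h * HS2 (g * h)%g).
  by apply/measurable_EFinP; exact: measurable_int (int_kHg g).
have E : \int[mu]_h (kX mu 6 h * HS2 (g * (rotJ R * h))%g) = \int[mu]_h (kX mu 6 h * HS2 (g * h)%g).
  rewrite -(preserves_Rintegral (preserves_mull Hmu (rotJ R)) mm); apply: eq_Rintegral => h _.
  congr (_ * _); rewrite /kX /Xg HS2_rotl //.
  by split; rewrite !mkSL2E // opprK.
have S : \int[mu]_h (kX mu 6 h * HS2 (g * h)%g) + \int[mu]_h (kX mu 6 h * HS2 (g * (rotJ R * h))%g) = HS2 g * 3.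
  rewrite -Rint_kH -RintegralZl // -RintegralD //.
    by apply: eq_Rintegral => h _; rewrite -mulrDr rotJ_HS2 mulrCA.
  exact: int_kHg.
  rewrite (_ : (fun h => _ * HS2 (g * (_ * h))%g) = fun h => kX mu 6 h * HS2 (g * rotJ R * h)%g); first exact: int_kHg.
  by apply/funext => h; rewrite mulgA.
by move: S; rewrite E; lra.
Qed.

(** The substitute for finite propagation speed: a bound by the weight [HS2 (u x)] is kept, up to a
    factor 3/2 for each application of [T 6]. *)
Lemma T6_HS2_bound f u (a : R) : mbounded f -> (forall h, `|f h| <= a * HS2 (u * h)%g) ->
  forall x, `|T mu 6 f x| <= 3 / 2 * a * HS2 (u * x)%g.
Proof.
move=> Hf fH x; have k0 := proj1 Wt6.
apply: (le_trans (T_norm_le Hmu x (leqW (leqnn 5)) Hf)).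
have Hn := mbounded_translate x (mbounded_norm Hf).
have -> : 3 / 2 * a * HS2 (u * x)%g = \int[mu]_h (a * (kX mu 6 h * HS2 (u * x * h)%g)).
  rewrite (_ : \int[mu]_h _ = a * \int[mu]_h (kX mu 6 h * HS2 (u * x * h)%g)); first by rewrite Rint_kHg; ring.
  by rewrite RintegralZl //; exact: int_kHg.
apply: le_Rintegral => //; first exact: (weight_integrable Wt6 Hn).
  rewrite (_ : _ \o _ = (fun h => a%:E * (EFin \o (fun h => kX mu 6 h * HS2 (u * x * h)%g)%R) h)%E).
    by apply: integrableZl => //; exact: int_kHg.
  by apply/funext => h /=; rewrite EFinM.
by move=> h _; rewrite mulrCA ler_wpM2l // -mulgA; exact: fH.
Qed.

End Propagation.

Section Diameter.
Variables (R : realType) (mu : {sigma_finite_measure set (borelSL2 R) -> \bar R}).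
Local Notation G := (borelSL2 R).
Implicit Types (g h : G) (f u w : G -> R).
Variables (Gam : set (SL2 R)) (D : set G) (v e0 rho : R).
Hypothesis L : lattice mu Gam D v e0 rho.
Let Hmu := lat_haar L.
Local Notation Tm S := (T mu S).
Local Notation Hs := (Hs Gam).
Local Notation ip := (ip mu D).
Local Notation ID := (ID mu D).
Let S6 : (5 <= 6)%N. Proof. by []. Qed.

Definition orbit_indic (x : G) : G -> R := \1_[set g : G | exists2 c, Gam c & Bin e0 (x^-1 * c * g)%g].

Lemma Hs_orbit_indic x : Hs (orbit_indic x).
Proof.
have [_ GM GV] := lat_subgroup L; split.
  apply: mbounded_indic.
  have [e [e1 e2 _]] := enumeration_ex (lat_countable L).
  rewrite (_ : [set g | _] = \bigcup_n (if e n is Some c then (fun g : G => (x^-1 * c * g)%g : G) @^-1` Bin e0 else set0)).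
    apply: bigcup_measurable => n _; case: (e n) => // c.
    by apply: measurable_preim; [exact: measurable_mulgl|exact: measurable_Bin].
  apply/seteqP; split => [g /= [c Gc Hc]|g [n _]].
    by have [n En] := e2 c Gc; exists n => //; rewrite En.
  by case En : (e n) => [c|//] Hc; exists c => //; exact: e1 En.
move=> c g Gc; rewrite /orbit_indic !indicE; congr (_ : bool)%:R.
apply/idP/idP; rewrite !inE /= => -[c' Gc' H].
  by exists (c' * c)%g; [exact: GM|rewrite mulgA -!mulgA in H *; rewrite !mulgA in H *].
by exists (c' * c^-1)%g; [by apply: GM => //; exact: GV|rewrite !mulgA mulgVK].
Qed.

Lemma orbit_indic01 x g : orbit_indic x g = 0 \/ orbit_indic x g = 1.
Proof. by rewrite /orbit_indic indicE; case: (_ \in _); [right|left]. Qed.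

Lemma ip_orbit_indic x : ip (orbit_indic x) (orbit_indic x) = ID (orbit_indic x).
Proof.
by apply: (eq_wint (weight_D L)) => g _; case: (orbit_indic01 x g) => ->; rewrite ?mulr0 ?mulr1.
Qed.

Let HB : weight mu (\1_(Bin e0) : G -> R).
Proof.
have h1 := lat_e0_gt0 L; have h2 := lat_e0_le1 L; have e16 : e0 / 16 <= 1 by lra.
exact: (weight_indic (measurable_Bin e0) (near1_fin Hmu e16)).
Qed.

Lemma Bin_bounded b : Bin e0 b -> HS2 b <= 10.
Proof.
have h1 := lat_e0_gt0 L; have h2 := lat_e0_le1 L; have e16 : e0 / 16 <= 1 by lra.
exact: near1_bounded e16 _.
Qed.

Let twentieth (x : R) : x <= 10 -> 1 / 20 * x <= 1 / 2. Proof. lra. Qed.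

Let wave_factor (A B w : R) : 0 < w -> 4 * w <= A * B -> 2 <= B / w * (A / 2).
Proof.
move=> w0 H; have -> : B / w * (A / 2) = A * B / (2 * w) by field; rewrite gt_eqF.
by rewrite ler_pdivlMr; lra.
Qed.

Let wave_absurd (I V a z : R) : 0 < V -> V <= I -> - I <= a -> 2 * I <= z -> a + z <= 1 / 2 * I -> False.
Proof. lra. Qed.

Definition Vin : R := wint mu \1_(Bin e0) (fun=> 1).

Lemma VinE : (Vin%:E = mu (Bin e0))%E.
Proof.
rewrite /Vin (wint_EFin HB); last exact: mbounded_cst.
rewrite -[X in mu X]setIT -integral_indic //; last exact: measurable_Bin.
by apply: eq_integral => h _; rewrite mulr1.
Qed.

Lemma Vin_gt0 : 0 < Vin.
Proof.
rewrite -lte_fin VinE; apply: near1_gt0 => //; have := lat_e0_gt0 L => ?.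
by rewrite divr_gt0.
Qed.

Lemma Vin_le x : Vin <= ID (orbit_indic x).
Proof.
have [Hb Hi] := Hs_orbit_indic x.
apply: le_trans (fold_le_real L x Hb _ Hi); last by move=> g; case: (orbit_indic01 x g) => ->.
rewrite le_eqVlt; apply/orP; left; apply/eqP; apply: (eq_wint HB) => h hB.
rewrite /orbit_indic indicE mem_set //=; exists 1%g; first by have [] := lat_subgroup L.
by rewrite mulg1 mulKg; move: hB; rewrite indicE; case: (boolP (h \in _)); rewrite ?ltxx // inE.
Qed.

Section Wave.
Variable c : R.
Hypothesis c0 : 0 <= c.

(* A discrete wave equation: [a_N = T_N(A) f] with [T_N] the Chebyshev polynomial. *)
Definition opA f : G -> R := fun g => c * Tm 6 f g.
Fixpoint wave (n : nat) f : (G -> R) * (G -> R) :=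
  if n is m.+1 then let: (a, b) := wave m f in
    (fun g => opA a g - b g + opA (opA b) g, fun g => opA b g + a g)
  else (f, fun=> 0).

Fixpoint wave_cst (n : nat) : R * R :=
  if n is m.+1 then let: (a, b) := wave_cst m in (c * a - b + c ^+ 2 * b, c * b + a) else (1, 0).

Lemma Hs_A f : Hs f -> Hs (opA f).
Proof.
move=> Hf; have [H1 H2] := Hs_T L S6 Hf; split; first exact: mboundedZ.
by move=> x g Gx; rewrite /opA H2.
Qed.

Lemma Hs_wave n f : Hs f -> Hs (wave n f).1 /\ Hs (wave n f).2.
Proof.
move=> Hf; elim: n => [|n] /=; first by split => //; exact: Hs_cst.
case: (wave n f) => a b /= [Ha Hb]; have Hab := Hs_A Hb; have Haa := Hs_A Ha.
split.
  rewrite (_ : (fun g => _) = fun g => (opA a g + (-1) * b g) + 1 * opA (opA b) g); last by apply/funext => g; ring.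
  by apply: Hs_lin; [exact: Hs_lin|exact: Hs_A].
rewrite (_ : (fun g => _) = fun g => opA b g + 1 * a g); last by apply/funext => g; ring.
exact: Hs_lin.
Qed.

Lemma opA_lin f u (k : R) : Hs f -> Hs u -> opA (fun g => f g + k * u g) = fun g => opA f g + k * opA u g.
Proof. by move=> [Hf _] [Hu _]; rewrite /opA (TD Hmu k S6 Hf Hu); apply/funext => g; ring. Qed.

Lemma opA_cst k : opA (fun=> k) = fun=> c * k.
Proof. by apply/funext => g; rewrite /opA T_cst. Qed.

Lemma opA_sym f u : Hs f -> Hs u -> ip (opA f) u = ip f (opA u).
Proof.
move=> Hf Hu; have Z y w : Hs y -> Hs w -> ip (fun g => c * y g) w = c * ip y w.
  move=> Hy Hw; rewrite (_ : (fun g => c * y g) = fun g => y g + (c - 1) * y g); last by apply/funext => g; ring.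
  by rewrite (ip_linl L) //; ring.
have HTf := Hs_T L S6 Hf; have HTu := Hs_T L S6 Hu.
by rewrite /opA (Z _ _ HTf Hu) (ipC L f) (Z _ _ HTu Hf) (ipC L (Tm 6 u)) (T_sym L S6 Hf Hu).
Qed.

Lemma wave_affine n f (m : R) : Hs f ->
  (wave n (fun g => f g + m * 1)).1 = (fun g => (wave n f).1 g + m * (wave_cst n).1) /\
  (wave n (fun g => f g + m * 1)).2 = (fun g => (wave n f).2 g + m * (wave_cst n).2).
Proof.
move=> Hf; elim: n => [|n] /=; first by split => //; apply/funext => g; rewrite mulr0 addr0.
have := Hs_wave n Hf; case: (wave n f) => a b /= [Ha Hb].
case: (wave n _) => a' b' /=; case: (wave_cst n) => p q /= [-> ->].
have K y k : Hs y -> opA (fun g => y g + m * k) = fun g => opA y g + m * (c * k).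
  by move=> Hy; rewrite (opA_lin m Hy (Hs_cst Gam k)) opA_cst.
by rewrite !K //; [split; apply/funext => g; ring|exact: Hs_A].
Qed.

(** The identity [T_n^2 + (1 - A^2) U_(n-1)^2 = 1] of the Chebyshev polynomials, with [b] in the
    role of [U_(n-1)(A) f]. *)
Lemma wave_conserved n f : Hs f -> let: (a, b) := wave n f in ip a a + ip b b - ip (opA b) (opA b) = ip f f.
Proof.
move=> Hf; elim: n => [|n] /=.
  rewrite (opA_cst 0) mulr0 addrK //.
have := Hs_wave n Hf; case: (wave n f) => a b /= [Ha Hb] <-.
have HAa := Hs_A Ha; have HAb := Hs_A Hb; have HAAb := Hs_A HAb.
have -> : (fun g => opA a g - b g + opA (opA b) g) = fun g => (opA a g + (-1) * b g) + 1 * opA (opA b) g.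
  by apply/funext => g; ring.
have -> : (fun g => opA b g + a g) = fun g => opA b g + 1 * a g by apply/funext => g; ring.
rewrite (opA_lin 1 HAb Ha).
have H1 := Hs_lin (-1) HAa Hb; have H2 := Hs_lin 1 H1 HAAb; have H3 := Hs_lin 1 HAb Ha; have H4 := Hs_lin 1 HAAb HAa.
rewrite (ip_linl L 1 H1 HAAb H2) (ip_linl L (-1) HAa Hb H2) !(ip_linr L 1 H1 HAAb) // !(ip_linr L (-1) HAa Hb) //.
rewrite (ip_linl L 1 HAb Ha H3) !(ip_linr L 1 HAb Ha) // (ip_linl L 1 HAAb HAa H4) !(ip_linr L 1 HAAb HAa) //.
rewrite (ipC L b (opA a)) (ipC L (opA (opA b)) (opA a)) (ipC L (opA (opA b)) b) (ipC L (opA b) a).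
rewrite (opA_sym Ha Hb) -(opA_sym Hb HAb).
move: (ip (opA a) (opA a)) (ip a (opA b)) (ip (opA a) (opA (opA b))) (ip b b) (ip (opA b) (opA b)).
by move: (ip (opA (opA b)) (opA (opA b))) (ip a a) => *; ring.
Qed.

(** The bounds [A] and [B] of the two components obey the recursion with all signs positive and [M]
    in place of the operator; with [w = sqrt (1 + M^2)], the combination [A + w B] is multiplied by
    [q] at each step. *)
Lemma wave_bound n f (eps : R) (x : G) : Hs f -> (forall h, `|f h| <= eps * HS2 (x * h)%g) ->
  let M := 3 / 2 * c in let q := M + Num.sqrt (1 + M ^+ 2) in
  forall h, `|(wave n f).1 h| <= eps * q ^+ n * HS2 (x * h)%g.
Proof.
move=> Hf Hfe M q; pose w := Num.sqrt (1 + M ^+ 2).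
have M0 : 0 <= M by rewrite mulr_ge0.
have w2 : w ^+ 2 = 1 + M ^+ 2 by rewrite sqr_sqrtr // addr_ge0 // sqr_ge0.
have w0 : 0 <= w by rewrite sqrtr_ge0.
suff : exists A B : R, [/\ 0 <= B, A + w * B = eps * q ^+ n, forall h, `|(wave n f).1 h| <= A * HS2 (x * h)%g &
    forall h, `|(wave n f).2 h| <= B * HS2 (x * h)%g].
  move=> [A [B [B0 E HA _]]] h; apply: (le_trans (HA h)).
  by rewrite ler_wpM2r ?(ltW (HS2_gt0 _)) // -E lerDl mulr_ge0.
elim: n => [|n].
  by exists eps, 0; split => //=; [rewrite mulr0 addr0 mulr1|move=> h; rewrite normr0 mul0r].
have := Hs_wave n Hf => /=; case: (wave n f) => a b /= [Ha Hb] [A [B [B0 E HA HB']]].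
have K y k : Hs y -> (forall h, `|y h| <= k * HS2 (x * h)%g) -> forall h, `|opA y h| <= M * k * HS2 (x * h)%g.
  move=> Hy Hk h; rewrite /opA normrM (ger0_norm c0).
  have := ler_wpM2l c0 (T6_HS2_bound Hmu Hy.1 Hk h); rewrite /M; move=> H; apply: (le_trans H).
  by rewrite le_eqVlt; apply/orP; left; apply/eqP; ring.
exists (M * A + (1 + M ^+ 2) * B), (M * B + A); split.
- rewrite addr_ge0 ?mulr_ge0 //.
  have := HA 1%g; have := normr_ge0 (a 1%g) => h1 h2; have := le_trans h1 h2.
  by rewrite pmulr_lge0 // HS2_gt0.
- by rewrite [q ^+ n.+1]exprSr mulrA -E -w2 /q -/w; ring.
- move=> h; apply: (le_trans (ler_normD _ _)); apply: (le_trans (lerD (ler_normB _ _) (lexx _))).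
  have := K _ _ Ha HA h; have := K _ _ (Hs_A Hb) (K _ _ Hb HB') h; have := HB' h.
  move: (HS2 _) => H; rewrite (_ : (M * A + _) * H = M * A * H + B * H + M * (M * B) * H); last by ring.
  lra.
- move=> h; apply: (le_trans (ler_normD _ _)); have := K _ _ Hb HB' h; have := HA h.
  move: (HS2 _) => H; rewrite mulrDl; lra.
Qed.

(** With [k = sqrt (c^2 - 1)], the combinations [a + k b] and [a - k b] are the powers of [c + k]
    and [c - k]. *)
Lemma wave_cst_lower n : 1 <= c -> (c + Num.sqrt (c ^+ 2 - 1)) ^+ n <= 2 * (wave_cst n).1.
Proof.
move=> c1; pose k := Num.sqrt (c ^+ 2 - 1); rewrite -/k.
have c2 : 0 <= c ^+ 2 - 1 by rewrite subr_ge0 exprn_ege1.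
have k2 : k ^+ 2 = c ^+ 2 - 1 by rewrite sqr_sqrtr.
have k0 : 0 <= k by rewrite sqrtr_ge0.
have kc : k <= c.
  rewrite -(ler_pXn2r (_ : 0 < 2)%N) ?nnegrE // k2; lra.
have [E1 E2] : (wave_cst n).1 + k * (wave_cst n).2 = (c + k) ^+ n /\ (wave_cst n).1 - k * (wave_cst n).2 = (c - k) ^+ n.
  elim: n => [|n] /=; first by rewrite mulr0 addr0 subr0.
  case: (wave_cst n) => a b /= [E1 E2]; rewrite ![_ ^+ n.+1]exprSr -E1 -E2.
  have c2k : c ^+ 2 = k ^+ 2 + 1 by rewrite k2; ring.
  by rewrite c2k; split; ring.
have : 0 <= (c - k) ^+ n by rewrite exprn_ge0 // subr_ge0.
by rewrite -E1 -E2; lra.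
Qed.

Lemma V0_wave n f : V0 mu Gam D f -> V0 mu Gam D (wave n f).1 /\ V0 mu Gam D (wave n f).2.
Proof.
move=> Vf; elim: n => [|n] /=.
  by split => //; split; [exact: Hs_cst|rewrite /ID (wint_cst (weight_D L)) mul0r].
have VA y : V0 mu Gam D y -> V0 mu Gam D (opA y).
  move=> Vy; rewrite /opA (_ : (fun g => _) = fun g => Tm 6 y g + (c - 1) * Tm 6 y g); last by apply/funext => g; ring.
  by apply: (V0_lin L); exact: (V0_T L S6 Vy).
case: (wave n f) => a b /= [Va Vb]; split.
  rewrite (_ : (fun g => _) = fun g => (opA a g + (-1) * b g) + 1 * opA (opA b) g); last by apply/funext => g; ring.
  by apply: (V0_lin L); [apply: (V0_lin L) => //; exact: VA|exact: (VA _ (VA _ Vb))].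
rewrite (_ : (fun g => _) = fun g => opA b g + 1 * a g); last by apply/funext => g; ring.
by apply: (V0_lin L) => //; exact: VA.
Qed.

End Wave.

Section Connect.
Variables (l : R) (N : nat).
Hypotheses (l0 : 0 <= l) (Hl : forall m, m != 0 -> laplace_eigenvalue Gam m -> l <= m).
Let c := 1 + l / 5.
Let M := 3 / 2 * c.
Let q := M + Num.sqrt (1 + M ^+ 2).
Let r := c + Num.sqrt (c ^+ 2 - 1).
Hypothesis HN : 4 * v <= r ^+ N * Vin.

Let c0 : 0 <= c. Proof. by have h := l0; rewrite /c; lra. Qed.
Let c1 : 1 <= c. Proof. by have h := l0; rewrite /c; lra. Qed.
Let q0 : 0 < q.
Proof.
rewrite /q ltr_pwDl // ?sqrtr_ge0 //; have := c1; rewrite /M; lra.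
Qed.

(** By the spectral gap [opA] does not increase the norm of functions of mean zero, so the conserved
    quantity bounds the first component. *)
Lemma wave_contraction f : V0 mu Gam D f -> ip (wave c N f).1 (wave c N f).1 <= ip f f.
Proof.
move=> Vf; have := wave_conserved c N Vf.1; have := V0_wave c N Vf.
case: (wave c N f) => a b /= [_ [Hb b0]] <-.
rewrite -addrA lerDl subr_ge0.
have -> : ip (opA c b) (opA c b) = (1 + l / 5) ^+ 2 * ip (Tm 6 b) (Tm 6 b); last exact: (spectral_gap L l0 Hl Hb b0).
have HT := Hs_T L S6 Hb.
rewrite /opA /c; move: (1 + l / 5) => k.
have Z y w : Hs y -> Hs w -> ip (fun g => k * y g) w = k * ip y w.
  move=> Hy Hw; rewrite (_ : (fun g => k * y g) = fun g => y g + (k - 1) * y g); last by apply/funext => g; ring.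
  by rewrite (ip_linl L) //; ring.
have Hk : Hs (fun g => k * Tm 6 b g) by have := Hs_A k Hb.
by rewrite (Z _ _ HT Hk) (ipC L _ (fun g => _ * _)) (Z _ _ HT HT) expr2 mulrA.
Qed.

(** Run the wave from the indicator of the balls around the orbit of [x] and pair it with that of
    [y]. If the orbits were far apart, the weight [HS2] would keep the pairing below [ID u / 2]; but
    the mean contributes at least [2 ID u] and the part of mean zero at least [- ID u], the latter
    because the volume at [x] is the smaller one. *)
Let connect_le (x y : G) : ID (orbit_indic x) <= ID (orbit_indic y) ->
  exists2 d, Gam d & HS2 (x^-1 * d * y)%g <= 200 * q ^+ N.
Proof.
move=> Ixy; apply: contrapT => H; set Rq := 200 * q ^+ N in H *.
have R0 : 0 < Rq by rewrite mulr_gt0 ?exprn_gt0.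
have far d : Gam d -> Rq < HS2 (x^-1 * d * y)%g.
  by move=> Gd; rewrite ltNge; apply/negP => Hd; apply: H; exists d.
have B10 := Bin_bounded.
have v0 := v_gt0 L; have V0' := Vin_gt0.
have Hx := Hs_orbit_indic x; have Hy := Hs_orbit_indic y.
pose F := orbit_indic x; pose u := orbit_indic y.
have Fle h : `|F h| <= 10 / Rq * HS2 (y^-1 * h)%g.
  have p0 : 0 <= 10 / Rq * HS2 (y^-1 * h)%g by rewrite mulr_ge0 ?divr_ge0 ?(ltW (HS2_gt0 _)) // ltW.
  rewrite /F /orbit_indic indicE; case: (boolP (h \in _)); rewrite ?normr0 // inE normr1 => -[d Gd Hd].
  rewrite mulrAC ler_pdivlMr // mul1r mulrC; apply: (le_trans (ltW (far d Gd))).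
  rewrite -HS2V (_ : ((_ * _)^-1)%g = (y^-1 * h * (x^-1 * d * h)^-1)%g); last by rewrite !invgM !invgK !mulgA mulgK.
  apply: (le_trans (HS2M _ _)); rewrite HS2V ler_wpM2l ?(ltW (HS2_gt0 _)) //; exact: B10.
have up : ip (wave c N F).1 u <= 1 / 2 * ID u.
  have [Ha _] := Hs_wave c N Hx; rewrite -[leRHS](wintZ (weight_D L)); last exact: Hy.1.
  apply: (le_wint (weight_D L)) => [||h _]; [exact: mboundedM Ha.1 Hy.1|exact: mboundedZ Hy.1|].
  rewrite /u /orbit_indic indicE; case: (boolP (h \in _)); rewrite ?mulr0 // inE !mulr1 => -[d Gd Hd].
  rewrite -(Ha.2 d h Gd); apply: (le_trans (ler_norm _)).
  apply: (le_trans (wave_bound c0 N Hx Fle _)).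
  (* The constant 200 is chosen so that the distortions by 10 coming from the two balls leave the
     value 1/2. *)
  have E : 10 / Rq * q ^+ N = 1 / 20 by rewrite /Rq; field; rewrite gt_eqF // exprn_gt0.
  by rewrite E mulgA; exact: twentieth (B10 _ Hd).
pose m := ID F / v; pose F0 g := F g + (- m) * 1.
have HF0 : Hs F0 by apply: Hs_lin => //; exact: Hs_cst.
have VF0 : V0 mu Gam D F0.
  split => //; rewrite /F0 (ID_lin L (-m) Hx (Hs_cst Gam 1)) (ID1 L) /m; field; by rewrite gt_eqF.
have FE : F = fun g => F0 g + m * 1 by apply/funext => g; rewrite /F0; ring.
have [E1 _] := wave_affine c N m HF0.
have [Ha _] := Hs_wave c N HF0.
have low : ip (wave c N F).1 u = ip (wave c N F0).1 u + m * (wave_cst c N).1 * ID u.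
  rewrite FE E1 (_ : (fun g => _) = fun g => (wave c N F0).1 g + (m * (wave_cst c N).1) * (fun=> 1) g); last by apply/funext => g; rewrite mulr1.
  by rewrite (ip_linl L _ Ha (Hs_cst Gam 1) Hy) (ipC L (fun=> 1) u) -(ID_ip L).
have n1 : ip F0 F0 <= ID F.
  rewrite /F0 (ip_linl L (- m) Hx (Hs_cst Gam 1) HF0) (ipC L (fun=> 1) F0) -(ID_ip L) VF0.2 mulr0 addr0.
  rewrite (ip_linr L (- m) Hx (Hs_cst Gam 1) Hx) ip_orbit_indic -(ID_ip L) mulNr lerBlDr lerDl.
  have I0 : 0 <= ID F by apply: le_trans (Vin_le x); exact: ltW.
  by rewrite mulr_ge0 // divr_ge0 // ltW.
have cs := ip_cauchy_schwarz L Ha Hy; have ct := wave_contraction VF0.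
have Iy := Vin_le y; have Ix := Vin_le x.
rewrite ip_orbit_indic in cs.
have Iu0 : 0 <= ID u := le_trans (ltW V0') Iy.
have lb : - ID u <= ip (wave c N F0).1 u.
  rewrite lerNl leNgt; apply/negP => Hn.
  have : ip (wave c N F0).1 u ^+ 2 <= ID u ^+ 2.
    apply: (le_trans cs); rewrite expr2; apply: (ler_wpM2r Iu0).
    exact: le_trans ct (le_trans n1 Ixy).
  rewrite leNgt => /negP; apply; rewrite -(sqrrN (ip _ u)).
  by rewrite (ltrXn2r 2 Iu0 Hn).
have wl := wave_cst_lower c0 N c1; rewrite -/r in wl.
have big : 2 * ID u <= m * (wave_cst c N).1 * ID u.
  apply: (ler_wpM2r Iu0).
  have vi : 0 <= v^-1 by rewrite invr_ge0 ltW.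
  have m1 : Vin / v <= m by exact: (ler_wpM2r vi Ix).
  have r0 : 0 <= r ^+ N by rewrite exprn_ge0 // addr_ge0 // sqrtr_ge0.
  apply: (@le_trans _ _ (Vin / v * (r ^+ N / 2))).
    exact: wave_factor v0 HN.
  apply: ler_pM => //; [exact: mulr_ge0 (ltW V0') vi|exact: divr_ge0|].
  by rewrite ler_pdivrMr // mulrC.
by move: up; rewrite low; exact: wave_absurd V0' Iy lb big.
Qed.

Lemma orbit_connect (x y : G) : exists2 d, Gam d & HS2 (x^-1 * d * y)%g <= 200 * q ^+ N.
Proof.
have [Ixy|/ltW Iyx] := leP (ID (orbit_indic x)) (ID (orbit_indic y)); first exact: connect_le.
have [d Gd Hd] := connect_le Iyx; exists (d^-1)%g; first by have [_ _] := lat_subgroup L; apply.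
by move: Hd; rewrite -HS2V !invgM !invgK mulgA.
Qed.

(** Walk from 1 to the given element by steps with [HS2 <= 10] and choose at each point an element
    of [Gam] close to it: consecutive choices differ by an element of the set. [P p] says that all
    elements of [Gam] close to [p] are generated. *)
Lemma lattice_generated :
  generated [set d | Gam d /\ HS2 d <= 10 * (200 * q ^+ N) ^+ 2] = Gam.
Proof.
have [G1 GM GV] := lat_subgroup L; set S := [set d | _].
apply/seteqP; split.
  by apply: smallest_sub => // d [].
have SS d : S d -> generated S d by move=> Sd; exact: sub_gen_smallest.
have SM x y : generated S x -> generated S y -> generated S (x * y)%g.
  by move=> Hx Hy A HA; have [[_ AM _] _] := HA; apply: AM; [exact: Hx|exact: Hy].
have q1 : 1 <= q ^+ N.
  rewrite exprn_ege1 // /q -[leLHS]addr0; apply: lerD; last exact: sqrtr_ge0.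
  by rewrite /M; have := c1; lra.
set Rq := 200 * q ^+ N; have R2 : 2 <= Rq by rewrite /Rq; move: (q ^+ N) q1 => y; lra.
have Sq : Rq <= 10 * Rq ^+ 2 by move: Rq R2 => y; nra.
pose P p := forall d, Gam d -> HS2 (p^-1 * d)%g <= Rq -> generated S d.
move=> d Gd; suff : P d by apply => //; rewrite mulVg HS2_1.
apply: (small_steps (P := P)) => [d' Gd'|p s Pp s10 d' Gd' Hd'].
  by rewrite invg1 mul1g => H; apply: SS; split => //; exact: le_trans Sq.
have [d0 Gd0] := orbit_connect p 1%g; rewrite mulg1 -/Rq => Hd0.
rewrite -[d'](mulVKg d0); apply: SM; first exact: Pp.
apply: SS; split; first by apply: GM => //; exact: GV.
have -> : (d0^-1 * d' = (p^-1 * d0)^-1 * s * ((p * s)^-1 * d'))%g.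
  by rewrite !invgM invgK !mulgA !mulgK.
apply: (le_trans (HS2M _ _)); rewrite -/Rq expr2 mulrA.
apply: ler_pM => //; rewrite ?(ltW (HS2_gt0 _)) //.
apply: (le_trans (HS2M _ _)); rewrite HS2V mulrC.
by apply: ler_pM => //; rewrite ?(ltW (HS2_gt0 _)).
Qed.

End Connect.
End Diameter.

(** * Lower bounds for eigenvalues *)

Section Regularity.
Variables (R : realType).
Local Notation G := (borelSL2 R).
Local Notation H2 := (@upper_half_plane R).
Implicit Types (g h : G).

Lemma continuous_measurable_SL2 (f : SL2 R -> R) : continuous f -> measurable_fun setT (f : G -> R).
Proof.
move=> cf; apply: (measurability _ (measurable_realfun.RGenOInfty.measurableE R)) => _ [_ [x ->] <-].
rewrite setTI; apply: sub_sigma_algebra; apply: open_comp; last exact: rray_open.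
by move=> g _; exact: cf.
Qed.

Lemma moebius_near1 (s : R) g : 0 <= s -> s <= 1 / 2 -> HS2 g <= 2 + s ^+ 2 ->
  `|(moebius g (zi R)).1| <= 2 * s /\ `|(moebius g (zi R)).2 - 1| <= 2 * s.
Proof.
move=> s0 s1 Hg; set z := moebius g (zi R).
have Hz : H2 z by apply: moebius_H2; exact: H2i.
have E : HS2 g = HS2 (gz z) by have [k Hk {1}->] := gz_rotation g; rewrite HS2_rotr.
have := HS2_gz 1%g Hz; rewrite mulg1 HS2V -E /Pz /PA /PB ga1 gb1 gc1 gd1 => F.
have z0 : 0 < z.2 := Hz.
have {}F : z.1 ^+ 2 + (z.2 - 1) ^+ 2 <= s ^+ 2 * z.2.
  have : (2 + HS2 g) * z.2 = (1 * z.1 + 0 * z.2 - 0) ^+ 2 + (1 * z.2 - 0 * z.1 + 1) ^+ 2 by rewrite F divfK // gt_eqF.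
  have : HS2 g * z.2 <= (2 + s ^+ 2) * z.2 by rewrite ler_wpM2r // ltW.
  by move: (HS2 g) (s ^+ 2) (z.1) (z.2) => H S a b ? ?; nra.
move: z0 F; move: (z.1) (z.2) => p q q0 F.
have s2 : s ^+ 2 <= 1 / 4 by nra.
have q2 : q <= 2.
  rewrite leNgt; apply/negP => q2; have := sqr_ge0 p; have : s ^+ 2 * q <= 1 / 4 * q by rewrite ler_wpM2r // ltW.
  by nra.
have s4 : s ^+ 2 * q <= (2 * s) ^+ 2 by have := sqr_ge0 s; rewrite exprMn; nra.
have K (x : R) : x ^+ 2 <= (2 * s) ^+ 2 -> `|x| <= 2 * s.
  move=> H; rewrite -(ler_pXn2r (_ : 0 < 2)%N) ?nnegrE ?mulr_ge0 //.
  by rewrite real_normK ?num_real.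
by split; apply: K; apply: (le_trans _ s4); [have := sqr_ge0 (q - 1)|have := sqr_ge0 p]; lra.
Qed.

(** Continuity of the action at [i], phrased through [HS2], so that continuity on the half-plane
    becomes continuity of the lift to the group. *)
Lemma moebius_nbhs g (A : set (R * R)) : nbhs (moebius g (zi R)) A ->
  exists2 s : R, 0 < s <= 1 & forall y, HS2 (g^-1 * y)%g <= 2 + s ^+ 2 -> A (moebius y (zi R)).
Proof.
move=> nA; have [d d0 Hd] : exists2 d : R, 0 < d & forall z : R * R, `|z.1| < d -> `|z.2 - 1| < d -> H2 z -> A (moebius g z).
  have : nbhs (zi R) [set z | H2 z -> A (moebius g z)].
    pose Dz (z : R * R) := (gc g * z.1 + gd g) ^+ 2 + (gc g * z.2) ^+ 2.
    pose Nm (z : R * R) := (ga g * z.1 + gb g) * (gc g * z.1 + gd g) + ga g * gc g * z.2 ^+ 2.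
    have c1 : (fun z : R * R => z.1) z @[z --> zi R] --> (zi R).1 by exact: cvg_fst.
    have c2 : (fun z : R * R => z.2) z @[z --> zi R] --> (zi R).2 by exact: cvg_snd.
    have cA (p q : R) : (fun z : R * R => p * z.1 + q) z @[z --> zi R] --> p * (zi R).1 + q.
      by apply: cvgD; [apply: cvgM => //; exact: cvg_cst|exact: cvg_cst].
    have cB (p : R) : (fun z : R * R => p * z.2) z @[z --> zi R] --> p * (zi R).2.
      by apply: cvgM => //; exact: cvg_cst.
    have [D0 E0] := moebiusE g (H2i R).
    have cD : Dz z @[z --> zi R] --> Dz (zi R).
      by rewrite /Dz; apply: cvgD; rewrite !expr2; apply: cvgM.
    have cN : Nm z @[z --> zi R] --> Nm (zi R).
      rewrite /Nm; apply: cvgD; apply: cvgM => //; first exact: cvg_cst.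
      by rewrite !expr2; apply: cvgM.
    have DN0 : Dz (zi R) != 0 by rewrite gt_eqF.
    have cphi : (Nm z / Dz z, z.2 / Dz z) @[z --> zi R] --> (Nm (zi R) / Dz (zi R), (zi R).2 / Dz (zi R)).
      have cX : (fun z => Nm z / Dz z) z @[z --> zi R] --> Nm (zi R) / Dz (zi R) by apply: cvgM => //; exact: cvgV.
      have cY : (fun z => z.2 / Dz z) z @[z --> zi R] --> (zi R).2 / Dz (zi R) by apply: cvgM => //; exact: cvgV.
      exact: (cvg_pair cX cY).
    have nb : nbhs (zi R) [set z | A (Nm z / Dz z, z.2 / Dz z)] by apply: cphi; rewrite -E0.
    suff sub : [set z | A (Nm z / Dz z, z.2 / Dz z)] `<=` [set z | H2 z -> A (moebius g z)] by exact: filterS sub nb.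
    by move=> z /= Az Hz; have [_ ->] := moebiusE g Hz.
  move=> /nbhs_ballP[d /= d0 Hd]; exists d => // z z1 z2 Hz; apply: Hd => //.
  by split; rewrite /ball /= distrC ?subr0.
exists (Num.min (1 / 2) (d / 3)).
  rewrite lt_min; apply/andP; split; last by rewrite ge_min; apply/orP; left; lra.
  by apply/andP; split; lra.
move=> y; set s := Num.min _ _ => Hy.
have s0 : 0 <= s by rewrite le_min; apply/andP; split; lra.
have s1 : s <= 1 / 2 by rewrite ge_min lexx.
have s2 : s <= d / 3 by rewrite ge_min lexx orbT.
have [A1 A2] := moebius_near1 s0 s1 Hy.
rewrite -[y](mulVKg g) moebius_mul_i; apply: Hd; last by apply: moebius_H2; exact: H2i.
- by apply: (le_lt_trans A1); lra.
- by apply: (le_lt_trans A2); lra.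
Qed.

End Regularity.

Section Eigenvalues.
Variables (R : realType) (mu : {sigma_finite_measure set (borelSL2 R) -> \bar R}).
Local Notation G := (borelSL2 R).
Local Notation H2 := (@upper_half_plane R).
Implicit Types (g h : G).
Variables (Gam : set (SL2 R)) (D : set G) (v e0 rho : R).
Hypothesis L : lattice mu Gam D v e0 rho.
Let Hmu := lat_haar L.
Local Notation Tm S := (T mu S).
Local Notation ID := (ID mu D).

Section Eigenfunction.
Variables (F : R * R -> R) (l : R).
Hypotheses (sF : smooth_on_H2 F) (Fi : forall g z, Gam g -> H2 z -> F (moebius g z) = F z)
  (F0 : exists2 z, H2 z & F z != 0) (lF : forall z, H2 z -> laplace_beltrami F z = l * F z).

Definition lift g := F (moebius g (zi R)).

Lemma lift_gz z : H2 z -> lift (gz z) = F z.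
Proof. by move=> Hz; rewrite /lift moebius_gz. Qed.

Lemma ginv_lift : ginv Gam lift.
Proof. by move=> c g Gc; rewrite /lift moebius_mul_i Fi //; apply: moebius_H2; exact: H2i. Qed.

(** Invariance and compactness of the set of representatives make the continuity uniform. *)
Lemma unif_lift : unif lift.
Proof.
move=> e ee; have e2 : 0 < e / 2 by rewrite divr_gt0.
have comp := @compact_HS2_ball R rho; move/compact_near_coveringP: comp => comp.
have HF : \forall x \near (0 : R)^'+, [set g : SL2 R | HS2 g <= rho] `<=`
    (fun g => forall h : G, HS2 h <= 2 + x ^+ 2 -> `|lift (g * h)%g - lift g| <= e).
  apply: (comp R ((0 : R)^'+) (fun x g => forall h : G, HS2 h <= 2 + x ^+ 2 -> `|lift (g * h)%g - lift g| <= e)) => g _.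
  have Hz : H2 (moebius g (zi R)) by apply: moebius_H2; exact: H2i.
  have [cF _] := sF 0; have := cF _ Hz => /cvgrPdist_le /(_ _ e2) /moebius_nbhs[s /andP[s0 s1] Hs].
  have s20 : 0 < s ^+ 2 / 9 by rewrite divr_gt0 // exprn_gt0.
  exists ([set y : SL2 R | HS2 (g^-1 * y)%g <= 2 + (s / 2) ^+ 2], [set x : R | 0 < x < s ^+ 2 / 9]).
    split; first by apply: nbhs_HS2; rewrite divr_gt0.
    by near=> x; apply/andP; split; near: x; [exact: nbhs_right_gt|exact: nbhs_right_lt].
  move=> [y x] /= [Hy /andP[x0 xs]] h Hh.
  have A : HS2 (g^-1 * y)%g <= 2 + s ^+ 2.
    by apply: (le_trans Hy); rewrite lerD2l exprMn; have := sqr_ge0 s; lra.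
  have B : HS2 (g^-1 * (y * h))%g <= 2 + s ^+ 2.
    rewrite mulgA; apply: (le_trans (HS2_mulr_le _ (ltW x0) Hh)).
    have s2 : s ^+ 2 <= 1 by rewrite expr_le1 // ltW.
    apply: (@le_trans _ _ ((1 + x) ^+ 2 * (2 + (s / 2) ^+ 2))); first by rewrite ler_wpM2l ?sqr_ge0.
    rewrite exprMn; move: s2 xs Hh; move: (s ^+ 2) s20 => S S0 S1 xs _.
    have : 1 <= 1 + S; nra.
  have := Hs _ A; have := Hs _ B; rewrite /= /lift.
  rewrite !ler_norml => /andP[? ?] /andP[? ?]; apply/andP; split; lra.
have pos : \forall x \near (0 : R)^'+, 0 < x by exact: nbhs_right_gt.
have [x [Hx x0]] := filter_ex (filterI HF pos).
exists x => // g h Hh; have [c Gc Hc] := lat_cocompact L g.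
by have := Hx _ Hc h Hh; rewrite -mulgA !(ginv_lift _ Gc).
Unshelve. all: by end_near.
Qed.

Lemma mbounded_lift : mbounded lift.
Proof.
split; first by apply: continuous_measurable_SL2; apply: unif_continuous; exact: unif_lift.
have [g1 H1] := attains_max L ginv_lift unif_lift.
have ni : ginv Gam (fun g => -1 * lift g) by move=> c g Gc; rewrite ginv_lift.
have [g2 H2'] := attains_max L ni (unifZ (-1) unif_lift).
exists (Num.max (lift g1) (-1 * lift g2)) => g; rewrite ler_norml; apply/andP; split; last by rewrite le_max H1.
by rewrite lerNl le_max; apply/orP; right; have := H2' g; rewrite mulN1r.
Qed.

Let smooth_lift : smooth_on_H2 (fun z => lift (gz z)).
Proof. by move=> n; apply: (Cn_congr _ (sF n)) => z Hz; rewrite lift_gz. Qed.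

Let laplace_lift z : H2 z -> laplace_beltrami (fun z => lift (gz z)) z = l * lift (gz z).
Proof. by move=> Hz; rewrite (lift_gz Hz) -(lF Hz); apply: (laplace_congr _ Hz) => w Hw; exact: lift_gz Hw. Qed.

Let lift0 : exists g, lift g != 0.
Proof. by have [z Hz Fz] := F0; exists (gz z); rewrite lift_gz. Qed.

Lemma eigenfunction_nonneg : 0 <= l.
Proof. exact: (eigen_nonneg L ginv_lift unif_lift smooth_lift laplace_lift lift0). Qed.

Lemma cmul_ge (m S : nat) : (5 <= S)%N -> 1 - l * (S%:R - 1)^-1 <= cmul l m S.
Proof.
have l0 := eigenfunction_nonneg.
elim: m S => [|m IH] S S5 /=.
  by rewrite lerBlDr lerDl mulr_ge0 // invr_ge0 subr_ge0 ler1n; lia.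
have a5 : 5 <= S%:R :> R by rewrite ler_nat.
have := IH S.+1 (leqW S5); have := @cmul_gt0 R l m S.+1 l0 (leqW S5).
move: (cmul l m S.+1) => c c0; rewrite -(natr1 S) addrK; move: (S%:R : R) a5 => a a5 Hc.
pose A := a * (a - 1); have A0 : 0 < A by rewrite mulr_gt0 //; lra.
rewrite -/A; have Al : 0 < A + l by rewrite ltr_wpDr.
have E : (a - 1)^-1 = a^-1 + A^-1 by rewrite /A; field; rewrite !gt_eqF //; lra.
have f1 : A / (A + l) = 1 - l / (A + l) by field; rewrite gt_eqF.
have f2 : l / (A + l) <= l * A^-1 by rewrite ler_wpM2l // lef_pV2 ?posrE // lerDl.
have f3 : 0 <= A / (A + l) by rewrite divr_ge0 // ltW.
have f4 : 0 <= l / (A + l) by rewrite divr_ge0 // ltW.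
have a0 : 0 <= l * a^-1 by rewrite mulr_ge0 // invr_ge0; lra.
apply: (@le_trans _ _ (A / (A + l) * (1 - l * a^-1))); last exact: ler_wpM2l.
have K (p x y : R) : p <= y -> 0 <= p -> 0 <= x -> 1 - (x + y) <= (1 - p) * (1 - x).
  by move=> py p0 x0; have := mulr_ge0 p0 x0; rewrite mulrBl mulrBr; lra.
by rewrite E f1 mulrDr; exact: K.
Qed.

(** At a minimum the positive Laplacian is nonpositive, and it is [l] times the value. *)
Let nonpos_point : 0 < l -> exists g, lift g <= 0.
Proof.
move=> lp; pose nw g := lift g + (-2) * lift g.
have ni : ginv Gam nw by move=> c g Gc; rewrite /nw !(ginv_lift _ Gc).
have un : unif nw by apply: unif_lincomb; exact: unif_lift.
have [g1 Hg1] := attains_max L ni un; exists g1.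
pose z1 := moebius g1 (zi R); have Hz1 : H2 z1 by apply: moebius_H2; exact: H2i.
have E1 : nw g1 = nw (gz z1) by apply: (@rotation_invariant _ nw) => g k Hk; exact: unif_rotr un g k Hk.
have Cn : Cn_on_H2 2 (fun z => nw (gz z)) by apply: Cn_lincomb; exact: smooth_lift.
have := laplace_at_max Cn Hz1; rewrite (laplace_lincomb (-2) (smooth_lift 2) (smooth_lift 2) Hz1) (laplace_lift Hz1).
have -> : l * lift (gz z1) + -2 * (l * lift (gz z1)) = l * nw (gz z1) by rewrite /nw; ring.
rewrite -E1 pmulr_rge0 // => H; have : 0 <= nw g1 by apply: H => w Hw; exact: Hg1.
by rewrite /nw; lra.
Qed.

Let bound_arith (M eta l' d t1 t0 w1 c : R) : 0 < M -> 0 <= d -> 0 < c -> 1 - l' * (6 - 1)^-1 <= c ->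
  `|t1 - c * w1| <= eta -> w1 <= 0 -> `|t0 - c * M| <= eta -> M - t1 <= d * (M - t0) ->
  5 * M <= d * (l' * M) + 5 * eta * (1 + d).
Proof.
move=> M0 d0 c0 Hc; rewrite !ler_norml => /andP[_ A] w0 /andP[B _] H.
have cw : c * w1 <= 0 by rewrite mulr_ge0_le0 // ltW.
have H1 : M - eta <= d * (M - t0) by lra.
have H2 : M - t0 <= M * (l' / 5) + eta.
  have : (1 - l' * (6 - 1)^-1) * M <= c * M by rewrite ler_wpM2r // ltW.
  have -> : (1 - l' * (6 - 1)^-1) * M = M - M * (l' / 5) by field.
  by lra.
have := ler_wpM2l d0 H2; lra.
Qed.

(** With [w] the lift and [M] its maximum, [M - T 6 w] is essentially at most [M l / 5] at a maximum
    and at least [M] where [w <= 0]; Harnack's inequality compares the two points with the factor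
    [Dm^6]. *)
Lemma eigenfunction_bound_pos (Dm : R) : l != 0 -> (exists2 z, H2 z & 0 < F z) ->
  (forall x y : G, exists2 d, Gam d & HS2 (x^-1 * d * y)%g <= Dm) -> 5 <= l * Dm ^+ 6.
Proof.
move=> ln [z2 Hz2 Fz2] HD; have l0 := eigenfunction_nonneg.
have lp : 0 < l by rewrite lt_neqAle eq_sym ln.
have [g1 w1] := nonpos_point lp; have [g0 Hg0] := attains_max L ginv_lift unif_lift.
pose M := lift g0; have M0 : 0 < M by apply: (lt_le_trans Fz2); rewrite -(lift_gz Hz2); exact: Hg0.
have [d Gd Hd] := HD g1 g0; pose b := (g1^-1 * d * g0)%g.
have D1 : 1 <= Dm by apply: le_trans Hd; have := HS2_ge2 (g1^-1 * d * g0)%g; lra.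
have D6 : 0 <= Dm ^+ 6 by rewrite exprn_ge0 // (le_trans ler01).
pose P g := M + (-1) * lift g.
have Hl := mbounded_lift; have HP : mbounded P by apply: mboundedD; [exact: mbounded_cst|exact: mboundedZ].
have P0 g : 0 <= P g by rewrite /P mulN1r subr_ge0; exact: Hg0.
have TP g : Tm 6 P g = M - Tm 6 lift g.
  by rewrite /P (TD Hmu (-1) _ (mbounded_cst G M) Hl) // T_cst // mulN1r.
have bD g : HS2 (g * b)%g <= Dm * HS2 g.
  by apply: (le_trans (HS2M _ _)); rewrite mulrC ler_wpM2r // ltW // HS2_gt0.
have Har := T_harnack Hmu (leqW (leqnn 5)) D1 bD HP P0 g1.
have Ti : ginv Gam (Tm 6 lift) by apply: ginv_T; exact: ginv_lift.
have E0 : Tm 6 lift (g1 * b)%g = Tm 6 lift g0 by rewrite /b !mulgA mulgV mul1g Ti.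
rewrite !TP E0 in Har.
suff : 5 * M <= Dm ^+ 6 * (l * M).
  by rewrite mulrA [Dm ^+ 6 * l]mulrC ler_pM2r.
apply/ler_addgt0Pl => e ee.
have p1 : 0 < 5 * (1 + Dm ^+ 6) by apply: mulr_gt0 => //; lra.
have [m _ Hm] := eigen_close L mbounded_lift ginv_lift unif_lift smooth_lift laplace_lift lift0 0%N (divr_gt0 ee p1).
have c0 := @cmul_gt0 R l m 6 l0 (leqW (leqnn 5)); have c1 := @cmul_ge m 6 (leqW (leqnn 5)).
have := bound_arith M0 D6 c0 c1 (Hm g1) w1 (Hm g0) Har.
have -> : 5 * (e / (5 * (1 + Dm ^+ 6))) * (1 + Dm ^+ 6) = e.
  by rewrite [5 * (e / _)]mulrC -mulrA divfK // gt_eqF.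
by rewrite addrC.
Qed.

End Eigenfunction.

Lemma eigenvalue_nonneg (l : R) : laplace_eigenvalue Gam l -> 0 <= l.
Proof. by move=> [F [sF Fi F0 lF]]; exact: (eigenfunction_nonneg sF Fi F0 lF). Qed.

Lemma eigenvalue_bound (l Dm : R) : laplace_eigenvalue Gam l -> l != 0 ->
  (forall x y : G, exists2 d, Gam d & HS2 (x^-1 * d * y)%g <= Dm) -> 5 <= l * Dm ^+ 6.
Proof.
move=> [F [sF Fi F0 lF]] ln HD; have [z Hz Fz] := F0.
case: (ltrgtP (F z) 0) => Fz0; last by rewrite Fz0 eqxx in Fz.
- pose F' z := F z + (-2) * F z; have FE w : F' w = - F w by rewrite /F'; ring.
  apply: (@eigenfunction_bound_pos F' l _ _ _ _ Dm ln) => //.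
  + by move=> n; apply: Cn_lincomb; exact: sF.
  + by move=> g w Gg Hw; rewrite !FE Fi.
  + by exists z => //; rewrite FE oppr_eq0.
  + by move=> w Hw; rewrite (laplace_lincomb (-2) (sF 2) (sF 2) Hw) (lF w Hw) /F'; ring.
  + by exists z => //; rewrite FE oppr_gt0.
- by apply: (eigenfunction_bound_pos sF Fi F0 lF ln _ HD); exists z.
Qed.

End Eigenvalues.

(** * Diameter bound by packing balls *)

Section Packing.
Variables (R : realType) (mu : {sigma_finite_measure set (borelSL2 R) -> \bar R}).
Local Notation G := (borelSL2 R).
Variables (Gam : set (SL2 R)) (D : set G) (v e0 rho : R).
Hypothesis L : lattice mu Gam D v e0 rho.
Local Notation ID := (ID mu D).
Local Notation Vin := (Vin mu e0).

Let reach (x : G) (r : R) : set G := [set g : G | exists2 c, Gam c & HS2 (x^-1 * c * g)%g <= r].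

Let measurable_reach x r : measurable (reach x r).
Proof.
have [e [e1 e2 _]] := enumeration_ex (lat_countable L).
rewrite (_ : reach x r = \bigcup_n (if e n is Some c then (fun g : G => (x^-1 * c * g)%g : G) @^-1` [set g : G | HS2 g <= r] else set0)).
  apply: bigcup_measurable => n _; case: (e n) => // c.
  by apply: measurable_preim; [exact: measurable_mulgl|exact: measurable_HS2_ball].
apply/seteqP; split => [g /= [c Gc Hc]|g [n _]].
  by have [n En] := e2 c Gc; exists n => //; rewrite En.
by case En : (e n) => [c|//] Hc; exists c => //; exact: e1 En.
Qed.

(** If the neighbourhood of radius [10 r] of the orbit is not everything, some small step leaves it;
    the balls around the orbit of the endpoint are disjoint from [reach x r] and contained in
    [reach x (1000 r)]. *)
Let reach_grow x r : 2 <= r -> ~ (forall g, reach x (10 * r) g) ->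
  ID \1_(reach x r) + Vin <= ID \1_(reach x (1000 * r)).
Proof.
move=> r2 H; have B10 := Bin_bounded L; have [G1 GM GV] := lat_subgroup L.
have [g [s [Hg s10 Hs]]] : exists g s : G, [/\ reach x (10 * r) g, HS2 s <= 10 & ~ reach x (10 * r) (g * s)%g].
  apply: contrapT => N; apply: H => g; rewrite -[g](mulVKg x).
  apply: (small_steps (P := fun g => reach x (10 * r) (x * g)%g)) => [|p s Hp s10].
    by exists 1%g => //; rewrite !mulg1 mulVg HS2_1; lra.
  by apply: contrapT => Hps; apply: N; exists (x * p)%g, s; split => //; rewrite -mulgA.
pose y := (g * s)%g; have [Hb Hi] := Hs_orbit_indic L y.
apply: (@le_trans _ _ (ID \1_(reach x r) + ID (orbit_indic Gam e0 y))); first by rewrite lerD2l (Vin_le L).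
rewrite -(IDD L) //; last by apply: mbounded_indic; exact: measurable_reach.
apply: (le_wint (weight_D L)) => [||h _].
- by apply: mboundedD => //; apply: mbounded_indic; exact: measurable_reach.
- by apply: mbounded_indic; exact: measurable_reach.
have step (a b : G) (q : R) : 0 <= q -> HS2 a <= q -> HS2 b <= 10 -> HS2 (a * b)%g <= 10 * q.
  move=> q0 aq b10; apply: (le_trans (HS2M _ _)); rewrite mulrC.
  by apply: ler_pM => //; rewrite ltW // HS2_gt0.
pose O := [set g : G | exists2 c, Gam c & Bin e0 (y^-1 * c * g)%g].
rewrite /orbit_indic !indicE -/O; have [Hy|Hy] := pselect (O h); [rewrite (mem_set Hy)|rewrite (memNset Hy)].
  have [c Gc Hc] := Hy; have [d Gd Hd] := Hg.
  rewrite (_ : h \in reach x r = false) ?add0r; last first.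
    apply: memNset.
    move=> [d' Gd' Hd']; apply: Hs; exists (d' * c^-1)%g; first by apply: GM => //; exact: GV.
    have -> : (x^-1 * (d' * c^-1) * (g * s) = (x^-1 * d' * h) * (y^-1 * c * h)^-1)%g.
      by rewrite /y !invgM !invgK !mulgA mulgK.
    by apply: step => //; [lra|rewrite HS2V; exact: B10].
  rewrite mem_set // /reach /=; exists (d * c)%g; first exact: GM.
  have -> : (x^-1 * (d * c) * h = x^-1 * d * g * s * (y^-1 * c * h))%g.
    by rewrite /y invgM !mulgA !mulgK.
  rewrite (_ : 1000 * r = 10 * (10 * (10 * r))); last by ring.
  by apply: (step); [lra|apply: (step) => //; lra|exact: B10].
rewrite addr0 ler_nat; case: (boolP (h \in reach x r)) => //; rewrite inE => -[c Gc Hc].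
by rewrite mem_set //; exists c => //; apply: (le_trans Hc); lra.
Qed.

(** Each failure to exhaust the quotient adds the volume of a ball, and there is no room for [m + 1]
    of them. *)
Lemma packing_diameter m : v < m.+1%:R * Vin ->
  forall x y : G, exists2 d, Gam d & HS2 (x^-1 * d * y)%g <= 20 * 1000 ^+ m.
Proof.
move=> Hv x y; apply: contrapT => N.
have k1 n : (1 : R) <= 1000 ^+ n by rewrite exprn_ege1 //; lra.
have far n : (n <= m)%N -> ~ (forall g, reach x (10 * (2 * 1000 ^+ n)) g).
  move=> nm H; apply: N; have [d Gd Hd] := H y; exists d => //; apply: (le_trans Hd).
  rewrite mulrA (_ : 10 * 2 = 20 :> R); last by ring.
  by rewrite ler_pM2l // ler_weXn2l //; lra.
have K n : (n <= m.+1)%N -> n%:R * Vin <= ID \1_(reach x (2 * 1000 ^+ n)).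
  elim: n => [|n IH] nm; first by rewrite mul0r; apply: (wint_ge0 (weight_D L)) => h _; rewrite indicE.
  have r2 : 2 <= 2 * 1000 ^+ n :> R by have := k1 n; lra.
  have := reach_grow r2 (far n nm); rewrite mulrCA -exprS => H; apply: le_trans H.
  by rewrite -natr1 mulrDl mul1r lerD2r; apply: IH; exact: ltnW.
suff Fv : ID \1_(reach x (2 * 1000 ^+ m.+1)) <= v by have := le_trans (K m.+1 (leqnn _)) Fv; rewrite leNgt Hv.
rewrite -(ID1 L); apply: (le_wint (weight_D L)) => [||h _].
- by apply: mbounded_indic; exact: measurable_reach.
- exact: mbounded_cst.
- by rewrite indicE; case: (_ \in _).
Qed.

End Packing.

(** * The injectivity radius *)

Section Coset.
Variables (R : realType) (Gam : set (SL2 R)).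
Hypothesis HG : is_subgroup Gam.
Local Notation G := (SL2 R).
Let G1 : Gam 1%g. Proof. by have [] := HG. Qed.
Let GM a b : Gam a -> Gam b -> Gam (a * b)%g. Proof. by have [_ + _] := HG; apply. Qed.
Let GV a : Gam a -> Gam (a^-1)%g. Proof. by have [_ _] := HG; apply. Qed.

Lemma pi_coset_eq (g h : G) :
  (\pi_(coset_space Gam) g = \pi_(coset_space Gam) h)%qT <-> Gam (g^-1 * h)%g.
Proof.
have -> : (\pi_(coset_space Gam) g = \pi_(coset_space Gam) h)%qT <-> left_coset Gam g = left_coset Gam h.
  split=> [/eqP|E]; first by rewrite eqmodE => /asboolP.
  by apply/eqP; rewrite eqmodE; apply/asboolP.
split=> [E|Ggh].
  have : left_coset Gam h h by exists 1%g => //; rewrite mulg1.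
  by rewrite -E => -[c Gc <-]; rewrite mulKg.
apply/seteqP; split => _ [c Gc <-].
  exists ((g^-1 * h)^-1 * c)%g; first by apply: GM => //; exact: GV.
  by rewrite invgM invgK !mulgA mulgV mul1g.
exists (g^-1 * h * c)%g; first exact: GM.
by rewrite !mulgA mulgV mul1g.
Qed.

Lemma continuous_HS2_mulr (c : G) : continuous (fun y : G => HS2 (y * c)%g : R).
Proof.
have cM (u w : G -> R) : continuous u -> continuous w -> continuous (fun h => u h * w h).
  by move=> cu cw h; apply: continuousM; [exact: cu|exact: cw].
have cD (u w : G -> R) : continuous u -> continuous w -> continuous (fun h => u h + w h).
  by move=> cu cw h; apply: continuousD; [exact: cu|exact: cw].
pose q (a b : R) i (h : G) := slmx h i 0 * a + slmx h i 1 * b.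
have cq a b i : continuous (q a b i).
  by apply: (cD); apply: (cM); [exact: continuous_entry|move=> h; exact: cst_continuous|exact: continuous_entry|move=> h; exact: cst_continuous].
have -> : (fun y => HS2 (y * c)%g : R) = fun h => q (ga c) (gc c) 0 h * q (ga c) (gc c) 0 h +
    q (gb c) (gd c) 0 h * q (gb c) (gd c) 0 h + q (ga c) (gc c) 1 h * q (ga c) (gc c) 1 h +
    q (gb c) (gd c) 1 h * q (gb c) (gd c) 1 h.
  by apply/funext => h; rewrite /HS2 gaM gbM gcM gdM !expr2.
by apply: (cD); [apply: (cD); [apply: (cD)|]|]; apply: (cM); exact: cq.
Qed.

(** The images of the sets [HS2 g < n] form an increasing open cover of the quotient. Inversion
    passes from [G/Gam] to the action on the left. *)
Lemma cocompact_HS2 : cocompact Gam -> exists rho : R, forall g, exists2 c, Gam c & HS2 (c * g)%g <= rho.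
Proof.
move=> /compact_near_coveringP co.
pose Q := quotient_topology (coset_space Gam).
pose P (n : nat) (q : Q) := exists g : G, (\pi_(coset_space Gam) g)%qT = q /\ HS2 g < n%:R.
have [|n0 _ Hn] := co nat \oo P _.
  move=> q _; pose g := repr q; pose m := (Num.bound (HS2 g)).+1.
  exists ([set q' | P m q'], [set n | (m <= n)%N]); last first.
    move=> [q' n] /= [[y [yq Hy]] mn]; exists y; split => //.
    by apply: (lt_le_trans Hy); rewrite ler_nat.
  split; last by exists m.
  apply: open_nbhs_nbhs; split; last first.
    exists g; split; first by rewrite reprK.
    by apply: (lt_trans (archi_boundP (ltW (HS2_gt0 g)))); rewrite ltr_nat.
  suff oU : open [set x : G | exists2 c, Gam c & HS2 (x * c)%g < m%:R].
    suff : open ((\pi_(coset_space Gam))%qT @^-1` [set q' | P m q'] : set G) by [].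
    suff -> : (\pi_(coset_space Gam))%qT @^-1` [set q' | P m q'] =
      [set x : G | exists2 c, Gam c & HS2 (x * c)%g < m%:R] by [].
    apply/seteqP; split => x /=.
      move=> [y [yx Hy]]; exists (x^-1 * y)%g; last by rewrite mulVKg.
      by apply/pi_coset_eq.
    move=> [c Gc Hc]; exists (x * c)%g; split => //.
    by apply/pi_coset_eq; rewrite invgM mulgVK; exact: GV.
  rewrite (_ : [set x : G | _] = \bigcup_(c in Gam) ((fun y : G => HS2 (y * c)%g) @^-1` [set r : R | r < m%:R])).
    apply: bigcup_open => c _; apply: open_comp; last exact: lray_open.
    by move=> y _; exact: continuous_HS2_mulr.
  by apply/seteqP; split => x [c Gc Hc]; exists c.
exists n0%:R => g; have [y [yg Hy]] := Hn n0 (leqnn n0) (\pi_(coset_space Gam) (g^-1)%g)%qT I.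
have /pi_coset_eq H := yg; exists (y^-1 * g^-1)%g => //.
by rewrite mulgVK HS2V ltW.
Qed.

End Coset.

Lemma elliptic_defect (R : realType) (t e : R) : `|t - 2| <= 2 * e -> `|t| < 2 ->
  (2 - t) * (2 + t) <= 8 * e.
Proof.
rewrite ler_norml ltr_norml => /andP[? ?] /andP[? ?].
have : (2 - t) * (2 + t) <= (2 * e) * 4 by apply: ler_pM; lra.
lra.
Qed.

Lemma hyperbolic_defect (R : realType) (t e : R) : `|t - 2| <= 2 * e -> 2 <= t -> t <= 2 + 1 / 200 ->
  (t - 2) * (t + 2) <= 10 * e.
Proof.
rewrite ler_norml => /andP[? ?] ? ?.
have : (t - 2) * (t + 2) <= (2 * e) * 5 by apply: ler_pM; lra.
lra.
Qed.

Section Discrete.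
Variables (R : realType) (Gam : set (SL2 R)).
Hypothesis HG : is_subgroup Gam.
Local Notation G := (borelSL2 R).
Let G1 : Gam 1%g. Proof. by have [] := HG. Qed.
Let GM a b : Gam a -> Gam b -> Gam (a * b)%g. Proof. by have [_ + _] := HG; apply. Qed.
Let GV a : Gam a -> Gam (a^-1)%g. Proof. by have [_ _] := HG; apply. Qed.

Lemma finite_pigeonhole (T : choiceType) (A : set T) (f : nat -> T) : finite_set A -> (forall n, A (f n)) ->
  exists i j, (i < j)%N /\ f i = f j.
Proof.
move=> /finite_seqP[s sE] Af; apply: contrapT => H.
have inj : {in iota 0 (size s).+1 &, injective f}.
  move=> i j _ _ fij; case: (ltngtP i j) => // ij; exfalso; apply: H; first by exists i, j.
  by exists j, i.
have : (size (map f (iota 0 (size s).+1)) <= size s)%N.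
  apply: uniq_leq_size; first by rewrite map_inj_in_uniq ?iota_uniq.
  by move=> _ /mapP[i _ ->]; have := Af i; rewrite sE.
by rewrite size_map size_iota ltnn.
Qed.

Section Finite.
Hypothesis disc : forall r, finite_set [set c | Gam c /\ HS2 c <= r].

Lemma isolated_identity : exists2 e : R, 0 < e & forall c, Gam c -> near1 e c -> c = 1%g.
Proof.
have [s sE] := proj1 (finite_seqP _) (disc 10).
suff [e e0 He] : exists2 e : R, 0 < e & forall c, c \in s -> near1 e c -> c = 1%g.
  exists (Num.min e 1); first by rewrite lt_min e0 ltr01.
  move=> c Gc [a1 a2 a3 a4]; apply: He.
    have : [set c | Gam c /\ HS2 c <= 10] c.
      split => //; apply: (@near1_bounded R (Num.min e 1)); first by rewrite ge_min lexx orbT.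
      by split.
    by rewrite sE.
  by split; [apply: lt_le_trans a1 _|apply: lt_le_trans a2 _|apply: lt_le_trans a3 _|apply: lt_le_trans a4 _]; rewrite ge_min lexx.
elim: s {sE} => [|x s [e e0 He]]; first by exists 1.
have [->|x1] := eqVneq x 1%g.
  by exists e => // c; rewrite inE => /orP[/eqP -> //|]; exact: He.
pose d := `|ga x - 1| + `|gb x| + `|gc x| + `|gd x - 1|.
have d0 : 0 < d.
  rewrite lt_neqAle /d !addr_ge0 // andbT eq_sym; apply: contra x1.
  rewrite !paddr_eq0 ?addr_ge0 // !normr_eq0 !subr_eq0 => /andP[/andP[/andP[/eqP a /eqP b] /eqP c] /eqP e'].
  by apply/eqP; apply: SL2_eq; rewrite ?ga1 ?gb1 ?gc1 ?gd1.
exists (Num.min e (d / 4)); first by rewrite lt_min e0 divr_gt0.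
have le1 : Num.min e (d / 4) <= e by rewrite ge_min lexx.
have le2 : Num.min e (d / 4) <= d / 4 by rewrite ge_min lexx orbT.
move=> c; rewrite inE => /orP[/eqP ->|cs] [a1 a2 a3 a4].
  exfalso; move: (lt_le_trans a1 le2) (lt_le_trans a2 le2) (lt_le_trans a3 le2) (lt_le_trans a4 le2).
  by rewrite /d; move: (`|_|) (`|_|) (`|_|) (`|_|) => *; lra.
by apply: He => //; split; [apply: lt_le_trans a1 _|apply: lt_le_trans a2 _|apply: lt_le_trans a3 _|apply: lt_le_trans a4 _].
Qed.

(** The powers are [c^n = x c - y] with [(x, y)] on the conic [x^2 - t x y + y^2 = 1], an ellipse
    for [|t| < 2]. So they stay bounded, and a bounded part of [Gam] is finite. *)
Lemma elliptic_finite_order c : Gam c -> `|\tr (slmx c)| < 2 -> exists2 j, (0 < j)%N & (c ^+ j)%g = 1%g.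
Proof.
move=> Gc; rewrite tr_g; set t := ga c + gd c => t2.
(* The pair starts at [(0, -1)] because [c^0 = 0 c - (-1)]. *)
pose s := fix s n : R * R := if n is n.+1 then let: (x, y) := s n in (t * x - y, x) else (0, -1).
have sinv n : let: (x, y) := s n in x ^+ 2 - t * x * y + y ^+ 2 = 1.
  by elim: n => [|n] /=; [rewrite mulr0 mul0r expr0n subr0 add0r sqrrN expr1n|case: (s n) => x y <-; ring].
have E := gdet c.
have pw n : [/\ ga (c ^+ n)%g = (s n).1 * ga c - (s n).2, gb (c ^+ n)%g = (s n).1 * gb c,
    gc (c ^+ n)%g = (s n).1 * gc c & gd (c ^+ n)%g = (s n).1 * gd c - (s n).2].
  elim: n => [|n [A B C Dd]]; first by rewrite /= !mul0r ga1 gb1 gc1 gd1 sub0r opprK.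
  rewrite expgSr !gE A B C Dd /=; case: (s n) => x y /=.
  have E1 : gb c * gc c = ga c * gd c - 1 by rewrite -E; ring.
  have E2 : gc c * gb c = ga c * gd c - 1 by rewrite -E; ring.
  by rewrite /t; split; rewrite ?mulrDl ?mulrBl -?mulrA ?E1 ?E2; ring.
pose K := (1 - t ^+ 2 / 4)^-1.
have K0 : 0 < 1 - t ^+ 2 / 4.
  have : t ^+ 2 < 2 ^+ 2 by rewrite -(real_normK (num_real t)) ltrXn2r.
  lra.
have sb n : (s n).1 ^+ 2 <= K /\ (s n).2 ^+ 2 <= K.
  have := sinv n; case: (s n) => x y /= H.
  have A (x' y' : R) : x' ^+ 2 - t * x' * y' + y' ^+ 2 = 1 -> x' ^+ 2 <= K.
    move=> H'; rewrite -[leRHS]mul1r ler_pdivlMr //.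
    have -> : x' ^+ 2 * (1 - t ^+ 2 / 4) = (x' ^+ 2 - t * x' * y' + y' ^+ 2) - (y' - t * x' / 2) ^+ 2 by field.
    by rewrite H' lerBlDr lerDl sqr_ge0.
  split; first exact: A H.
  by apply: (A _ x); rewrite -H; ring.
have bnd n : HS2 (c ^+ n)%g <= 2 * K * (HS2 c + 2).
  rewrite /HS2; have [-> -> -> ->] := pw n; have [A B] := sb n; move: (s n).1 (s n).2 A B => x y A B.
  have K1 u : (x * u - y) ^+ 2 <= 2 * K * (u ^+ 2 + 1).
    have H1 : x ^+ 2 * u ^+ 2 <= K * u ^+ 2 by rewrite ler_wpM2r ?sqr_ge0.
    have -> : (x * u - y) ^+ 2 = 2 * (x ^+ 2 * u ^+ 2 + y ^+ 2) - (x * u + y) ^+ 2 by ring.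
    by have := sqr_ge0 (x * u + y); lra.
  have K2 u : (x * u) ^+ 2 <= 2 * K * u ^+ 2.
    have H1 : x ^+ 2 * u ^+ 2 <= K * u ^+ 2 by rewrite ler_wpM2r ?sqr_ge0.
    have : 0 <= K * u ^+ 2 by rewrite mulr_ge0 ?sqr_ge0 // invr_ge0 ltW.
    by rewrite exprMn; lra.
  by have := K1 (ga c); have := K1 (gd c); have := K2 (gb c); have := K2 (gc c); lra.
have Gp n : Gam (c ^+ n)%g by elim: n => [|n IH]; [rewrite expg0|rewrite expgS; exact: GM].
have [i [j [ij cij]]] := finite_pigeonhole (f := fun n => (c ^+ n)%g) (disc (2 * K * (HS2 c + 2))) (fun n => conj (Gp n) (bnd n)).
exists (j - i)%N; first by rewrite subn_gt0.
apply: (@mulgI _ (c ^+ i)%g); rewrite -expgnDr mulg1 subnKC //; exact: ltnW.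
Qed.

Hypothesis coc : exists rho : R, forall g : G, exists2 c, Gam c & HS2 (c * g)%g <= rho.

(** An element of trace 2 is conjugate to [upper t]. A large diagonal matrix shrinks [t], and
    cocompactness brings the conjugating element back to bounded size at the cost of replacing [c]
    by a conjugate in [Gam], now close to 1. Isolation of 1 makes this conjugate trivial, hence [c]
    too. *)
Lemma no_unipotent c : Gam c -> \tr (slmx c) = 2 -> c = 1%g.
Proof.
move=> Gc; rewrite tr_g => t2.
have [g [t E]] : exists g t, c = (g * upper t * g^-1)%g.
  have dE : gd c = 2 - ga c by rewrite -t2; ring.
  have [c0|c0] := eqVneq (gc c) 0.
    exists 1%g, (gb c); rewrite mul1g invg1 mulg1.
    have a1 : ga c = 1.
      have := gdet c; rewrite c0 dE mulr0 subr0 => H; apply/eqP; rewrite -subr_eq0 -sqrf_eq0; apply/eqP.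
      have -> : (ga c - 1) ^+ 2 = 1 - ga c * (2 - ga c) by ring.
      by rewrite H subrr.
    by apply: SL2_eq; rewrite !mkSL2E // dE a1; ring.
  have det : (ga c - 1) * 0 - - (gc c)^-1 * gc c = 1 by field.
  exists (mkSL2 det), (- (gc c)^-1).
  have bE : gb c = (ga c * (2 - ga c) - 1) / gc c 
    by apply: (canRL (mulfK c0)); have := gdet c; rewrite dE; lra.
  by apply: SL2_eq; rewrite !gE !mkSL2E ?bE ?dE; field.
have [e ee He] := isolated_identity; have [rho Hrho] := coc.
pose r := Num.max rho 1; have r1 : 1 <= r by rewrite le_max lexx orbT.
(* The diagonal entry [s] below satisfies [t / s^2 = y], and [y] is small enough for [|y| r < e]. *)
pose y := t / ((`|t| + 1) * r * 2 / e).
pose s := Num.sqrt ((`|t| + 1) * r * 2 / e).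
have t0 := normr_ge0 t.
have q0 : 0 < (`|t| + 1) * r * 2 / e by rewrite !(mulr_gt0, divr_gt0) // ?invr_gt0 //; lra.
have s0 : 0 < s by rewrite sqrtr_gt0.
have yE : y = t / s ^+ 2 by rewrite /s sqr_sqrtr // ltW.
have yr : `|y| * r < e.
  have -> : `|y| = `|t| / ((`|t| + 1) * r * 2 / e) by rewrite normrM normfV (gtr0_norm q0).
  rewrite mulrAC ltr_pdivrMr // (_ : e * _ = (`|t| + 1) * r * 2); last by field; rewrite gt_eqF.
  have : 0 < r by lra.
  by nra.
have dets : s * s^-1 - 0 * 0 = 1 by rewrite mulr0 subr0 mulfV // gt_eqF.
have [d Gd Hd] := Hrho (g * mkSL2 dets)%g.
have [k [kr cE]] : exists k, HS2 k <= r /\ (d * c * d^-1 = k * upper y * k^-1)%g.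
  exists (d * (g * mkSL2 dets))%g; split; first by rewrite (le_trans Hd) // le_max lexx.
  rewrite E yE; have -> : upper (t / s ^+ 2) = ((mkSL2 dets)^-1 * upper t * mkSL2 dets)%g.
    have sn : s != 0 by rewrite gt_eqF.
    by apply: SL2_eq; rewrite !gE !mkSL2E; field.
  by rewrite !invgM !mulgA !mulgK.
have [A B C W] := coord_sqr_le k.
have small z : `|z| <= r -> `|y * z| < e.
  by move=> zr; apply: le_lt_trans yr; rewrite normrM ler_wpM2l.
have ac : `|ga k * gc k| <= r.
  rewrite ler_norml; have := sqr_ge0 (ga k - gc k); have := sqr_ge0 (ga k + gc k).
  have : ga k ^+ 2 + gc k ^+ 2 <= r.
    by apply: le_trans kr; rewrite /HS2; have := sqr_ge0 (gb k); have := sqr_ge0 (gd k); lra.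
  by move=> *; apply/andP; split; nra.
have : (d * c * d^-1)%g = 1%g.
  apply: He; first by apply: GM; [exact: GM|exact: GV].
  have dk := gdet k; rewrite cE; split; rewrite !gE !mkSL2E.
  - rewrite (_ : _ - 1 = y * (- (ga k * gc k)) + (ga k * gd k - gb k * gc k - 1)); last by ring.
    rewrite dk subrr addr0.
    by apply: small; rewrite normrN.
  - rewrite (_ : _ + _ = y * ga k ^+ 2); last by ring.
    by apply: small; rewrite ger0_norm ?sqr_ge0 // (le_trans A).
  - rewrite (_ : _ + _ = y * (- gc k ^+ 2)); last by ring.
    by apply: small; rewrite normrN ger0_norm ?sqr_ge0 // (le_trans C).
  - rewrite (_ : _ - 1 = y * (ga k * gc k) + (ga k * gd k - gb k * gc k - 1)); last by ring.
    by rewrite dk subrr addr0; exact: small.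
by move=> H; rewrite -[c](mulKg d) -[(d * c)%g](mulgK (d^-1)%g) H invgK mul1g mulVg.
Qed.

(* The trace gaps leave no room for a nontrivial [c] conjugate into a small neighbourhood of [1]. *)
Lemma injectivity_radius (k : fieldExtType rat) (iota : {rmorphism k -> R}) p x c :
  arithmetic_Fuchsian Gam -> range iota = invariant_trace_field Gam ->
  prime p -> (32 * \dim {:k} ^ 2 <= p)%N -> Gam c ->
  near1 (20 * (\dim {:k})%:R * p.+1%:R)^-1 (x^-1 * c * x)%g -> c = 1%g.
Proof.
move=> arith ktr pp pbig Gc; set n := \dim {:k}; set ep := (_ * _)^-1 => nr.
have n1 : (1 <= n)%N by rewrite /n adim_gt0.
have [y yE] : exists y, iota y = \tr (slmx (c ^+ 2)%g).
  have : range iota (\tr (slmx (c ^+ 2)%g)).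
    rewrite ktr; apply: sub_gen_smallest; exists (c ^+ 2)%g => //.
    by apply: sub_gen_smallest; exists c.
  by move=> [y _ <-]; exists y.
have nR : 1 <= n%:R :> R by rewrite ler1n.
have pR : 32 * n%:R ^+ 2 + 1 <= p.+1%:R :> R.
  by rewrite -natrX -natrM natr1 ler_nat ltnS.
have ep0 : 0 < ep by rewrite invr_gt0 !mulr_gt0 ?ltr0n.
have ep1 : ep * (20 * n%:R * p.+1%:R) = 1 by rewrite mulVf // gt_eqF // !mulr_gt0 ?ltr0n.
have trc : \tr (slmx c) = ga (x^-1 * c * x)%g + gd (x^-1 * c * x)%g.
  rewrite tr_g !gE; have := gdet x; move: (ga x) (gb x) (gc x) (gd x) (ga c) (gb c) (gc c) (gd c) => a b c0 d e f g h E.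
  rewrite -[LHS]mul1r -E; ring.
have tr2 : \tr (slmx (c ^+ 2)%g) = \tr (slmx c) ^+ 2 - 2.
  rewrite expgS expg1 !tr_g !gE.
  by transitivity ((ga c + gd c) ^+ 2 - 2 * (ga c * gd c - gb c * gc c)); [ring|rewrite gdet mulr1].
(* In determinant 1 one has [a + d - 2 = b c - (a - 1)(d - 1)], so the trace is quadratically close
   to 2. *)
have t2 : `|\tr (slmx c) - 2| <= 2 * ep ^+ 2.
  rewrite trc; have E := gdet (x^-1 * c * x)%g; case: nr.
  move: (ga _) (gb _) (gc _) (gd _) E => a b c0 d E a1 b1 c1 d1.
  have -> : a + d - 2 = b * c0 - (a - 1) * (d - 1) + (a * d - b * c0 - 1) by ring.
  rewrite E subrr addr0.
  apply: (le_trans (ler_normB _ _)); rewrite !normrM mulrDl mul1r expr2.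
  by apply: lerD; apply: ler_pM => //; exact: ltW.
set t := \tr (slmx c) in trc tr2 t2 *.
have ep2 : ep ^+ 2 * (400 * (n%:R ^+ 2 * p.+1%:R ^+ 2)) = 1.
  by transitivity ((ep * (20 * n%:R * p.+1%:R)) ^+ 2); [ring|rewrite ep1 expr1n].
have P2 : 1 <= n%:R ^+ 2 * p.+1%:R ^+ 2 :> R.
  by rewrite -exprMn exprn_ege1 // mulr_ege1 // ler1n.
have eps : ep ^+ 2 <= 1 / 400.
  have e2 : 0 <= ep ^+ 2 by rewrite sqr_ge0.
  have := ler_wpM2l e2 P2; move: ep2; rewrite mulrCA => ep2; lra.
have [tt|tt|tt] := ltrgtP t 2; last exact: no_unipotent.
- have tb : `|t| < 2 by rewrite ltr_norml; move: t2; rewrite ler_norml => /andP[]; lra.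
  have [j j0 cj] := elliptic_finite_order Gc tb.
  have ne : \tr (slmx (c ^+ 2)%g) != 2.
    rewrite tr2; apply/eqP => H; move: tb; rewrite ltr_norml => /andP[ta tb'].
    have : (2 - t) * (2 + t) = 0 by lra.
    by apply/eqP; rewrite mulf_neq0 // gt_eqF // ?subr_gt0 //; rewrite addrC -ltrBlDr sub0r.
  have := elliptic_trace_gap yE j0 cj ne; rewrite tr2 -/n => gap; exfalso.
  have ub : 2 - (t ^+ 2 - 2) <= 8 * ep ^+ 2.
    have -> : 2 - (t ^+ 2 - 2) = (2 - t) * (2 + t) by ring.
    exact: elliptic_defect t2 tb.
  have g0 : (8 * n ^ 2)%:R ^- 2 * (64 * n%:R ^+ 4) = 1 :> R.
    rewrite natrM natrX; field; by rewrite pnatr_eq0 -lt0n.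
  have n4 : 1 <= n%:R ^+ 4 :> R by rewrite exprn_ege1.
  have big : 64 * n%:R ^+ 4 < 50 * (n%:R ^+ 2 * p.+1%:R ^+ 2) :> R.
    have : (32 * n%:R ^+ 2) ^+ 2 <= p.+1%:R ^+ 2 :> R.
      by apply: lerXn2r; rewrite ?nnegrE ?mulr_ge0 ?exprn_ge0 //; lra.
    rewrite exprMn -exprM => H; have n2 : 1 <= n%:R ^+ 2 :> R by rewrite exprn_ege1.
    have p2 : 0 <= p.+1%:R ^+ 2 :> R by rewrite exprn_ge0.
    have := ler_wpM2r p2 n2; move: H n4; move: (n%:R ^+ 4) (p.+1%:R ^+ 2) (n%:R ^+ 2) => N4 q N2; lra.
  have : (8 * n ^ 2)%:R ^- 2 * (64 * n%:R ^+ 4) <= 8 * ep ^+ 2 * (64 * n%:R ^+ 4).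
    by rewrite ler_wpM2r ?mulr_ge0 ?exprn_ge0 // (le_trans gap).
  have e20 : 0 < ep ^+ 2 by rewrite exprn_gt0.
  have : ep ^+ 2 * (64 * n%:R ^+ 4) < ep ^+ 2 * (50 * (n%:R ^+ 2 * p.+1%:R ^+ 2)) by rewrite ltr_pM2l.
  rewrite g0; move: ep2; move: (ep ^+ 2) (n%:R ^+ 4) (n%:R ^+ 2 * p.+1%:R ^+ 2) => A B C A1 A2 A3.
  have : A * (50 * C) = 1 / 8 by lra.
  lra.
- have t3 : t <= 2 + 1 / 200 by move: t2; rewrite ler_norml => /andP[]; lra.
  have gt2 : 2 < \tr (slmx (c ^+ 2)%g).
    have p1 : 0 < t - 2 by lra.
    have p2 : 0 < t + 2 by lra.
    have p3 := mulr_gt0 p1 p2.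
    by rewrite tr2; lra.
  have := hyperbolic_trace_gap arith Gc yE pp pbig gt2; rewrite tr2 -/n => gap; exfalso.
  have ub : t ^+ 2 - 2 - 2 <= 10 * ep ^+ 2.
    have -> : t ^+ 2 - 2 - 2 = (t - 2) * (t + 2) by ring.
    exact: hyperbolic_defect t2 (ltW tt) t3.
  have g0 : (8 * (2 * n * p.+1)%:R ^+ 2)^-1 * (32 * (n%:R ^+ 2 * p.+1%:R ^+ 2)) = 1 :> R.
    have n0 : n%:R != 0 :> R by rewrite pnatr_eq0 -lt0n.
    have p0 : p.+1%:R != 0 :> R by rewrite pnatr_eq0.
    rewrite !natrM; move: n0 p0; move: (n%:R : R) (p.+1%:R : R) => a b a0 b0; field.
    by rewrite a0 b0.
  have h0 : 0 <= 32 * (n%:R ^+ 2 * p.+1%:R ^+ 2) :> R by lra.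
  have := ler_wpM2r h0 (le_trans gap ub); rewrite g0.
  move: ep2; move: (ep ^+ 2) (n%:R ^+ 2 * p.+1%:R ^+ 2) => A C A1.
  have : 10 * A * (32 * C) = 32 / 40 by lra.
  lra.
Qed.

End Finite.
End Discrete.

Section Build.
Variables (R : realType) (mu : {sigma_finite_measure set (borelSL2 R) -> \bar R}).
Local Notation G := (borelSL2 R).
Variables (Gam : set (SL2 R)) (F : set G) (v : R).
Hypotheses (Hmu : haar_measure mu) (HG : is_subgroup Gam) (cG : countable Gam)
  (FF : fundamental_domain Gam F) (Fv : mu F = v%:E).
Let D : set G := (fun g : G => (g^-1)%g : G) @^-1` F.
Let GM a b : Gam a -> Gam b -> Gam (a * b)%g. Proof. by have [_ + _] := HG; apply. Qed.
Let GV a : Gam a -> Gam (a^-1)%g. Proof. by have [_ _] := HG; apply. Qed.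

Lemma measurable_domain : measurable D.
Proof. by apply: measurable_preim; [exact: measurable_invg|have [] := FF]. Qed.

Lemma domain_volume : mu D = v%:E.
Proof. by rewrite haar_preimV //; have [] := FF. Qed.

Lemma domain_cover g : exists2 c, Gam c & D (c * g)%g.
Proof.
have [_ [_ _ sF]] := FF; have [f Ff E] := sF (\pi_(coset_space Gam) (g^-1)%g)%qT I.
have /(pi_coset_eq HG) H := E; exists (f^-1 * g^-1)%g => //.
by rewrite /D /= mulgVK invgK.
Qed.

Lemma domain_unique g c c' : Gam c -> Gam c' -> D (c * g)%g -> D (c' * g)%g -> c = c'.
Proof.
move=> Gc Gc' Dc Dc'; have [_ [_ iF _]] := FF.
have : ((c * g)^-1)%g = ((c' * g)^-1)%g.
  apply: iF; rewrite ?inE //; apply/(pi_coset_eq HG); rewrite invgK invgM !mulgA mulgK.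
  by apply: GM => //; exact: GV.
by move/(can_inj invgK)/mulIg.
Qed.

(** Discreteness comes from the fundamental domain. With infinitely many elements in a ball,
    infinitely many disjoint translates of each bounded part of [D] would lie in a bounded set; so
    [D] would be null, and the whole group with it since [Gam] is countable. *)
Lemma finite_in_ball r : finite_set [set c | Gam c /\ HS2 c <= r].
Proof.
apply: contrapT => inf; have mD := measurable_domain.
have [f [fA finj]] : exists f : nat -> G, (forall n, Gam (f n) /\ HS2 (f n) <= r) /\ injective f.
  have /infiniteP/pcard_leP/unsquash f := inf; exists f; split.
    by move=> n; exact: (@funS _ _ _ _ f n I).
  by move=> i j; apply: inj; rewrite inE.
have small s : mu (D `&` [set g : G | HS2 g <= s]) = 0%E.
  set B := D `&` _; have mB : measurable B by apply: measurableI => //; exact: measurable_HS2_ball.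
  pose A n : set G := (fun h : G => ((f n)^-1 * h)%g : G) @^-1` B.
  have mA n : measurable (A n) by apply: measurable_preim => //; exact: measurable_mulgl.
  have muA n : mu (A n) = mu B by rewrite /A haar_preim.
  have tA : trivIset setT A.
    apply/trivIsetP => i j _ _ ij; apply/seteqP; split => // h [[Di _] [Dj _]].
    move/eqP: ij; apply; apply: finj; apply: (can_inj invgK).
    by apply: (domain_unique _ _ Di Dj); apply: GV; [have [] := fA i|have [] := fA j].
  have Ab : \bigcup_n A n `<=` [set g : G | HS2 g <= r * s].
    move=> h [n _ [_ /= Hh]]; have [_ fr] := fA n; rewrite -[h](mulVKg (f n)).
    by apply: (le_trans (HS2M _ _)); apply: ler_pM => //; rewrite ltW // HS2_gt0.
  have fin : (mu (\bigcup_n A n) < +oo)%E by apply: haar_HS2_bounded Ab => //; exact: bigcup_measurable.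
  have Bfin : (mu B < +oo)%E.
    by apply: (haar_HS2_bounded Hmu mB) => h [_]; exact.
  have B0 : (0 <= mu B)%E by [].
  have {}fin : (\sum_(i <oo) mu B < +oo)%E.
    move: fin; rewrite measure_bigcup // (eq_eseriesr (fun i _ => muA i)).
    by rewrite (eq_eseriesl (Q := xpredT)) // => i; rewrite in_setT.
   apply/eqP; rewrite eq_le B0 andbT leNgt; apply/negP => Bpos.
  have Bf : mu B \is a fin_num by rewrite ge0_fin_numE.
  have b0 : 0 < fine (mu B) by rewrite fine_gt0 // Bpos.
  have ge n : (\sum_(0 <= i < n) mu B <= \sum_(i <oo) mu B)%E.
    by exact: (@nneseries_lim_ge R (fun=> mu B) xpredT 0 n (fun _ _ _ => B0)).
  have S0 : (0 <= \sum_(i <oo) mu B)%E by exact: nneseries_ge0.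
  move: ge S0 fin; move: (\sum_(_ <oo) mu B)%E => S ge S0 fin.
  have Sf : S \is a fin_num by rewrite ge0_fin_numE.
  have := ge (Num.bound (fine S / fine (mu B))).
  rewrite -(fineK Bf) -(fineK Sf) sumEFin lee_fin sumr_const_nat subn0 -mulr_natl.
  apply/negP; rewrite -ltNge -ltr_pdivrMr //.
  by apply: archi_boundP; rewrite divr_ge0 ?fine_ge0.
have null (A : set G) (E : nat -> set G) : measurable A -> (forall n, measurable (E n)) ->
    (forall n, mu (E n) = 0%E) -> A `<=` \bigcup_n E n -> mu A = 0%E.
  move=> mA mE E0 AE; apply/eqP; rewrite eq_le measure_ge0 andbT.
  apply: (le_trans (measure_sigma_subadditive _ mE mA AE)).
  by rewrite eseries0 // => i _ _; exact: E0.
have D0 : mu D = 0%E.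
  apply: (null _ (fun n => D `&` [set g : G | HS2 g <= n%:R])) => // [n|g Dg].
    by apply: measurableI => //; exact: measurable_HS2_ball.
  by exists (Num.bound (HS2 g)) => //; split => //=; rewrite ltW // archi_boundP // ltW // HS2_gt0.
have [e [e1 e2 _]] := enumeration_ex cG.
have [+ _ _] := Hmu; apply/negP; rewrite negbK; apply/eqP.
apply: (null _ (fun n => if e n is Some c then (fun h : G => (c * h)%g : G) @^-1` D else set0)) => // [n|n|g _].
- by case: (e n) => // c; apply: measurable_preim => //; exact: measurable_mulgl.
- by case: (e n) => [c|]; rewrite ?measure0 // haar_preim.
- by have [c Gc Dc] := domain_cover g; have [n En] := e2 c Gc; exists n => //; rewrite En.
Qed.

Lemma lattice_build (k : fieldExtType rat) (iota : {rmorphism k -> R}) p :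
  arithmetic_Fuchsian Gam -> cocompact Gam -> range iota = invariant_trace_field Gam ->
  prime p -> (32 * \dim {:k} ^ 2 <= p)%N ->
  exists rho, lattice mu Gam D v (20 * (\dim {:k})%:R * p.+1%:R)^-1 rho.
Proof.
move=> arith coc ktr pp pbig; have [rho Hrho] := cocompact_HS2 HG coc; exists rho.
have n1 : (1 <= \dim {:k})%N by rewrite adim_gt0.
have q0 : 0 < 20 * (\dim {:k})%:R * p.+1%:R :> R by rewrite !mulr_gt0 ?ltr0n.
split => //.
- exact: measurable_domain.
- exact: domain_volume.
- exact: domain_cover.
- by move=> g c c'; exact: domain_unique.
- by rewrite invr_gt0.
- rewrite invf_le1 //; have : 1 <= (\dim {:k})%:R :> R by rewrite ler1n.
  have : 1 <= p.+1%:R :> R by rewrite ler1n.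
  by move: (_%:R) (_%:R) => a b; nra.
- move=> x c Gc; apply: (injectivity_radius HG finite_in_ball _ arith ktr pp pbig Gc).
  by exists rho.
Qed.

End Build.

(** * Comparison of the bounds *)

Section Rates.
Variable R : realType.
Local Notation rho := (ln (27 / 20 : R)).

(** Concavity of the logarithm between 1 and 27/20, obtained from the tangent bounds of [expR] at
    0. *)
Lemma ln_chord_le (t : R) : 0 <= t -> t <= 1 -> t * rho <= ln (1 + 7 / 20 * t).
Proof.
move=> t0 t1; have E : expR rho = 27 / 20 by rewrite lnK // posrE; lra.
have P : 0 < 1 + 7 / 20 * t by lra.
rewrite -ler_expR [leRHS]lnK ?posrE //; set s := t * rho.
have a1 : expR s * (1 + (rho - s)) <= 27 / 20.
  have X : expR rho = expR s * expR (rho - s) by rewrite -expRD addrC subrK.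
  rewrite -[leRHS]E X ler_wpM2l ?expR_ge0 //; exact: expR_ge1Dx.
have a2 : expR s * (1 - s) <= 1.
  rewrite -[leRHS](expR0 R) -(subrr s) expRD ler_wpM2l ?expR_ge0 //; exact: expR_ge1Dx.
have := ler_wpM2l t0 a1; have t1' : 0 <= 1 - t by lra.
have := ler_wpM2l t1' a2; move: (expR s) => e; rewrite /s; move: rho => r.
have -> : (1 - t) * (e * (1 - t * r)) = e * (1 - t) - t * (e * (r - t * r)) by ring.
have -> : t * (e * (1 + (r - t * r))) = e * t + t * (e * (r - t * r)) by ring.
by lra.
Qed.

Section Spectral.
Variable t : R.
Hypotheses (t0 : 0 < t) (t1 : t <= 1).
(** This is [1 + lambda / 5], as [lambda = t (2 - t) / 4] is the inverse of
    [t = 1 - sqrt (1 - 4 lambda)]. *)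
Let c : R := 1 + t * (2 - t) / 4 / 5.
Let M : R := 3 / 2 * c.
Let q : R := M + Num.sqrt (1 + M ^+ 2).
Let r : R := c + Num.sqrt (c ^+ 2 - 1).
Let c1 : 1 + t / 20 <= c.
Proof. by have := t0; have := t1; rewrite /c; nra. Qed.
Let c2 : c <= 21 / 20.
Proof. by have := sqr_ge0 (1 - t); rewrite /c; nra. Qed.

(** [c - 1 >= t / 20] and [sqrt (c^2 - 1) >= 3 t / 10] add up to the slope 7/20 of [ln_chord_le]. *)
Lemma growth_rate_ge : t * rho <= ln r.
Proof.
have p0 := t0; have p1 := t1; have q1 := c1.
apply: le_trans (ln_chord_le (ltW t0) t1) _.
have s : 3 / 10 * t <= Num.sqrt (c ^+ 2 - 1).
  rewrite -[leLHS]ger0_norm -?sqrtr_sqr; last by lra.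
  by apply: ler_wsqrtr; rewrite /c; nra.
by rewrite ler_ln ?posrE /r; lra.
Qed.

Lemma operator_rate_le : 1 <= q /\ ln q <= 9 / 2 * rho.
Proof.
have p1 := t1; have q1 := c1; have q2 := c2; have p0 := t0.
have s0 := sqrtr_ge0 (1 + M ^+ 2).
have s : Num.sqrt (1 + M ^+ 2) <= 187 / 100.
  rewrite -[leRHS]ger0_norm -?sqrtr_sqr; last by lra.
  by apply: ler_wsqrtr; rewrite /M; nra.
have qe : q <= 69 / 20 by rewrite /q /M; lra.
have qg : 1 <= q by rewrite /q /M; lra.
split=> //; have q0 : 0 < q by lra.
(* Squaring makes the exponent 9/2 an integer: [(69/20)^2 <= (27/20)^9]. *)
have : ln (q ^+ 2) <= ln ((27 / 20) ^+ 9).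
  have b0 : 0 < 27 / 20 :> R by lra.
  rewrite ler_ln ?posrE ?exprn_gt0 //; apply: (@le_trans _ _ ((69 / 20) ^+ 2)); last by lra.
  by rewrite lerXn2r ?nnegrE //; lra.
by rewrite !lnXn //; last lra; rewrite -!mulr_natr; lra.
Qed.

(** [N] is the first integer above [ln W / (t rho)]; rounding up costs at most one factor [q], which
    is the term [9 / 2 * rho]. *)
Lemma wave_steps W : 1 <= W ->
  exists N, W <= r ^+ N /\ q ^+ N <= expR (9 / 2 * rho + 9 / 2 / t * ln W).
Proof.
move=> W1; have W0 : 0 < W by lra.
have rho0 : 0 < rho by rewrite ln_gt0 //; lra.
have lW := ln_ge0 W1; have [q1 lq] := operator_rate_le; have lr := growth_rate_ge.
have r0 : 0 < r by rewrite /r; have := c1; have := t0; have := sqrtr_ge0 (c ^+ 2 - 1); lra.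
have q0 : 0 < q by lra.
have x0 : 0 < t * rho by rewrite mulr_gt0.
pose u := ln W / (t * rho); have u0 : 0 <= u by rewrite divr_ge0 // ltW.
have uW : u * (t * rho) = ln W by rewrite mulfVK // gt_eqF.
have /andP[Nu uN] := truncn_itv u0.
exists (Num.truncn u).+1; set N := (Num.truncn u).+1 in uN *.
have Nu1 : N%:R <= 1 + u by rewrite /N -natr1 addrC lerD2l.
split.
  rewrite -[leLHS]lnK ?posrE // -[r]lnK ?posrE // -expRM_natl ler_expR -uW.
  by apply: ler_pM => //; [exact: ltW|exact: ltW].
rewrite -[q]lnK ?posrE // -expRM_natl ler_expR.
apply: (@le_trans _ _ ((1 + u) * (9 / 2 * rho))).
  apply: ler_pM => //; first by rewrite ln_ge0.
rewrite mulrDl mul1r lerD2l -uW le_eqVlt; apply/orP; left; apply/eqP.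
by field; rewrite gt_eqF.
Qed.

End Spectral.

(** Here [x] and [y] stand for [ln n] and [ln v]. Either the slack in [n] and [v] is large and the
    left side is not positive, or both are bounded and then so is [1/t]. *)
Lemma exponent_tradeoff (k1 k2 T x y t : R) : 0 <= k1 -> 0 <= k2 -> 0 <= x -> 0 < t ->
  0 <= T -> - k1 - 48 / 5 * x <= y -> (3 / 2 * y + 84 / 5 * x <= k2 -> 1 / t <= T) ->
  (k2 - 3 / 2 * y - 84 / 5 * x) / t <= (k2 + 3 / 2 * k1) * T.
Proof.
move=> k10 k20 x0 t0 T0 yx HT; have i0 : 0 < t^-1 by rewrite invr_gt0.
have [small|big] := leP (3 / 2 * y + 84 / 5 * x) k2.
  have := HT small; rewrite mul1r => tT.
  by apply: ler_pM => //; [lra|exact: ltW|lra].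
apply: (@le_trans _ _ 0); last by rewrite mulr_ge0 //; lra.
by rewrite pmulr_lle0 //; lra.
Qed.

Lemma spectral_parameter (l : R) : 0 < l -> let m := Num.min (1 / 4) l in
  let t := 1 - Num.sqrt (1 - 4 * m) in
  [/\ 0 < t, t <= 1, m = t * (2 - t) / 4 & 2 * m <= t].
Proof.
move=> l0 m t; have m0 : 0 < m by rewrite lt_min l0 andbT; lra.
have m1 : m <= 1 / 4 by rewrite ge_min lexx.
have s0 := sqrtr_ge0 (1 - 4 * m); have s2 : Num.sqrt (1 - 4 * m) ^+ 2 = 1 - 4 * m.
  by rewrite sqr_sqrtr; lra.
have t2 : 2 * m <= t by rewrite /t; move: s0 s2; move: (Num.sqrt _) => s; nra.
by split=> //; rewrite /t; [move: t2; rewrite /t; lra|lra|move: s2; move: (Num.sqrt _) => s; nra].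
Qed.

End Rates.

Lemma norm_slmx_le (R : realType) (g : SL2 R) : `|slmx g| ^+ 2 <= HS2 g.
Proof.
have [ha hb hc hd] := coord_sqr_le g; have H0 : 0 <= HS2 g by exact/ltW/HS2_gt0.
rewrite -(sqr_sqrtr H0); rewrite lerXn2r ?nnegrE ?sqrtr_ge0 //.
apply: mx_norm_le; first exact: sqrtr_ge0.
have E z : z ^+ 2 <= HS2 g -> `|z| <= Num.sqrt (HS2 g).
  by move=> h; rewrite -sqrtr_sqr ler_wsqrtr.
move=> i j; apply: E.
have [->|->] : i = 0 \/ i = 1 by case: i => [[|[|//]] ?]; [left|right]; apply: val_inj.
  have [->|->] : j = 0 \/ j = 1 by case: j => [[|[|//]] ?]; [left|right]; apply: val_inj.
    exact: ha.
  exact: hb.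
have [->|->] : j = 0 \/ j = 1 by case: j => [[|[|//]] ?]; [left|right]; apply: val_inj.
  exact: hc.
exact: hd.
Qed.

Lemma HS2_le_norm (R : realType) (g : SL2 R) : HS2 g <= 4 * `|slmx g| ^+ 2.
Proof.
have E i j : slmx g i j ^+ 2 <= `|slmx g| ^+ 2.
  by rewrite -[leLHS]real_normK ?num_real // lerXn2r ?nnegrE ?mx_entry_norm_le.
by have := E 0 0; have := E 0 1; have := E 1 0; have := E 1 1; rewrite /HS2 /ga /gb /gc /gd; lra.
Qed.

(** A ball of radius of order [1/(n p)] has volume at least of order [(n p)^(-3)], and
    [p^5 <= K n^11] turns this into [n^(-48/5)]. *)
Lemma inner_volume_ge (R : realType) (mu : {sigma_finite_measure set (borelSL2 R) -> \bar R})
    (K : nat) : haar_measure mu -> exists2 k1 : R, 0 <= k1 & forall n p, (0 < n)%N -> (0 < p)%N ->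
  (p ^ 5 <= K * n ^ 11)%N ->
  forall V : R, (V%:E = mu (Bin (20 * n%:R * p.+1%:R)^-1))%E -> - k1 - 48 / 5 * ln n%:R <= ln V.
Proof.
move=> Hmu; have [c c0 Hc] := near1_lower Hmu.
pose K' : R := K.+1%:R; have K0 : 0 < K' by rewrite ltr0Sn.
have lK : 0 <= ln K' by rewrite ln_ge0 // ler1n.
(* [640 = 20 * 16 * 2]: the constant of the radius, the factor 16 of [Bin], and [p + 1 <= 2 p]. *)
have [A [A1 AE]] : exists A : R, 1 <= A /\ A = 640 by exists 640; split=> //; lra.
have lA := ln_ge0 A1; have A0 : 0 < A by lra.
exists (`|ln c| + 3 * ln A + 3 / 5 * ln K') => [|n p n0 p0 pn V VE].
  by have := normr_ge0 (ln c); lra.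
have nR : 1 <= n%:R :> R by rewrite ler1n.
have pR : 1 <= p%:R :> R by rewrite ler1n.
have n'0 : 0 < n%:R :> R by lra.
have p'0 : 0 < p%:R :> R by lra.
have d0 : 0 < A * n%:R * p%:R :> R by rewrite !mulr_gt0.
have dE : (A * n%:R * p%:R)^-1 <= (20 * n%:R * p.+1%:R)^-1 / 16 :> R.
  rewrite -invfM lef_pV2 ?posrE ?mulr_gt0 // AE -[p.+1%:R]natr1.
  have := ler_wpM2l (ltW n'0) pR; lra.
have V1 : c * ((A * n%:R * p%:R)^-1) ^+ 3 <= V.
  rewrite -lee_fin VE; apply: le_trans (Hc _ _ _) _.
  - by rewrite invr_gt0.
  - by rewrite invf_le1 // mulr_ege1 // mulr_ege1.
  apply: le_measure; rewrite ?inE; [exact: measurable_near1|exact: measurable_near1|].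
  by move=> g [] ????; split; apply: lt_le_trans dE.
have V0 : 0 < V by apply: lt_le_trans V1; rewrite mulr_gt0 // exprn_gt0 // invr_gt0.
have lp : 5 * ln p%:R <= ln K' + 11 * ln n%:R.
  have : ln (p%:R ^+ 5) <= ln (K' * n%:R ^+ 11).
    rewrite ler_ln ?posrE ?mulr_gt0 ?exprn_gt0 // -!natrX -natrM ler_nat.
    by apply: leq_trans pn _; rewrite leq_mul2r leqnSn orbT.
  have nX : 0 < n%:R ^+ 11 :> R by exact: exprn_gt0.
  rewrite (lnM K0 nX) (lnXn 5 p'0) (lnXn 11 n'0) -(mulr_natl _ 5) -(mulr_natl _ 11).
  lra.
have : ln (c * (A * n%:R * p%:R)^-1 ^+ 3) <= ln V.
  by rewrite ler_ln ?posrE // mulr_gt0 // exprn_gt0 // invr_gt0.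
rewrite lnM ?posrE ?exprn_gt0 ?invr_gt0 // lnXn ?invr_gt0 // lnV ?posrE //.
rewrite !lnM ?posrE ?mulr_gt0 // -(mulr_natl _ 3).
have := ler_norm (- ln c); rewrite normrN; lra.
Qed.

Lemma uniform_packing (R : realType) (B : R) : 0 <= B -> exists2 Dm : R, 0 < Dm &
  forall (mu : {sigma_finite_measure set (borelSL2 R) -> \bar R}) Gam D v e0 rho,
  lattice mu Gam D v e0 rho -> v <= B * Vin mu e0 ->
  forall x y : borelSL2 R, exists2 d, Gam d & HS2 (x^-1 * d * y)%g <= Dm.
Proof.
move=> B0; exists (20 * 1000 ^+ Num.bound B) => [|mu Gam D v e0 rho L vB].
  have k0 : 0 < 1000 :> R by lra.
  have k1 : 0 < 20 :> R by lra.
  exact: mulr_gt0 k1 (exprn_gt0 _ k0).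
apply: (packing_diameter L); apply: (le_lt_trans vB); rewrite ltr_pM2r ?(Vin_gt0 L) //.
by apply: (lt_trans (archi_boundP B0)); rewrite ltr_nat.
Qed.

(** With [i = 1/t], [x = ln n], [y = ln v] and [w] the logarithm of the volume of the ball,
    [60 = 216/5 + 84/5] and [6 = 9/2 + 3/2] split the exponents into the part spent on the diameter
    and the slack used in [exponent_tradeoff]. *)
Lemma exponent_lt (R : realType) (k1 lb l4 rho x y w i Q : R) :
  0 <= lb -> 0 <= rho -> 1 <= i -> - k1 - 48 / 5 * x <= w ->
  (9 / 2 * (l4 + k1) + 9 / 2 * rho + lb + 1 - 3 / 2 * y - 84 / 5 * x) * i <= Q ->
  lb + (9 / 2 * rho + 9 / 2 * i * (l4 + y - w)) < Q + 60 * i * x + 6 * i * y.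
Proof.
move=> lb0 rho0 i1 wx key.
have A0 : 0 <= lb + 9 / 2 * rho + 1 by lra.
have A1 := ler_wpM2l A0 i1.
have i0 : 0 <= 9 / 2 * i by lra.
have wx' : - w <= k1 + 48 / 5 * x by lra.
have A2 := ler_wpM2l i0 wx'.
by lra.
Qed.

Theorem theorem1p1 (R : realType) (mu : {measure set (borelSL2 R) -> \bar R}) :
  haar_measure mu ->
  exists2 C : R, 0 < C &
    forall (Gam : set (SL2 R)) (k : fieldExtType rat) (iota : {rmorphism k -> R})
           (v l1 : R),
      arithmetic_Fuchsian Gam ->
      cocompact Gam ->
      range iota = invariant_trace_field Gam ->
      has_covolume mu Gam v ->
      smallest_nonzero_eigenvalue Gam l1 ->
      let lambda := Num.min (1 / 4) l1 in
      let t := 1 - Num.sqrt (1 - 4 * lambda) in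
      let S := [set g | Gam g /\
                 `|slmx g| < C * (\dim {:k})%:R `^ (60 / t) * v `^ (6 / t)] in
      finite_set S /\ generated S = Gam.
Proof.
move=> Hmu0; have [mu1 mu1E] := haar_sigma_finite Hmu0.
have Hmu : haar_measure mu1.
  have [h1 h2 h3] := Hmu0; split=> [|K cK|g B mB].
  - by move: h1; rewrite -(mu1E setT).
  - by move: (h2 K cK); rewrite -(mu1E K).
  - exact: etrans (mu1E _) (etrans (h3 g B mB) (esym (mu1E B))).
have [K HK] := exists_prime_above_square.
have [k1 k10 Hk1] := inner_volume_ge K Hmu.
pose rho : R := ln (27 / 20); have rho0 : 0 <= rho by rewrite ln_ge0 //; lra.
(* The generators satisfy [HS2 <= 10 (200 q^N)^2], so their norms are at most [b q^N]. *)
have [b [b1 bE]] : exists b : R, 1 <= b /\ 10 * 200 ^+ 2 <= b ^+ 2 by exists 700; split; lra.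
have lb := ln_ge0 b1.
have l4 : 0 <= ln 4 :> R by rewrite ln_ge0 //; lra.
pose k2 : R := 9 / 2 * (ln 4 + k1) + 9 / 2 * rho + ln b + 1.
have k20 : 0 <= k2 by rewrite /k2; lra.
(* Bound for [ln n] in the bounded case: [3/2 ln v + 84/5 ln n <= k2] and [ln v >= - k1 - 48/5 ln n]
   leave [12/5 ln n <= k2 + 3/2 k1]. *)
pose X : R := (k2 + 3 / 2 * k1) * 5 / 12.
(* In that case [ln v <= 2/3 k2] and [ln V >= - k1 - 48/5 X], which bounds the ratio of the covolume
   to the volume of the ball. *)
have [Dm D0 HDm] := uniform_packing (expR_ge0 (2 / 3 * k2 + k1 + 48 / 5 * X)).
(* Lower bound for [lam] given by [eigenvalue_bound] for the diameter [Dm]; with [2 lam <= t] it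
   yields [1/t <= T]. *)
pose w : R := Num.min (1 / 4) (5 / Dm ^+ 6).
have w0 : 0 < w.
  have D6 := exprn_gt0 6 D0; have f0 : 0 < 5 :> R by lra.
  by rewrite lt_min (divr_gt0 f0 D6) andbT; lra.
pose T : R := (2 * w)^-1; have T0 : 0 <= T by rewrite invr_ge0; lra.
exists (expR ((k2 + 3 / 2 * k1) * T)); first exact: expR_gt0.
move=> Gam k iota v l1 arith coc ktr [F FF Fv] [l1n l1e l1min] lam t S.
have n0 : (0 < \dim {:k})%N by exact: adim_gt0.
set n := \dim {:k} in n0 S *.
have [p pp [pbig psmall]] := HK n n0.
have HG : is_subgroup Gam by case: arith.
rewrite -mu1E in Fv.
have [rh L] := lattice_build Hmu HG (arithmetic_countable arith) FF Fv arith coc ktr pp pbig.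
set e0 := (20 * _ * _)^-1 in L; set V := Vin mu1 e0.
have V0 : 0 < V := Vin_gt0 L.
have Vv : V <= v by rewrite -lee_fin (VinE L) (Bin_le_v L).
have v0 : 0 < v by lra.
have lV : - k1 - 48 / 5 * ln n%:R <= ln V.
  by apply: (Hk1 n p n0 (prime_gt0 pp) psmall); exact: VinE L.
have lVv : ln V <= ln v by rewrite ler_ln ?posrE.
have n1 : 1 <= n%:R :> R by rewrite ler1n.
have x0 := ln_ge0 n1; set x := ln n%:R in lV x0.
have l1p : 0 < l1 by rewrite lt_neqAle eq_sym l1n (eigenvalue_nonneg L l1e).
have [t0 t1 lamE t2] := spectral_parameter l1p; rewrite -/lam -/t in t0 t1 lamE t2.
have lam0 : 0 <= lam by rewrite lamE; nra.
have Hl m' : m' != 0 -> laplace_eigenvalue Gam m' -> lam <= m'.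
  by move=> ? ?; apply: (@le_trans _ _ l1); [rewrite ge_min lexx orbT|exact: l1min].
have tT : 3 / 2 * ln v + 84 / 5 * x <= k2 -> 1 / t <= T.
  move=> small; have xX : x <= X by rewrite /X; lra.
  have vV : v <= expR (2 / 3 * k2 + k1 + 48 / 5 * X) * V.
    rewrite -ler_pdivrMr // -[leLHS]lnK ?posrE ?divr_gt0 // ler_expR ln_div ?posrE //; lra.
  have H := eigenvalue_bound L l1e l1n (HDm _ _ _ _ _ _ L vV).
  have wl : w <= lam.
    have D6 := exprn_gt0 6 D0.
    by rewrite le_min ge_min lexx /= ge_min (ler_pdivrMr _ _ D6) H orbT.
  have w2 : 0 < 2 * w := mulr_gt0 (ltr0Sn R 1) w0.
  rewrite mul1r /T lef_pV2 ?posrE //; apply: le_trans t2.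
  by rewrite ler_pM2l ?ltr0Sn.
have key := exponent_tradeoff k10 k20 x0 t0 T0 (le_trans lV lVv) tT.
have W1 : 1 <= 4 * v / V by rewrite ler_pdivlMr //; lra.
have [N [WN qN]] := wave_steps t0 t1 W1.
have HN : 4 * v <= (1 + lam / 5 + Num.sqrt ((1 + lam / 5) ^+ 2 - 1)) ^+ N * V.
  by rewrite -ler_pdivrMr // lamE.
have gen := lattice_generated L lam0 Hl HN.
set q := 3 / 2 * (1 + lam / 5) + _ in gen.
have q1 : 1 <= q ^+ N.
  by rewrite exprn_ege1 // /q lamE; have [] := operator_rate_le t0 t1.
have bound : b * q ^+ N < expR ((k2 + 3 / 2 * k1) * T) * n%:R `^ (60 / t) * v `^ (6 / t).
  have nn : n%:R != 0 :> R by rewrite pnatr_eq0 -lt0n.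
  rewrite /powR (negbTE nn) (gt_eqF v0) -/x -!expRD.
  have -> : b = expR (ln b) by rewrite lnK // posrE (lt_le_trans ltr01).
  apply: (@le_lt_trans _ _ (expR (ln b + (9 / 2 * rho + 9 / 2 / t * (ln 4 + ln v - ln V))))).
    rewrite expRD ler_pM2l ?expR_gt0 // /q lamE.
    by apply: (le_trans qN); rewrite ler_expR ln_div ?posrE ?mulr_gt0 // lnM ?posrE.
  rewrite ltr_expR; have i1 : 1 <= t^-1 by rewrite invf_ge1.
  exact: exponent_lt lb rho0 i1 lV key.
split.
  set B := expR _ * _ * _ in S *.
  apply: (@sub_finite_set _ _ [set c | Gam c /\ HS2 c <= 4 * B ^+ 2]); last first.
    exact: (finite_in_ball Hmu HG (arithmetic_countable arith) FF).
  move=> g [Gg gB]; split=> //; apply: (le_trans (HS2_le_norm g)).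
  by rewrite ler_pM2l // lerXn2r ?nnegrE ?(ltW gB) // (le_trans _ (ltW gB)).
apply/seteqP; split; first by apply: smallest_sub => // g [].
rewrite -{1}gen => g Hg A [HA SA]; apply: Hg; split=> // d [Gd Hd]; apply: SA; split=> //.
apply: le_lt_trans bound.
have q0 : 0 <= b * q ^+ N := mulr_ge0 (le_trans ler01 b1) (le_trans ler01 q1).
rewrite -[leLHS]ger0_norm // -[leRHS]ger0_norm // -!sqrtr_sqr ler_wsqrtr //.
apply: (le_trans (norm_slmx_le d)); apply: (le_trans Hd).
by rewrite !exprMn mulrA ler_wpM2r // sqr_ge0.
Qed.
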